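(* Let $M_W,L_W\ge 0$, $\rho>0$, $\delta\in(0,1]$ and $N\ge 1$. Assume that $W$ is $(M_W,L_W)$-decomposable, that $m_*$ satisfies a $\rho$-Talagrand inequality, and that $\mathcal F(\nu|m_* )\ge \delta\,H(\nu|m_* )$ for all $\nu\in\mathcal P_2(\mathcal X)$. Put $\ell_W=L_W/\rho$, let $\varepsilon\in(0,1]$ and set $$\delta_N=(1-\varepsilon)\delta-\Bigl(1+\frac{M_W+\ell_W}{\varepsilon\delta}\Bigr)\frac{2\ell_W}{N},\qquad \Delta_{\mathcal F}=2\Bigl(1+\frac{M_W+\ell_W}{\varepsilon\delta}\Bigr)(M_W+\ell_W d).$$ Then for all $\nu^N\in\mathcal P_2(\mathcal X^N)$, $$H(\nu^N|m^N_* )\ge\delta_N H(\nu^N|m_*^{\otimes N})-\Delta_{\mathcal F}-2M_W-2\ell_Wd.$$ Consequently, for all $\nu^N\in\mathcal P_1(\mathcal X^N)$, $$H(\nu^N|m^N_* )\ge\frac{\delta_N\rho}{64(1+\Delta_{\mathcal F}+2M_W+2\ell_Wd)^2}\,\mathcal W_1^2(\nu^N,m^N_* ).$$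
   Context: $\mathcal X$ is either $\mathbb T^d$ (flat torus) or $\mathbb R^d$; $\mathcal P_p$ denotes probability measures with finite $p$-th moment (all probability measures on the torus). $\mathcal W_p$ is the $L^p$ Wasserstein distance for the Euclidean (flat) distance, on $\mathcal X$ or on $\mathcal X^N$. $\langle\cdot,\cdot\rangle$ is integration of a function against a (signed) measure; $[N]=\{1,\dots,N\}$. A kernel $U:\mathcal X\times\mathcal X\to\mathbb R$ is of quadratic growth if $|U(x,y)|\le C(1+|x|^2+|y|^2)$ (void on the torus). Setting: $V:\mathcal X\to\mathbb R$ and $W:\mathcal X\times\mathcal X\to\mathbb R$ are of class $C^2$, $W$ symmetric of quadratic growth. For $\nu\in\mathcal P_2(\mathcal X)$, $\Pi[\nu](dx)\propto\exp(-V(x)-\langle W(x,\cdot),\nu\rangle)\,dx$ (assumed normalizable), and $m_*\in\mathcal P_2(\mathcal X)$ is a fixed measure with $m_*=\Pi[m_*]$. For $\boldsymbol x=(x^1,\dots,x^N)$, $\mu_{\boldsymbol x}=\frac1N\sum_{i\in[N]}\delta_{x^i}$. The $N$-particle Gibbs measure is the probability measure $m^N_*(d\boldsymbol x)\propto\exp(-N\langle V,\mu_{\boldsymbol x}\rangle-\frac N2\langle W,\mu_{\boldsymbol x}^{\otimes2}\rangle)\,d\boldsymbol x$ (assumed normalizable). Relative entropy: $H(\nu|m)=\int\log\frac{d\nu}{dm}\,d\nu$ ($+\infty$ if $\nu\not\ll m$). Reduced kernel: $W_*(x,y)=W(x,y)-\langle W(x,\cdot),m_*\rangle-\langle W(\cdot,y),m_*\rangle+\langle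 W,m_*^{\otimes2}\rangle$; and $\mathcal F(\nu|m_* )=H(\nu|m_* )+\frac12\langle W_*,\nu^{\otimes2}\rangle$ for $\nu\in\mathcal P_2(\mathcal X)$. A kernel $U$ of quadratic growth is positive if $\langle U,(\nu-\nu')^{\otimes2}\rangle\ge0$ for all $\nu,\nu'\in\mathcal P_2(\mathcal X)$. Double oscillation: $\mathrm{Osc}_2U=\sup_{x,y,z,w}\langle U,(\delta_x-\delta_y)\otimes(\delta_z-\delta_w)\rangle$. $W$ is $(M_W,L_W)$-decomposable if $W=W^+-W^-$ with $W^\pm$ positive symmetric kernels of quadratic growth such that: if $\mathcal X=\mathbb T^d$, $\mathrm{Osc}_2W^++\mathrm{Osc}_2W^-\le4M_W$ and $L_W=0$; if $\mathcal X=\mathbb R^d$, $W^s=W^s_{b}+W^s_{q}$ for $s=+,-$ with symmetric kernels satisfying $\mathrm{Osc}_2W_b^++\mathrm{Osc}_2W_b^-\le4M_W$ and $\|\nabla^2_{1,2}W_q^+\|_{L^\infty}+\|\nabla^2_{1,2}W_q^-\|_{L^\infty}\le L_W$ ($\nabla_{1,2}^2$ is the mixed second derivative matrix, in operator norm). $m$ satisfies a $\rho$-Talagrand inequality if $H(\nu|m)\ge\frac\rho2\mathcal W_2^2(\nu,m)$ for all $\nu\in\mathcal P_2(\mathcal X)$. *)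

(* Defs.v *)
From HB Require Import structures.
From mathcomp Require Import all_boot all_order all_algebra.
From mathcomp Require Import all_classical all_reals all_analysis.

Set Implicit Arguments.
Unset Strict Implicit.
Unset Printing Implicit Defensive.

Import Order.TTheory GRing.Theory Num.Theory.
Import numFieldNormedType.Exports.

Local Open Scope classical_set_scope.
Local Open Scope ring_scope.

Variant ambient := Torus | Euclid.

Section axis.
Context (R : realType) (k : ambient).

Definition in_cell (r : R) : bool := if k is Torus then 0 <= r < 1 else true.

(* The one-dimensional space: R itself, or the circle R/Z, each class being
   represented by its unique element of [0, 1[. *)
Record axis := Axis { coord : R ; coordP : in_cell coord }.

HB.instance Definition _ := [isSub for coord].
HB.instance Definition _ := [Choice of axis by <:].

Definition wrap (r : R) : R :=
  if k is Torus then r - (Num.floor r)%:~R else r.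

Lemma wrap_in_cell r : in_cell (wrap r).
Proof.
rewrite /in_cell /wrap; case: k => //.
by rewrite subr_ge0 ltrBlDl floor_le_tmp /= -intrD1 floorD1_gt.
Qed.

(* The canonical projection R -> R/Z (the identity when the space is R). *)
Definition axis_proj (r : R) : axis := Axis (wrap_in_cell r).

HB.instance Definition _ := isPointed.Build axis (axis_proj 0).

End axis.

Definition axis_display : measure_display.
Proof. exact. Qed.

Section axis_measurable.
Context (R : realType) (k : ambient).
Local Notation axis := (axis R k).

Definition axis_measurable : set (set axis) :=
  preimage_set_system setT (@coord R k) measurable.

Let axis_sigma : sigma_algebra setT axis_measurable.
Proof. exact: sigma_algebra_preimage (sigma_algebra_measurable R). Qed.

Let axis_set0 : axis_measurable set0.
Proof. by case: axis_sigma. Qed.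

Let axis_setC A : axis_measurable A -> axis_measurable (~` A).
Proof. by case: axis_sigma => _ + _ => /[apply]; rewrite setTD. Qed.

Let axis_bigcup (F : (set axis)^nat) : (forall i, axis_measurable (F i)) ->
  axis_measurable (\bigcup_i F i).
Proof. by case: axis_sigma => _ _; apply. Qed.

HB.instance Definition _ := @isMeasurable.Build axis_display axis
  axis_measurable axis_set0 axis_setC axis_bigcup.

Lemma measurable_coord : measurable_fun [set: axis] (@coord R k).
Proof. by move=> _ B mB; exists B. Qed.

Lemma coord_preimageK (B : set R) :
  @coord R k @` (@coord R k @^-1` B) = B `&` [set r | in_cell k r].
Proof.
apply/seteqP; split => [_ [x Bx <-]|r [Br kr]]; first by split => //; case: x Bx.
by exists (Axis kr).
Qed.

Lemma measurable_cell : measurable [set r : R | in_cell k r].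
Proof.
case: k => /=.
  rewrite (_ : [set _ | _] = `[0%R, 1%R[%classic); first exact: measurable_itv.
  by apply/seteqP; split => r /=; rewrite in_itv.
by rewrite (_ : [set _ | _] = setT)//; apply/seteqP; split.
Qed.

Lemma measurable_coord_image (A : set axis) :
  measurable A -> measurable (@coord R k @` A).
Proof.
move=> [B mB <-]; rewrite setTI coord_preimageK.
by apply: measurableI => //; exact: measurable_cell.
Qed.

Definition axis_volume (A : set axis) : \bar R :=
  lebesgue_measure (@coord R k @` A).

Let volume0 : axis_volume set0 = 0%E.
Proof. by rewrite /axis_volume image_set0 measure0. Qed.

Let volume_ge0 A : (0 <= axis_volume A)%E.
Proof. exact: measure_ge0. Qed.

Let volume_sigma_additive : semi_sigma_additive axis_volume.
Proof.
move=> F mF tF mUF; rewrite /axis_volume image_bigcup.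
apply: measure_semi_sigma_additive.
- by move=> n; exact: measurable_coord_image.
- move=> i j _ _ [_ [[x Fix <-] [y Fjy /val_inj yx]]].
  by apply: tF => //; exists x; split => //; rewrite -yx.
- by rewrite -image_bigcup; exact: measurable_coord_image.
Qed.

HB.instance Definition _ := isMeasure.Build _ _ _ axis_volume
  volume0 volume_ge0 volume_sigma_additive.

Let volume_sigma_finite : sigma_finite setT axis_volume.
Proof.
have [F UF mF] := sigma_finiteT (@lebesgue_measure R).
exists (fun n => @coord R k @^-1` F n).
  by rewrite -preimage_bigcup -UF preimage_setT.
move=> n; have [mFn Fn] := mF n; split; first by exists (F n) => //; rewrite setTI.
rewrite /axis_volume coord_preimageK (le_lt_trans _ Fn)//.
apply: le_measure; [|by rewrite inE|exact: subIsetl].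
by rewrite inE; apply: measurableI => //; exact: measurable_cell.
Qed.

HB.instance Definition _ := Measure_isSigmaFinite.Build _ _ _ axis_volume
  volume_sigma_finite.

End axis_measurable.

Section product_measure.
Context d (T : measurableType d) (R : realType).
Variable mu : {sigma_finite_measure set T -> \bar R}.

Section cons.
Variables (n : nat) (nu : {sigma_finite_measure set (n.-tuple T) -> \bar R}).

Definition cons_pair (z : T * n.-tuple T) : n.+1.-tuple T :=
  [tuple of z.1 :: z.2].

Definition uncons (t : n.+1.-tuple T) : T * n.-tuple T :=
  (thead t, [tuple of behead t]).

Lemma measurable_cons_pair : measurable_fun setT cons_pair.
Proof. by apply: measurable_cons. Qed.

Lemma measurable_uncons : measurable_fun setT uncons.
Proof.
by apply/measurable_fun_pairP; split;
  [exact: measurable_tnth|exact: measurable_behead].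
Qed.

Lemma cons_pairK : cancel cons_pair uncons.
Proof.
move=> [x t]; rewrite /uncons /cons_pair theadE /=.
by congr pair; exact/val_inj.
Qed.

Definition cons_measure (A : set (n.+1.-tuple T)) : \bar R :=
  (mu \x nu)%E (cons_pair @^-1` A).

Let mpre A : measurable A -> measurable (cons_pair @^-1` A).
Proof. by move=> mA; rewrite -[X in measurable X]setTI; exact: measurable_cons_pair. Qed.

Let cons0 : cons_measure set0 = 0%E.
Proof. by rewrite /cons_measure preimage_set0 measure0. Qed.

Let cons_ge0 A : (0 <= cons_measure A)%E.
Proof. exact: measure_ge0. Qed.

Let cons_sigma_additive : semi_sigma_additive cons_measure.
Proof.
move=> F mF tF mUF; rewrite /cons_measure preimage_bigcup.
apply: measure_semi_sigma_additive.
- by move=> i; exact: mpre.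
- apply/trivIsetP => i j _ _ ij; rewrite -preimage_setI.
  by move/trivIsetP : tF => /(_ _ _ I I ij) ->; rewrite preimage_set0.
- by rewrite -preimage_bigcup; exact: mpre.
Qed.

HB.instance Definition _ := isMeasure.Build _ _ _ cons_measure
  cons0 cons_ge0 cons_sigma_additive.

Let cons_sigma_finite : sigma_finite setT cons_measure.
Proof.
have /sigma_finiteP[F [TF ndF Foo]] := sigma_finiteT mu.
have /sigma_finiteP[G [TG ndG Goo]] := sigma_finiteT nu.
exists (fun i => uncons @^-1` (F i `*` G i)).
  apply/esym; rewrite -subTset => t _.
  have [a _ Fa] : (\bigcup_i F i) (uncons t).1 by rewrite -TF.
  have [b _ Gb] : (\bigcup_i G i) (uncons t).2 by rewrite -TG.
  exists (maxn a b) => //; split.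
    by move: Fa; exact/subsetPset/ndF/leq_maxl.
  by move: Gb; exact/subsetPset/ndG/leq_maxr.
move=> i; have [mFi Fi] := Foo i; have [mGi Gi] := Goo i; split.
  by rewrite -[X in measurable X]setTI; apply: measurable_uncons => //;
    exact: measurableX.
rewrite /cons_measure -comp_preimage (_ : uncons \o cons_pair = id); last first.
  by apply/funext => z /=; rewrite cons_pairK.
by rewrite preimage_id product_measure1E// lte_mul_pinfty// ge0_fin_numE.
Qed.

HB.instance Definition _ := Measure_isSigmaFinite.Build _ _ _ cons_measure
  cons_sigma_finite.

End cons.

Fixpoint tensor_power (n : nat) : {sigma_finite_measure set (n.-tuple T) -> \bar R} :=
  match n with
  | 0 => @dirac _ _ [tuple] R
  | n'.+1 => cons_measure (tensor_power n')
  end.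

End product_measure.

Section distance.
Context (R : realType) (k : ambient).

(* On the circle, the distance of two points of [0, 1[ modulo 1. *)
Definition axis_dist (x y : axis R k) : R :=
  let r := `|coord x - coord y| in
  if k is Torus then Num.min r (1 - r) else r.

Definition tuple_dist (T : Type) (dist : T -> T -> R) (n : nat)
    (x y : n.-tuple T) : R :=
  Num.sqrt (\sum_(i < n) dist (tnth x i) (tnth y i) ^+ 2).

End distance.
Arguments tuple_dist {R T} dist {n}.

(* R^d or (R/Z)^d; configurations of N particles live in
   N.-tuple (state_space R k d). *)
Notation state_space R k d := (d.-tuple (axis R k)).

Section state_space.
Context (R : realType) (k : ambient) (d : nat).
Local Notation X := (state_space R k d).

Definition space_proj (x : 'rV[R]_d) : X :=
  [tuple axis_proj k (x ord0 i) | i < d].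

Definition origin : X := [tuple axis_proj k 0 | _ < d].

Definition space_dist : X -> X -> R := tuple_dist (@axis_dist R k).

Definition space_norm (x : X) : R := space_dist x origin.

Definition space_volume : {sigma_finite_measure set X -> \bar R} :=
  tensor_power (@axis_volume R k) d.

Section particles.
Variable N : nat.

Definition config_origin : N.-tuple X := [tuple origin | _ < N].

Definition config_dist : N.-tuple X -> N.-tuple X -> R :=
  tuple_dist space_dist.

Definition config_volume : {sigma_finite_measure set (N.-tuple X) -> \bar R} :=
  tensor_power space_volume N.

End particles.
End state_space.
Arguments origin {R k d}.
Arguments space_dist {R k d}.
Arguments space_norm {R k d}.
Arguments config_origin {R k d N}.
Arguments config_dist {R k d N}.

Section transport.
Context d (T : measurableType d) (R : realType).
Implicit Types mu nu : probability T R.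

(* P_p; the base point o is immaterial. *)
Definition finite_moment (dist : T -> T -> R) (o : T) (p : nat) :
    set (probability T R) :=
  [set nu | (\int[nu]_x (dist x o ^+ p)%:E < +oo)%E].

Definition couplings mu nu : set (probability (T * T)%type R) :=
  [set pi : probability (T * T)%type R | forall A, measurable A ->
    pi (A `*` setT) = mu A /\ pi (setT `*` A) = nu A].

Definition wasserstein (dist : T -> T -> R) (p : nat) mu nu : \bar R :=
  (ereal_inf [set \int[pi : probability (T * T)%type R]_z (dist z.1 z.2 ^+ p)%:E
              | pi in couplings mu nu] `^ p%:R^-1)%E.

(* The density is positive nu-almost everywhere, so the value of lne at
   nonpositive arguments does not matter. *)
Definition relative_entropy nu (m : {sigma_finite_measure set T -> \bar R}) : \bar R :=
  if `[< nu `<< m >] then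
    (\int[nu]_x lne (Radon_Nikodym (charge_of_finite_measure nu) m x))%E
  else +oo%E.

Definition talagrand (dist : T -> T -> R) (o : T) (rho : R) (m : probability T R) : Prop :=
  forall nu, finite_moment dist o 2 nu ->
    ((rho / 2)%:E * wasserstein dist 2 nu m ^+ 2 <= relative_entropy nu m)%E.

End transport.

Section gibbs.
Context d (T : measurableType d) (R : realType).
Variables (vol : {measure set T -> \bar R}) (E : T -> R).

Definition partition_function : \bar R := (\int[vol]_x (expR (- E x))%:E)%E.

Definition normalizable : Prop := (0 < partition_function < +oo)%E.

Definition is_gibbs (P : probability T R) : Prop :=
  normalizable /\ forall A, measurable A ->
    P A = ((fine partition_function)^-1%:E *
           \int[vol]_(x in A) (expR (- E x))%:E)%E.

End gibbs.

Section kernels.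
Context d (T : measurableType d) (R : realType).
Implicit Types (U : T -> T -> R) (mu nu : {measure set T -> \bar R}).

Definition pairing U mu (nu : {sigma_finite_measure set T -> \bar R}) : R :=
  \int[(mu \x nu)%E]_z U z.1 z.2.

Definition measurable_kernel U := measurable_fun [set: T * T] (fun z => U z.1 z.2).

Definition symmetric_kernel U := forall x y, U x y = U y x.

(* <U, (delta_x - delta_y) (x) (delta_z - delta_w)>, expanded. *)
Definition osc2 U : \bar R :=
  ereal_sup [set (U q.1.1 q.2.1 - U q.1.1 q.2.2 - U q.1.2 q.2.1 + U q.1.2 q.2.2)%:E
            | q in [set: (T * T) * (T * T)]].

Definition reduced_kernel U (m : probability T R) : T -> T -> R := fun x y =>
  U x y - \int[m]_z U x z - \int[m]_z U z y + pairing U m m.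

Definition free_energy U (m nu : probability T R) : \bar R :=
  (relative_entropy nu m + (2^-1 * pairing (reduced_kernel U m) nu nu)%:E)%E.

End kernels.

Section empirical.
Context d (T : measurableType d) (R : realType) (N : nat) (x : N.-tuple T).

(* The empirical measure of x, for 0 < N; the default value point is never
   used. *)
Definition empirical : set T -> \bar R :=
  mscale (N%:R^-1)%:nng (msum (fun i => dirac (nth point x i)) N).

HB.instance Definition _ := Measure.on empirical.

Let empirical_fin : fin_num_fun empirical.
Proof.
move=> A mA; rewrite /empirical /mscale /= fin_numM// /msum.
by apply/sum_fin_numP => i _ _; exact: fin_num_measure.
Qed.

HB.instance Definition _ := Measure_isFinite.Build _ _ _ empirical empirical_fin.

End empirical.
Arguments empirical {d T R N}.

Section particle_energy.
Context d (T : measurableType d) (R : realType).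
Variables (V : T -> R) (W : T -> T -> R).

Definition mean_field_potential (nu : probability T R) (x : T) : R :=
  V x + \int[nu]_y W x y.

Definition particle_energy (N : nat) (x : N.-tuple T) : R :=
  N%:R * \int[empirical x]_y V y
  + N%:R / 2 * pairing W (empirical x) (empirical x).

End particle_energy.

Definition class_C2 (R : realType) (n : nat) (f : 'rV[R]_n -> R) : Prop :=
  let e i : 'rV[R]_n := delta_mx ord0 i in
  [/\ continuous f,
      forall i x, derivable f x (e i),
      forall i, continuous ('D_(e i) f),
      forall i j x, derivable ('D_(e i) f) x (e j)
    & forall i j, continuous ('D_(e j) ('D_(e i) f))].

Definition euclidean_norm (R : realType) (n : nat) (v : 'cV[R]_n) : R :=
  Num.sqrt (\sum_(i < n) v i ord0 ^+ 2).

Definition operator_norm (R : realType) (n : nat) (A : 'M[R]_n) : \bar R :=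
  ereal_sup [set (euclidean_norm (A *m v))%:E | v in [set v | euclidean_norm v <= 1]].

Section decomposability.
Context (R : realType) (k : ambient) (d : nat).
Local Notation X := (state_space R k d).
Implicit Types (V : X -> R) (U W : X -> X -> R).

(* A function on the torus is C^2 when its periodic lift to R^d is. *)
Definition potential_C2 V : Prop := class_C2 (fun x => V (space_proj k x)).

Definition kernel_C2 U : Prop :=
  class_C2 (fun z : 'rV[R]_(d + d) =>
    U (space_proj k (lsubmx z)) (space_proj k (rsubmx z))).

(* On the torus the growth condition is void. *)
Definition quadratic_growth U : Prop :=
  measurable_kernel U /\
  (k = Euclid -> exists C : R, forall x y,
     `|U x y| <= C * (1 + space_norm x ^+ 2 + space_norm y ^+ 2)).

Definition P2 : set (probability X R) := finite_moment space_dist origin 2.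

(* The integrability clause says that the pairings are defined; on R^d it
   follows from quadratic growth. *)
Definition positive_kernel U : Prop :=
  (forall nu nu', P2 nu -> P2 nu' ->
    (nu \x nu')%E.-integrable setT (EFin \o (fun z => U z.1 z.2))) /\
  (forall nu nu', P2 nu -> P2 nu' ->
    0 <= pairing U nu nu - pairing U nu nu' - pairing U nu' nu + pairing U nu' nu').

Section mixed.
Variable U : X -> X -> R.
Let lift (x y : 'rV[R]_d) : R := U (space_proj k x) (space_proj k y).
Let e i : 'rV[R]_d := delta_mx ord0 i.

(* The mixed derivative is a classical one, existing at every point, and its
   L^infinity norm is the supremum over all points (for a continuous mixed
   derivative this is the essential supremum). *)
Definition mixed_differentiable : Prop :=
  (forall x y, differentiable (lift x) y) /\
  (forall x y j, differentiable (fun x' => 'D_(e j) (lift x') y) x).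

Definition mixed_hessian (x y : 'rV[R]_d) : 'M[R]_d :=
  \matrix_(i, j) 'D_(e i) (fun x' => 'D_(e j) (lift x') y) x.

Definition mixed_hessian_norm : \bar R :=
  ereal_sup [set operator_norm (mixed_hessian p.1 p.2)
            | p in [set: 'rV[R]_d * 'rV[R]_d]].

End mixed.

Definition decomposable (MW LW : R) W : Prop :=
  exists Wp Wm : X -> X -> R,
    [/\ forall x y, W x y = Wp x y - Wm x y,
        [/\ symmetric_kernel Wp, quadratic_growth Wp & positive_kernel Wp],
        [/\ symmetric_kernel Wm, quadratic_growth Wm & positive_kernel Wm]
      & match k with
        | Torus => (osc2 Wp + osc2 Wm <= (4 * MW)%:E)%E /\ LW = 0
        | Euclid => exists Wpb Wpq Wmb Wmq : X -> X -> R,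
            [/\ forall x y, Wp x y = Wpb x y + Wpq x y,
                forall x y, Wm x y = Wmb x y + Wmq x y,
                [/\ symmetric_kernel Wpb, symmetric_kernel Wpq,
                    symmetric_kernel Wmb & symmetric_kernel Wmq],
                (osc2 Wpb + osc2 Wmb <= (4 * MW)%:E)%E
              & [/\ mixed_differentiable Wpq, mixed_differentiable Wmq
                & (mixed_hessian_norm Wpq + mixed_hessian_norm Wmq <= LW%:E)%E]]
        end].

End decomposability.

(* Main.v *)
(** Relative to the product [m_*^N], the Gibbs measure has energy
    [N/2 <W_*, mu_x^2>].  Reveal the particles of a law of [N] particles one at a
    time: by the chain rule the entropies of the successive conditional laws sum
    to the entropy of the whole.  Their average is a random probability measure,
    to which coercivity applies.  The empirical measure differs from it by a sum
    of martingale increments, so positivity of [W^+] and [W^-] bounds the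
    quadratic error by its diagonal terms, of order [1/N]; Pinsker's inequality
    (bounded part) and Talagrand's (quadratic part) turn these, and by
    Cauchy-Schwarz the cross terms, into entropies and constants.  The argument is
    run for laws on finitely many cells of space and passed to the limit.

    For the transport inequality, Talagrand's inequality tensorises, and the
    additive defect of the entropy inequality is absorbed as follows: for
    [nu = h M], transport only the normalised positive and negative parts of
    [h - 1] to each other through [m_*^N]; their mass [t] satisfies
    [2 t^2 <= H(nu|M)], so [t^2] times the defect is again an entropy. *)
From HB Require Import structures.
From mathcomp Require Import all_boot all_order all_algebra.
From mathcomp Require Import all_classical all_reals all_analysis.
From mathcomp Require Import measurable_realfun ring lra.
Require Import Defs.

Set Implicit Arguments.
Unset Strict Implicit.
Unset Printing Implicit Defensive.

Import Order.TTheory GRing.Theory Num.Theory.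
Import numFieldNormedType.Exports.

Local Open Scope classical_set_scope.
Local Open Scope ring_scope.

(** Conditional laws and gluings of couplings would call for disintegration. On finitely many cells
    they are finite sums, and a law [a] on the cells is realised by the step density [a / q] with
    respect to [m_*], of entropy exactly [kl a q]: Talagrand's inequality and coercivity transfer to
    cells without error, and only the energy is approximated. This works uniformly on bounded
    regions only, hence the passage through conditioned laws. The two parts of [W^+] and of [W^-]
    come without growth or measurability; only their second differences are controlled. Kernels are
    therefore replaced by second differences based at the origin, which changes neither [W_*] nor
    pairings with differences of laws. The factor [1 + (MW + lW) / (eps * delta)] is [1 + t^-1] in
    Young's inequality for the cross terms, with [t] such that the error costs a fraction [eps] of
    the coercivity. The additive terms outside [DeltaF] come from the normalising constant of the
    Gibbs measure relative to the product, bounded by Jensen's inequality. *)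

(** * Scalar inequalities for the entropy integrand *)

Section entropy_function.
Context (R : realType).
Implicit Types x t u : R.

(** Relative entropy is [\int phi f] for a density [f] of mass one: the affine part integrates to
    zero and makes the integrand nonnegative, so that no integral is of the form infinity minus
    infinity. Since [0 * ln 0 = 0], the value [phi 0 = 1] is the right limit. *)
Definition phi x : R := x * ln x - x + 1.

Lemma phi1 : phi 1 = 0.
Proof. by rewrite /phi ln1 mulr0 add0r addNr. Qed.

Lemma ln_ge_sub_inv x : 0 < x -> 1 - x^-1 <= ln x.
Proof.
move=> x0; have x1 : -1 < x^-1 - 1 by rewrite ltrBrDl subrr invr_gt0.
have := le_ln1Dx x1; rewrite addrC subrK lnV ?posrE// => ?; lra.
Qed.

Lemma phi_ge0 x : 0 <= x -> 0 <= phi x.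
Proof.
rewrite le_eqVlt => /predU1P[<-|x0]; first by rewrite /phi mul0r; lra.
have := ler_wpM2l (ltW x0) (ln_ge_sub_inv x0).
rewrite mulrBr divff ?gt_eqF// /phi; lra.
Qed.

Lemma phi_le_sqr x : 0 <= x -> phi x <= (x - 1) ^+ 2.
Proof.
rewrite le_eqVlt => /predU1P[<-|x0]; first by rewrite /phi mul0r; lra.
have x1 : -1 < x - 1 by lra.
have := le_ln1Dx x1; rewrite addrC subrK => /(ler_wpM2l (ltW x0)).
rewrite /phi => ?; nra.
Qed.

(* The difference of the two sides vanishes at 1 and has derivative
   [(x - 1)^3 / (x^2 (x + 2)^2)]. *)
Lemma ln_pade x : 0 < x -> (x - 1) * (5 * x + 1) / (2 * x * (x + 2)) <= ln x.
Proof.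
move=> x0; pose r (y : R) : R := (y - 1) * (5 * y + 1) / (2 * y * (y + 2)).
pose g (y : R) : R := ln y - r y.
pose dg (y : R) : R := (y - 1) ^+ 3 / (y ^+ 2 * (y + 2) ^+ 2).
have dgE (y : R) : 0 < y -> is_derive y 1 g (dg y).
  move=> y0; have yn : 2 * y * (y + 2) != 0 by rewrite gt_eqF//; nra.
  have := is_derive1_ln y0 => dln.
  pose h (z : R) : R := (2 * z * (z + 2)).
  have dh : is_derive y 1 h (4 * y + 4).
    rewrite /h; apply: is_derive_eq; rewrite /GRing.scale/=; ring.
  have dhV := @is_deriveV _ h y _ 1 yn dh.
  rewrite /g /r.
  apply: is_derive_eq; rewrite /GRing.scale/= /h /dg.
  by field; apply/andP; split; rewrite gt_eqF//; lra.
have cg (y z : R) : 0 < y -> {within `[y, z], continuous g}.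
  move=> y0; apply: continuous_in_subspaceT => w /[!inE]/=; rewrite in_itv/= => /andP[yw _].
  apply/differentiable_continuous/derivable1_diffP.
  by have [] := dgE w (lt_le_trans y0 yw).
have g1 : g 1 = 0 by rewrite /g /r ln1 subrr !mul0r subrr.
rewrite -/(r x) -subr_ge0 -/(g x).
have [x1|x1|->] := ltgtP x 1; last by rewrite g1.
- have [w w1] : exists2 w, w \in `]x, 1[ & g 1 - g x = dg w * (1 - x).
    apply: MVT => // [w|]; last exact: cg.
    by rewrite in_itv/= => /andP[xw _]; apply: dgE; lra.
  move: w1; rewrite in_itv/= => /andP[xw w1]; rewrite g1 sub0r => gx.
  suff : dg w <= 0 by nra.
  rewrite /dg mulr_le0_ge0 ?invr_ge0//; last by rewrite mulr_ge0// sqr_ge0.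
  rewrite exprS mulr_le0_ge0 ?sqr_ge0//; lra.
- have [w w1] : exists2 w, w \in `]1, x[ & g x - g 1 = dg w * (x - 1).
    apply: MVT => // [w|]; last by apply: cg; lra.
    by rewrite in_itv/= => /andP[xw _]; apply: dgE; lra.
  move: w1; rewrite in_itv/= => /andP[xw w1]; rewrite g1 subr0 => ->.
  have : 0 <= dg w.
    rewrite /dg divr_ge0//; last by rewrite mulr_ge0// sqr_ge0.
    by rewrite exprn_ge0//; lra.
  by nra.
Qed.

(** The pointwise form of Pinsker's inequality; multiplied out, it is exactly [ln_pade]. The weight
    [4 + 2 x] has mean 6 under a density of mass one, which is what makes the integrated constant
    sharp. *)
Lemma phi_pinsker x : 0 <= x -> 3 * (x - 1) ^+ 2 <= (4 + 2 * x) * phi x.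
Proof.
rewrite le_eqVlt => /predU1P[<-|x0]; first by rewrite /phi mul0r; lra.
have p : 0 < 2 * x * (x + 2) by nra.
have := ln_pade x0; rewrite ler_pdivrMr// => h.
have E : (4 + 2 * x) * phi x - 3 * (x - 1) ^+ 2 =
   ln x * (2 * x * (x + 2)) - (x - 1) * (5 * x + 1) by rewrite /phi; ring.
by rewrite -subr_ge0 E subr_ge0.
Qed.

Lemma sqr_le_phi u : 0 <= u <= 1 -> u ^+ 2 <= 3 * phi (1 + u).
Proof.
move=> /andP[u0 u1]; have x0 : 0 <= 1 + u by lra.
have := phi_pinsker x0; have := phi_ge0 x0.
by rewrite (_ : 1 + u - 1 = u); [nra|ring].
Qed.

Lemma sqr_le_phiB u : 0 <= u <= 1 -> u ^+ 2 <= 2 * phi (1 - u).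
Proof.
move=> /andP[u0 u1]; have x0 : 0 <= 1 - u by lra.
have := phi_pinsker x0; have := phi_ge0 x0.
by rewrite (_ : 1 - u - 1 = - u); [nra|ring].
Qed.

Lemma scaled_phi_le_sqr t u : 0 < t -> 0 <= u ->
  t ^+ 2 * phi (u / t) <= u ^+ 2 + t ^+ 2.
Proof.
move=> t0 u0; have := phi_le_sqr (divr_ge0 u0 (ltW t0)).
move=> /(ler_wpM2l (sqr_ge0 t)) /le_trans; apply.
rewrite -exprMn mulrBr mulrCA divff ?gt_eqF// !mulr1; nra.
Qed.

(** Meant for [u] the positive part of [h - 1] and [t] its mass, so that [u / t] is a probability
    density. Up to [u = 1] both sides are quadratic. Beyond, [phi (1 + u)] dominates [u] and
    [u * ln u], and the term in [- ln t] created by the normalisation is harmless because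
    [t * - ln t <= 1 - t]. *)
Lemma scaled_phi_pos t u : 0 < t <= 1 -> 0 <= u ->
  t ^+ 2 * phi (u / t) <= 7 * phi (1 + u) + t ^+ 2.
Proof.
move=> /andP[t0 t1] u0; have ph0 : 0 <= phi (1 + u) by apply: phi_ge0; lra.
have [u1|u1] := leP u 1.
  by apply: le_trans (scaled_phi_le_sqr t0 u0) _; have := @sqr_le_phi u; rewrite u0 u1; lra.
have up : 0 < u by lra.
have -> : t ^+ 2 * phi (u / t) = t * u * ln u + u * (t * - ln t) - t * u + t ^+ 2.
  by rewrite /phi lnM ?posrE ?invr_gt0// lnV ?posrE//; field; rewrite gt_eqF.
have lt1 : t * - ln t <= 1 - t.
  have := ler_wpM2l (ltW t0) (ln_ge_sub_inv t0).
  rewrite mulrBr divff ?gt_eqF//; lra.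
have lu0 : 0 <= ln u by apply: ln_ge0; lra.
have h1 : t * u * ln u <= u * ln u by rewrite ler_wpM2r// ler_piMl.
have h2 : u * (t * - ln t) <= u by apply: le_trans (ler_wpM2l u0 lt1) _; nra.
have h3 : u <= (8 / 3) * phi (1 + u).
  have x0 : 0 <= 1 + u by lra.
  by have := phi_pinsker x0; rewrite (_ : 1 + u - 1 = u); [nra|ring].
have h4 : u * ln u <= phi (1 + u) + u.
  have : ln u <= ln (1 + u) by rewrite ler_ln ?posrE//; lra.
  have : 0 <= ln (1 + u) by apply: ln_ge0; lra.
  by rewrite /phi; nra.
nra.
Qed.

Lemma scaled_phi_neg t u : 0 < t <= 1 -> 0 <= u <= 1 ->
  t ^+ 2 * phi (u / t) <= 7 * phi (1 - u) + t ^+ 2.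
Proof.
move=> /andP[t0 t1] /andP[u0 u1]; have ph0 : 0 <= phi (1 - u) by apply: phi_ge0; lra.
by apply: le_trans (scaled_phi_le_sqr t0 u0) _; have := @sqr_le_phiB u; rewrite u0 u1; lra.
Qed.
End entropy_function.

(** * Relative entropy on a finite set *)

Section finite_entropy.
Context (R : realType) (I : finType).
Implicit Types (a b q : I -> R).

Definition pmf a := (forall i, 0 <= a i) /\ \sum_i a i = 1.

Definition dominated a b := forall i, b i = 0 -> a i = 0.

(** Terms with [a i = 0] vanish whatever the logarithm is; under [dominated a q] no other term has a
    zero denominator. *)
Definition kl a q : R := \sum_i a i * ln (a i / q i).

Lemma kl_phi a q : pmf a -> pmf q -> dominated a q ->
  kl a q = \sum_i q i * phi (a i / q i).
Proof.
move=> [a0 a1] [q0 q1] aq.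
have -> : kl a q = \sum_i (a i * ln (a i / q i) - a i + q i).
  by rewrite big_split/= big_split/= sumrN a1 q1 subrK.
apply: eq_bigr => i _; have [q0i|qn] := eqVneq (q i) 0.
  by rewrite (aq _ q0i) q0i !mul0r subr0 addr0.
by rewrite /phi mulrDr mulrBr mulr1 !mulrA [q i * a i]mulrC mulfK.
Qed.

Lemma kl_ge0 a q : pmf a -> pmf q -> dominated a q -> 0 <= kl a q.
Proof.
move=> pa pq aq; rewrite kl_phi// sumr_ge0// => i _.
by rewrite mulr_ge0 ?pq.1// phi_ge0// divr_ge0 ?pq.1 ?pa.1.
Qed.

(** The two sides differ by [kl a b]. *)
Lemma kl_gibbs a b q : pmf a -> pmf b -> pmf q -> dominated a b -> dominated b q ->
  \sum_i a i * ln (b i / q i) <= kl a q.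
Proof.
move=> pa pb pq ab bq; rewrite -subr_ge0.
suff -> : kl a q - \sum_i a i * ln (b i / q i) = kl a b by exact: kl_ge0.
rewrite /kl -sumrB; apply: eq_bigr => i _; rewrite -mulrBr.
have [->|an] := eqVneq (a i) 0; first by rewrite !mul0r.
have bn : b i != 0 by apply: contra an => /eqP/ab ->.
have qn : q i != 0 by apply: contra bn => /eqP/bq ->.
have a0 : 0 < a i by rewrite lt_neqAle eq_sym an pa.1.
have b0 : 0 < b i by rewrite lt_neqAle eq_sym bn pb.1.
have q0 : 0 < q i by rewrite lt_neqAle eq_sym qn pq.1.
congr (_ * _); rewrite -ln_div ?posrE ?divr_gt0//; congr ln.
by field; rewrite bn qn.
Qed.

(** Convexity of entropy: [kl_gibbs] with the average as test law, summed over [i], has [N] times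
    the entropy of the average on its left. *)
Lemma kl_avg N (a : 'I_N -> I -> R) q : (0 < N)%N -> pmf q ->
  (forall i, pmf (a i)) -> (forall i, dominated (a i) q) ->
  N%:R * kl (fun k => N%:R^-1 * \sum_i a i k) q <= \sum_i kl (a i) q.
Proof.
move=> N0 pq pa aq; set b := fun k => _.
have Nn : N%:R != 0 :> R by rewrite pnatr_eq0 -lt0n.
have Np : 0 < N%:R^-1 :> R by rewrite invr_gt0 ltr0n.
have pb : pmf b.
  split=> [k|]; first by rewrite mulr_ge0 ?(ltW Np)// sumr_ge0// => i _; exact: (pa i).1.
  rewrite -mulr_sumr exchange_big/=.
  by under eq_bigr do rewrite (pa _).2; rewrite sumr_const card_ord mulVf.
have ab i : dominated (a i) b.
  move=> k /eqP; rewrite mulf_eq0 gt_eqF//= psumr_eq0 => [|j _]; last exact: (pa j).1.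
  by move=> /allP/(_ i); rewrite mem_index_enum => /(_ isT)/eqP.
have bq : dominated b q.
  by move=> k qk; rewrite /b big1 ?mulr0// => i _; exact: aq.
have -> : N%:R * kl b q = \sum_i \sum_k a i k * ln (b k / q k).
  rewrite exchange_big/= mulr_sumr; apply: eq_bigr => k _.
  by rewrite -mulr_suml mulrA /b mulVKf.
by apply: ler_sum => i _; exact: kl_gibbs.
Qed.

End finite_entropy.

(** * Conditional expectation along an equivalence relation on a finite set *)

Section conditional_expectation.
Context (R : realType) (C : finType) (p : C -> R) (e : rel C).
Hypotheses (p_ge0 : forall c, 0 <= p c) (e_equiv : equivalence_rel e).

Definition class_mass c : R := \sum_(c' | e c c') p c'.

(** On a class of mass zero the inverse, hence the mean, is 0. This is harmless: conditional means
    only count with the weight [p c]. *)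
Definition cond_mean (F : C -> R) c : R :=
  (class_mass c)^-1 * \sum_(c' | e c c') p c' * F c'.

Let e_sym c c' : e c c' = e c' c.
Proof.
have [_ ec] := e_equiv c c c; apply/idP/idP => h.
  by have [_ /(_ h) <-] := e_equiv c c' c; have [-> _] := e_equiv c c c.
by have [_ /(_ h) <-] := e_equiv c' c c'; have [-> _] := e_equiv c' c' c'.
Qed.

Lemma eq_class_mass c c' : e c c' -> class_mass c = class_mass c'.
Proof.
by move=> cc'; apply: eq_bigl => x; have [_ /(_ cc') ->] := e_equiv c c' x.
Qed.

Lemma le_class_mass c : p c <= class_mass c.
Proof.
rewrite /class_mass (bigD1 c)/=; last by have [-> _] := e_equiv c c c.
by rewrite lerDl sumr_ge0.
Qed.

(** The first argument of [F] is a parameter constant on classes: it stands for what is already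
    known when the mean is taken. After exchanging the sums each [c'] collects the mass of its own
    class, which cancels the normalisation. *)
Lemma cond_mean_tower (F : C -> C -> R) :
  (forall c c', e c c' -> F c =1 F c') ->
  \sum_c p c * cond_mean (F c) c = \sum_c p c * F c c.
Proof.
move=> FE; transitivity (\sum_c \sum_(c' | e c c')
    p c * (class_mass c')^-1 * (p c' * F c' c')).
  apply: eq_bigr => c _; rewrite mulrA mulr_sumr; apply: eq_bigr => c' cc'.
  by rewrite (eq_class_mass cc') (FE _ _ cc').
rewrite (exchange_big_dep xpredT)//=; apply: eq_bigr => c _.
rewrite -2!mulr_suml; under eq_bigl do rewrite e_sym.
have [->|pn] := eqVneq (p c) 0; first by rewrite !(mul0r, mulr0).
rewrite -/(class_mass c) mulfV ?mul1r// gt_eqF//.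
by rewrite (lt_le_trans _ (le_class_mass c))// lt_neqAle eq_sym pn p_ge0.
Qed.

Lemma cond_mean_sum J (s : seq J) (F : J -> C -> R) c :
  cond_mean (fun c' => \sum_(j <- s) F j c') c = \sum_(j <- s) cond_mean (F j) c.
Proof.
rewrite -mulr_sumr exchange_big/=; congr (_ * _).
by apply: eq_bigr => c' _; rewrite mulr_sumr.
Qed.

Lemma cond_meanZ (r : R) (F : C -> R) c :
  cond_mean (fun c' => r * F c') c = r * cond_mean F c.
Proof.
rewrite /cond_mean mulrCA; congr (_ * _); rewrite mulr_sumr.
by apply: eq_bigr => c' _; rewrite mulrCA.
Qed.

Lemma cond_meanZr (r : R) (F : C -> R) c :
  cond_mean (fun c' => F c' * r) c = cond_mean F c * r.
Proof.
rewrite mulrC -cond_meanZ; congr (_ * _); apply: eq_bigr => c' _.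
by rewrite [in RHS](mulrC r).
Qed.

Lemma cond_mean1 c : p c != 0 -> cond_mean (fun=> 1) c = 1.
Proof.
move=> pn; rewrite /cond_mean; under eq_bigr do rewrite mulr1.
rewrite mulVf// gt_eqF// (lt_le_trans _ (le_class_mass c))//.
by rewrite lt_neqAle eq_sym pn p_ge0.
Qed.

End conditional_expectation.

(** * Quadratic forms that are nonnegative on differences of laws *)

Section bilinear.
Context (R : realType) (I : finType).
Implicit Types (k : I -> I -> R) (u v w : I -> R) (q : I -> R).

Definition bil k u v : R := \sum_i \sum_j u i * v j * k i j.

Lemma bilDl k u u' v : bil k (fun i => u i + u' i) v = bil k u v + bil k u' v.
Proof.
rewrite -big_split; apply: eq_bigr => i _; rewrite -big_split.
by apply: eq_bigr => j _; rewrite !mulrDl.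
Qed.

Lemma bilZl k r u v : bil k (fun i => r * u i) v = r * bil k u v.
Proof.
rewrite mulr_sumr; apply: eq_bigr => i _; rewrite mulr_sumr.
by apply: eq_bigr => j _; rewrite !mulrA.
Qed.

Lemma bilC k u v : (forall i j, k i j = k j i) -> bil k u v = bil k v u.
Proof.
move=> kC; rewrite /bil exchange_big; apply: eq_bigr => i _; apply: eq_bigr => j _.
by rewrite kC; congr (_ * _); rewrite mulrC.
Qed.

Lemma bilBl k u u' v : bil k (fun i => u i - u' i) v = bil k u v - bil k u' v.
Proof.
have -> : (fun i => u i - u' i) = (fun i => u i + -1 * u' i).
  by apply/funext => i; rewrite mulN1r.
by rewrite bilDl bilZl mulN1r.
Qed.

Lemma bilBr k u v v' : bil k u (fun i => v i - v' i) = bil k u v - bil k u v'.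
Proof.
rewrite -sumrB; apply: eq_bigr => i _; rewrite -sumrB.
by apply: eq_bigr => j _; rewrite mulrBr mulrBl.
Qed.

Lemma bil_sumr k J (s : seq J) u (v : J -> I -> R) :
  bil k u (fun i => \sum_(j <- s) v j i) = \sum_(j <- s) bil k u (v j).
Proof.
rewrite /bil [RHS]exchange_big; apply: eq_bigr => i _; rewrite [RHS]exchange_big.
by apply: eq_bigr => j _; rewrite mulr_sumr mulr_suml.
Qed.

Lemma bil_delta k i j :
  bil k (fun i' => (i == i')%:R) (fun j' => (j == j')%:R) = k i j.
Proof.
rewrite /bil (bigD1 i)//= [X in _ + X]big1 => [|i' ii']; last first.
  by rewrite big1// => j' _; rewrite eq_sym (negPf ii') !mul0r.
rewrite (bigD1 j)//= [X in _ + X + _]big1 => [|j' jj']; last first.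
  by rewrite (eq_sym j) (negPf jj') mulr0 mul0r.
by rewrite !eqxx !mul1r !addr0.
Qed.

(** Nonnegativity is demanded on differences of probability vectors only, because kernels are known
    to be positive only when tested on probability measures; domination by [q] is what lets such
    vectors be realised by measures. *)
Definition positive_on q k := forall a b, pmf a -> pmf b ->
  dominated a q -> dominated b q ->
  0 <= bil k (fun i => a i - b i) (fun i => a i - b i).

(* [t (a - b) + (a' - b')] is a multiple of a difference of two probability
   vectors. *)
Lemma positive_on2 q k (t : R) a b a' b' : positive_on q k -> 0 <= t ->
  pmf a -> pmf b -> pmf a' -> pmf b' ->
  dominated a q -> dominated b q -> dominated a' q -> dominated b' q ->
  0 <= bil k (fun i => t * (a i - b i) + (a' i - b' i))
             (fun i => t * (a i - b i) + (a' i - b' i)).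
Proof.
move=> kp t0 [a0 a1] [b0 b1] [a'0 a'1] [b'0 b'1] aq bq a'q b'q.
set u := fun i => _.
have t1 : 0 < 1 + t by lra.
pose x i := (1 + t)^-1 * (t * a i + a' i); pose y i := (1 + t)^-1 * (t * b i + b' i).
have px : pmf x.
  split=> [i|]; first by rewrite mulr_ge0 ?invr_ge0 ?(ltW t1)// addr_ge0// mulr_ge0.
  by rewrite -mulr_sumr big_split/= -mulr_sumr a1 a'1 mulr1 addrC mulVf ?gt_eqF.
have py : pmf y.
  split=> [i|]; first by rewrite mulr_ge0 ?invr_ge0 ?(ltW t1)// addr_ge0// mulr_ge0.
  by rewrite -mulr_sumr big_split/= -mulr_sumr b1 b'1 mulr1 addrC mulVf ?gt_eqF.
have := kp _ _ px py; have -> : u = fun i => (1 + t) * (x i - y i).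
  by apply/funext => i; rewrite /u /x /y; field; rewrite gt_eqF.
rewrite bilZl; have -> (v w : I -> R) : bil k v (fun i => (1 + t) * w i) = (1 + t) * bil k v w.
  rewrite /bil mulr_sumr; apply: eq_bigr => i _; rewrite mulr_sumr.
  by apply: eq_bigr => j _; rewrite mulrCA !mulrA.
move=> h; rewrite mulr_ge0 ?(ltW t1)// mulr_ge0 ?(ltW t1)//; apply: h.
  by move=> i qi; rewrite /x aq// a'q// mulr0 addr0 mulr0.
by move=> i qi; rewrite /y bq// b'q// mulr0 addr0 mulr0.
Qed.

(** Young's inequality for a form that is not known to be nonnegative on all vectors: expand it at
    [t u + v] and at [t u - v], two vectors covered by [positive_on2], and divide by [t]. *)
Lemma positive_on_cross q k (t : R) a b a' b' : (forall i j, k i j = k j i) ->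
  positive_on q k -> 0 < t ->
  pmf a -> pmf b -> pmf a' -> pmf b' ->
  dominated a q -> dominated b q -> dominated a' q -> dominated b' q ->
  `|2 * bil k (fun i => a i - b i) (fun i => a' i - b' i)| <=
  t * bil k (fun i => a i - b i) (fun i => a i - b i) +
  t^-1 * bil k (fun i => a' i - b' i) (fun i => a' i - b' i).
Proof.
move=> kC kp t0 pa pb pa' pb' aq bq a'q b'q.
set u := fun i => a i - b i; set v := fun i => a' i - b' i.
have E (s : R) (y z : I -> R) :
    bil k (fun i => t * y i + s * z i) (fun i => t * y i + s * z i) =
    t * (t * bil k y y + 2 * s * bil k y z + t^-1 * (s ^+ 2 * bil k z z)).
  rewrite bilDl !bilZl !(bilC _ (fun i => t * y i + s * z i))// !bilDl !bilZl.
  by rewrite (bilC z y)//; field; rewrite gt_eqF.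
have h1 := positive_on2 kp (ltW t0) pa pb pa' pb' aq bq a'q b'q.
have h2 := positive_on2 kp (ltW t0) pa pb pb' pa' aq bq b'q a'q.
have E1 := E 1 u v; have E2 := E (-1) u v.
have F1 : (fun i => t * u i + 1 * v i) = (fun i => t * (a i - b i) + (a' i - b' i)).
  by apply/funext => i; rewrite mul1r.
have F2 : (fun i => t * u i + -1 * v i) = (fun i => t * (a i - b i) + (b' i - a' i)).
  by apply/funext => i; rewrite mulN1r opprB.
move: h1 h2 => /=; rewrite -F1 -F2 E1 E2 !pmulr_rge0// => h1 h2.
rewrite ler_norml; apply/andP; split; lra.
Qed.

End bilinear.

(** * Revealing the particles one at a time *)

Section martingale.
Context (R : realType) (I : finType) (N : nat).
Local Notation C := (N.-tuple I).

(** Agreement strictly before [i], that is, the information available just before particle [i] is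
    revealed. For [i = 0] there is a single class, for [i = N] all classes are singletons. *)
Definition same_prefix (i : nat) : rel C := fun c c' =>
  [forall j : 'I_N, (j < i)%N ==> (tnth c j == tnth c' j)].

Lemma same_prefixP i c c' :
  reflect (forall j : 'I_N, (j < i)%N -> tnth c j = tnth c' j) (same_prefix i c c').
Proof.
apply: (iffP forallP) => h j; last by apply/implyP => /h ->.
by move=> ji; have := h j; rewrite ji => /eqP.
Qed.

Lemma same_prefix_equiv i : equivalence_rel (same_prefix i).
Proof.
move=> c c' c''; split; first exact/same_prefixP.
move=> /same_prefixP cc'; apply/same_prefixP/same_prefixP => h j ji.
  by rewrite -cc'// h.
by rewrite cc'// h.
Qed.

Variables (p : C -> R).
Hypothesis pp : pmf p.

Definition conditional_pmf (i : 'I_N) (c : C) (x : I) : R :=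
  cond_mean p (same_prefix i) (fun c' => (tnth c' i == x)%:R) c.
Local Notation a := conditional_pmf.

Lemma eq_conditional_pmf (i : 'I_N) c c' : same_prefix i c c' -> a i c = a i c'.
Proof.
move=> cc'; apply/funext => x; rewrite /a /cond_mean.
rewrite (eq_class_mass p (same_prefix_equiv i) cc'); congr (_ * _).
by apply: eq_bigl => y; have [_ /(_ cc') ->] := same_prefix_equiv i c c' y.
Qed.

Lemma conditional_pmfP i c : p c != 0 -> pmf (a i c).
Proof.
move=> pn; split=> [x|]; last first.
  rewrite -cond_mean_sum -[RHS](cond_mean1 pp.1 (same_prefix_equiv i) pn).
  congr (_ * _); apply: eq_bigr => c' _; congr (_ * _).
  by rewrite (bigD1 (tnth c' i))//= eqxx big1 ?addr0// => x; rewrite eq_sym => /negPf->.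
rewrite mulr_ge0 ?invr_ge0// sumr_ge0// => [c' _|c' _]; first exact: pp.1.
by rewrite mulr_ge0// pp.1.
Qed.

(** [F] sees the configuration only through the particles before [i]; drawing particle [i] afresh
    from its conditional law then leaves the mean unchanged. *)
Lemma mean_conditional_pmf (i : 'I_N) (F : I -> C -> R) :
  (forall c c', same_prefix i c c' -> F^~ c =1 F^~ c') ->
  \sum_c p c * \sum_x a i c x * F x c = \sum_c p c * F (tnth c i) c.
Proof.
move=> FE; rewrite -(cond_mean_tower pp.1 (same_prefix_equiv i) (F := fun c c' => F (tnth c' i) c)).
  apply: eq_bigr => c _; congr (_ * _).
  under eq_bigr do rewrite -cond_meanZr.
  rewrite -cond_mean_sum; congr (_ * _); apply: eq_bigr => c' _; congr (_ * _).
  rewrite (bigD1 (tnth c' i))//= eqxx mul1r big1 ?addr0// => x xn.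
  by rewrite eq_sym (negPf xn) mul0r.
by move=> c c' cc' c''; rewrite (FE _ _ cc').
Qed.

Lemma conditional_pmf_dominated i c q :
  (forall c, p c != 0 -> q (tnth c i) != 0) -> dominated (a i c) q.
Proof.
move=> pq x qx; rewrite /a /cond_mean big1 ?mulr0// => c' _.
have [xE|] := eqVneq (tnth c' i) x; last by rewrite mulr0.
have [->|/pq] := eqVneq (p c') 0; first by rewrite mul0r.
by rewrite xE qx eqxx.
Qed.

Lemma conditional_pmfE (i : 'I_N) c : a i c (tnth c i) =
  class_mass p (same_prefix i.+1) c / class_mass p (same_prefix i) c.
Proof.
rewrite mulrC; congr (_ * _); rewrite [in RHS]/class_mass.
rewrite [in LHS](bigID (fun c' => tnth c' i == tnth c i))/= [X in _ + X]big1 => [|c' /andP[_ /negPf->]]; last by rewrite mulr0.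
rewrite addr0; apply: eq_big => [c'|c' /andP[_ ->]]; last by rewrite mulr1.
apply/andP/same_prefixP => [[/same_prefixP h /eqP ii] j|h].
  by rewrite ltnS leq_eqVlt => /predU1P[/val_inj->//|/h].
by split; [apply/same_prefixP => j /ltnW; exact: h|rewrite h].
Qed.

(** The chain rule. By [conditional_pmfE] the conditional probability of the particle actually
    observed is a ratio of consecutive prefix masses, so the logarithms telescope from the total
    mass 1 down to [p c]. *)
Lemma sum_kl_conditional q : pmf q -> (forall c, p c != 0 -> forall i, q (tnth c i) != 0) ->
  \sum_i \sum_c p c * kl (a i c) q = kl p (fun c => \prod_i q (tnth c i)).
Proof.
move=> pq pq0.
under eq_bigr => i _.
  rewrite (mean_conditional_pmf (i := i) (F := fun x c => ln (a i c x / q x))); last first.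
    by move=> c c' cc' x; rewrite (eq_conditional_pmf cc').
  over.
rewrite exchange_big/=; apply: eq_bigr => c _; rewrite -mulr_sumr.
have [->|pn] := eqVneq (p c) 0; first by rewrite !mul0r.
congr (_ * _); pose P i := class_mass p (same_prefix i) c.
have P0 i : 0 < P i.
  apply: lt_le_trans (le_class_mass pp.1 (same_prefix_equiv i) c).
  by rewrite lt_neqAle eq_sym pn pp.1.
have q0 i : 0 < q (tnth c i) by rewrite lt_neqAle eq_sym pq0 ?pq.1.
have lnprod (J : finType) (F : J -> R) : (forall j, 0 < F j) -> ln (\prod_j F j) = \sum_j ln (F j).
  move=> F0; suff : 0 < \prod_j F j /\ ln (\prod_j F j) = \sum_j ln (F j) by case.
  apply: (big_ind2 (fun x y => 0 < x /\ ln x = y)) => //; first by rewrite ln1.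
  by move=> x y z t [x0 xE] [z0 zE]; rewrite mulr_gt0// lnM ?posrE// xE zE.
rewrite ln_div ?posrE//; last 2 first.
  by rewrite lt_neqAle eq_sym pn pp.1.
  by apply: prodr_gt0 => i _.
rewrite lnprod//; under eq_bigr => i _.
  rewrite conditional_pmfE ln_div ?posrE//; last by rewrite divr_gt0// ; exact: P0.
  rewrite ln_div ?posrE; [|exact: P0|exact: P0].
  over.
rewrite sumrB; congr (_ - _).
rewrite -(big_mkord xpredT (fun i => ln (P i.+1) - ln (P i))) telescope_sumr//.
have -> : P 0 = 1.
  rewrite /P /class_mass -pp.2; apply: eq_bigl => c'.
  by apply/same_prefixP => j.
have -> : P N = p c.
  rewrite /P /class_mass (big_pred1 c)// => c'.
  apply/same_prefixP/eqP => [h|->//].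
  by apply: eq_from_tnth => j; rewrite h.
by rewrite ln1 subr0.
Qed.

(* The increments [delta_(c_i) - a_i] are martingale differences, so the
   off-diagonal terms of the square of their sum average to 0. *)
Lemma mean_bil_increments (k : I -> I -> R) : (forall i j, k i j = k j i) ->
  let x i c j := (tnth c i == j)%:R - a i c j in
  let X c j := \sum_i x i c j in
  \sum_c p c * bil k (X c) (X c) =
  \sum_i \sum_c p c * (\sum_j a i c j * k j j - bil k (a i c) (a i c)).
Proof.
move=> kC x X.
have off (i j : 'I_N) : (i < j)%N -> \sum_c p c * bil k (x i c) (x j c) = 0.
  move=> ij; pose F y c := bil k (x i c) (fun z => (y == z)%:R - a j c z).
  rewrite -[LHS](mean_conditional_pmf (i := j) (F := F)); last first.
    move=> c c' cc' y; rewrite /F /x (eq_conditional_pmf cc').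
    move/same_prefixP : (cc') => /(_ _ ij) ->.
    rewrite (@eq_conditional_pmf i c c')//; apply/same_prefixP => l li.
    by move/same_prefixP : cc' => -> //; exact: ltn_trans ij.
  apply: big1 => c _; have [->|pn] := eqVneq (p c) 0; first by rewrite mul0r.
  rewrite /F; under eq_bigr do rewrite bilBr mulrBr.
  rewrite sumrB -mulr_suml (conditional_pmfP j pn).2 mul1r.
  suff -> : \sum_i0 a j c i0 * bil k (x i c) (fun z => (i0 == z)%:R) =
      bil k (x i c) (a j c) by rewrite subrr mulr0.
  have -> : a j c = fun z => \sum_y a j c y * (y == z)%:R.
    apply/funext => z; rewrite (bigD1 z)//= eqxx mulr1 big1 ?addr0// => y /negPf->.
    by rewrite mulr0.
  rewrite bil_sumr; apply: eq_bigr => y _; rewrite (bilC _ (fun z => _ * _))//.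
  rewrite bilZl (bilC _ (x i c))//; congr (_ * _).
  rewrite (bigD1 y)//= eqxx mulr1 big1 ?addr0// => z /negPf zy.
  by rewrite zy mulr0.
have diag i : \sum_c p c * bil k (x i c) (x i c) =
    \sum_c p c * (\sum_j a i c j * k j j - bil k (a i c) (a i c)).
  pose F y c := k y y - 2 * bil k (a i c) (fun z => (y == z)%:R) + bil k (a i c) (a i c).
  transitivity (\sum_c p c * F (tnth c i) c).
    apply: eq_bigr => c _; congr (_ * _).
    rewrite /x bilBl !bilBr bil_delta (bilC _ (a i c))// /F; ring.
  rewrite -(mean_conditional_pmf (i := i)) => [|c c' cc' y]; last first.
    by rewrite /F (eq_conditional_pmf cc').
  apply: eq_bigr => c _; have [->|pn] := eqVneq (p c) 0; first by rewrite !mul0r.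
  congr (_ * _); under eq_bigr do rewrite /F mulrDr mulrBr.
  rewrite big_split sumrB/= -mulr_suml (conditional_pmfP i pn).2 mul1r.
  suff -> : \sum_i0 a i c i0 * (2 * bil k (a i c) (fun z => (i0 == z)%:R)) =
     2 * bil k (a i c) (a i c) by lra.
  have {4}-> : a i c = fun z => \sum_y a i c y * (y == z)%:R.
    apply/funext => z; rewrite (bigD1 z)//= eqxx mulr1 big1 ?addr0// => y /negPf->.
    by rewrite mulr0.
  rewrite bil_sumr mulr_sumr; apply: eq_bigr => y _; rewrite mulrCA; congr (_ * _).
  by rewrite (bilC _ (fun z => _ * _))// bilZl (bilC (a i c)).
rewrite -(eq_bigr _ (fun i _ => diag i)).
transitivity (\sum_i \sum_j \sum_c p c * bil k (x i c) (x j c)).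
  under [RHS]eq_bigr do rewrite exchange_big/=.
  rewrite [RHS]exchange_big/=; apply: eq_bigr => c _.
  rewrite (bil_sumr k _ (X c) (fun i => x i c)) mulr_sumr; apply: eq_bigr => i _.
  by rewrite (bilC (X c))// (bil_sumr k _ (x i c) (fun i => x i c)) mulr_sumr.
apply: eq_bigr => i _; rewrite (bigD1 i)//= [X in _ + X]big1 ?addr0// => j ji.
have [ij|ij] := ltnP i j; first exact: off.
rewrite (eq_bigr (fun c => p c * bil k (x j c) (x i c))) => [|c _]; last by rewrite bilC.
by apply: off; rewrite ltn_neqAle ij andbT; apply: contra ji => /eqP/val_inj->.
Qed.

End martingale.

Lemma bil_sqrD (R : realType) (I : finType) (k : I -> I -> R) (u v : I -> R) :
  (forall i j, k i j = k j i) ->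
  bil k (fun i => u i + v i) (fun i => u i + v i) =
  bil k u u + 2 * bil k u v + bil k v v.
Proof.
move=> kC; rewrite bilDl (bilC u)// (bilC v)// !bilDl (bilC v u)//; ring.
Qed.

(** * The energy inequality for laws on finitely many cells *)

Section discrete_core.
Context (R : realType) (I : finType) (N : nat).
Variables (q : I -> R) (kp km : I -> I -> R) (gp gm : I -> R).
Variables (S c0 l4 delta eps : R).
Hypotheses (N_gt0 : (0 < N)%N) (pq : pmf q).
Hypotheses (kpC : forall i j, kp i j = kp j i) (kmC : forall i j, km i j = km j i).
Hypotheses (S_ge0 : 0 <= S) (delta_gt0 : 0 < delta) (delta_le1 : delta <= 1).
(** When [S = 0] the parameter [eps * delta / S] wanted in Young's inequality is infinite; both
    error constants have to vanish then. *)
Hypotheses (eps_gt0 : 0 < eps) (S0 : S = 0 -> c0 = 0 /\ l4 = 0).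
Hypotheses (c0_ge0 : 0 <= c0) (l4_ge0 : 0 <= l4).
Hypotheses (kp_pos : positive_on q kp) (km_pos : positive_on q km).
Hypotheses (gp_ge0 : forall i, q i != 0 -> 0 <= gp i).
Hypotheses (gm_ge0 : forall i, q i != 0 -> 0 <= gm i).

Let dq (a : I -> R) i := a i - q i.

Hypothesis sum_le_kl : forall a, pmf a -> dominated a q ->
  bil kp (dq a) (dq a) + bil km (dq a) (dq a) <= 2 * S * kl a q.
(** Without [gp] and [gm], each bracket is the mean of the form at [delta_i - a] for [i] of law [a],
    the size of one martingale increment. [gp] and [gm] restore the diagonal of the kernel, which
    averaging over pairs of points of a cell loses. *)
Hypothesis gap_le_kl : forall a, pmf a -> dominated a q ->
  (\sum_i a i * (gp i + kp i i) - bil kp a a) +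
  (\sum_i a i * (gm i + km i i) - bil km a a) <= c0 + l4 * kl a q.
Hypothesis coercive : forall a, pmf a -> dominated a q ->
  delta * kl a q <= kl a q + 2^-1 * (bil kp (dq a) (dq a) - bil km (dq a) (dq a)).

Definition empirical_pmf (c : N.-tuple I) (j : I) : R :=
  N%:R^-1 * \sum_i (tnth c i == j)%:R.

(** The cell version of [N/2 <W_*, mu^2>]. A particle interacts with itself on the diagonal of the
    kernel, whereas the matrices average over two independent points of a cell; the sum of [gp - gm]
    makes up for this. *)
Definition mean_energy (c : N.-tuple I) : R :=
  (2 * N%:R)^-1 * (N%:R ^+ 2 * (bil kp (dq (empirical_pmf c)) (dq (empirical_pmf c))
                                - bil km (dq (empirical_pmf c)) (dq (empirical_pmf c)))
                   + \sum_i (gp (tnth c i) - gm (tnth c i))).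

Variable p : N.-tuple I -> R.
Hypothesis pp : pmf p.
Hypothesis p_dom : forall c, p c != 0 -> forall i, q (tnth c i) != 0.

Local Notation a := (conditional_pmf p).
Let qN (c : N.-tuple I) := \prod_i q (tnth c i).
Let x i (c : N.-tuple I) j := (tnth c i == j)%:R - a i c j.
Let X c j := \sum_i x i c j.

Let Nn : N%:R != 0 :> R. Proof. by rewrite pnatr_eq0 -lt0n. Qed.
Let Np : 0 < N%:R :> R. Proof. by rewrite ltr0n. Qed.

Let pmf_delta (i : I) : pmf (fun j => (i == j)%:R : R).
Proof. by split=> [j|]; rewrite ?ler0n// (bigD1 i)//= eqxx big1 ?addr0// => j; rewrite eq_sym => /negPf->. Qed.

Let pmf_avg (b : 'I_N -> I -> R) : (forall i, pmf (b i)) ->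
  pmf (fun j => N%:R^-1 * \sum_i b i j).
Proof.
move=> pb; split=> [k|].
  by rewrite mulr_ge0 ?invr_ge0 ?(ltW Np)// sumr_ge0// => i _; exact: (pb i).1.
rewrite -mulr_sumr exchange_big/=.
by under eq_bigr do rewrite (pb _).2; rewrite sumr_const card_ord mulVf.
Qed.

Let dom_avg (b : 'I_N -> I -> R) : (forall i, dominated (b i) q) ->
  dominated (fun j => N%:R^-1 * \sum_i b i j) q.
Proof. by move=> bq k qk; rewrite big1 ?mulr0// => i _; exact: bq. Qed.

(** Split [mu - q] into [eta - q] and [mu - eta], with [eta] the average of the conditional laws.
    Coercivity applies to [eta]; the cross term costs [t] times the squares of the first part and
    [t^-1] times those of the second; by convexity the entropy of [eta] is at most the average of
    the conditional entropies. *)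
Let energy_ge (t : R) c : p c != 0 -> 0 < t -> t * S <= eps * delta ->
  - (1 - delta + eps * delta) * \sum_i kl (a i c) q
  - (1 + t^-1) / (2 * N%:R) * (bil kp (X c) (X c) + bil km (X c) (X c)
     + \sum_i (gp (tnth c i) + gm (tnth c i))) <= mean_energy c.
Proof.
move=> pn t0 tS.
have pa i : pmf (a i c) := conditional_pmfP pp i pn.
have aq i : dominated (a i c) q by apply: conditional_pmf_dominated => c' /p_dom.
pose eta j := N%:R^-1 * \sum_i a i c j.
have peta : pmf eta by exact: pmf_avg.
have etaq : dominated eta q by exact: dom_avg.
pose mu := empirical_pmf c.
have pmu : pmf mu by apply: pmf_avg => i; exact: pmf_delta.
have muq : dominated mu q.
  apply: dom_avg => i j qj; have [E|//] := eqVneq (tnth c i) j.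
  by have := p_dom pn i; rewrite E qj eqxx.
have XE : X c = fun j => N%:R * (mu j - eta j).
  by apply/funext => j; rewrite /X sumrB mulrBr /mu /eta /empirical_pmf !mulVKf.
have bilX k : bil k (X c) (X c) = N%:R ^+ 2 * bil k (fun j => mu j - eta j) (fun j => mu j - eta j).
  rewrite XE bilZl expr2 -mulrA; congr (_ * _).
  rewrite /bil mulr_sumr; apply: eq_bigr => i _; rewrite mulr_sumr.
  by apply: eq_bigr => j _; rewrite mulrCA !mulrA.
pose b j := mu j - eta j.
have sq k : (forall i j, k i j = k j i) -> positive_on q k ->
    `|bil k (dq mu) (dq mu) - bil k (dq eta) (dq eta) - bil k b b| <=
     t * bil k (dq eta) (dq eta) + t^-1 * bil k b b.
  move=> kC kpos.
  have -> : dq mu = fun j => dq eta j + b j.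
    by apply/funext => j; rewrite /dq /b; ring.
  rewrite bil_sqrD//.
  have := positive_on_cross kC kpos t0 peta pq pmu peta etaq (fun _ => id) muq etaq.
  rewrite -/b -/(dq eta); congr (`| _ | <= _); ring.
have := sq _ kpC kp_pos; have := sq _ kmC km_pos; rewrite !ler_norml.
move=> /andP[_ hm] /andP[hp _].
have bp0 : 0 <= bil kp b b by exact: kp_pos.
have bm0 : 0 <= bil km b b by exact: km_pos.
have gpge : 0 <= \sum_i gp (tnth c i) by apply: sumr_ge0 => i _; exact/gp_ge0/p_dom.
have gmge : 0 <= \sum_i gm (tnth c i) by apply: sumr_ge0 => i _; exact/gm_ge0/p_dom.
have ti : 0 < t^-1 by rewrite invr_gt0.
have cov := kl_avg N_gt0 pq pa aq.
have D0 : 0 <= kl eta q by exact: kl_ge0.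
have co := coercive peta etaq; have su := sum_le_kl peta etaq.
(* The error [t] times the squares of [eta - q] takes a fraction [eps] of the coercivity constant,
   and the squares of [b] enter with coefficients at least [- (1 + t^-1)]. *)
have M1 : - (1 - delta + eps * delta) * (2 * kl eta q) - (1 + t^-1) * (bil kp b b + bil km b b) <=
    bil kp (dq mu) (dq mu) - bil km (dq mu) (dq mu).
  have h1 : t * (bil kp (dq eta) (dq eta) + bil km (dq eta) (dq eta)) <= eps * delta * (2 * kl eta q).
    have : t * (2 * S * kl eta q) <= eps * delta * (2 * kl eta q) by nra.
    by apply: le_trans; rewrite ler_wpM2l// ltW.
  nra.
have e0 : 0 <= 1 - delta + eps * delta by rewrite addr_ge0 ?subr_ge0// mulr_ge0// ltW.
rewrite /mean_energy !bilX big_split sumrB/= -/mu -/b.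
have -> : (2 * N%:R)^-1 = 2^-1 * N%:R^-1 :> R by rewrite invfM.
have A1 := ler_wpM2l e0 cov; rewrite -/eta in A1.
have NV : 0 < N%:R^-1 :> R by rewrite invr_gt0.
have A2 := ler_wpM2l (ltW Np) M1.
have np := Np; have nn := Nn; set n := N%:R : R in A1 A2 NV np nn *.
have nE y : 2^-1 * n^-1 * (n ^+ 2 * y) = 2^-1 * n * y by field.
set GP := \sum_i gp _ in gpge *; set GM := \sum_i gm _ in gmge *.
have A3 : - (1 + t^-1) * (GP + GM) <= GP - GM by nra.
have A4 := ler_wpM2l (ltW NV) A3.
set Bp := bil kp b b in A2 bp0 *; set Bm := bil km b b in A2 bm0 *.
set T := 1 + t^-1 in A2 A3 A4 *.
set E := bil kp _ _ - _ in A2 *.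
rewrite [leRHS]mulrDr nE.
have -> : T * (2 ^-1 / n) = T / (2 * n) by rewrite invfM.
have -> : T / (2 * n) * (n ^+ 2 * Bp + n ^+ 2 * Bm + (GP + GM)) =
  2^-1 * (n * (T * (Bp + Bm))) + 2^-1 * (n^-1 * (T * (GP + GM))) by field.
by move: A1 A2 A4; lra.
Qed.

Let c0l4 (t : R) : 0 < t -> (S != 0 -> t * S = eps * delta) ->
  (1 + t^-1) * c0 = (1 + S / (eps * delta)) * c0 /\
  (1 + t^-1) * l4 = (1 + S / (eps * delta)) * l4.
Proof.
move=> t0 tS; have [SE|Sn] := eqVneq S 0; first by have [-> ->] := S0 SE; rewrite !mulr0.
by rewrite -tS//; split; congr (_ * _); congr (_ + _); field; rewrite Sn gt_eqF.
Qed.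

(** Average [energy_ge] over [p]: the conditional entropies add up to the entropy of [p], and the
    squares of the martingale, reduced to their diagonal by orthogonality, are bounded by
    [gap_le_kl]. For [t = eps * delta / S] the factor [1 + t^-1] is the announced one. *)
Theorem discrete_core :
  0 <= (1 - ((1 - eps) * delta - (1 + S / (eps * delta)) * (l4 / (2 * N%:R)))) * kl p qN
       + \sum_c p c * mean_energy c + (1 + S / (eps * delta)) * (c0 / 2).
Proof.
have ed : 0 < eps * delta by rewrite mulr_gt0.
have [t [t0 tS]] : exists t : R, 0 < t /\ (S != 0 -> t * S = eps * delta).
  (* For [S = 0] any [t] will do, as the error constants vanish. *)
  have [->|Sn] := eqVneq S 0; first by exists 1.
  exists (eps * delta / S); rewrite divr_gt0//; last by rewrite lt_neqAle eq_sym Sn S_ge0.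
  by split => // _; rewrite divfK.
have tS' : t * S <= eps * delta.
  by have [->|/tS->//] := eqVneq S 0; rewrite mulr0 ltW.
have [tc tl] := c0l4 t0 tS.
have T0 : 0 <= 1 + t^-1 by rewrite addr_ge0// invr_ge0 ltW.
have : \sum_c p c * (- (1 - delta + eps * delta) * \sum_i kl (a i c) q
  - (1 + t^-1) / (2 * N%:R) * (bil kp (X c) (X c) + bil km (X c) (X c)
     + \sum_i (gp (tnth c i) + gm (tnth c i)))) <= \sum_c p c * mean_energy c.
  apply: ler_sum => c _; have [->|pn] := eqVneq (p c) 0; first by rewrite !mul0r.
  by rewrite ler_wpM2l ?pp.1//; exact: energy_ge.
set e := 1 - delta + eps * delta; set T := (1 + t^-1) / _.
have klE : \sum_c p c * \sum_i kl (a i c) q = kl p qN.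
  rewrite -(sum_kl_conditional pp pq p_dom) exchange_big/=.
  by apply: eq_bigr => c _; rewrite mulr_sumr.
have -> : \sum_c p c * (- e * (\sum_i kl (a i c) q) -
   T * (bil kp (X c) (X c) + bil km (X c) (X c) + \sum_i (gp (tnth c i) + gm (tnth c i)))) =
  - e * kl p qN - T * (\sum_c p c * bil kp (X c) (X c) + \sum_c p c * bil km (X c) (X c)
    + \sum_c p c * \sum_i (gp (tnth c i) + gm (tnth c i))).
  rewrite -klE !mulr_sumr -!big_split/= mulr_sumr -sumrB; apply: eq_bigr => c _.
  by ring.
rewrite (mean_bil_increments pp kpC) (mean_bil_increments pp kmC).
have gE : \sum_c p c * (\sum_i (gp (tnth c i) + gm (tnth c i))) =
   \sum_i \sum_c p c * (\sum_j a i c j * (gp j + gm j)).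
  rewrite [RHS](eq_bigr (fun i => \sum_c p c * (gp (tnth c i) + gm (tnth c i)))).
    by rewrite exchange_big/=; apply: eq_bigr => c _; rewrite mulr_sumr.
  by move=> i _; rewrite (mean_conditional_pmf pp (i := i) (F := fun x _ => gp x + gm x)).
rewrite gE -!big_split/=.
set Y := \sum_(i < N) _.
have YE : Y <= N%:R * c0 + l4 * kl p qN.
  have -> : N%:R * c0 + l4 * kl p qN = \sum_i (\sum_c p c * (c0 + l4 * kl (a i c) q)).
    under eq_bigr do (under eq_bigr do rewrite mulrDr mulrCA; rewrite big_split/= -mulr_suml pp.2 mul1r -mulr_sumr).
    by rewrite big_split/= sumr_const card_ord mulr_natl -mulr_sumr (sum_kl_conditional pp pq p_dom).
  apply: ler_sum => i _; rewrite -!big_split/=; apply: ler_sum => c _.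
  have [->|pn] := eqVneq (p c) 0; first by rewrite !mul0r !addr0.
  rewrite -!mulrDr ler_wpM2l ?pp.1//.
  have aq : dominated (a i c) q by apply: conditional_pmf_dominated => c' /p_dom.
  apply: le_trans (gap_le_kl (conditional_pmfP pp i pn) aq).
  under [X in _ <= (X - _) + _]eq_bigr do rewrite mulrDr.
  under [X in _ <= _ + (X - _)]eq_bigr do rewrite mulrDr.
  under [X in _ + X <= _]eq_bigr do rewrite mulrDr.
  by rewrite !big_split/= le_eqVlt; apply/orP; left; apply/eqP; ring.
have T0' : 0 <= T by rewrite divr_ge0// mulr_ge0.
have := ler_wpM2l T0' YE.
have -> : T * (N%:R * c0 + l4 * kl p qN) =
   (1 + S / (eps * delta)) * (c0 / 2) + (1 + S / (eps * delta)) * (l4 / (2 * N%:R)) * kl p qN.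
  rewrite [X in _ = X + _]mulrA -tc [X in _ = _ + X * _]mulrA -tl /T.
  by field; rewrite Nn gt_eqF.
rewrite /e; lra.
Qed.

End discrete_core.

(** * Integrals of real functions *)

Section real_integrals.
Context d (T : measurableType d) (R : realType) (mu : {measure set T -> \bar R}).
Implicit Types f g : T -> R.

Definition L1 f : Prop := mu.-integrable setT (EFin \o f).

Lemma L1_measurable f : L1 f -> measurable_fun setT f.
Proof. by move=> /(measurable_int mu)/measurable_EFinP. Qed.

Lemma L1_lty f : L1 f -> (\int[mu]_x `|f x|%:E < +oo)%E.
Proof. by move=> /integrableP[]. Qed.

Lemma L1P f : measurable_fun setT f -> (\int[mu]_x `|f x|%:E < +oo)%E -> L1 f.
Proof. by move=> mf foo; apply/integrableP; split => //; exact/measurable_EFinP. Qed.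

Lemma L1_ge0 f : measurable_fun setT f -> (forall x, 0 <= f x) ->
  (\int[mu]_x (f x)%:E < +oo)%E -> L1 f.
Proof.
move=> mf f0 foo; apply: L1P => //.
by under eq_integral do rewrite ger0_norm//.
Qed.

Lemma L1D f g : L1 f -> L1 g -> L1 (fun x => f x + g x).
Proof. exact: integrableD. Qed.

Lemma L1B f g : L1 f -> L1 g -> L1 (fun x => f x - g x).
Proof. exact: integrableB. Qed.

Lemma L1Z (r : R) f : L1 f -> L1 (fun x => r * f x).
Proof. exact: integrableZl. Qed.

Lemma L1N f : L1 f -> L1 (fun x => - f x).
Proof. exact: integrableN. Qed.

Lemma L1_norm f : L1 f -> L1 (fun x => `|f x|).
Proof. exact: integrable_abse. Qed.

Lemma L1_sum J (s : seq J) (F : J -> T -> R) :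
  (forall j, L1 (F j)) -> L1 (fun x => \sum_(j <- s) F j x).
Proof.
move=> h; rewrite /L1 (_ : _ \o _ = fun x => (\sum_(j <- s) (F j x)%:E)%E).
  by apply: integrable_sum => // j _; exact: h.
by apply/funext => x /=; rewrite sumEFin.
Qed.

Lemma L1_le f g : measurable_fun setT f -> (forall x, `|f x| <= g x) -> L1 g -> L1 f.
Proof.
move=> mf fg ig; apply: le_integrable ig => //; first exact/measurable_EFinP.
by move=> x _ /=; rewrite lee_fin (le_trans (fg x))// ler_norm.
Qed.

Lemma EFin_Rintegral f : L1 f -> (\int[mu]_x f x)%:E = (\int[mu]_x (f x)%:E)%E.
Proof. by move=> fi; rewrite fineK//; exact: integrable_fin_num. Qed.

Lemma RintD f g : L1 f -> L1 g -> \int[mu]_x (f x + g x) = \int[mu]_x f x + \int[mu]_x g x.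
Proof. exact: RintegralD. Qed.

Lemma RintB f g : L1 f -> L1 g -> \int[mu]_x (f x - g x) = \int[mu]_x f x - \int[mu]_x g x.
Proof. exact: RintegralB. Qed.

Lemma RintZ r f : L1 f -> \int[mu]_x (r * f x) = r * \int[mu]_x f x.
Proof. exact: RintegralZl. Qed.

Lemma RintN f : L1 f -> \int[mu]_x (- f x) = - \int[mu]_x f x.
Proof.
move=> fi; under eq_Rintegral do rewrite -mulN1r.
by rewrite RintZ// mulN1r.
Qed.

Lemma Rint_sum J (s : seq J) (F : J -> T -> R) : (forall j, L1 (F j)) ->
  \int[mu]_x (\sum_(j <- s) F j x) = \sum_(j <- s) \int[mu]_x F j x.
Proof.
move=> h; elim: s => [|j s IH].
  rewrite big_nil /Rintegral (_ : (fun x => _) = cst 0%E) ?integral0//.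
  by apply/funext => x; rewrite big_nil.
rewrite big_cons -IH -RintD//; last exact: L1_sum.
by apply: eq_Rintegral => x _; rewrite big_cons.
Qed.

Lemma le_Rint f g : L1 f -> L1 g -> (forall x, f x <= g x) ->
  \int[mu]_x f x <= \int[mu]_x g x.
Proof. by move=> fi gi fg; exact: le_Rintegral. Qed.

Lemma Rint_ge0 f : (forall x, 0 <= f x) -> 0 <= \int[mu]_x f x.
Proof. by move=> f0; exact: Rintegral_ge0. Qed.

Lemma L1_indicM f A : measurable A -> L1 f -> L1 (fun x => \1_A x * f x).
Proof.
move=> mA fi; apply: L1_le (L1_norm fi) => [|x].
  by apply: measurable_funM => //; exact: L1_measurable.
by rewrite normrM indicE; case: (_ \in _); rewrite ?normr1 ?mul1r// normr0 mul0r.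
Qed.

End real_integrals.

Section finite_integrals.
Context d (T : measurableType d) (R : realType) (P : {measure set T -> \bar R}).
Hypothesis P1 : P setT = 1%E.

Lemma L1_cst (r : R) : L1 P (fun=> r).
Proof.
apply: L1P => //; rewrite (_ : (fun x => _) = cst `|r|%:E)//.
by rewrite integral_cst// -/setT P1 mule1 ltry.
Qed.

Lemma Rint_cst (r : R) : \int[P]_x r = r.
Proof. by rewrite Rintegral_cst// P1/= mulr1. Qed.

Lemma L1_bounded (f : T -> R) (M : R) : measurable_fun setT f ->
  (forall x, `|f x| <= M) -> L1 P f.
Proof. by move=> mf fM; apply: L1_le mf fM (L1_cst M). Qed.

End finite_integrals.

Lemma measurable_fun_inv d (T : measurableType d) (R : realType) (f : T -> R) :
  measurable_fun setT f -> (forall x, 0 <= f x) -> measurable_fun setT (fun x => (f x)^-1).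
Proof.
move=> mf f0; rewrite (_ : (fun x => _) = (fun r => powR r (-1)) \o f).
  by apply: measurableT_comp.
by apply/funext => x /=; rewrite powR_inv1.
Qed.

Lemma measurable_fun_phi d (T : measurableType d) (R : realType) (f : T -> R) :
  measurable_fun setT f -> measurable_fun setT (fun x => phi (f x)).
Proof.
move=> mf; apply: measurable_funD => //; apply: measurable_funB => //.
by apply: measurable_funM => //; apply: measurableT_comp.
Qed.

(** * Densities and relative entropy *)

Section densities.
Context d (T : measurableType d) (R : realType).

(** A real, everywhere nonnegative version of the density, which can be multiplied, truncated and
    compared at every point; the Radon-Nikodym derivative agrees with it almost everywhere only. *)
Definition has_density (nu : set T -> \bar R) (mu : {measure set T -> \bar R})
    (f : T -> R) : Prop :=
  [/\ measurable_fun setT f, forall x, 0 <= f x &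
   forall A, measurable A -> nu A = (\int[mu]_(x in A) (f x)%:E)%E].

Variables (nu : {finite_measure set T -> \bar R}).
Variables (mu : {sigma_finite_measure set T -> \bar R}) (f : T -> R).

Lemma has_density_dominates : has_density nu mu f -> nu `<< mu.
Proof.
move=> [mf f0 nuE]; apply/null_content_dominatesP => A mA A0; rewrite nuE//.
by rewrite null_set_integral//; apply/measurable_EFinP; exact: measurable_funTS.
Qed.

Hypothesis dens : has_density nu mu f.

Let dens_m : measurable_fun setT f. Proof. by case: dens. Qed.
Let dens_ge0 x : 0 <= f x. Proof. by case: dens. Qed.

Lemma has_density_L1 : L1 mu f.
Proof.
have [mf f0 nuE] := dens; apply: L1_ge0 => //.
by rewrite -nuE// ltey_eq fin_num_measure.
Qed.

Lemma ae_eq_density : ae_eq mu setT (Radon_Nikodym_SigmaFinite.f nu mu) (EFin \o f).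
Proof.
have [mf f0 nuE] := dens; have nm := has_density_dominates dens.
apply: integral_ae_eq => //.
- exact: Radon_Nikodym_SigmaFinite.f_integrable.
- exact/measurable_EFinP.
- by move=> A _ mA; rewrite -Radon_Nikodym_SigmaFinite.f_integral// nuE.
Qed.

Lemma ge0_integral_density (g : T -> \bar R) : measurable_fun setT g ->
  (forall x, (0 <= g x)%E) ->
  (\int[nu]_x g x = \int[mu]_x (g x * (f x)%:E))%E.
Proof.
move=> mg g0; have nm := has_density_dominates dens.
have mf : measurable_fun setT (EFin \o f) by exact/measurable_EFinP.
rewrite -(Radon_Nikodym_SigmaFinite.change_of_variables nm)//.
apply: ae_eq_integral => //.
- apply: emeasurable_funM => //.
  exact: (measurable_int mu) (Radon_Nikodym_SigmaFinite.f_integrable nm).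
- exact: emeasurable_funM.
- by apply: ae_eqe_mul2l; exact: ae_eq_density.
Qed.

Lemma L1_density (g : T -> R) : measurable_fun setT g ->
  L1 nu g <-> L1 mu (fun x => g x * f x).
Proof.
move=> mg; suff E : (\int[nu]_x `|g x|%:E = \int[mu]_x `|g x * f x|%:E)%E.
  split=> h; (apply: L1P; first by [|apply: measurable_funM]).
    by rewrite -E; exact: L1_lty.
  by rewrite E; exact: L1_lty.
rewrite ge0_integral_density//; last by apply/measurable_EFinP; apply: measurableT_comp.
by apply: eq_integral => x _; rewrite -EFinM normrM (ger0_norm (dens_ge0 x)).
Qed.

(** No integrability is assumed: positive and negative parts agree separately, hence so do the
    default values when a part is infinite. *)
Lemma Rintegral_density (g : T -> R) : measurable_fun setT g ->
  \int[nu]_x g x = \int[mu]_x (g x * f x).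
Proof.
move=> mg; have mg' : measurable_fun setT (EFin \o g) by exact/measurable_EFinP.
rewrite /Rintegral integralE [in RHS]integralE; congr fine; congr (_ - _)%E.
  rewrite ge0_integral_density//; last exact: measurable_funepos.
  apply: eq_integral => x _; rewrite !funeposE/= -!EFin_max -EFinM.
  by rewrite maxr_pMl ?dens_ge0// mul0r.
rewrite ge0_integral_density//; last exact: measurable_funeneg.
apply: eq_integral => x _; rewrite !funenegE/= -!EFin_max -EFinM.
by rewrite maxr_pMl ?dens_ge0// mul0r mulNr.
Qed.

Hypotheses (mu1 : mu setT = 1%E) (nu1 : nu setT = 1%E).

Let mphi : measurable_fun setT (fun x => (phi (f x))%:E).
Proof. by apply/measurable_EFinP; exact: measurable_fun_phi. Qed.

(* [ln f] is split as [(ln f - 1 + 1/f) + (1 - 1/f)]: the first part is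
   nonnegative, and the second one is integrable. *)
Lemma integral_ln_density :
  (\int[nu]_x (ln (f x))%:E = \int[mu]_x (phi (f x))%:E)%E.
Proof.
have [mf f0 nuE] := dens.
pose Z := f @^-1` [set 0].
have mZ : measurable Z by rewrite -[Z]setTI; exact: mf.
pose A x : R := \1_(~` Z) x * (ln (f x) - 1 + (f x)^-1).
pose B x : R := \1_(~` Z) x * (1 - (f x)^-1).
have ZE x : (x \in Z) = (f x == 0).
  by apply/idP/eqP => [|fx]; rewrite inE.
have indZ x : (\1_(~` Z) x : R) = (f x != 0)%:R.
  by rewrite indicE in_setC ZE.
have mA : measurable_fun setT A.
  apply: measurable_funM; first by apply/measurable_indic/measurableC.
  apply: measurable_funD; last exact: measurable_fun_inv.
  by apply: measurable_funB => //; exact: measurableT_comp.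
have mB : measurable_fun setT B.
  apply: measurable_funM; first by apply/measurable_indic/measurableC.
  by apply: measurable_funB => //; exact: measurable_fun_inv.
have A0 x : 0 <= A x.
  rewrite /A indZ; have [->|fx] := eqVneq (f x) 0; first by rewrite mul0r.
  have : 0 < f x by rewrite lt_neqAle eq_sym fx f0.
  by move=> /ln_ge_sub_inv; rewrite mul1r; lra.
have lnE x : ln (f x) = A x + B x.
  rewrite /A /B indZ; have [->|fx] := eqVneq (f x) 0; first by rewrite !mul0r ln0// addr0.
  by rewrite !mul1r; ring.
have AfE x : phi (f x) = A x * f x + \1_Z x.
  have -> : \1_Z x = (f x == 0)%:R :> R.
    by rewrite indicE ZE.
  rewrite /A indZ /phi; have [->|fx] := eqVneq (f x) 0 => /=; first by rewrite !mul0r; lra.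
  by rewrite addr0 mul1r; field.
have BfE x : B x * f x = f x - 1 + \1_Z x.
  have -> : \1_Z x = (f x == 0)%:R :> R.
    by rewrite indicE ZE.
  rewrite /B indZ; have [->|fx] := eqVneq (f x) 0 => /=; first by rewrite !mulr0; lra.
  by rewrite mul1r addr0; field.
have fL := has_density_L1.
have ZL : L1 mu (\1_Z : T -> R).
  by apply: (@L1_bounded _ _ _ mu mu1 _ 1) => // x; rewrite indicE; case: (_ \in _); rewrite ?normr1// normr0.
have c1 := L1_cst mu1 1.
have BL : L1 nu B.
  apply/L1_density => //; rewrite (_ : (fun x => _) = fun x => f x - 1 + \1_Z x); last first.
    by apply/funext => x; exact: BfE.
  by apply: L1D => //; exact: L1B.
have iB : \int[nu]_x B x = \int[mu]_x \1_Z x.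
  rewrite Rintegral_density//; under eq_Rintegral do rewrite BfE.
  rewrite RintD//; last exact: L1B.
  rewrite RintB// Rint_cst//.
  by rewrite {1}/Rintegral -nuE// nu1/= subrr add0r.
have iphi : (\int[mu]_x (phi (f x))%:E = \int[nu]_x (A x)%:E + (\int[nu]_x B x)%:E)%E.
  rewrite iB EFin_Rintegral// ge0_integral_density//; last exact/measurable_EFinP.
  rewrite -ge0_integralD//; last 3 first.
  - by move=> x _; rewrite -EFinM lee_fin mulr_ge0.
  - by apply/measurable_EFinP; exact: measurable_funM.
  - exact/measurable_EFinP.
  by apply: eq_integral => x _; rewrite AfE.
have mA' : measurable_fun setT (EFin \o A) by exact/measurable_EFinP.
have := leey (\int[nu]_x (A x)%:E); rewrite le_eqVlt => /predU1P[Aoo|AL].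
  rewrite iphi Aoo addye//.
  have mln : measurable_fun setT (fun x => (ln (f x))%:E).
    by apply/measurable_EFinP; exact: measurableT_comp.
  have neg : (\int[nu]_x (fun x => (ln (f x))%:E)^\- x < +oo)%E.
    apply: le_lt_trans (L1_lty BL); apply: ge0_le_integral => //.
    - exact: measurable_funeneg.
    - by apply/measurable_EFinP; exact: measurableT_comp.
    move=> x _; rewrite funenegE/= -EFin_max lee_fin ge_max normr_ge0 andbT.
    by have := A0 x; have := ler_norm (- B x); rewrite normrN lnE; lra.
  have pos : (\int[nu]_x (fun x => (ln (f x))%:E)^\+ x = +oo)%E.
    apply/eqP; rewrite -leye_eq leNgt; apply/negP => h.
    suff : (\int[nu]_x (A x)%:E < +oo)%E by rewrite Aoo.
    have := lte_add_pinfty h (L1_lty BL); apply: le_lt_trans.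
    rewrite -ge0_integralD//; last 2 first.
    - exact: measurable_funepos.
    - by apply/measurable_EFinP; exact: measurableT_comp.
    apply: ge0_le_integral => //.
    - by move=> x _; rewrite lee_fin.
    - apply: emeasurable_funD; first exact: measurable_funepos.
      by apply/measurable_EFinP; exact: measurableT_comp.
    move=> x _; rewrite funeposE -EFin_max -EFinD lee_fin.
    have : ln (f x) <= Num.max (ln (f x)) 0 by rewrite le_max lexx.
    by have := ler_norm (- B x); rewrite normrN {1}lnE; lra.
  by rewrite integralE pos addye// eqe_oppLR/= lt_eqF.
have AL1 : L1 nu A by exact: L1_ge0.
rewrite iphi -[in RHS]EFin_Rintegral//; under [LHS]eq_integral do rewrite lnE.
by rewrite integralD_EFin// -!EFin_Rintegral.
Qed.

End densities.

Section entropy_density.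
Context d (T : measurableType d) (R : realType).

(** Under [nu] the density is almost everywhere positive, and there [lne] and [ln] agree;
    [integral_ln_density] then trades the integral against [nu] for that of a nonnegative function
    against [mu]. *)
Lemma relative_entropyE (nu : probability T R) (mu : {sigma_finite_measure set T -> \bar R})
    (f : T -> R) : has_density nu mu f -> mu setT = 1%E ->
  relative_entropy nu mu = (\int[mu]_x (phi (f x))%:E)%E.
Proof.
move=> dens mu1; have nm := has_density_dominates dens.
rewrite /relative_entropy asboolT// -(integral_ln_density dens)//; last exact: probability_setT.
have [mf f0 nuE] := dens.
set g := Radon_Nikodym _ mu.
have fg : ae_eq mu setT g (EFin \o f).
  apply: ae_eq_trans (ae_eq_density dens).
  exact/ae_eq_sym/ae_eq_Radon_Nikodym_SigmaFinite.
have mg : measurable_fun setT g.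
  exact: measurable_int (Radon_Nikodym_integrable (nu := charge_of_finite_measure nu) nm).
have gfin x : g x \is a fin_num.
  exact: (Radon_Nikodym_fin_num (nu := charge_of_finite_measure nu)).
have mfg : measurable_fun setT (fun x => fine (g x)).
  exact: measurableT_comp.
have mlg : measurable_fun setT (fun x => lne (g x)).
  rewrite (_ : (fun x => _) = fun x => if fine (g x) <= 0 then -oo%E else (ln (fine (g x)))%:E).
    apply: measurable_fun_ifT => //; first exact: measurable_fun_ler.
    by apply/measurable_EFinP; exact: measurableT_comp.
  by apply/funext => x; rewrite -{1}(fineK (gfin x)).
have f_gt0 : {ae nu, forall x, 0 < f x}.
  exists (f @^-1` [set 0]); split.
  - by rewrite -[X in measurable X]setTI; exact: mf.
  - rewrite nuE; last by rewrite -[X in measurable X]setTI; exact: mf.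
    by apply: integral0_eq => x /= ->.
  - by move=> x /= /negP; rewrite lt_neqAle f0 andbT negbK eq_sym => /eqP.
apply: ae_eq_integral => //.
  by apply/measurable_EFinP; exact: measurableT_comp.
have fgn := null_dominates_ae_eq measurableT nm fg.
apply: filterS2 f_gt0 fgn => x fx + _ => /(_ I) ->/=.
by rewrite leNgt fx.
Qed.

Lemma density_of_dominated (nu : probability T R) (mu : {sigma_finite_measure set T -> \bar R}) :
  nu `<< mu -> exists f, has_density nu mu f.
Proof.
move=> nm; exists (fun x => fine (Radon_Nikodym_SigmaFinite.f nu mu x)).
have fin x := Radon_Nikodym_SigmaFinite.f_fin_num nm x.
have ge0 x := Radon_Nikodym_SigmaFinite.f_ge0 nm x.
split=> [|x|A mA].
- apply: measurableT_comp => //.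
  exact: measurable_int (Radon_Nikodym_SigmaFinite.f_integrable nm).
- exact: fine_ge0.
- rewrite (Radon_Nikodym_SigmaFinite.f_integral nm)//.
  by apply: eq_integral => x _; rewrite fineK.
Qed.

Lemma relative_entropy_lty (nu : probability T R) (mu : {sigma_finite_measure set T -> \bar R}) :
  (relative_entropy nu mu < +oo)%E -> nu `<< mu.
Proof. by rewrite /relative_entropy; case: asboolP. Qed.

Lemma eq_has_density (nu nu' : set T -> \bar R) (mu mu' : {measure set T -> \bar R}) f :
  (forall A, measurable A -> nu A = nu' A) ->
  (forall A, measurable A -> mu A = mu' A) ->
  has_density nu mu f -> has_density nu' mu' f.
Proof.
move=> nuE muE [mf f0 E]; split=> // A mA; rewrite -nuE// E//.
by apply: eq_measure_integral => B mB _; exact: muE.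
Qed.

Lemma has_density_integral1 (nu : probability T R) (mu : {measure set T -> \bar R}) f :
  has_density nu mu f -> \int[mu]_x f x = 1.
Proof. by move=> [_ _ nuE]; rewrite /Rintegral -nuE// probability_setT. Qed.

End entropy_density.

Section density_probability.
Context d (T : measurableType d) (R : realType) (mu : {measure set T -> \bar R}).
Variables (f : T -> R).
Hypotheses (mf : measurable_fun setT f) (f0 : forall x, 0 <= f x).
Hypothesis f1 : (\int[mu]_x (f x)%:E = 1)%E.

(* The hypotheses are passed as arguments so that the instances below depend on
   them. *)
Definition density_measure of measurable_fun setT f & (forall x, 0 <= f x) &
    (\int[mu]_x (f x)%:E = 1)%E := fun A : set T => (\int[mu]_(x in A) (f x)%:E)%E.
Local Notation nu := (density_measure mf f0 f1).

Let nu0 : nu set0 = 0%E. Proof. by rewrite /density_measure integral_set0. Qed.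

Let nu_ge0 A : (0 <= nu A)%E.
Proof. by apply: integral_ge0 => x _; rewrite lee_fin. Qed.

Let nu_additive : semi_sigma_additive nu.
Proof.
apply: semi_sigma_additive_nng_induced; first exact/measurable_EFinP.
by move=> x; rewrite lee_fin.
Qed.

HB.instance Definition _ := isMeasure.Build _ _ _ nu nu0 nu_ge0 nu_additive.
HB.instance Definition _ := Measure_isProbability.Build _ _ _ nu f1.

Lemma exists_density : exists P : probability T R, has_density P mu f.
Proof. by exists nu; split. Qed.

End density_probability.

(** * Image measures, marginals and products *)

Section pushforward_probability.
Context d d' (T : measurableType d) (T' : measurableType d') (R : realType).
Variables (P : probability T R) (g : T -> T').

Lemma exists_pushforward : measurable_fun setT g ->
  exists Q : probability T' R, (forall A, measurable A -> Q A = P (g @^-1` A)) /\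
   forall F : T' -> \bar R, measurable_fun setT F -> (forall y, 0 <= F y)%E ->
    (\int[Q]_y F y = \int[P]_x F (g x))%E.
Proof.
move=> mg; pose X : {mfun T >-> T'} := HB.pack g (@isMeasurableFun.Build _ _ _ _ g mg).
exists (distribution P X); split => // F mF F0.
by rewrite ge0_integral_distribution.
Qed.

End pushforward_probability.

Lemma integral1 d (T : measurableType d) (R : realType)
    (mu : {measure set T -> \bar R}) D : measurable D ->
  (\int[mu]_(x in D) (1 : R)%:E = mu D)%E.
Proof. by move=> mD; rewrite -[RHS]mul1e; exact: integral_cst. Qed.

Lemma integral_indicT d (T : measurableType d) (R : realType)
    (mu : {measure set T -> \bar R}) D : measurable D ->
  (\int[mu]_x (\1_D x : R)%:E = mu D)%E.
Proof. by move=> mD; rewrite integral_indic// setIT. Qed.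

Section marginals.
Context d1 d2 (T1 : measurableType d1) (T2 : measurableType d2) (R : realType).
Variable pi : probability (T1 * T2)%type R.

Lemma ge0_integral_fst (mu : {measure set T1 -> \bar R}) (F : T1 -> \bar R) :
  (forall A, measurable A -> pi (A `*` setT) = mu A) ->
  measurable_fun setT F -> (forall x, 0 <= F x)%E ->
  (\int[pi]_z F z.1 = \int[mu]_x F x)%E.
Proof.
move=> piE mF F0.
have [Q [QE QF]] := exists_pushforward pi (@measurable_fst _ _ T1 T2).
rewrite -(QF F)//; apply: eq_measure_integral => A mA _.
rewrite -piE//; apply: etrans (QE _ mA) _; congr (pi _).
by apply/seteqP; split => -[x y]/= => [|[]].
Qed.

Lemma ge0_integral_snd (mu : {measure set T2 -> \bar R}) (F : T2 -> \bar R) :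
  (forall A, measurable A -> pi (setT `*` A) = mu A) ->
  measurable_fun setT F -> (forall x, 0 <= F x)%E ->
  (\int[pi]_z F z.2 = \int[mu]_x F x)%E.
Proof.
move=> piE mF F0.
have [Q [QE QF]] := exists_pushforward pi (@measurable_snd _ _ T1 T2).
rewrite -(QF F)//; apply: eq_measure_integral => A mA _.
rewrite -piE//; apply: etrans (QE _ mA) _; congr (pi _).
by apply/seteqP; split => -[x y]/= => [|[]].
Qed.

End marginals.

Lemma exists_product d1 d2 (T1 : measurableType d1) (T2 : measurableType d2)
    (R : realType) (P : probability T1 R) (Q : probability T2 R) :
  exists PQ : probability (T1 * T2)%type R, forall A, measurable A -> PQ A = (P \x Q)%E A.
Proof.
have PQ1 : (P \x Q)%E setT = 1%E.
  rewrite -setXTT product_measure1E// -[RHS]mule1.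
  by congr (_ * _)%E; exact: probability_setT.
have [||PQ [_ _ PQE]] := @exists_density _ _ _ (P \x Q)%E (cst (1 : R)) (measurable_cst _).
- by [].
- by rewrite [LHS]integral1.
- by exists PQ => A mA; rewrite PQE// integral1.
Qed.

(** * Gluing two couplings along countably many cells *)

Section gluing.
Context dA dZ dC (A : measurableType dA) (Z : measurableType dZ)
  (C : measurableType dC) (R : realType).
Variables (pi1 : probability (A * Z)%type R) (pi2 : probability (Z * C)%type R).
Variable c : Z -> nat.
Hypothesis mc : measurable_fun setT c.
Local Notation cell j := (c @^-1` [set j]).
Hypothesis same_mass : forall j, pi1 (setT `*` cell j) = pi2 (cell j `*` setT).

Let b j : R := fine (pi1 (setT `*` cell j)).

Let mcell j : measurable (cell j).
Proof. by rewrite -[X in measurable X]setTI; exact: mc. Qed.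

Let b_ge0 j : 0 <= b j. Proof. exact: fine_ge0. Qed.

Let bE j : (b j)%:E = pi1 (setT `*` cell j).
Proof. by rewrite fineK// fin_num_measure//; exact: measurableX. Qed.

(** Inside a cell the two middle points stay independent. Gluing them exactly would need conditional
    laws given a point of [Z]; here the displacement within a cell is left to the cost functions.
    Null cells receive weight 0 because their inverse mass is 0. *)
Let w (z : (A * Z) * (Z * C)) : R :=
  (if c z.1.2 == c z.2.1 then 1 else 0) * (b (c z.1.2))^-1.

Let mb d (T : measurableType d) (g : T -> nat) : measurable_fun setT g ->
  measurable_fun setT (fun x => (b (g x))^-1).
Proof.
move=> mg; apply: measurable_fun_inv => //.
by apply: measurableT_comp mg => //.
Qed.

Let mw : measurable_fun setT w.
Proof.
have m1 : measurable_fun setT (fun z : (A * Z) * (Z * C) => c z.1.2).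
  by apply: measurableT_comp mc _; exact: measurableT_comp.
have m2 : measurable_fun setT (fun z : (A * Z) * (Z * C) => c z.2.1).
  by apply: measurableT_comp mc _; exact: measurableT_comp.
apply: measurable_funM; last exact: mb.
by apply: measurable_fun_ifT => //; exact: measurable_fun_eqn.
Qed.

Let w_ge0 z : 0 <= w z.
Proof. by rewrite mulr_ge0 ?invr_ge0//; case: ifP. Qed.

Let int_w1 s : (\int[pi2]_t (w (s, t))%:E = (b (c s.2) != 0)%:R%:E)%E.
Proof.
have -> : (\int[pi2]_t (w (s, t))%:E =
    \int[pi2]_t ((b (c s.2))^-1%:E * (\1_(cell (c s.2) `*` setT) t)%:E))%E.
  apply: eq_integral => t _; rewrite -EFinM mulrC /w /=; congr (_ * _)%:E.
  rewrite indicE; case: eqVneq => [E|E]; first by rewrite mem_set.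
  by rewrite memNset// => -[/= E' _]; rewrite E' eqxx in E.
rewrite ge0_integralZl_EFin//; last 2 first.
  by apply/measurable_EFinP/measurable_indic; exact: measurableX.
  by rewrite invr_ge0.
rewrite integral_indic//; last exact: measurableX.
rewrite setIT; transitivity ((b (c s.2))^-1%:E * (b (c s.2))%:E)%E.
  by congr (_ * _)%E; rewrite bE same_mass.
rewrite -EFinM; have [->|bn] := eqVneq (b _) 0; first by rewrite mulr0.
by rewrite mulVf.
Qed.

Let int_w2 t : (\int[pi1]_s (w (s, t))%:E = (b (c t.1) != 0)%:R%:E)%E.
Proof.
have -> : (\int[pi1]_s (w (s, t))%:E =
    \int[pi1]_s ((b (c t.1))^-1%:E * (\1_(setT `*` cell (c t.1)) s)%:E))%E.
  apply: eq_integral => s _; rewrite -EFinM mulrC /w /=.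
  rewrite indicE; case: eqVneq => [E|E]; first by rewrite mem_set// E mulrC.
  by rewrite memNset ?mulr0 ?mul0r ?mulr0// => -[/= _ E']; rewrite E' eqxx in E.
rewrite ge0_integralZl_EFin//; last 2 first.
  by apply/measurable_EFinP/measurable_indic; exact: measurableX.
  by rewrite invr_ge0.
rewrite integral_indic//; last exact: measurableX.
rewrite setIT; transitivity ((b (c t.1))^-1%:E * (b (c t.1))%:E)%E.
  by congr (_ * _)%E; rewrite bE.
rewrite -EFinM; have [->|bn] := eqVneq (b _) 0; first by rewrite mulr0.
by rewrite mulVf.
Qed.

Let ae1 : {ae pi1, forall s, b (c s.2) != 0}.
Proof.
have : pi1.-negligible (\bigcup_j (if b j == 0 then setT `*` cell j else set0)).
  apply: negligible_bigcup => j; case: ifPn => [/eqP bj|_]; last exact: negligible_set0.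
  apply/negligibleP; first exact: measurableX.
  by apply: etrans (esym (bE j)) _; rewrite bj.
apply: negligibleS => s /= /negP; rewrite negbK => /eqP bs.
by exists (c s.2) => //=; rewrite bs eqxx.
Qed.

Let ae2 : {ae pi2, forall t, b (c t.1) != 0}.
Proof.
have : pi2.-negligible (\bigcup_j (if b j == 0 then cell j `*` setT else set0)).
  apply: negligible_bigcup => j; case: ifPn => [/eqP bj|_]; last exact: negligible_set0.
  apply/negligibleP; first exact: measurableX.
  by apply: etrans (esym (same_mass j)) _; rewrite -bE bj.
apply: negligibleS => s /= /negP; rewrite negbK => /eqP bs.
by exists (c s.1) => //=; rewrite bs eqxx.
Qed.

Let int_wG1 (G : A * Z -> R) : measurable_fun setT G -> (forall s, 0 <= G s) ->
  (\int[pi1 \x pi2]_z (G z.1 * w z)%:E = \int[pi1]_s (G s)%:E)%E.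
Proof.
move=> mG G0.
have mGw : measurable_fun setT (fun z : (A * Z) * (Z * C) => (G z.1 * w z)%:E).
  by apply/measurable_EFinP/measurable_funM => //; exact: measurableT_comp.
rewrite fubini_tonelli1//; last by move=> z; rewrite lee_fin mulr_ge0.
have E s : fubini_F pi2 (fun z => (G z.1 * w z)%:E) s = (G s * (b (c s.2) != 0)%:R)%:E.
  rewrite /fubini_F/=; under eq_integral do rewrite EFinM.
  rewrite ge0_integralZl_EFin//; first by rewrite int_w1.
    by move=> t _; rewrite lee_fin.
  by apply/measurable_EFinP; apply: measurableT_comp mw _.
under eq_integral do rewrite E.
apply: ae_eq_integral => //.
- apply/measurable_EFinP/measurable_funM => //.
  apply: (@measurableT_comp _ _ _ _ _ _ (fun j : nat => (b j != 0)%:R : R)) => //.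
  exact: measurableT_comp.
- exact/measurable_EFinP.
- by apply: filterS ae1 => s bs _; rewrite bs mulr1.
Qed.

Let int_wG2 (G : Z * C -> R) : measurable_fun setT G -> (forall s, 0 <= G s) ->
  (\int[pi1 \x pi2]_z (G z.2 * w z)%:E = \int[pi2]_s (G s)%:E)%E.
Proof.
move=> mG G0.
have mGw : measurable_fun setT (fun z : (A * Z) * (Z * C) => (G z.2 * w z)%:E).
  by apply/measurable_EFinP/measurable_funM => //; exact: measurableT_comp.
rewrite fubini_tonelli2//; last by move=> z; rewrite lee_fin mulr_ge0.
have E s : fubini_G pi1 (fun z => (G z.2 * w z)%:E) s = (G s * (b (c s.1) != 0)%:R)%:E.
  rewrite /fubini_G/=; under eq_integral do rewrite EFinM.
  rewrite ge0_integralZl_EFin//; first by rewrite int_w2.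
    by move=> t _; rewrite lee_fin.
  by apply/measurable_EFinP; apply: measurableT_comp mw _.
under eq_integral do rewrite E.
apply: ae_eq_integral => //.
- apply/measurable_EFinP/measurable_funM => //.
  apply: (@measurableT_comp _ _ _ _ _ _ (fun j : nat => (b j != 0)%:R : R)) => //.
  exact: measurableT_comp.
- exact/measurable_EFinP.
- by apply: filterS ae2 => s bs _; rewrite bs mulr1.
Qed.

(* The glued coupling has density [1_(c z = c z') / mass of the cell] with
   respect to [pi1 x pi2]. *)
Lemma gluing : exists pi : probability (A * C)%type R,
  [/\ forall E, measurable E -> pi (E `*` setT) = pi1 (E `*` setT),
      forall E, measurable E -> pi (setT `*` E) = pi2 (setT `*` E) &
   forall (F : A * C -> R) (G1 : A * Z -> R) (G2 : Z * C -> R),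
     measurable_fun setT F -> measurable_fun setT G1 -> measurable_fun setT G2 ->
     (forall z, 0 <= F z) -> (forall z, 0 <= G1 z) -> (forall z, 0 <= G2 z) ->
     (forall x z z' y, c z = c z' -> (pi1 (setT `*` cell (c z)) != 0)%E ->
        F (x, y) <= G1 (x, z) + G2 (z', y)) ->
     (\int[pi]_z (F z)%:E <= \int[pi1]_z (G1 z)%:E + \int[pi2]_z (G2 z)%:E)%E].
Proof.
have w1 : (\int[pi1 \x pi2]_z (w z)%:E = 1)%E.
  have := @int_wG1 (cst (1 : R)) (measurable_cst _) (fun=> ler01).
  under eq_integral do rewrite mul1r.
  by move=> ->; rewrite [LHS]integral1//; exact: probability_setT.
have [PQ PQE] := exists_product pi1 pi2.
have intPQ (F : (A * Z) * (Z * C) -> \bar R) : (\int[PQ]_z F z = \int[pi1 \x pi2]_z F z)%E.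
  by apply: eq_measure_integral => B mB _; exact: PQE.
have w1' : (\int[PQ]_z (w z)%:E = 1)%E by rewrite intPQ.
have [Pi Pid] := exists_density mw w_ge0 w1'.
pose g (z : (A * Z) * (Z * C)) := (z.1.1, z.2.2).
have mg : measurable_fun setT g.
  apply/measurable_fun_pairP; split.
    exact: (measurableT_comp measurable_fst measurable_fst).
  exact: (measurableT_comp measurable_snd measurable_snd).
have [pi [piE piF]] := exists_pushforward Pi mg.
have intF (F : A * C -> R) : measurable_fun setT F -> (forall z, 0 <= F z) ->
    (\int[pi]_z (F z)%:E = \int[pi1 \x pi2]_z (F (g z) * w z)%:E)%E.
  move=> mF F0; rewrite (piF (fun z => (F z)%:E)) => [||z]; last by rewrite lee_fin.
    rewrite (ge0_integral_density Pid) => [||z]; last by rewrite lee_fin.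
      by rewrite -intPQ; apply: eq_integral => z _.
    by apply/measurable_EFinP; exact: measurableT_comp.
  exact/measurable_EFinP.
exists pi; split.
- move=> E mE; have mEX : measurable (E `*` [set: C]) by exact: measurableX.
  have mEX' : measurable (E `*` [set: Z]) by exact: measurableX.
  apply: etrans (esym (integral_indicT _ mEX)) _.
  apply: etrans _ (integral_indicT _ mEX').
  rewrite intF -?int_wG1//; try exact/measurable_indic.
- move=> E mE; have mEX : measurable ([set: A] `*` E) by exact: measurableX.
  have mEX' : measurable ([set: Z] `*` E) by exact: measurableX.
  apply: etrans (esym (integral_indicT _ mEX)) _.
  apply: etrans _ (integral_indicT _ mEX').
  rewrite intF -?int_wG2//; try exact/measurable_indic.
- move=> F G1 G2 mF mG1 mG2 F0 G10 G20 FG.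
  rewrite intF// -int_wG1// -int_wG2// -ge0_integralD//; last 4 first.
  + by move=> z _; rewrite lee_fin mulr_ge0.
  + by apply/measurable_EFinP/measurable_funM => //; exact: measurableT_comp.
  + by move=> z _; rewrite lee_fin mulr_ge0.
  + by apply/measurable_EFinP/measurable_funM => //; exact: measurableT_comp.
  apply: ge0_le_integral => //.
  + by move=> z _; rewrite lee_fin mulr_ge0.
  + by apply/measurable_EFinP/measurable_funM => //; exact: measurableT_comp.
  + by apply: emeasurable_funD; apply/measurable_EFinP/measurable_funM => //; exact: measurableT_comp.
  move=> [[x z] [z' y]] _; rewrite -EFinD lee_fin -mulrDl /w /g/=.
  case: eqVneq => [E|]; last by rewrite !mul0r !mulr0.
  have [->|bn] := eqVneq (b (c z)) 0; first by rewrite invr0 !mulr0.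
  rewrite ler_wpM2r ?mulr_ge0 ?invr_ge0//; apply: FG => //.
  by apply: contra bn => /eqP h; rewrite /b h.
Qed.

End gluing.

(** * Tensor powers, boxes and their marginals *)

Section tensor_probability.
Context d (T : measurableType d) (R : realType) (P : probability T R).

Definition tensor_prob (n : nat) : set (n.-tuple T) -> \bar R := tensor_power P n.

Arguments tensor_prob n A : clear implicits.

HB.instance Definition _ n := Measure.on (tensor_prob n).

Let tensor_prob1 n : tensor_prob n setT = 1%E.
Proof.
rewrite /tensor_prob; elim: n => [|n IH]; first by rewrite /= diracT.
rewrite /= /cons_measure preimage_setT -setXTT product_measure1E// -[RHS]mule1.
congr (_ * _)%E; first exact: probability_setT.
exact: IH.
Qed.

HB.instance Definition _ n := Measure_isProbability.Build _ _ _ (tensor_prob n) (tensor_prob1 n).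

End tensor_probability.
Arguments tensor_prob {d T R} P n A.

Section tensor_integrals.
Context d (T : measurableType d) (R : realType).

Lemma ge0_integral_tensorS (mu : {sigma_finite_measure set T -> \bar R}) n
    (F : n.+1.-tuple T -> \bar R) :
  measurable_fun setT F -> (forall x, 0 <= F x)%E ->
  (\int[tensor_power mu n.+1]_x F x =
   \int[mu]_x \int[tensor_power mu n]_t F [tuple of x :: t])%E.
Proof.
move=> mF F0.
have mc := @measurable_cons_pair _ T n.
transitivity (\int[pushforward (mu \x tensor_power mu n)%E (@cons_pair _ T n)]_x F x)%E.
  by apply: eq_measure_integral => A mA _.
rewrite ge0_integral_pushforward// preimage_setT fubini_tonelli1//.
  exact: measurableT_comp.
by move=> x; exact: F0.
Qed.

Lemma has_density_tensor (mu' : probability T R)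
    (mu : {sigma_finite_measure set T -> \bar R}) (g : T -> R) n :
  has_density mu' mu g ->
  has_density (tensor_power mu' n) (tensor_power mu n) (fun x => \prod_i g (tnth x i)).
Proof.
move=> dens; have [mg g0 _] := dens.
have mprod n' : measurable_fun setT (fun x : n'.-tuple T => \prod_i g (tnth x i)).
  rewrite (_ : (fun x => _) = fun x => \prod_(i <- index_enum 'I_n') g (tnth x i))//.
  apply: measurable_prod => i _; apply: measurableT_comp => //.
  exact: measurable_tnth.
elim: n => [|n IH]; split=> [|x|A mA].
- exact: mprod.
- by apply: prodr_ge0.
- rewrite /= integral_dirac//=; last by apply/measurable_EFinP/measurable_funTS; exact: mprod.
  by rewrite big_ord0 mule1.
- exact: mprod.
- by apply: prodr_ge0.
have mA1 : measurable_fun setT (fun x : n.+1.-tuple T => (\1_A x : R)%:E).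
  exact/measurable_EFinP/measurable_indic.
have mcons (x : T) : measurable_fun setT (fun t : n.-tuple T => [tuple of x :: t]).
  by apply: (measurable_cons (f := fun=> x) (g := id)).
apply: etrans (esym (integral_indicT _ mA)) _.
rewrite ge0_integral_tensorS//.
have mI x : measurable_fun setT (fun t : n.-tuple T => (\1_A [tuple of x :: t] : R)%:E).
  by apply: (measurableT_comp mA1); exact: mcons.
have E1 x : (\int[tensor_power mu' n]_t (\1_A [tuple of x :: t] : R)%:E =
    \int[tensor_power mu n]_t ((\1_A [tuple of x :: t] : R)%:E * (\prod_i g (tnth t i))%:E))%E.
  transitivity (\int[tensor_prob mu' n]_t (\1_A [tuple of x :: t] : R)%:E)%E.
    by apply: eq_measure_integral.
  apply: (@ge0_integral_density _ _ _ (tensor_prob mu' n) _ _ IH).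
    exact: mI.
  by move=> t; rewrite lee_fin.
apply: etrans (eq_integral _ _ (fun x _ => E1 x)) _.
rewrite (ge0_integral_density dens) => [||x]; last first.
  by apply: integral_ge0 => t _; rewrite -EFinM lee_fin mulr_ge0// prodr_ge0.
- apply: (@measurable_fun_fubini_tonelli_F _ _ _ _ _ (tensor_power mu n)
    (fun z => ((\1_A (cons_pair z) : R)%:E * (\prod_i g (tnth z.2 i))%:E)%E)).
    apply: emeasurable_funM.
      by apply: (measurableT_comp mA1); exact: measurable_cons_pair.
    apply/measurable_EFinP.
    exact: (measurableT_comp (mprod n) measurable_snd).
  by move=> z; rewrite -EFinM lee_fin mulr_ge0// prodr_ge0.
rewrite integral_mkcond ge0_integral_tensorS; last 2 first.
- rewrite (_ : _ \_ _ = fun x => ((\1_A x * \prod_i g (tnth x i))%R)%:E).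
    apply/measurable_EFinP/measurable_funM; last exact: mprod.
    exact/measurable_indic.
  apply/funext => x; rewrite patchE indicE; case: (_ \in _); first by rewrite mul1r.
  by rewrite mul0r.
- move=> x; rewrite patchE; case: ifP => // _; rewrite lee_fin; exact: prodr_ge0.
apply: eq_integral => x _.
rewrite muleC -ge0_integralZl_EFin//; last 2 first.
- by move=> t _; rewrite -EFinM lee_fin mulr_ge0// prodr_ge0.
- by apply: emeasurable_funM; [exact: mI|apply/measurable_EFinP; exact: mprod].
apply: eq_integral => t _; rewrite patchE indicE; case: (_ \in _); last by rewrite mul0e mule0.
rewrite mul1e -EFinM big_ord_recl; congr (_ * _)%:E; apply: eq_bigr => i _.
by rewrite tnthS.
Qed.

End tensor_integrals.

Section boxes.
Context d (T : measurableType d) (R : realType) (P : probability T R).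

Definition box n (A : 'I_n -> set T) : set (n.-tuple T) :=
  [set x | forall i, A i (tnth x i)].

Lemma measurable_box n (A : 'I_n -> set T) : (forall i, measurable (A i)) ->
  measurable (box A).
Proof.
move=> mA; rewrite (_ : box A = \bigcap_i ((@tnth n T)^~ i @^-1` A i)).
  apply: fin_bigcap_measurable => // i _; rewrite -[X in measurable X]setTI.
  by apply: measurable_tnth.
by apply/seteqP; split=> x h i; [move=> _|]; exact: h.
Qed.

Lemma tensor_prob_box n (A : 'I_n -> set T) : (forall i, measurable (A i)) ->
  tensor_prob P n (box A) = (\prod_i P (A i))%E.
Proof.
elim: n A => [|n IH] A mA.
  rewrite big_ord0 [LHS](_ : _ = \d_([tuple] : 0.-tuple T) (box A))// diracE.
  by rewrite mem_set// => -[].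
rewrite big_ord_recl -(IH (fun i => A (lift ord0 i)))// /tensor_prob/= /cons_measure.
rewrite -product_measure1E//; last by apply: measurable_box.
congr ((_ \x _)%E _); apply/seteqP; split => -[x t]/= => [h|[xA tA] i].
  by split=> [|i]; [have := h ord0|have := h (lift ord0 i)]; rewrite ?tnthS.
by have [j ->|->//] := unliftP ord0 i; rewrite tnthS; exact: tA.
Qed.

Lemma ge0_integral_tensor1 n (i : 'I_n) (F : T -> \bar R) :
  measurable_fun setT F -> (forall x, 0 <= F x)%E ->
  (\int[tensor_prob P n]_x F (tnth x i) = \int[P]_x F x)%E.
Proof.
move=> mF F0.
have [Q [QE QF]] := exists_pushforward (tensor_prob P n) (@measurable_tnth _ T n i).
rewrite -QF//; apply: eq_measure_integral => A mA _.
apply: etrans (QE _ mA) _.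
rewrite (_ : _ @^-1` A = box (fun j => if j == i then A else setT)).
  apply: etrans (tensor_prob_box _) _; first by move=> j; case: ifP.
  rewrite (bigD1 i)//= eqxx big1 ?mule1// => j /negPf->; exact: probability_setT.
apply/seteqP; split => x /= h; last by have := h i; rewrite eqxx.
by move=> j; case: eqVneq => [->|].
Qed.

Lemma ge0_integral_tensor2 n (i j : 'I_n) (F : T * T -> \bar R) : i != j ->
  measurable_fun setT F -> (forall x, 0 <= F x)%E ->
  (\int[tensor_prob P n]_x F (tnth x i, tnth x j) = \int[P \x P]_x F x)%E.
Proof.
move=> ij mF F0.
have mg : measurable_fun setT (fun x : n.-tuple T => (tnth x i, tnth x j)).
  by apply/measurable_fun_pairP; split; exact: measurable_tnth.
have [Q [QE QF]] := exists_pushforward (tensor_prob P n) mg.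
rewrite -QF//; apply: eq_measure_integral => A mA _.
apply/esym/product_measure_unique => // B C mB mC.
apply: etrans (QE _ (measurableX mB mC)) _.
rewrite (_ : _ @^-1` _ = box (fun l => if l == i then B else if l == j then C else setT)).
  apply: etrans (tensor_prob_box _) _; first by move=> l; case: ifP => // _; case: ifP.
  rewrite (bigD1 i)//= eqxx; congr (_ * _)%E.
  rewrite (bigD1 j)/=; last by rewrite eq_sym.
  rewrite eq_sym (negPf ij) eqxx big1 ?mule1// => l /andP[/negPf-> /negPf->].
  exact: probability_setT.
apply/seteqP; split => x /= h; last first.
  by split; [have := h i|have := h j]; rewrite eqxx//= eq_sym (negPf ij).
by move=> l; case: eqVneq => [->|_]; [case: h|case: eqVneq => // ->; case: h].
Qed.

End boxes.

(** * Finite Cauchy-Schwarz and Minkowski inequalities, distances *)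

Section finite_cauchy_schwarz.
Context (R : realType).

Lemma cauchy_schwarz_sum (I : finType) (a b : I -> R) :
  \sum_i a i * b i <= Num.sqrt (\sum_i a i ^+ 2) * Num.sqrt (\sum_i b i ^+ 2).
Proof.
set A := \sum_i a i ^+ 2; set B := \sum_i b i ^+ 2; set C := \sum_i a i * b i.
have A0 : 0 <= A by apply: sumr_ge0 => i _; exact: sqr_ge0.
have B0 : 0 <= B by apply: sumr_ge0 => i _; exact: sqr_ge0.
have h (t : R) : 0 <= t ^+ 2 * A - 2 * t * C + B.
  have -> : t ^+ 2 * A - 2 * t * C + B = \sum_i (t * a i - b i) ^+ 2.
    rewrite !mulr_sumr -sumrB -big_split/=; apply: eq_bigr => i _; ring.
  by apply: sumr_ge0 => i _; exact: sqr_ge0.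
rewrite -sqrtrM//; apply: le_trans (ler_norm _) _.
rewrite -sqrtr_sqr ler_sqrt ?mulr_ge0//.
(* For [A = 0] the polynomial is affine in [t], and a nonzero slope would make it negative
   somewhere. *)
have [A00|An] := eqVneq A 0.
  have [->|Cn] := eqVneq C 0; first by rewrite expr0n mulr_ge0.
  have := h ((B + 1) / (2 * C)); rewrite A00 mulr0.
  by rewrite (_ : 2 * _ * C = B + 1); [lra|field].
have Ap : 0 < A by rewrite lt_neqAle eq_sym An.
have := h (C / A).
have -> : (C / A) ^+ 2 * A - 2 * (C / A) * C + B = (A * B - C ^+ 2) / A by field.
by rewrite pmulr_lge0 ?invr_gt0// subr_ge0.
Qed.

Lemma minkowski_sum (I : finType) (a b : I -> R) :
  Num.sqrt (\sum_i (a i + b i) ^+ 2) <=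
  Num.sqrt (\sum_i a i ^+ 2) + Num.sqrt (\sum_i b i ^+ 2).
Proof.
have A0 : 0 <= \sum_i a i ^+ 2 by apply: sumr_ge0 => i _; exact: sqr_ge0.
have B0 : 0 <= \sum_i b i ^+ 2 by apply: sumr_ge0 => i _; exact: sqr_ge0.
rewrite -[leRHS]ger0_norm ?addr_ge0 ?sqrtr_ge0// -sqrtr_sqr ler_sqrt ?sqr_ge0//.
have -> : \sum_i (a i + b i) ^+ 2 =
   \sum_i a i ^+ 2 + 2 * (\sum_i a i * b i) + \sum_i b i ^+ 2.
  rewrite mulr_sumr -!big_split/=; apply: eq_bigr => i _; ring.
have := cauchy_schwarz_sum a b; have := sqr_sqrtr A0; have := sqr_sqrtr B0; nra.
Qed.

End finite_cauchy_schwarz.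

Section distances.
Context (R : realType).

Definition is_dist (T : Type) (dist : T -> T -> R) : Prop :=
  [/\ forall x y, 0 <= dist x y, forall x, dist x x = 0,
      forall x y, dist x y = dist y x &
      forall x y z, dist x z <= dist x y + dist y z].

Lemma axis_dist_is_dist (k : ambient) : is_dist (@axis_dist R k).
Proof.
split=> [x y|x|x y|x y z].
- rewrite /axis_dist; case: k x y => [x y|//] /=.
  have := coordP x; have := coordP y; rewrite /in_cell => /andP[y0 y1] /andP[x0 x1].
  rewrite le_min normr_ge0/= subr_ge0 ler_norml; apply/andP; split; lra.
- by rewrite /axis_dist subrr normr0; case: k x => // x; rewrite min_l// subr0.
- by rewrite /axis_dist distrC.
- rewrite /axis_dist; case: k x y z => [x y z|x y z] /=.
    have := coordP x; have := coordP y; have := coordP z; rewrite /in_cell.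
    move: (coord x) (coord y) (coord z) => a b c /andP[c0 c1] /andP[b0 b1] /andP[a0 a1].
    have t1 : `|a - c| <= `|a - b| + `|b - c| by exact: ler_distD.
    have t2 : `|b - c| <= `|a - b| + `|a - c|.
      by rewrite (distrC a b); exact: ler_distD.
    have t3 : `|a - b| <= `|a - c| + `|b - c|.
      by rewrite (distrC b c); exact: ler_distD.
    (* For three points of an interval of length 1 the pairwise distances add up to twice the
       largest one. This settles the case where both short paths go around the circle. *)
    have t4 : `|a - b| + `|b - c| + `|a - c| <= 2.
      by case: (ger0P (a - b)) => ?; case: (ger0P (b - c)) => ?; case: (ger0P (a - c)) => ?; lra.
    move: `|a - b| `|b - c| `|a - c| t1 t2 t3 t4 => p q r *.
    by rewrite ge_min; apply/orP; case: (leP p (1 - p)) => ?; case: (leP q (1 - q)) => ?;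
      [left; lra|right; lra|right; lra|left; lra].
  exact: ler_distD.
Qed.

Lemma tuple_dist_is_dist (T : Type) (dist : T -> T -> R) n :
  is_dist dist -> is_dist (@tuple_dist R T dist n).
Proof.
move=> [d0 dxx dC dT]; split=> [x y|x|x y|x y z].
- exact: sqrtr_ge0.
- by rewrite /tuple_dist big1 ?sqrtr0// => i _; rewrite dxx expr0n.
- by rewrite /tuple_dist; under eq_bigr do rewrite dC.
apply: le_trans (minkowski_sum _ _).
rewrite ler_sqrt; last by apply: sumr_ge0 => i _; exact: sqr_ge0.
by apply: ler_sum => i _; rewrite lerXn2r ?nnegrE ?addr_ge0.
Qed.

Lemma tuple_dist_sqr (T : Type) (dist : T -> T -> R) n (x y : n.-tuple T) :
  tuple_dist dist x y ^+ 2 = \sum_i dist (tnth x i) (tnth y i) ^+ 2.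
Proof. by rewrite sqr_sqrtr// sumr_ge0// => i _; exact: sqr_ge0. Qed.

Lemma space_dist_is_dist k d : is_dist (@space_dist R k d).
Proof. exact/tuple_dist_is_dist/axis_dist_is_dist. Qed.

Lemma config_dist_is_dist k d N : is_dist (@config_dist R k d N).
Proof. exact/tuple_dist_is_dist/space_dist_is_dist. Qed.

Lemma sqr_dist_triangle (T : Type) (dist : T -> T -> R) (t : R) x y z :
  is_dist dist -> 0 < t ->
  dist x z ^+ 2 <= (1 + t) * dist x y ^+ 2 + (1 + t^-1) * dist y z ^+ 2.
Proof.
move=> [d0 _ _ dT] t0; have := dT x y z.
move: (d0 x y) (d0 y z) (d0 x z).
set a := dist x y; set b := dist y z; set c := dist x z => a0 b0 c0 abc.
have h : 2 * a * b <= t * a ^+ 2 + t^-1 * b ^+ 2.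
  rewrite -subr_ge0 (_ : _ - _ = t^-1 * (t * a - b) ^+ 2); last by field; rewrite gt_eqF.
  by rewrite mulr_ge0 ?sqr_ge0// invr_ge0 ltW.
nra.
Qed.

Lemma measurable_fun_sqrt d (T : measurableType d) (f : T -> R) :
  measurable_fun setT f -> (forall x, 0 <= f x) ->
  measurable_fun setT (fun x => Num.sqrt (f x)).
Proof.
move=> mf f0; rewrite (_ : (fun x => _) = (fun r => powR r (2^-1)) \o f).
  exact: measurableT_comp.
by apply/funext => x /=; rewrite powR12_sqrt.
Qed.

Lemma measurable_axis_dist k :
  measurable_fun setT (fun z : axis R k * axis R k => axis_dist z.1 z.2).
Proof.
have mr : measurable_fun setT (fun z : axis R k * axis R k => `|coord z.1 - coord z.2|).
  apply: measurableT_comp => //; apply: measurable_funB.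
    exact: (measurableT_comp (@measurable_coord R k) measurable_fst).
  exact: (measurableT_comp (@measurable_coord R k) measurable_snd).
rewrite /axis_dist; case: k mr => // mr.
by apply: measurable_minr => //; exact: measurable_funB.
Qed.

Lemma measurable_tuple_dist d (T : measurableType d) (dist : T -> T -> R) n :
  measurable_fun setT (fun z : T * T => dist z.1 z.2) ->
  measurable_fun setT (fun z : n.-tuple T * n.-tuple T => tuple_dist dist z.1 z.2).
Proof.
move=> md; apply: measurable_fun_sqrt => [|z]; last first.
  by apply: sumr_ge0 => i _; exact: sqr_ge0.
apply: measurable_sum => i; apply: measurable_funX.
apply: (measurableT_comp (f := fun z : T * T => dist z.1 z.2)
  (g := fun z : n.-tuple T * n.-tuple T => (tnth z.1 i, tnth z.2 i))) => //.
apply/measurable_fun_pairP; split.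
  exact: (measurableT_comp (measurable_tnth i) measurable_fst).
exact: (measurableT_comp (measurable_tnth i) measurable_snd).
Qed.

Lemma measurable_space_dist k d :
  measurable_fun setT (fun z : state_space R k d * state_space R k d => space_dist z.1 z.2).
Proof. exact: (measurable_tuple_dist (n := d) (@measurable_axis_dist k)). Qed.

Lemma measurable_config_dist k d N :
  measurable_fun setT (fun z : N.-tuple (state_space R k d) * N.-tuple (state_space R k d) =>
    config_dist z.1 z.2).
Proof. exact: (measurable_tuple_dist (n := N) (@measurable_space_dist k d)). Qed.

End distances.

(** * Measurability through countable cells, and finite grids *)

Lemma measurable_fun_countable d (T : measurableType d) (c : T -> nat) :
  (forall j, measurable (c @^-1` [set j])) -> measurable_fun setT c.
Proof.
move=> mc _ B _; rewrite setTI (_ : _ @^-1` B = \bigcup_(j in B) (c @^-1` [set j])).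
  by apply: bigcup_measurable => j _; exact: mc.
by apply/seteqP; split => [x Bx|x [j Bj /= ->]//]; exists (c x).
Qed.

(** Continuous functions are handled this way: evaluated at grid points, they depend on countably
    many cells only, so that the sigma-algebra generated by the coordinates need not be compared
    with the open sets. *)
Lemma measurable_of_discretization d (T : measurableType d) (R : realType)
    (F : T -> R) (c : nat -> T -> nat) (r : nat -> nat -> R) :
  (forall m, measurable_fun setT (c m)) ->
  (forall x, r m (c m x) @[m --> \oo] --> F x) -> measurable_fun setT F.
Proof.
move=> mc rF; apply: (measurable_fun_cvg (h := fun m x => r m (c m x))) => // m.
exact: (measurableT_comp (f := r m)).
Qed.

Section grid.
Context (R : realType) (n s : nat).
Hypothesis s_gt0 : (0 < s)%N.
Local Notation K := (2 * n * s)%N.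

(** [K] intervals of length [1 / s] cover [[-n, n[], and the last index [K] collects all the rest,
    which keeps the number of cells finite. *)
Definition grid (r : R) : 'I_K.+1 :=
  if - n%:R <= r < n%:R then inord (Num.truncn ((r + n%:R) * s%:R)) else ord_max.

Let sp : 0 < s%:R :> R. Proof. by rewrite ltr0n. Qed.

Lemma grid_trunc_lt (r : R) : - n%:R <= r < n%:R -> (Num.truncn ((r + n%:R) * s%:R) < K)%N.
Proof.
move=> /andP[r0 r1]; have h0 : 0 <= (r + n%:R) * s%:R by rewrite mulr_ge0// -lerBlDr sub0r.
rewrite -(ltr_nat R); have /andP[h1 _] := truncn_itv h0; apply: le_lt_trans h1 _.
by rewrite 2!natrM ltr_pM2r// mulr2n; lra.
Qed.

Lemma grid_inner (r : R) : (grid r < K)%N = (- n%:R <= r < n%:R).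
Proof.
rewrite /grid; case: ifPn => [h|_]; last by rewrite ltnn.
by rewrite inordK ?grid_trunc_lt// ltnW// ltnS grid_trunc_lt.
Qed.

Lemma grid_mesh (r r' : R) : grid r = grid r' -> (grid r < K)%N -> `|r - r'| <= s%:R^-1.
Proof.
move=> E gr; have gr' := gr; rewrite E grid_inner in gr'; rewrite grid_inner in gr.
move: E; rewrite /grid gr gr' => /(congr1 val).
rewrite /= !inordK; try by rewrite ltnW// ltnS grid_trunc_lt.
have h (x : R) : - n%:R <= x < n%:R -> 0 <= (x + n%:R) * s%:R.
  by move=> /andP[x0 _]; rewrite mulr_ge0// -lerBlDr sub0r.
have := truncn_itv (h _ gr); have := truncn_itv (h _ gr').
set a := Num.truncn _; set b := Num.truncn _ => /andP[a0 a1] /andP[b0 b1] ab.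
rewrite ab in b0 b1; rewrite -[leRHS]mul1r ler_pdivlMr// -[s%:R]ger0_norm ?ler0n//.
rewrite -normrM mulrBl ler_norml; move: a0 a1 b0 b1; rewrite -natr1 !mulrDl.
by move=> *; apply/andP; split; lra.
Qed.

Lemma measurable_grid j : measurable (grid @^-1` [set j]).
Proof.
have mI : measurable (`[- n%:R, n%:R[%classic : set R) by exact: measurable_itv.
pose A := [set r : R | (j%:R <= (r + n%:R) * s%:R < j.+1%:R)].
have mA : measurable A.
  rewrite (_ : A = `[j%:R / s%:R - n%:R, j.+1%:R / s%:R - n%:R[%classic).
    exact: measurable_itv.
  apply/seteqP; split => r /=; rewrite in_itv/= lerBlDr ltrBrDr ler_pdivrMr// ltr_pdivlMr//.
have [jK|jK] := ltnP j K.
  rewrite (_ : _ @^-1` _ = `[- n%:R, n%:R[%classic `&` A); first exact: measurableI.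
  apply/seteqP; split => r /=; rewrite in_itv/=.
    move=> E; have h : - n%:R <= r < n%:R by rewrite -grid_inner E.
    split=> //; move: E; rewrite /grid h => /(congr1 val); rewrite /= inordK.
      by move=> jE; rewrite /A/= -jE; apply: truncn_itv; rewrite mulr_ge0// -lerBlDr sub0r; case/andP: h.
    by rewrite ltnW// ltnS grid_trunc_lt.
  move=> [h Ar]; rewrite /grid h; apply/val_inj; rewrite /= inordK.
    exact/truncn_def.
  by rewrite ltnW// ltnS grid_trunc_lt.
rewrite (_ : _ @^-1` _ = ~` `[- n%:R, n%:R[%classic); first exact: measurableC.
apply/seteqP; split => r /=; rewrite in_itv/= => h.
  by apply/negP; rewrite -grid_inner h -leqNgt.
apply/val_inj => /=; rewrite /grid; move/negP/negPf : h => ->/=.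
by apply/eqP; rewrite eqn_leq jK -ltnS ltn_ord.
Qed.

End grid.

Section cells.
Context d (T : measurableType d) (R : realType) (m : nat) (feat : 'I_m -> T -> R).
Hypothesis mfeat : forall i, measurable_fun setT (feat i).
Variables (n s : nat).
Hypothesis s_gt0 : (0 < s)%N.
Local Notation K := (2 * n * s)%N.

Definition cell_of (x : T) : m.-tuple 'I_K.+1 := [tuple grid n s (feat i x) | i < m].

Definition inner_cell (k : m.-tuple 'I_K.+1) : bool := [forall i, (tnth k i < K)%N].

Lemma inner_cellE x : inner_cell (cell_of x) = [forall i, - n%:R <= feat i x < n%:R].
Proof. by apply: eq_forallb => i; rewrite tnth_mktuple grid_inner. Qed.

Lemma cell_mesh x y i : cell_of x = cell_of y -> inner_cell (cell_of x) ->
  `|feat i x - feat i y| <= s%:R^-1.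
Proof.
move=> E /forallP/(_ i); rewrite tnth_mktuple => h; apply: (@grid_mesh _ n s) => //.
by have := congr1 (fun k => tnth k i) E; rewrite !tnth_mktuple.
Qed.

Lemma measurable_cell_of k : measurable [set x | cell_of x = k].
Proof.
rewrite (_ : [set _ | _] = \bigcap_i (feat i @^-1` (grid n s @^-1` [set tnth k i]))).
  apply: fin_bigcap_measurable => // i _; rewrite -[X in measurable X]setTI.
  by apply: mfeat => //; exact: measurable_grid.
apply/seteqP; split=> x /= h; first by move=> i _ /=; rewrite -h tnth_mktuple.
by apply: eq_from_tnth => i; rewrite tnth_mktuple; exact: h.
Qed.

End cells.

Section countable_cells.
Context d (T : measurableType d) (R : realType) (m : nat) (feat : 'I_m -> T -> R).
Hypothesis mfeat : forall i, measurable_fun setT (feat i).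
Variable s : nat.
Hypothesis s_gt0 : (0 < s)%N.

(** Here no cell is an exterior one: the mesh is small everywhere, at the price of countably many
    cells. *)
Definition floor_cell (x : T) : nat :=
  pickle [tuple Num.floor (feat i x * s%:R) | i < m].

Lemma floor_cell_mesh x y i : floor_cell x = floor_cell y ->
  `|feat i x - feat i y| <= s%:R^-1.
Proof.
move=> /(pcan_inj pickleK) /(congr1 (fun k => tnth k i)); rewrite !tnth_mktuple => E.
have sp : 0 < s%:R :> R by rewrite ltr0n.
rewrite -[leRHS]mul1r ler_pdivlMr// -[s%:R]ger0_norm ?ler0n// -normrM mulrBl.
have := floor_itv (feat i x * s%:R); have := floor_itv (feat i y * s%:R).
rewrite E intrD => /andP[a0 a1] /andP[b0 b1].
by rewrite ler_norml; apply/andP; split; lra.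
Qed.

Lemma measurable_floor_cell : measurable_fun setT floor_cell.
Proof.
apply: measurable_fun_countable => j.
case E : (unpickle j : option (m.-tuple int)) => [k|]; last first.
  rewrite (_ : _ @^-1` _ = set0)//; apply/seteqP; split=> // x /= h.
  by move: E; rewrite -h /floor_cell pickleK.
have [kj|kj] := eqVneq (pickle k) j; last first.
  rewrite (_ : _ @^-1` _ = set0)//; apply/seteqP; split=> // x /= h.
  by move: E kj; rewrite -h /floor_cell pickleK => -[->]; rewrite eqxx.
have sp : 0 < s%:R :> R by rewrite ltr0n.
rewrite (_ : _ @^-1` _ = \bigcap_i (feat i @^-1`
    `[(tnth k i)%:~R / s%:R, (tnth k i + 1)%:~R / s%:R[%classic)).
  apply: fin_bigcap_measurable => // i _; rewrite -[X in measurable X]setTI.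
  by apply: mfeat => //; exact: measurable_itv.
apply/seteqP; split=> x /=.
  rewrite /floor_cell -kj => /(pcan_inj pickleK) h i _ /=; rewrite in_itv/=.
  rewrite ler_pdivrMr// ltr_pdivlMr//.
  by have := floor_itv (feat i x * s%:R); rewrite -h tnth_mktuple.
move=> h; rewrite -kj; congr pickle; apply: eq_from_tnth => i; rewrite tnth_mktuple.
have := h i I; rewrite /= in_itv/= ler_pdivrMr// ltr_pdivlMr// => hi.
exact/floor_def.
Qed.

End countable_cells.

(** * Uniform continuity on boxes and measurability of continuous functions *)

Section continuous_on_boxes.
Context (R : realType) (n : nat) (f : 'rV[R]_n -> R).
Hypothesis cf : continuous f.

Let box_set (M : R) : set 'rV[R]_n := [set v | forall i, `[- M, M]%classic (v ord0 i)].

Let box_compact M : compact (box_set M).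
Proof. exact: (@rV_compact R n (fun=> `[- M, M]%classic) (fun=> @segment_compact R _ _)). Qed.

(** Only [u] is confined to the box. Compactness in its covering form, along the filter of large
    [s], yields a single mesh [s.+1%:R^-1] for all points of the box. *)
Lemma unif_continuous_box (M e : R) : 0 < e -> exists2 t : R, 0 < t &
  forall u v : 'rV[R]_n, (forall i, `|u ord0 i| <= M) ->
    (forall i, `|u ord0 i - v ord0 i| <= t) -> `|f u - f v| <= e.
Proof.
move=> e0; pose P (s : nat) (u : 'rV[R]_n) := forall v : 'rV[R]_n,
  (forall i, `|u ord0 i - v ord0 i| <= s.+1%:R^-1) -> `|f u - f v| <= e.
have : \forall s \near \oo, box_set M `<=` P s.
  refine ((compact_near_coveringP (box_set M)).1 (@box_compact M) nat \oo P _ _).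
  move=> u _; have /cvgrPdist_lt/(_ (e / 2)) := @cf u.
  rewrite divr_gt0// => /(_ isT)/nbhs_ballP[r/= r0 ur].
  exists (ball u (r / 2), [set s | s.+1%:R^-1 < r / 2]); first split.
  - by apply: nbhsx_ballx; rewrite divr_gt0.
  - have := near_infty_natSinv_lt (PosNum (divr_gt0 r0 (ltr0Sn _ 1))); exact.
  move=> [u' s] /= [uu' sr] v u'v.
  have h1 : `|f u - f u'| < e / 2.
    by apply: ur; apply: le_ball uu'; rewrite ler_piMr ?(ltW r0)//; lra.
  have h2 : `|f u - f v| < e / 2.
    apply: ur; split=> // i j; rewrite (ord1 i) /ball/=.
    rewrite (le_lt_trans (ler_distD (u' ord0 j) _ _))//.
    rewrite [ltRHS](splitr r) ltrD//; first exact: (uu'.2 ord0 j).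
    exact: le_lt_trans (u'v j) sr.
  rewrite (le_trans (ler_distD (f u) _ _))// (splitr e) lerD//; last exact: ltW.
  by rewrite distrC ltW.
move=> [s _ /(_ _ (leqnn s)) h]; exists s.+1%:R^-1; first by rewrite invr_gt0.
move=> u v uM uv; apply: h => // i /=; rewrite in_itv/= -ler_norml; exact: uM.
Qed.

Lemma measurable_continuous_row d (T : measurableType d) (feat : 'I_n -> T -> R) :
  (forall i, measurable_fun setT (feat i)) ->
  measurable_fun setT (fun x => f (\row_i feat i x)).
Proof.
move=> mfeat.
pose r (m j : nat) : R := if unpickle j is Some k then
  f (\row_i ((tnth (k : n.-tuple int) i)%:~R / m.+1%:R)) else 0.
apply: (@measurable_of_discretization _ _ _ _ (fun m => floor_cell feat m.+1) r).
  by move=> m; exact: measurable_floor_cell.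
move=> x; apply/cvgrPdist_lt => e e0.
have /cvgrPdist_lt/(_ e e0)/nbhs_ballP[t/= t0 ut] := @cf (\row_i feat i x).
have := near_infty_natSinv_lt (PosNum t0); apply: filterS => m /= mt.
rewrite /r /floor_cell pickleK; apply: ut; split=> // i j; rewrite !mxE tnth_mktuple /ball/=.
apply: le_lt_trans mt; have mp : 0 < m.+1%:R :> R by rewrite ltr0n.
have /andP[h0 h1] := floor_itv (feat j x * m.+1%:R).
rewrite intrD in h1; set y := Num.floor _ in h0 h1 *.
have -> : feat j x - y%:~R / m.+1%:R = (feat j x * m.+1%:R - y%:~R) / m.+1%:R.
  by field; rewrite gt_eqF.
rewrite normrM (ger0_norm (x := m.+1%:R^-1)) ?invr_ge0//.
by rewrite ler_piMl ?invr_ge0// ler_norml; apply/andP; split; lra.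
Qed.

End continuous_on_boxes.

(** * Coordinates of the state space *)

Section coordinates.
Context (R : realType) (k : ambient) (d : nat).
Local Notation X := (state_space R k d).

Definition crd (j : 'I_d) (x : X) : R := coord (tnth x j).

Lemma measurable_crd j : measurable_fun setT (crd j).
Proof. exact: (measurableT_comp (@measurable_coord R k) (measurable_tnth j)). Qed.

Lemma space_proj_crd (x : X) : space_proj k (\row_j crd j x) = x.
Proof.
apply: eq_from_tnth => j; rewrite tnth_mktuple mxE; apply/val_inj => /=.
rewrite /crd /wrap; have := coordP (tnth x j); rewrite /in_cell; case: k x => // x h.
rewrite (_ : Num.floor _ = 0) ?subr0//.
by apply: floor_def; rewrite add0r.
Qed.

Lemma axis_dist_le (a b : axis R k) : axis_dist a b <= `|coord a - coord b|.
Proof. by rewrite /axis_dist; case: k a b => // a b; rewrite ge_min lexx. Qed.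

Lemma space_dist_le (x y : X) (t : R) : 0 <= t ->
  (forall j, `|crd j x - crd j y| <= t) -> space_dist x y <= Num.sqrt d%:R * t.
Proof.
move=> t0 h; rewrite -[in leRHS](ger0_norm t0) -sqrtr_sqr -sqrtrM ?ler0n//.
rewrite ler_sqrt ?mulr_ge0 ?ler0n ?sqr_ge0//.
apply: (@le_trans _ _ (\sum_(i < d) t ^+ 2)).
  apply: ler_sum => j _; rewrite lerXn2r ?nnegrE//.
    by have [] := axis_dist_is_dist R k.
  exact: le_trans (axis_dist_le _ _) (h j).
by rewrite sumr_const card_ord mulr_natl.
Qed.

Lemma config_dist_le N (x y : N.-tuple X) (t : R) : 0 <= t ->
  (forall i, space_dist (tnth x i) (tnth y i) <= t) -> config_dist x y <= Num.sqrt N%:R * t.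
Proof.
move=> t0 h; rewrite -[in leRHS](ger0_norm t0) -sqrtr_sqr -sqrtrM ?ler0n//.
rewrite ler_sqrt ?mulr_ge0 ?ler0n ?sqr_ge0//.
apply: (@le_trans _ _ (\sum_(i < N) t ^+ 2)).
  apply: ler_sum => j _; rewrite lerXn2r ?nnegrE//.
  by have [] := @space_dist_is_dist R k d.
by rewrite sumr_const card_ord mulr_natl.
Qed.

Lemma kernel_unif_continuous (U : X -> X -> R) (M e : R) : kernel_C2 U -> 0 < e ->
  exists2 t : R, 0 < t & forall x y x' y',
    (forall j, `|crd j x| <= M) -> (forall j, `|crd j y| <= M) ->
    (forall j, `|crd j x - crd j x'| <= t) -> (forall j, `|crd j y - crd j y'| <= t) ->
    `|U x y - U x' y'| <= e.
Proof.
move=> [cU _ _ _ _] e0; have [t t0 ht] := unif_continuous_box cU M e0.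
exists t => // x y x' y' xM yM xx yy.
have := ht (row_mx (\row_j crd j x) (\row_j crd j y)) (row_mx (\row_j crd j x') (\row_j crd j y')).
rewrite !row_mxKl !row_mxKr !space_proj_crd; apply => i.
  by case: (split_ordP i) => j ->; rewrite ?row_mxEl ?row_mxEr mxE.
by case: (split_ordP i) => j ->; rewrite ?row_mxEl ?row_mxEr !mxE.
Qed.

Lemma measurable_potential (V : X -> R) : potential_C2 V -> measurable_fun setT V.
Proof.
move=> [cV _ _ _ _]; have := measurable_continuous_row cV measurable_crd.
by under [X in measurable_fun _ X]eq_fun do rewrite space_proj_crd.
Qed.

End coordinates.

(** * Mean value theorem on segments and operator norms *)

Section mean_value.
Context (R : realType) (n : nat).
Implicit Types (f : 'rV[R]_n -> R) (u v : 'rV[R]_n).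
Let e i : 'rV[R]_n := delta_mx ord0 i.

Lemma derive_row f x v : differentiable f x ->
  'D_v f x = \sum_i v ord0 i * 'D_(e i) f x.
Proof.
move=> df; rewrite deriveE// {1}(row_sum_delta v) linear_sum/=.
by apply: eq_bigr => i _; rewrite linearZ/= -deriveE.
Qed.

Lemma mean_value_segment f a b : (forall x, differentiable f x) ->
  exists x, f a - f b = \sum_i (a - b) ord0 i * 'D_(e i) f x.
Proof.
move=> df; pose line (t : R) : 'rV[R]_n := b + t *: (a - b).
have dfl (t : R) : is_derive t 1 (f \o line) ('D_(a - b) f (line t)).
  have E : (fun h : R => h^-1 *: (((f \o line) \o shift t) (h *: 1) - (f \o line) t)) =
      (fun h => h^-1 *: ((f \o shift (line t)) (h *: (a - b)) - f (line t))).
    apply/funext => h /=; congr (_ *: (f _ - _)).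
    rewrite (_ : h%:A = h); last by rewrite /GRing.scale/= mulr1.
    by rewrite /line scalerDl addrCA.
  split; first by rewrite /derivable E; exact: diff_derivable.
  by rewrite /derive E.
have [t _] : exists2 t, t \in `[0, 1]%R &
    (f \o line) 1 - (f \o line) 0 = 'D_(a - b) f (line t) * (1 - 0).
  apply: MVT_segment => //.
  apply: continuous_subspaceT => t.
    by apply/differentiable_continuous/derivable1_diffP; have [] := dfl t.
rewrite /= subr0 mulr1 /line scale1r scale0r addr0 [b + (a - b)]addrC subrK => ->.
by exists (b + t *: (a - b)); exact: derive_row.
Qed.
End mean_value.

Section operator_norm_bound.
Context (R : realType) (n : nat).

Lemma euclidean_norm_ge0 (v : 'cV[R]_n) : 0 <= euclidean_norm v.
Proof. exact: sqrtr_ge0. Qed.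

Lemma euclidean_normZ (t : R) (v : 'cV[R]_n) : 0 <= t ->
  euclidean_norm (t *: v) = t * euclidean_norm v.
Proof.
move=> t0; rewrite /euclidean_norm -[in RHS](ger0_norm t0) -sqrtr_sqr -sqrtrM ?sqr_ge0//.
by congr Num.sqrt; rewrite mulr_sumr; apply: eq_bigr => i _; rewrite mxE exprMn.
Qed.

Lemma euclidean_norm0_eq0 (v : 'cV[R]_n) : euclidean_norm v = 0 -> v = 0.
Proof.
move=> /eqP; rewrite sqrtr_eq0 => v0; apply/matrixP => i j; rewrite (ord1 j) mxE.
apply/eqP; rewrite -(sqrf_eq0 (v i 0)); apply/eqP/le_anti; rewrite sqr_ge0 andbT.
apply: le_trans v0; rewrite (bigD1 i)//= lerDl sumr_ge0// => l _; exact: sqr_ge0.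
Qed.

Lemma operator_norm_ge (A : 'M[R]_n) (L : R) (v : 'cV[R]_n) :
  (operator_norm A <= L%:E)%E -> euclidean_norm (A *m v) <= L * euclidean_norm v.
Proof.
move=> AL; have [v0|vn] := eqVneq (euclidean_norm v) 0.
  rewrite v0 mulr0 (euclidean_norm0_eq0 v0) mulmx0 /euclidean_norm big1 ?sqrtr0// => i _.
  by rewrite mxE expr0n.
have vp : 0 < euclidean_norm v by rewrite lt_neqAle eq_sym vn euclidean_norm_ge0.
have vi : 0 <= (euclidean_norm v)^-1 by rewrite invr_ge0 ltW.
rewrite -ler_pdivrMr// mulrC -euclidean_normZ// scalemxAr -lee_fin.
apply: le_trans AL; apply: ereal_sup_ubound; exists ((euclidean_norm v)^-1 *: v) => //=.
by rewrite euclidean_normZ// mulVf.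
Qed.

Lemma bilinear_le (A : 'M[R]_n) (L : R) (u v : 'I_n -> R) :
  (operator_norm A <= L%:E)%E ->
  \sum_i \sum_j u i * v j * A i j <=
  L * Num.sqrt (\sum_i u i ^+ 2) * Num.sqrt (\sum_j v j ^+ 2).
Proof.
move=> AL; have := operator_norm_ge (\col_j v j) AL.
have -> : euclidean_norm (\col_j v j) = Num.sqrt (\sum_j v j ^+ 2).
  by congr Num.sqrt; apply: eq_bigr => j _; rewrite mxE.
move=> h; have := cauchy_schwarz_sum u (fun i => (A *m \col_j v j) i 0).
have -> : \sum_i u i * (A *m \col_j v j) i 0 = \sum_i \sum_j u i * v j * A i j.
  apply: eq_bigr => i _; rewrite mxE mulr_sumr; apply: eq_bigr => j _.
  by rewrite mxE -mulrA (mulrC (v j)).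
move=> /le_trans; apply; rewrite mulrAC mulrC.
by rewrite ler_wpM2r ?sqrtr_ge0//; exact: h.
Qed.

End operator_norm_bound.

(** * Second differences of kernels *)

Section second_differences.
Context (R : realType) (T : Type).
Implicit Types (U : T -> T -> R).

(** The pairing of [U] with [delta_x - delta_y] tensor [delta_z - delta_w], whose supremum is
    [osc2 U]. *)
Definition D2 U x y z w : R := U x z - U x w - U y z + U y w.

(** Only functions of one variable are subtracted, so [D2] and pairings with differences of laws do
    not change, while the kernel now vanishes when an argument is [o]. Bounds on second differences
    thus become bounds on the kernel itself. *)
Definition centered (o : T) U x y : R := D2 U x o y o.

Lemma D2_centered o U x y z w : D2 (centered o U) x y z w = D2 U x y z w.
Proof. rewrite /D2 /centered /D2; ring. Qed.

Lemma D2_swap U x y z w : D2 U y x z w = - D2 U x y z w.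
Proof. rewrite /D2; ring. Qed.

End second_differences.

Lemma ge0_adde_le_fin_num (R : realType) (a b : \bar R) (r : R) :
  (0 <= a -> 0 <= b -> a + b <= r%:E -> exists a' b' : R,
    [/\ (0 <= a')%R, (0 <= b')%R, (a' + b' <= r)%R, a = a'%:E & b = b'%:E])%E.
Proof. by case: a => [a||]; case: b => [b||]// *; exists a, b; split. Qed.

Section osc2_bounds.
Context d (T : measurableType d) (R : realType) (o : T).
Implicit Types (U : T -> T -> R).

Lemma centered_symmetric U : symmetric_kernel U -> symmetric_kernel (centered o U).
Proof. by move=> UC x y; rewrite /centered /D2 (UC y x) (UC y o) (UC o x); ring. Qed.

Lemma osc2_ge0 U : (0 <= osc2 U)%E.
Proof.
apply: ereal_sup_ubound; exists ((o, o), (o, o)) => //=.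
by rewrite subrr sub0r addNr.
Qed.

Lemma D2_le_osc2 U x y z w : ((D2 U x y z w)%:E <= osc2 U)%E.
Proof. by apply: ereal_sup_ubound; exists ((x, y), (z, w)). Qed.

Lemma osc2_sum U U' (M : R) : (osc2 U + osc2 U' <= M%:E)%E ->
  exists a b : R, [/\ 0 <= a, 0 <= b, a + b <= M,
    forall x y z w, D2 U x y z w <= a & forall x y z w, D2 U' x y z w <= b].
Proof.
move=> h; have h0 := osc2_ge0 U; have h0' := osc2_ge0 U'.
have [a [b [a0 b0 ab aE bE]]] := ge0_adde_le_fin_num h0 h0' h.
exists a, b; split=> // x y z w.
  by rewrite -lee_fin -aE D2_le_osc2.
by rewrite -lee_fin -bE D2_le_osc2.
Qed.

End osc2_bounds.

Section mixed_hessian_bounds.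
Context (R : realType) (d : nat).
Local Notation X := (state_space R Euclid d).
Implicit Types (U : X -> X -> R).

Lemma space_distE (x y : X) :
  space_dist x y = Num.sqrt (\sum_(j < d) (crd j x - crd j y) ^+ 2).
Proof.
congr Num.sqrt; apply: eq_bigr => j _; rewrite /axis_dist /crd.
by rewrite real_normK// num_real.
Qed.

Lemma mixed_hessian_norm_ge0 U : (0 <= mixed_hessian_norm U)%E.
Proof.
apply: le_trans (ereal_sup_ubound _); last by exists (0, 0).
apply: ereal_sup_ubound; exists 0 => /=.
  by rewrite /euclidean_norm big1 ?sqrtr0 ?ler01// => i _; rewrite mxE expr0n.
by rewrite mulmx0 /euclidean_norm big1 ?sqrtr0// => i _; rewrite mxE expr0n.
Qed.

(** Apply the mean value theorem in the second variable, at a point [q] depending on all four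
    arguments, then in the first variable with [q] frozen: the second difference is the mixed
    Hessian at one single point, applied to the two increments. *)
Lemma D2_le_mixed_hessian U (L : R) x y z w :
  mixed_differentiable U -> (mixed_hessian_norm U <= L%:E)%E ->
  D2 U x y z w <= L * space_dist x y * space_dist z w.
Proof.
move=> [dU ddU] UL; pose row (x : X) : 'rV[R]_d := \row_j crd j x.
pose lift (x y : 'rV[R]_d) : R := U (space_proj Euclid x) (space_proj Euclid y).
pose e i : 'rV[R]_d := delta_mx ord0 i.
have UE a b : U a b = lift (row a) (row b) by rewrite /lift !space_proj_crd.
have [q qE] : exists q, D2 U x y z w = \sum_i (row z - row w) ord0 i *
    ('D_(e i) (lift (row x)) q - 'D_(e i) (lift (row y)) q).
  have df v : differentiable (lift (row x) - lift (row y)) v.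
    by apply: differentiableB; exact: dU.
  have [q qE] := mean_value_segment (row z) (row w) df.
  exists q; rewrite /D2 !UE (_ : _ + _ = (lift (row x) - lift (row y)) (row z) -
      (lift (row x) - lift (row y)) (row w)); last by rewrite !fctE; ring.
  rewrite qE; apply: eq_bigr => i _; congr (_ * _).
  by rewrite deriveB//; apply: diff_derivable; exact: dU.
pose G (x' : 'rV[R]_d) : R := \sum_i (row z - row w) ord0 i * 'D_(e i) (lift x') q.
have dG v : differentiable G v.
  rewrite (_ : G = \sum_i ((row z - row w) ord0 i \*: (fun x' => 'D_(e i) (lift x') q))).
    by apply: differentiable_sum => i; apply: differentiableZ; exact: ddU.
  by apply/funext => x'; rewrite fct_sumE.
have [p pE] := mean_value_segment (row x) (row y) dG.
have -> : D2 U x y z w = \sum_i \sum_j (crd i x - crd i y) * (crd j z - crd j w) *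
    mixed_hessian U p q i j.
  rewrite qE; transitivity (G (row x) - G (row y)).
    by rewrite /G -sumrB; apply: eq_bigr => i _; rewrite mulrBr.
  rewrite pE; apply: eq_bigr => i _; rewrite !mxE.
  have -> : 'D_(e i) G p = \sum_j (crd j z - crd j w) * mixed_hessian U p q i j.
    rewrite (_ : G = \sum_j ((row z - row w) ord0 j \*: (fun x' => 'D_(e j) (lift x') q))); last first.
      by apply/funext => x'; rewrite fct_sumE.
    rewrite derive_sum => [|j]; last first.
      by apply: derivableZ; apply: diff_derivable; exact: ddU.
    apply: eq_bigr => j _; rewrite deriveZ; last by apply: diff_derivable; exact: ddU.
    by rewrite !mxE.
  by rewrite mulr_sumr; apply: eq_bigr => j _; rewrite mulrA.
rewrite !space_distE; apply: bilinear_le; apply: le_trans UL.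
by apply: ereal_sup_ubound; exists (p, q).
Qed.

Lemma mixed_hessian_sum U U' (L : R) : mixed_differentiable U -> mixed_differentiable U' ->
  (mixed_hessian_norm U + mixed_hessian_norm U' <= L%:E)%E ->
  exists a b : R, [/\ 0 <= a, 0 <= b, a + b <= L,
    forall x y z w, D2 U x y z w <= a * space_dist x y * space_dist z w &
    forall x y z w, D2 U' x y z w <= b * space_dist x y * space_dist z w].
Proof.
move=> dU dU' h; have h0 := mixed_hessian_norm_ge0 U; have h0' := mixed_hessian_norm_ge0 U'.
have [a [b [a0 b0 ab aE bE]]] := ge0_adde_le_fin_num h0 h0' h.
exists a, b; split=> // x y z w.
  by apply: D2_le_mixed_hessian => //; rewrite aE.
by apply: D2_le_mixed_hessian => //; rewrite bE.
Qed.

End mixed_hessian_bounds.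

Lemma integral_cstr d (T : measurableType d) (R : realType)
    (mu : {measure set T -> \bar R}) D (r : \bar R) : measurable D ->
  (\int[mu]_(x in D) r = r * mu D)%E.
Proof. by move=> mD; exact: integral_cst. Qed.

Lemma transfer_Rintegral d d' (T : measurableType d) (T' : measurableType d') (R : realType)
    (P : {measure set T -> \bar R}) (Q : {measure set T' -> \bar R}) (g : T -> T')
    (f : T' -> R) : measurable_fun setT g ->
  (forall F : T' -> \bar R, measurable_fun setT F -> (forall y, 0 <= F y)%E ->
    (\int[Q]_y F y = \int[P]_x F (g x))%E) ->
  measurable_fun setT f ->
  (L1 Q f <-> L1 P (fun x => f (g x))) /\ \int[Q]_y f y = \int[P]_x f (g x).
Proof.
move=> mg QP mf; have mfg : measurable_fun setT (fun x => f (g x)) by exact: measurableT_comp.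
have mEf : measurable_fun setT (EFin \o f) by exact/measurable_EFinP.
have E : (\int[Q]_y `|f y|%:E = \int[P]_x `|f (g x)|%:E)%E.
  rewrite (QP (fun y => `|f y|%:E))//.
  by apply/measurable_EFinP; exact: measurableT_comp.
split; first by split=> /L1_lty h; apply: L1P => //; [rewrite -E|rewrite E].
rewrite /Rintegral integralE [in RHS]integralE; congr fine; congr (_ - _)%E.
  rewrite QP//; last exact: measurable_funepos.
  by apply: eq_integral => x _; rewrite !funeposE.
rewrite QP//; last exact: measurable_funeneg.
by apply: eq_integral => x _; rewrite !funenegE.
Qed.

(** * Integrals on product spaces *)

Section product_integrals.
Context d1 d2 (T1 : measurableType d1) (T2 : measurableType d2) (R : realType).
Variables (P : probability T1 R) (Q : probability T2 R).

Lemma ge0_integral_prod_fst (F : T1 -> \bar R) : measurable_fun setT F ->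
  (forall x, 0 <= F x)%E -> (\int[P]_x F x = \int[P \x Q]_z F z.1)%E.
Proof.
move=> mF F0; rewrite (fubini_tonelli1 (fun z : T1 * T2 => F z.1))//; last first.
  exact: (measurableT_comp mF measurable_fst).
apply: eq_integral => x _; rewrite /fubini_F/=.
rewrite [RHS]integral_cstr// -[LHS]mule1; congr (_ * _)%E.
exact/esym/probability_setT.
Qed.

Lemma ge0_integral_prod_snd (F : T2 -> \bar R) : measurable_fun setT F ->
  (forall x, 0 <= F x)%E -> (\int[Q]_x F x = \int[P \x Q]_z F z.2)%E.
Proof.
move=> mF F0; rewrite (fubini_tonelli2 (fun z : T1 * T2 => F z.2))//; last first.
  exact: (measurableT_comp mF measurable_snd).
apply: eq_integral => x _; rewrite /fubini_G/=.
rewrite [RHS]integral_cstr// -[LHS]mule1; congr (_ * _)%E.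
exact/esym/probability_setT.
Qed.

Lemma Rintegral_prod_fst (f : T1 -> R) : L1 P f ->
  L1 (P \x Q)%E (fun z => f z.1) /\ \int[(P \x Q)%E]_z f z.1 = \int[P]_x f x.
Proof.
move=> fi; have [h1 h2] := transfer_Rintegral measurable_fst ge0_integral_prod_fst (L1_measurable fi).
by split; [exact/h1|rewrite h2].
Qed.

Lemma Rintegral_prod_snd (f : T2 -> R) : L1 Q f ->
  L1 (P \x Q)%E (fun z => f z.2) /\ \int[(P \x Q)%E]_z f z.2 = \int[Q]_x f x.
Proof.
move=> fi; have [h1 h2] := transfer_Rintegral measurable_snd ge0_integral_prod_snd (L1_measurable fi).
by split; [exact/h1|rewrite h2].
Qed.

Lemma Rfubini (f : T1 * T2 -> R) : L1 (P \x Q)%E f ->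
  (forall x, L1 Q (fun y => f (x, y))) ->
  L1 P (fun x => \int[Q]_y f (x, y)) /\
  \int[(P \x Q)%E]_z f z = \int[P]_x \int[Q]_y f (x, y).
Proof.
move=> fi fxi.
have E : fubini_F Q (EFin \o f) = EFin \o (fun x => \int[Q]_y f (x, y)).
  by apply/funext => x; rewrite /= EFin_Rintegral.
split; first by rewrite /L1 -E; exact: integrable_fubini_F.
by rewrite /Rintegral -(integral12_prod_meas1 fi) E.
Qed.

Lemma L1_prodM (a : T1 -> R) (b : T2 -> R) : L1 P a -> L1 Q b ->
  L1 (P \x Q)%E (fun z => a z.1 * b z.2) /\
  \int[(P \x Q)%E]_z (a z.1 * b z.2) = \int[P]_x a x * \int[Q]_y b y.
Proof.
move=> ai bi; have ma := L1_measurable ai; have mb := L1_measurable bi.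
have mab : measurable_fun setT (fun z : T1 * T2 => a z.1 * b z.2).
  apply: measurable_funM; first exact: (measurableT_comp ma measurable_fst).
  exact: (measurableT_comp mb measurable_snd).
have abi : L1 (P \x Q)%E (fun z => a z.1 * b z.2).
  apply/integrable12ltyP; first exact/measurable_EFinP.
  rewrite (_ : (fun x => _) = fun x => (`|a x|%:E * (\int[Q]_y `|b y|)%:E)%E); last first.
    apply/funext => x; rewrite EFin_Rintegral; last exact: L1_norm.
    rewrite -ge0_integralZl_EFin//; last by apply/measurable_EFinP; exact: measurableT_comp.
    by apply: eq_integral => y _; rewrite -EFinM -normrM.
  under eq_integral do rewrite muleC.
  rewrite ge0_integralZl_EFin//; last 2 first.
    by apply/measurable_EFinP; exact: measurableT_comp.
    by apply: Rintegral_ge0.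
  by rewrite -EFin_Rintegral ?ltry//; exact: L1_norm.
split=> //; have [|_ ->] := Rfubini abi; first by move=> x; exact: (L1Z (a x) bi).
rewrite -RintegralZr//; apply: eq_Rintegral => x _; exact: (RintZ (a x) bi).
Qed.

End product_integrals.

(** * Kernels split into a bounded and a Lipschitz part *)

Section split_kernels.
Context (R : realType) (k : ambient) (d : nat).
Local Notation X := (state_space R k d).
Implicit Types (U K B Q : X -> X -> R).

(** What the estimates retain of [W^+] or [W^-] after centering: [B] is controlled by its double
    oscillation, [Q] by its mixed Hessian. *)
Definition split_kernel K B Q (c l : R) : Prop :=
  [/\ symmetric_kernel K /\ (forall x y, K x y = B x y + Q x y),
      measurable_kernel B /\ measurable_kernel Q,
      (forall x y z w, D2 B x y z w <= c) /\ (forall x y, `|B x y| <= c) &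
      (forall x y z w, D2 Q x y z w <= l * space_dist x y * space_dist z w) /\
      (forall x y, `|Q x y| <= l * space_norm x * space_norm y)].

Definition square_nonneg K : Prop := forall nu nu' : probability X R, P2 nu -> P2 nu' ->
  0 <= pairing K nu nu - pairing K nu nu' - pairing K nu' nu + pairing K nu' nu'.

Lemma space_dist0 (x : X) : space_dist x x = 0.
Proof. by have [_ -> _ _] := @space_dist_is_dist R k d. Qed.

Lemma space_dist_ge0 (x y : X) : 0 <= space_dist x y.
Proof. by have [-> _ _ _] := @space_dist_is_dist R k d. Qed.

Lemma space_distC (x y : X) : space_dist x y = space_dist y x.
Proof. by have [_ _ -> _] := @space_dist_is_dist R k d. Qed.

Lemma dirac_P2 : P2 (\d_(@origin R k d) : probability X R).
Proof.
have md : measurable_fun setT (fun x : X => (space_dist x origin ^+ 2)%:E).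
  apply/measurable_EFinP/measurable_funX.
  apply: (measurableT_comp (@measurable_space_dist R k d) (g := fun x => (x, origin))).
  exact: measurable_pair2.
by rewrite /P2 /finite_moment/= integral_dirac//= space_dist0 expr0n/= mule0.
Qed.

(** The sections of [U] at the origin are integrable because [positive_kernel] includes
    integrability against products with a Dirac mass. *)
Lemma pairing_centered U (nu nu' : probability X R) :
  positive_kernel U -> P2 nu -> P2 nu' ->
  pairing (centered origin U) nu nu' = pairing U nu nu' - \int[nu]_x U x origin
    - \int[nu']_y U origin y + U origin origin.
Proof.
move=> [Ui _] nuP nu'P; rewrite /pairing.
have Unn' : L1 (nu \x nu')%E (fun z => U z.1 z.2) by exact: Ui.
have mU := L1_measurable Unn'.
have mUx (x : X) : measurable_fun setT (fun y => U x y).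
  by apply: (measurableT_comp mU (g := fun y => (x, y))); exact: measurable_pair1.
have mUy (y : X) : measurable_fun setT (fun x => U x y).
  by apply: (measurableT_comp mU (g := fun x => (x, y))); exact: measurable_pair2.
have mnU : measurable_fun setT (fun z : X * X => `|U z.1 z.2|%:E).
  by apply/measurable_EFinP; exact: (measurableT_comp _ mU).
have dint (F : X -> R) : measurable_fun setT F ->
    (\int[\d_(@origin R k d)]_y `|F y|%:E = `|F origin|%:E)%E.
  move=> mF; rewrite integral_dirac// ?diracT ?mul1e//.
  by apply/measurable_EFinP; exact: measurableT_comp.
have Uo (mu : probability X R) : P2 mu -> L1 mu (fun x => U x origin).
  move=> muP; have := L1_lty (Ui _ _ muP dirac_P2).
  rewrite fubini_tonelli1//= => h; apply: L1P => //; apply: le_lt_trans h.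
  by rewrite le_eqVlt; apply/orP; left; apply/eqP; apply: eq_integral => x _; rewrite -dint.
have oU (mu : probability X R) : P2 mu -> L1 mu (fun y => U origin y).
  move=> muP; have := L1_lty (Ui _ _ dirac_P2 muP).
  rewrite fubini_tonelli2//= => h; apply: L1P => //; apply: le_lt_trans h.
  rewrite le_eqVlt; apply/orP; left; apply/eqP; apply: eq_integral => y _.
  by rewrite -(dint (fun x => U x y)).
have [i1 e1] := Rintegral_prod_fst nu' (Uo _ nuP).
have [i2 e2] := Rintegral_prod_snd nu (oU _ nu'P).
have nn1 : (nu \x nu')%E setT = 1%E.
  rewrite -setXTT product_measure1E// -[RHS]mule1.
  by congr (_ * _)%E; exact: probability_setT.
rewrite -e1 -e2 -RintB// -RintB//; last exact: L1B.
rewrite -[U origin origin in RHS](Rint_cst nn1) -RintD//.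
  by apply: L1B => //; exact: L1B.
exact: L1_cst.
Qed.

Lemma square_nonneg_centered U : positive_kernel U -> square_nonneg (centered origin U).
Proof.
move=> Up nu nu' nuP nu'P; have [_ /(_ _ _ nuP nu'P)] := Up.
rewrite !pairing_centered//; lra.
Qed.

End split_kernels.

Section euclidean_measurability.
Context (R : realType) (d : nat).
Local Notation X := (state_space R Euclid d).

Lemma crd_space_proj (u : 'rV[R]_d) j : crd j (space_proj Euclid u) = u ord0 j.
Proof. by rewrite /crd tnth_mktuple. Qed.

(** The quadratic part of a decomposition is differentiable in each variable separately, with no
    joint measurability. The bound on second differences makes the centered kernel jointly
    continuous, hence a limit of functions constant on grid cells. *)
Lemma measurable_lipschitz_kernel (Q : X -> X -> R) (l : R) : 0 <= l ->
  (forall x y z w, D2 Q x y z w <= l * space_dist x y * space_dist z w) ->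
  measurable_kernel (centered origin Q).
Proof.
move=> l0 Ql; set K := centered origin Q.
have QlN x y z w : `|D2 Q x y z w| <= l * space_dist x y * space_dist z w.
  by rewrite ler_norml Ql andbT lerNl -D2_swap (space_distC x) Ql.
pose feat (i : 'I_(d + d)) (z : X * X) : R :=
  match fintype.split i with inl j => crd j z.1 | inr j => crd j z.2 end.
have mfeat i : measurable_fun setT (feat i).
  rewrite /feat; case: (fintype.split i) => j.
    exact: (measurableT_comp (@measurable_crd R Euclid d j) measurable_fst).
  exact: (measurableT_comp (@measurable_crd R Euclid d j) measurable_snd).
pose pt (m : nat) (h : 'I_d -> 'I_(d + d)) (t : (d + d).-tuple int) : X :=
  space_proj Euclid (\row_j ((tnth t (h j))%:~R / m.+1%:R)).
pose r (m j : nat) : R := if unpickle j is Some t then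
  K (pt m (lshift d) t) (pt m (@rshift d d) t) else 0.
apply: (@measurable_of_discretization _ _ _ _ (fun m => floor_cell feat m.+1) r).
  by move=> m; exact: measurable_floor_cell.
move=> [x y] /=.
have close m i : `|feat i (x, y) - (Num.floor (feat i (x, y) * m.+1%:R))%:~R / m.+1%:R| <= m.+1%:R^-1.
  have mp : 0 < m.+1%:R :> R by rewrite ltr0n.
  have /andP[h0 h1] := floor_itv (feat i (x, y) * m.+1%:R).
  rewrite intrD in h1; set q := Num.floor _ in h0 h1 *.
  have -> : feat i (x, y) - q%:~R / m.+1%:R = (feat i (x, y) * m.+1%:R - q%:~R) / m.+1%:R.
    by field; rewrite gt_eqF.
  rewrite normrM (ger0_norm (x := m.+1%:R^-1)) ?invr_ge0//.
  by rewrite ler_piMl ?invr_ge0// ler_norml; apply/andP; split; lra.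
pose t m := [tuple Num.floor (feat i (x, y) * m.+1%:R) | i < d + d].
pose x' m := pt m (lshift d) (t m); pose y' m := pt m (@rshift d d) (t m).
have dx m : space_dist x (x' m) <= Num.sqrt d%:R * m.+1%:R^-1.
  apply: space_dist_le => [|j]; first by rewrite invr_ge0.
  rewrite crd_space_proj mxE tnth_mktuple.
  by have := close m (lshift d j); rewrite /feat (unsplitK (inl j)).
have dy m : space_dist y (y' m) <= Num.sqrt d%:R * m.+1%:R^-1.
  apply: space_dist_le => [|j]; first by rewrite invr_ge0.
  rewrite crd_space_proj mxE tnth_mktuple.
  by have := close m (rshift d j); rewrite /feat (unsplitK (inr j)).
pose S : R := Num.sqrt d%:R.
pose C : R := l * S * (space_norm y + space_norm x + S).
have S0 : 0 <= S by exact: sqrtr_ge0.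
have nx0 : 0 <= space_norm x by exact: space_dist_ge0.
have ny0 : 0 <= space_norm y by exact: space_dist_ge0.
have C0 : 0 <= C by rewrite !mulr_ge0// !addr_ge0.
have bound m : `|K x y - K (x' m) (y' m)| <= C * m.+1%:R^-1.
  (* Move [x] first, then [y]: each second difference has one small factor. *)
  have -> : K x y - K (x' m) (y' m) = D2 Q x (x' m) y origin + D2 Q (x' m) origin y (y' m).
    by rewrite /K /centered /D2; ring.
  apply: le_trans (ler_normD _ _) _.
  have h1 := QlN x (x' m) y origin; have h2 := QlN (x' m) origin y (y' m).
  have i0 : 0 <= m.+1%:R^-1 :> R by rewrite invr_ge0.
  have i1 : m.+1%:R^-1 <= 1 :> R by rewrite invf_le1 ?ltr0n// ler1n.
  have nx' : space_dist (x' m) origin <= space_norm x + S.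
    have [_ _ _ T] := @space_dist_is_dist R Euclid d.
    apply: le_trans (T _ x _) _; rewrite addrC lerD2l space_distC.
    by apply: le_trans (dx m) _; rewrite ler_piMr.
  apply: le_trans (lerD h1 h2) _.
  have h3 : l * space_dist x (x' m) * space_dist y origin <= l * (S * m.+1%:R^-1) * space_norm y.
    by rewrite ler_wpM2r// ler_wpM2l// dx.
  have h4 : l * space_dist (x' m) origin * space_dist y (y' m) <=
      l * (space_norm x + S) * (S * m.+1%:R^-1).
    by rewrite ler_pM ?mulr_ge0 ?space_dist_ge0// ler_wpM2l.
  apply: le_trans (lerD h3 h4) _.
  by rewrite /C le_eqVlt; apply/orP; left; apply/eqP; ring.
apply/cvgrPdist_lt => e e0.
have Ce : 0 < e / (C + 1) by rewrite divr_gt0// ltr_wpDl.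
have := near_infty_natSinv_lt (PosNum Ce); apply: filterS => m /= me.
rewrite /r /floor_cell pickleK -/(t m) -/(x' m) -/(y' m).
apply: le_lt_trans (bound m) _.
apply: (@le_lt_trans _ _ ((C + 1) * m.+1%:R^-1)); first by rewrite ler_wpM2r ?invr_ge0// lerDl.
by rewrite mulrC -ltr_pdivlMr// ltr_wpDl.
Qed.

End euclidean_measurability.

Section decomposition.
Context (R : realType) (d : nat).

(** The bounded part gets its measurability as the difference of the whole kernel and the Lipschitz
    part. *)
Lemma split_kernel_centered k (U Ub Uq : state_space R k d -> state_space R k d -> R) (c l : R) :
  symmetric_kernel U -> measurable_kernel U -> (forall x y, U x y = Ub x y + Uq x y) ->
  0 <= c -> 0 <= l -> (forall x y z w, D2 Ub x y z w <= c) ->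
  (forall x y z w, D2 Uq x y z w <= l * space_dist x y * space_dist z w) ->
  measurable_kernel (centered origin Uq) ->
  split_kernel (centered origin U) (centered origin Ub) (centered origin Uq) c l.
Proof.
move=> UC mU UE c0 l0 Ubc Uql mUq; have KE x y : centered origin U x y =
    centered origin Ub x y + centered origin Uq x y.
  by rewrite /centered /D2 !UE; ring.
have mUx (x : state_space R k d) : measurable_fun setT (fun y => U x y).
  by apply: (measurableT_comp mU (g := fun y => (x, y))); exact: measurable_pair1.
have mUy (y : state_space R k d) : measurable_fun setT (fun x => U x y).
  by apply: (measurableT_comp mU (g := fun x => (x, y))); exact: measurable_pair2.
have mUc : measurable_kernel (centered origin U).
  apply: measurable_funD => //; apply: measurable_funB; first apply: measurable_funB => //.
    exact: (measurableT_comp (mUy origin) measurable_fst).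
  exact: (measurableT_comp (mUx origin) measurable_snd).
split; first by split => //; exact: centered_symmetric.
- split=> //; rewrite /measurable_kernel.
  rewrite (_ : (fun z => _) = fun z => centered origin U z.1 z.2 - centered origin Uq z.1 z.2).
    exact: measurable_funB.
  by apply/funext => z; rewrite KE addrK.
- split=> [x y z w|x y]; first by rewrite D2_centered.
  rewrite ler_norml; apply/andP; split; last exact: Ubc.
  by rewrite lerNl -D2_swap; exact: Ubc.
- split=> [x y z w|x y]; first by rewrite D2_centered.
  rewrite ler_norml; apply/andP; split; last exact: Uql.
  by rewrite lerNl -D2_swap (le_trans (Uql _ _ _ _))// space_distC.
Qed.

Lemma decomposable_split k (W : state_space R k d -> state_space R k d -> R) (MW LW : R) :
  decomposable MW LW W -> 0 <= LW ->
  exists Kp Bp Qp Km Bm Qm (cp lp cm lm : R),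
    [/\ split_kernel Kp Bp Qp cp lp /\ square_nonneg Kp,
        split_kernel Km Bm Qm cm lm /\ square_nonneg Km,
        forall x y, centered origin W x y = Kp x y - Km x y,
        [/\ 0 <= cp, 0 <= cm, 0 <= lp & 0 <= lm] &
        [/\ cp + cm <= 4 * MW, lp + lm <= LW & k = Torus -> LW = 0]].
Proof.
move=> [Wp [Wm [WE [Wps [Wpm _] Wpp] [Wms [Wmm _] Wmp]]]].
have WKE x y : centered origin W x y = centered origin Wp x y - centered origin Wm x y.
  by rewrite /centered /D2 !WE; ring.
case: k W Wp Wm WE WKE Wps Wpm Wpp Wms Wmm Wmp => W Wp Wm WE WKE Wps Wpm Wpp Wms Wmm Wmp.
  move=> [osc ->] _; have [cp [cm [cp0 cm0 cpm hp hm]]] := osc2_sum origin osc.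
  (* On the torus the whole kernel is the bounded part, and the Lipschitz part is zero with constant
     0. *)
  pose Z : state_space R Torus d -> state_space R Torus d -> R := fun _ _ => 0.
  have mZ : measurable_kernel (centered origin Z).
    rewrite /measurable_kernel (_ : (fun z => _) = cst 0)//.
    by apply/funext => z; rewrite /centered /D2 /Z/=; ring.
  have D2Z x y z w : D2 Z x y z w <= 0 * space_dist x y * space_dist z w.
    by rewrite !mul0r /D2 /Z; lra.
  exists (centered origin Wp), (centered origin Wp), (centered origin Z),
    (centered origin Wm), (centered origin Wm), (centered origin Z), cp, 0, cm, 0; split=> //.
  - split; last exact: square_nonneg_centered.
    by apply: split_kernel_centered => // x y; rewrite addr0.
  - split; last exact: square_nonneg_centered.
    by apply: split_kernel_centered => // x y; rewrite addr0.
move=> [Wpb [Wpq [Wmb [Wmq [WpE WmE _ osc [dp dm mh]]]]]] LW0.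
have [cp [cm [cp0 cm0 cpm hp hm]]] := osc2_sum origin osc.
have [lp [lm [lp0 lm0 lpm hp' hm']]] := mixed_hessian_sum dp dm mh.
exists (centered origin Wp), (centered origin Wpb), (centered origin Wpq),
  (centered origin Wm), (centered origin Wmb), (centered origin Wmq), cp, lp, cm, lm.
split=> //.
- split; last exact: square_nonneg_centered.
  by apply: split_kernel_centered => //; exact: (measurable_lipschitz_kernel (l := lp)).
- split; last exact: square_nonneg_centered.
  by apply: split_kernel_centered => //; exact: (measurable_lipschitz_kernel (l := lm)).
Qed.

End decomposition.

(** * Mixtures, Pinsker's inequality and total variation couplings *)

Section mixture.
Context d (T : measurableType d) (R : realType).
Variables (P Q : probability T R) (t : R).
Hypothesis t01 : 0 <= t <= 1.

Let t0 : 0 <= t. Proof. by case/andP: t01. Qed.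
Let s0 : 0 <= 1 - t. Proof. by rewrite subr_ge0; case/andP: t01. Qed.

Let mix : set T -> \bar R := measure_add (mscale (NngNum s0) P) (mscale (NngNum t0) Q).

HB.instance Definition _ := Measure.on mix.

Let mixE A : mix A = ((1 - t)%:E * P A + t%:E * Q A)%E.
Proof. by rewrite /mix measure_addE. Qed.

Let mix_setT : mix setT = 1%E.
Proof. by rewrite mixE !probability_setT !mule1 -EFinD subrK. Qed.

HB.instance Definition _ := Measure_isProbability.Build _ _ _ mix mix_setT.

Lemma exists_mixture : exists M : probability T R,
  (forall A, measurable A -> M A = ((1 - t)%:E * P A + t%:E * Q A)%E) /\
  forall F : T -> \bar R, measurable_fun setT F -> (forall x, 0 <= F x)%E ->
    (\int[M]_x F x = (1 - t)%:E * \int[P]_x F x + t%:E * \int[Q]_x F x)%E.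
Proof.
exists mix; split=> [A _|F mF F0]; first exact: mixE.
by rewrite ge0_integral_measure_add// !ge0_integral_mscale.
Qed.

End mixture.

Section total_variation.
Context d (T : measurableType d) (R : realType).
Variable P : probability T R.

Let P1 : P setT = 1%E := probability_setT P.

Lemma pinsker (f : T -> R) : (forall x, 0 <= f x) -> L1 P f -> \int[P]_x f x = 1 ->
  L1 P (fun x => phi (f x)) ->
  2 * (2^-1 * \int[P]_x `|f x - 1|) ^+ 2 <= \int[P]_x phi (f x).
Proof.
move=> f0 fi f1 pfi; set t : R := 2^-1 * _; set H := \int[P]_x phi (f x).
have H0 : 0 <= H by apply: Rint_ge0 => x; exact: phi_ge0.
have t0 : 0 <= t by rewrite mulr_ge0 ?invr_ge0//; exact: Rint_ge0.
have [->|tn0] := eqVneq t 0; first by rewrite expr0n mulr0.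
have tp : 0 < t by rewrite lt_neqAle eq_sym tn0.
(* Young's inequality with a parameter fitted to the result: the first term integrates to [t], half
   of the integral [2 t] of the left side. *)
have pw x : `|f x - 1| <= t / 6 * (4 + 2 * f x) + (2 * t)^-1 * phi (f x).
  have h := phi_pinsker (f0 x); have h0 := phi_ge0 (f0 x).
  pose a : R := t * (4 + 2 * f x) / 3; pose b : R := phi (f x) / t.
  have a0 : 0 <= a by rewrite divr_ge0// mulr_ge0// addr_ge0// mulr_ge0.
  have b0 : 0 <= b by rewrite divr_ge0.
  have ab : (f x - 1) ^+ 2 <= a * b.
    rewrite (_ : a * b = (4 + 2 * f x) * phi (f x) / 3); last by rewrite /a /b; field.
    by rewrite ler_pdivlMr//; lra.
  rewrite (_ : t / 6 * _ + _ = (a + b) / 2); last by rewrite /a /b; field.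
  rewrite -ler_sqr ?nnegrE ?divr_ge0 ?addr_ge0// real_normK ?num_real//.
  apply: le_trans ab _; rewrite -subr_ge0.
  rewrite (_ : _ - _ = ((a - b) / 2) ^+ 2) ?sqr_ge0//; by field.
have i1 : L1 P (fun x => t / 6 * (4 + 2 * f x)).
  by apply: L1Z; apply: L1D; [exact: L1_cst|exact: L1Z].
have i2 : L1 P (fun x => (2 * t)^-1 * phi (f x)) by exact: L1Z.
have := le_Rint (L1_norm (L1B fi (L1_cst P1 1))) (L1D i1 i2) pw.
rewrite RintD// RintZ; last by apply: L1D; [exact: L1_cst|exact: L1Z].
rewrite RintD; [|exact: L1_cst|exact: L1Z].
rewrite Rint_cst// RintZ// f1 RintZ// -/H => h.
have {}h : 2 * t <= t + (2 * t)^-1 * H by move: h; rewrite /t; lra.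
have : 2 * t * t <= (2 * t)^-1 * H * (2 * t) by rewrite (mulrC _ (2 * t)) ler_pM2l; lra.
rewrite (_ : (2 * t)^-1 * H * (2 * t) = H); first by rewrite expr2 mulrA.
by field.
Qed.

(* Couple [nu] with [P] by leaving the common mass [min f 1] where it is. *)
Lemma total_variation_coupling (nu nup num : probability T R) (f : T -> R)
    (pi0 : probability (T * T)%type R) :
  has_density nu P f ->
  let t := 2^-1 * \int[P]_x `|f x - 1| in
  0 < t ->
  has_density nup P (fun x => Num.max (f x - 1) 0 / t) ->
  has_density num P (fun x => Num.max (1 - f x) 0 / t) ->
  couplings nup num pi0 ->
  t <= 1 /\ exists pi : probability (T * T)%type R, couplings nu P pi /\
    forall F : T * T -> \bar R, measurable_fun setT F -> (forall z, 0 <= F z)%E ->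
      (forall x, F (x, x) = 0%E) -> (\int[pi]_z F z = t%:E * \int[pi0]_z F z)%E.
Proof.
move=> nuf t tp nupf numf pi0E; have [mf f0 nuE] := nuf.
have fi := has_density_L1 nuf; have f1 := has_density_integral1 nuf.
have mg : measurable_fun setT (fun x => Num.min (f x) 1) by exact: measurable_minr.
have g0 x : 0 <= Num.min (f x) 1 by rewrite le_min f0 ler01.
have gi : L1 P (fun x => Num.min (f x) 1).
  by apply: (L1_bounded P1 (M := 1)) => // x; rewrite ger0_norm// ge_min lexx orbT.
have ai : L1 P (fun x => `|f x - 1|) by apply/L1_norm/L1B => //; exact: L1_cst.
have g1 : \int[P]_x Num.min (f x) 1 = 1 - t.
  have -> : (fun x => Num.min (f x) 1) = fun x => 2^-1 * (f x + 1 - `|f x - 1|).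
    apply/funext => x; rewrite /Num.min; case: ltP => fx.
      by rewrite ltr0_norm; lra.
    by rewrite ger0_norm; lra.
  rewrite RintZ; last by apply: L1B => //; apply: L1D => //; exact: L1_cst.
  rewrite RintB//; last by apply: L1D => //; exact: L1_cst.
  by rewrite RintD//; [rewrite f1 Rint_cst// /t; lra|exact: L1_cst].
have t1 : t <= 1 by rewrite -subr_ge0 -g1 Rint_ge0.
split=> //.
have Ef1 : (\int[P]_x (Num.min (f x) 1)%:E = (1 - t)%:E)%E by rewrite -g1 EFin_Rintegral.
have [rho rhoE] : exists rho : probability T R, forall F : T -> \bar R,
    measurable_fun setT F -> (forall x, 0 <= F x)%E ->
    ((1 - t)%:E * \int[rho]_x F x = \int[P]_x (F x * (Num.min (f x) 1)%:E))%E.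
  (* For [t = 1] there is no common mass to normalise, and [rho] has weight 0 in the mixture. *)
  have [t1E|tn1] := eqVneq t 1.
    exists P => F mF F0; rewrite t1E subrr mul0e; apply/esym.
    have h0 : ae_eq P setT (EFin \o (fun x => Num.min (f x) 1)) (cst 0%E).
      apply/ae_eq_integral_abs => //; first exact/measurable_EFinP.
      under eq_integral do rewrite /= ger0_norm//.
      by rewrite Ef1 t1E subrr.
    rewrite (ge0_ae_eq_integral (g := cst 0%E)) ?integral0//.
    - by apply: emeasurable_funM => //; exact/measurable_EFinP.
    - by move=> x _; rewrite mule_ge0// lee_fin.
    - by apply: filterS h0 => x /= h _; rewrite h// mule0.
  have s0 : 0 < 1 - t by rewrite subr_gt0 lt_neqAle tn1.
  have [|||rho rhod] := @exists_density _ _ _ P (fun x => (1 - t)^-1 * Num.min (f x) 1).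
  - exact: measurable_funM.
  - by move=> x; rewrite mulr_ge0// invr_ge0 ltW.
  - rewrite -EFin_Rintegral; last exact: L1Z.
    by rewrite RintZ// g1 mulVf// gt_eqF.
  exists rho => F mF F0; rewrite (ge0_integral_density rhod)//.
  rewrite -ge0_integralZl//.
  - apply: eq_integral => x _; rewrite muleCA -EFinM mulrA divff ?mul1r ?gt_eqF//.
  - apply: emeasurable_funM => //; apply/measurable_EFinP; exact: measurable_funM.
  - by move=> x _; rewrite mule_ge0// lee_fin mulr_ge0// invr_ge0 ltW.
  - by rewrite lee_fin ltW.
have mdiag : measurable_fun setT (fun x : T => (x, x)) by exact: measurable_fun_pair.
have [D [_ DE]] := exists_pushforward rho mdiag.
have t01 : 0 <= t <= 1 by rewrite (ltW tp).
have [pi [piA piE]] := exists_mixture D pi0 t01.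
exists pi; split=> [A mA|F mF F0 Fd].
  have mind (B : set (T * T)) : measurable B -> measurable_fun setT (EFin \o \1_B : T * T -> \bar R).
    by move=> mB; apply/measurable_EFinP.
  have key (B : set (T * T)) : measurable B -> (forall x, B (x, x) <-> A x) ->
      pi B = (\int[P]_(x in A) (Num.min (f x) 1)%:E + t%:E * pi0 B)%E.
    move=> mB BA; rewrite piA//; congr (_ + _)%E.
    rewrite -integral_indicT// (DE (EFin \o \1_B)); last 2 first.
      exact: mind.
      by move=> y; rewrite lee_fin.
    rewrite (rhoE (fun x => (\1_B (x, x))%:E)).
    - rewrite [RHS]integral_mkcond; apply: eq_integral => x _.
      rewrite patchE indicE muleC; case: ifPn => [|] xA.
        by rewrite mem_set ?mule1//; apply/BA; rewrite inE in xA.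
      rewrite memNset ?mule0// => /BA; rewrite notin_setE in xA; exact: xA.
    - exact: (measurableT_comp (mind _ mB) mdiag).
    - by move=> x; rewrite lee_fin.
  have [E1 E2] := pi0E _ mA.
  have part (h : T -> R) : measurable_fun setT h -> (forall x, 0 <= h x) ->
      (t%:E * \int[P]_(x in A) (h x / t)%:E = \int[P]_(x in A) (h x)%:E)%E.
    move=> mh h0; rewrite -ge0_integralZl//.
    - by apply: eq_integral => x _; rewrite -EFinM mulrCA divff ?mulr1// gt_eqF.
    - by apply/measurable_EFinP/measurable_funTS; apply: measurable_funM.
    - by move=> x _; rewrite lee_fin divr_ge0// ltW.
    - by rewrite lee_fin ltW.
  have [mup up0 upE] := nupf; have [mum um0 umE] := numf.
  have mp : measurable_fun setT (fun x => Num.max (f x - 1) 0).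
    by apply: measurable_maxr => //; exact: measurable_funB.
  have mm : measurable_fun setT (fun x => Num.max (1 - f x) 0).
    by apply: measurable_maxr => //; exact: measurable_funB.
  have p0 x : 0 <= Num.max (f x - 1) 0 by rewrite le_max lexx orbT.
  have m0 x : 0 <= Num.max (1 - f x) 0 by rewrite le_max lexx orbT.
  split.
    rewrite key; last 2 first.
      exact: measurableX.
      by move=> x; split=> [[]|].
    rewrite E1 upE// part// nuE// -ge0_integralD//.
    - apply: eq_integral => x _; rewrite -EFinD; congr EFin.
      by rewrite /Num.min /Num.max; case: ltP => ?; case: ltP => ?; lra.
    - by move=> x _; rewrite lee_fin.
    - by apply/measurable_EFinP/measurable_funTS.
    - by move=> x _; rewrite lee_fin.
    - by apply/measurable_EFinP/measurable_funTS.
  rewrite key; last 2 first.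
    exact: measurableX.
    by move=> x; split=> [[]|].
  rewrite E2 umE// part// -[RHS]integral1// -ge0_integralD//.
  - apply: eq_integral => x _; rewrite -EFinD; congr EFin.
    by rewrite /Num.min /Num.max; case: ltP => ?; case: ltP => ?; lra.
  - by move=> x _; rewrite lee_fin.
  - by apply/measurable_EFinP/measurable_funTS.
  - by move=> x _; rewrite lee_fin.
  - by apply/measurable_EFinP/measurable_funTS.
rewrite piE// DE// (eq_integral (fun=> 0%E)); last by move=> x _; exact: Fd.
by rewrite integral0 mule0 add0e.
Qed.

End total_variation.

Lemma ge0_integral_prod_map d1 d2 e1 e2 (T1 : measurableType d1) (T2 : measurableType d2)
    (S1 : measurableType e1) (S2 : measurableType e2) (R : realType)
    (P1 : probability T1 R) (P2 : probability T2 R) (Q1 : probability S1 R)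
    (Q2 : probability S2 R) (g1 : T1 -> S1) (g2 : T2 -> S2) (F : S1 * S2 -> \bar R) :
  measurable_fun setT g1 -> measurable_fun setT g2 ->
  (forall H : S1 -> \bar R, measurable_fun setT H -> (forall x, 0 <= H x)%E ->
    (\int[Q1]_x H x = \int[P1]_x H (g1 x))%E) ->
  (forall H : S2 -> \bar R, measurable_fun setT H -> (forall x, 0 <= H x)%E ->
    (\int[Q2]_x H x = \int[P2]_x H (g2 x))%E) ->
  measurable_fun setT F -> (forall z, 0 <= F z)%E ->
  (\int[Q1 \x Q2]_z F z = \int[P1 \x P2]_z F (g1 z.1, g2 z.2))%E.
Proof.
move=> mg1 mg2 E1 E2 mF F0.
have mg : measurable_fun setT (fun z : T1 * T2 => (g1 z.1, g2 z.2)).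
  apply/measurable_fun_pairP; split.
    exact: (measurableT_comp mg1 measurable_fst).
  exact: (measurableT_comp mg2 measurable_snd).
rewrite fubini_tonelli1// fubini_tonelli1//; last exact: (measurableT_comp mF mg).
rewrite E1; last 2 first.
- exact: measurable_fun_fubini_tonelli_F.
- by move=> x; apply: integral_ge0.
apply: eq_integral => x _; rewrite /fubini_F/= (E2 (fun y => F (g1 x, y)))//.
by apply: (measurableT_comp mF (g := fun y => (g1 x, y))); exact: measurable_pair1.
Qed.

(** * Quadratic forms evaluated through couplings *)

Section quadratic_form.
Context d (T : measurableType d) (R : realType).
Implicit Types (U : T -> T -> R).

(* [< U, (nu - nu') (x) (nu - nu') >] *)
Definition form U (nu nu' : probability T R) : R :=
  pairing U nu nu - pairing U nu nu' - pairing U nu' nu + pairing U nu' nu'.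

Variables (U : T -> T -> R) (nu nu' : probability T R) (pi : probability (T * T)%type R).
Hypothesis piE : couplings nu nu' pi.

Lemma coupling_fst (F : T -> \bar R) : measurable_fun setT F -> (forall x, 0 <= F x)%E ->
  (\int[nu]_x F x = \int[pi]_z F z.1)%E.
Proof. by move=> mF F0; rewrite (@ge0_integral_fst _ _ _ _ _ pi nu)// => A /piE[]. Qed.

Lemma coupling_snd (F : T -> \bar R) : measurable_fun setT F -> (forall x, 0 <= F x)%E ->
  (\int[nu']_x F x = \int[pi]_z F z.2)%E.
Proof. by move=> mF F0; rewrite (@ge0_integral_snd _ _ _ _ _ pi nu')// => A /piE[]. Qed.

Hypothesis mU : measurable_kernel U.
Hypothesis Ui : forall a b : probability T R, a = nu \/ a = nu' -> b = nu \/ b = nu' ->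
  L1 (a \x b)%E (fun z => U z.1 z.2).

(** Take two independent copies of the coupling: all four pairings become integrals against
    [pi \x pi], and their combination is a second difference. *)
Lemma form_coupling :
  L1 (pi \x pi)%E (fun q => D2 U q.1.1 q.1.2 q.2.1 q.2.2) /\
  form U nu nu' = \int[(pi \x pi)%E]_q D2 U q.1.1 q.1.2 q.2.1 q.2.2.
Proof.
have mU' : measurable_fun setT (fun z => U z.1 z.2) := mU.
have one (a b : probability T R) (g1 g2 : T * T -> T) : a = nu \/ a = nu' -> b = nu \/ b = nu' ->
    measurable_fun setT g1 -> measurable_fun setT g2 ->
    (forall H : T -> \bar R, measurable_fun setT H -> (forall x, 0 <= H x)%E ->
      (\int[a]_x H x = \int[pi]_x H (g1 x))%E) ->
    (forall H : T -> \bar R, measurable_fun setT H -> (forall x, 0 <= H x)%E ->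
      (\int[b]_x H x = \int[pi]_x H (g2 x))%E) ->
    L1 (pi \x pi)%E (fun q => U (g1 q.1) (g2 q.2)) /\
    pairing U a b = \int[(pi \x pi)%E]_q U (g1 q.1) (g2 q.2).
  move=> ha hb mg1 mg2 ga gb.
  have mg : measurable_fun setT (fun q : (T * T) * (T * T) => (g1 q.1, g2 q.2)).
    apply/measurable_fun_pairP; split.
      exact: (measurableT_comp mg1 measurable_fst).
    exact: (measurableT_comp mg2 measurable_snd).
  have [h1 h2] := transfer_Rintegral mg (fun F mF F0 =>
    ge0_integral_prod_map mg1 mg2 ga gb mF F0) mU'.
  by split; [exact/h1/Ui|exact: h2].
have mf := @measurable_fst _ _ T T; have ms := @measurable_snd _ _ T T.
have [i1 e1] := one nu nu _ _ (or_introl erefl) (or_introl erefl) mf mf coupling_fst coupling_fst.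
have [i2 e2] := one nu nu' _ _ (or_introl erefl) (or_intror erefl) mf ms coupling_fst coupling_snd.
have [i3 e3] := one nu' nu _ _ (or_intror erefl) (or_introl erefl) ms mf coupling_snd coupling_fst.
have [i4 e4] := one nu' nu' _ _ (or_intror erefl) (or_intror erefl) ms ms coupling_snd coupling_snd.
have i12 := L1B i1 i2; have i123 := L1B i12 i3.
by split; [exact: L1D|rewrite /form e1 e2 e3 e4 -RintB// -RintB// -RintD].
Qed.

(** A product bound on second differences factorises over the two copies of the coupling. It is used
    with [g] the indicator of distinct points, which leads to total variation, and with [g] the
    distance, which leads to transport cost. *)
Lemma form_le (g : T * T -> R) (a : R) : L1 pi g ->
  (forall x y z w, D2 U x y z w <= a * (g (x, y) * g (z, w))) ->
  form U nu nu' <= a * (\int[pi]_z g z) ^+ 2.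
Proof.
move=> gi Ug; have [Di ->] := form_coupling; have [ggi ggE] := L1_prodM gi gi.
rewrite expr2 -ggE -RintZ//; apply: le_Rint => //; first exact: L1Z.
by move=> [[x y] [z w]]; exact: Ug.
Qed.

End quadratic_form.

Section variation_parts.
Context d (T : measurableType d) (R : realType).
Variables (P nu : probability T R) (f : T -> R).
Hypothesis nuf : has_density nu P f.

Let mf : measurable_fun setT f. Proof. by case: nuf. Qed.
Let f0 x : 0 <= f x. Proof. by case: nuf. Qed.
Let P1 : P setT = 1%E := probability_setT P.
Let t : R := 2^-1 * \int[P]_x `|f x - 1|.
Let fi : L1 P (fun x => f x - 1).
Proof. by apply: L1B; [exact: has_density_L1 nuf|exact: L1_cst]. Qed.

Lemma variation_parts : 0 < t -> exists nup num : probability T R,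
  has_density nup P (fun x => Num.max (f x - 1) 0 / t) /\
  has_density num P (fun x => Num.max (1 - f x) 0 / t).
Proof.
move=> tp; have f1 := has_density_integral1 nuf.
have f10 : \int[P]_x (f x - 1) = 0.
  rewrite RintB; [by rewrite f1 Rint_cst// subrr|exact: has_density_L1 nuf|exact: L1_cst].
(* [s = 1] gives the positive part of [f - 1], [s = -1] the negative part; both have mass [t]
   because [f - 1] has mean zero. *)
have part (g : T -> R) (s : R) : measurable_fun setT g -> (forall x, 0 <= g x) ->
    (forall x, g x = 2^-1 * (`|f x - 1| + s * (f x - 1))) ->
    exists mu : probability T R, has_density mu P (fun x => g x / t).
  move=> mg g0 gE; apply: exists_density.
  - exact: measurable_funM.
  - by move=> x; rewrite divr_ge0// ltW.
  - have gi : L1 P (fun x => `|f x - 1| + s * (f x - 1)).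
      by apply: L1D; [exact: L1_norm|exact: L1Z].
    have -> : (fun x => (g x / t)%:E) = fun x => (t^-1 * (2^-1 * (`|f x - 1| + s * (f x - 1))))%:E.
      by apply/funext => x; rewrite gE mulrC.
    rewrite -EFin_Rintegral; last by do 2 apply: L1Z.
    rewrite RintZ ?RintZ//; last exact: L1Z.
    rewrite RintD//; [|exact: L1_norm|exact: L1Z].
    by rewrite RintZ// f10 mulr0 addr0 -/t mulVf// gt_eqF.
have [|||nup h1] := part (fun x => Num.max (f x - 1) 0) 1.
- by apply: measurable_maxr => //; exact: measurable_funB.
- by move=> x; rewrite le_max lexx orbT.
- move=> x; rewrite /Num.max; case: ltP => h; [rewrite ltr0_norm//|rewrite ger0_norm//]; lra.
have [|||num h2] := part (fun x => Num.max (1 - f x) 0) (-1).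
- by apply: measurable_maxr => //; exact: measurable_funB.
- by move=> x; rewrite le_max lexx orbT.
- move=> x; rewrite distrC /Num.max; case: ltP => h; [rewrite ltr0_norm//|rewrite ger0_norm//]; lra.
by exists nup, num.
Qed.

Lemma diagonal_coupling : t = 0 -> exists pi : probability (T * T)%type R, couplings nu P pi /\
  forall F : T * T -> \bar R, measurable_fun setT F -> (forall z, 0 <= F z)%E ->
    (forall x, F (x, x) = 0%E) -> (\int[pi]_z F z = 0)%E.
Proof.
move=> t0; have mdiag : measurable_fun setT (fun x : T => (x, x)) by exact: measurable_fun_pair.
have [pi [piA piE]] := exists_pushforward P mdiag.
have ae : ae_eq P setT (EFin \o (fun x => f x - 1)) (cst 0%E).
  apply/ae_eq_integral_abs => //; first by apply/measurable_EFinP; exact: L1_measurable fi.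
  rewrite -EFin_Rintegral; last exact: L1_norm.
  by congr EFin; move/eqP: t0; rewrite mulf_eq0 invr_eq0 pnatr_eq0/= => /eqP.
have nuP A : measurable A -> nu A = P A.
  move=> mA; have [_ _ ->//] := nuf; rewrite -[RHS]integral1//.
  apply: ge0_ae_eq_integral => //; first exact/measurable_EFinP/measurable_funTS.
  - by move=> x _; rewrite lee_fin.
  - apply: filterS ae => x /= h Ax; congr EFin.
    by have := h I; case=> /eqP; rewrite subr_eq0 => /eqP.
exists pi; split=> [A mA|F mF F0 Fd].
  rewrite nuP// !piA//; try exact: measurableX.
  by split; congr (P _); apply/seteqP; split=> x //= [].
by rewrite piE// (eq_integral (fun=> 0%E)) ?integral0// => x _; exact: Fd.
Qed.

(** Leave the common mass in place and couple the normalised excesses in any way, here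
    independently: only a mass [t] moves, and [g] is at most 1 on it. *)
Lemma total_variation_le (g : T * T -> R) : measurable_fun setT g ->
  (forall z, 0 <= g z <= 1) -> (forall x, g (x, x) = 0) ->
  exists pi : probability (T * T)%type R, couplings nu P pi /\ \int[pi]_z g z <= t.
Proof.
move=> mg g01 gd.
have t0 : 0 <= t by rewrite mulr_ge0 ?invr_ge0//; exact: Rint_ge0.
have mEg : measurable_fun setT (EFin \o g) by exact/measurable_EFinP.
have g0 z : (0 <= (g z)%:E)%E by rewrite lee_fin; case/andP: (g01 z).
have [t00|tn0] := eqVneq t 0.
  have [pi [piE h]] := diagonal_coupling t00; exists pi; split=> //.
  by rewrite /Rintegral (h (EFin \o g))// => x /=; rewrite gd.
have tp : 0 < t by rewrite lt_neqAle eq_sym tn0.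
have [nup [num [hp hm]]] := variation_parts tp.
have [PQ PQE] := exists_product nup num.
have cPQ : couplings nup num PQ.
  move=> A mA; rewrite !PQE; try exact: measurableX.
  split; rewrite product_measure1E//; first by rewrite -[RHS]mule1; congr (_ * _)%E; exact: probability_setT.
  by rewrite -[RHS]mul1e; congr (_ * _)%E; exact: probability_setT.
have [_ [pi [piE h]]] := total_variation_coupling nuf tp hp hm cPQ.
exists pi; split=> //.
have gi (M : probability (T * T)%type R) : L1 M g.
  apply: (L1_bounded (probability_setT M) (M := 1)) => // z.
  by rewrite ger0_norm; case/andP: (g01 z).
rewrite -lee_fin EFin_Rintegral// (h (EFin \o g))//; last by move=> x /=; rewrite gd.
rewrite -EFin_Rintegral// -EFinM lee_fin ler_piMr//.
rewrite -[leRHS](Rint_cst (probability_setT PQ)); apply: le_Rint => //; first exact: L1_cst (probability_setT PQ) _.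
by move=> z; case/andP: (g01 z).
Qed.

End variation_parts.

Lemma dominated_Rintegral d (T : measurableType d) (R : realType)
    (mu : {measure set T -> \bar R}) (f_ : nat -> T -> R) (f g : T -> R) :
  (forall n, measurable_fun setT (f_ n)) -> measurable_fun setT f ->
  (forall x, f_ n x @[n --> \oo] --> f x) -> L1 mu g ->
  (forall n x, `|f_ n x| <= g x) ->
  \int[mu]_x f_ n x @[n --> \oo] --> \int[mu]_x f x.
Proof.
move=> mf_ mf fc gi fg.
have fi : L1 mu f.
  apply: L1_le gi => // x; have h : `|f_ n x| @[n --> \oo] --> `|f x| by exact: cvg_norm (fc x).
  rewrite -(cvg_lim (@Rhausdorff R) h); apply: limr_le; first by apply/cvg_ex; exists `|f x|.
  by apply: nearW => n; exact: fg.
apply: fine_cvg; rewrite EFin_Rintegral//.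
apply: (dominated_cvg measurableT (g := EFin \o g)) => //.
- by move=> n; exact/measurable_EFinP.
- by move=> x _; apply: cvg_EFin; [exact: nearW|exact: fc].
- by move=> n x _; rewrite /= lee_fin.
Qed.

(** * Second moments and integrability of split kernels *)

Section state_moments.
Context (R : realType) (k : ambient) (d : nat).
Local Notation X := (state_space R k d).
Implicit Types nu : probability X R.

Lemma space_dist_eq0 (x y : X) : space_dist x y = 0 -> x = y.
Proof.
move/eqP; rewrite sqrtr_eq0 => h; apply: eq_from_tnth => j; apply/val_inj => /=.
have : axis_dist (tnth x j) (tnth y j) = 0.
  apply/eqP; rewrite -sqrf_eq0; apply/eqP/le_anti; rewrite sqr_ge0 andbT.
  apply: le_trans h; rewrite (bigD1 j)//= lerDl sumr_ge0// => l _; exact: sqr_ge0.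
move: (tnth x j) (tnth y j) => a b; rewrite /axis_dist.
case: k a b => -[a /= pa] [b /= pb]; last by move/eqP; rewrite normr_eq0 subr_eq0 => /eqP.
rewrite /in_cell in pa pb; rewrite /Num.min; case: ifPn => _.
  by move/eqP; rewrite normr_eq0 subr_eq0 => /eqP.
have : `|a - b| < 1 by rewrite ltr_norml; apply/andP; split; lra.
lra.
Qed.

Lemma measurable_space_norm : measurable_fun setT (@space_norm R k d).
Proof.
apply: (measurableT_comp (@measurable_space_dist R k d) (g := fun x => (x, origin))).
exact: measurable_pair2.
Qed.

Lemma P2_sqr_norm nu : P2 nu -> L1 nu (fun x => space_norm x ^+ 2).
Proof.
move=> h; apply: L1_ge0 => //; last by move=> x; exact: sqr_ge0.
by apply: measurable_funX; exact: measurable_space_norm.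
Qed.

Lemma P2_norm nu : P2 nu -> L1 nu (@space_norm R k d).
Proof.
move=> h; apply: (L1_le (g := fun x => 1 + space_norm x ^+ 2)).
- exact: measurable_space_norm.
- move=> x; rewrite ger0_norm ?space_dist_ge0//.
  by have := sqr_ge0 (space_norm x - 1); have := sqr_ge0 (space_norm x); lra.
- by apply: L1D; [exact: L1_cst (probability_setT nu) _|exact: P2_sqr_norm].
Qed.

Lemma P2_bounded_density (m nu : probability X R) (f : X -> R) (M : R) :
  P2 m -> has_density nu m f -> (forall x, f x <= M) -> P2 nu.
Proof.
move=> mP nuf fM; have [mf f0 _] := nuf; rewrite /P2 /finite_moment/=.
have mn : measurable_fun setT (fun x : X => (space_dist x origin ^+ 2)%:E).
  by apply/measurable_EFinP/measurable_funX; exact: measurable_space_norm.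
have n0 (x : X) : (0 <= (space_dist x origin ^+ 2)%:E)%E by rewrite lee_fin sqr_ge0.
rewrite (ge0_integral_density nuf)//.
have M0 : 0 <= M by exact: le_trans (f0 origin) (fM _).
apply: (@le_lt_trans _ _ (\int[m]_x (M%:E * (space_dist x origin ^+ 2)%:E))%E).
  apply: ge0_le_integral => //.
  - by move=> x _; rewrite mule_ge0// lee_fin.
  - by apply: emeasurable_funM => //; exact/measurable_EFinP.
  - by apply: emeasurable_funM => //.
  - by move=> x _; rewrite -!EFinM lee_fin mulrC ler_wpM2r// sqr_ge0.
by rewrite ge0_integralZl ?lee_fin// lte_mul_pinfty ?lee_fin.
Qed.

Lemma sqr_Rintegral_le d' (S : measurableType d') (P : probability S R) (g : S -> R) :
  measurable_fun setT g -> L1 P (fun x => g x ^+ 2) ->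
  L1 P g /\ (\int[P]_x g x) ^+ 2 <= \int[P]_x (g x ^+ 2).
Proof.
move=> mg g2i; have P1 := probability_setT P.
have gi : L1 P g.
  apply: (L1_le (g := fun x => 1 + g x ^+ 2)) => //.
    move=> x; have := sqr_ge0 (`|g x| - 1); have := sqr_ge0 (g x).
    by rewrite -(real_normK (num_real (g x))); lra.
  by apply: L1D => //; exact: L1_cst.
split=> //; set a := \int[P]_x g x.
have i1 : L1 P (fun x => 2 * a * g x) by exact: L1Z.
have i2 : L1 P (fun x => g x ^+ 2 - 2 * a * g x) by exact: L1B.
have : 0 <= \int[P]_x (g x ^+ 2 - 2 * a * g x + a ^+ 2).
  apply: Rint_ge0 => x; rewrite (_ : _ + _ = (g x - a) ^+ 2) ?sqr_ge0//; ring.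
rewrite RintD//; last exact: L1_cst.
rewrite Rint_cst// RintB// RintZ// -/a; lra.
Qed.

Lemma coupling_dist nu nu' (pi : probability (X * X)%type R) : couplings nu nu' pi ->
  (\int[pi]_z (space_dist z.1 z.2 ^+ 2)%:E < +oo)%E ->
  [/\ L1 pi (fun z => space_dist z.1 z.2 ^+ 2), L1 pi (fun z => space_dist z.1 z.2) &
      (\int[pi]_z space_dist z.1 z.2) ^+ 2 <= \int[pi]_z (space_dist z.1 z.2 ^+ 2)].
Proof.
move=> _ h; have md := @measurable_space_dist R k d.
have i2 : L1 pi (fun z => space_dist z.1 z.2 ^+ 2).
  by apply: L1_ge0 => //; [exact: measurable_funX|move=> z; exact: sqr_ge0].
by have [i1 le] := sqr_Rintegral_le md i2.
Qed.

Section kernel_integrability.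
Variables (K B Q : X -> X -> R) (c l : R).
Hypothesis sK : split_kernel K B Q c l.

Lemma split_integrable nu nu' : P2 nu -> P2 nu' ->
  [/\ L1 (nu \x nu')%E (fun z => K z.1 z.2), L1 (nu \x nu')%E (fun z => B z.1 z.2) &
      L1 (nu \x nu')%E (fun z => Q z.1 z.2)].
Proof.
move=> nuP nuP'; have [[_ KE] [mB mQ] [_ Bc] [_ Ql]] := sK.
have nn1 : (nu \x nu')%E setT = 1%E.
  rewrite -setXTT product_measure1E// -[RHS]mule1.
  by congr (_ * _)%E; exact: probability_setT.
have Bi : L1 (nu \x nu')%E (fun z => B z.1 z.2) by apply: (L1_bounded nn1 mB (M := c)) => z.
have Qi : L1 (nu \x nu')%E (fun z => Q z.1 z.2).
  have [i _] := L1_prodM (P2_norm nuP) (P2_norm nuP').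
  by apply: (L1_le mQ _ (L1Z l i)) => z; rewrite mulrA.
split=> //; rewrite (_ : (fun z => _) = fun z => B z.1 z.2 + Q z.1 z.2); first exact: L1D.
by apply/funext => z; exact: KE.
Qed.

Lemma split_measurable : measurable_kernel K.
Proof.
have [[_ KE] [mB mQ] _ _] := sK; rewrite /measurable_kernel.
rewrite (_ : (fun z => _) = fun z => B z.1 z.2 + Q z.1 z.2); first exact: measurable_funD.
by apply/funext => z; exact: KE.
Qed.

Lemma split_diagonal nu : P2 nu -> L1 nu (fun x => K x x).
Proof.
move=> nuP; have [[_ KE] _ [_ Bc] [_ Ql]] := sK.
apply: (L1_le (g := fun x => c + l * space_norm x ^+ 2)).
- apply: (measurableT_comp split_measurable (g := fun x => (x, x))).
  exact: measurable_fun_pair.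
- by move=> x; rewrite KE (le_trans (ler_normD _ _))// lerD// (le_trans (Ql _ _))// expr2 mulrA.
- apply: L1D; first exact: L1_cst (probability_setT nu) _.
  by apply: L1Z; exact: P2_sqr_norm.
Qed.

Lemma split_section nu x : P2 nu -> L1 nu (K x).
Proof.
move=> nuP; have [[_ KE] _ [_ Bc] [_ Ql]] := sK.
apply: (L1_le (g := fun y => c + l * space_norm x * space_norm y)).
- by apply: (measurableT_comp split_measurable (g := fun y => (x, y))); exact: measurable_pair1.
- by move=> y; rewrite KE (le_trans (ler_normD _ _))// lerD.
- apply: L1D; first exact: L1_cst (probability_setT nu) _.
  by apply: L1Z; exact: P2_norm.
Qed.

Lemma split_D2 x y z w : D2 K x y z w = D2 B x y z w + D2 Q x y z w.
Proof. by have [[_ KE] _ _ _] := sK; rewrite /D2 !KE; ring. Qed.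

Lemma split_form nu nu' : P2 nu -> P2 nu' -> form K nu nu' = form B nu nu' + form Q nu nu'.
Proof.
move=> nuP nuP'; have [[_ KE] _ _ _] := sK.
have one (a b : probability X R) : P2 a -> P2 b -> pairing K a b = pairing B a b + pairing Q a b.
  move=> aP bP; have [_ Bi Qi] := split_integrable aP bP.
  by rewrite /pairing -RintD//; apply: eq_Rintegral => z _; exact: KE.
rewrite /form (one _ _ nuP nuP) (one _ _ nuP nuP') (one _ _ nuP' nuP) (one _ _ nuP' nuP').
by do 8 move: (pairing _ _ _) => ?; lra.
Qed.

End kernel_integrability.
End state_moments.

(** * Consequences of Talagrand's inequality for one particle *)

Section transport_entropy.
Context (R : realType) (k : ambient) (d : nat).
Local Notation X := (state_space R k d).
Variables (m : probability X R) (rho : R).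
Hypothesis rho0 : 0 < rho.
Hypothesis T2 : talagrand space_dist origin rho m.
Hypothesis mP : P2 m.

Section density.
Variables (nu : probability X R) (f : X -> R).
Hypothesis nuP : P2 nu.
Hypothesis nuf : has_density nu m f.
Hypothesis phif : L1 m (fun x => phi (f x)).
Let H : R := \int[m]_x phi (f x).

Let f0 x : 0 <= f x. Proof. by case: nuf. Qed.
Let H0 : 0 <= H. Proof. by apply: Rint_ge0 => x; exact: phi_ge0. Qed.

(** A coupling whose cost is within [e] of the infimum stands in for an optimal one. *)
Lemma talagrand_coupling (e : R) : 0 < e -> exists pi : probability (X * X)%type R,
  [/\ couplings nu m pi, L1 pi (fun z => space_dist z.1 z.2 ^+ 2),
      L1 pi (fun z => space_dist z.1 z.2) &
      \int[pi]_z (space_dist z.1 z.2 ^+ 2) <= 2 / rho * H + e].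
Proof.
move=> e0; have := T2 nuP; rewrite (relative_entropyE nuf (probability_setT m)).
rewrite -EFin_Rintegral// -/H /wasserstein; set S := [set _ | _ in _] => h.
have S0 : (0 <= ereal_inf S)%E.
  by apply: le_ereal_inf_tmp => _ [pi _ <-]; apply: integral_ge0 => z _; rewrite lee_fin sqr_ge0.
rewrite poweR12_sqrt// sqr_sqrte// in h.
have Slt : (ereal_inf S < (2 / rho * H + e)%:E)%E.
  rewrite ltNge; apply/negP => hS.
  have : ((rho / 2)%:E * (2 / rho * H + e)%:E <= H%:E)%E.
    by apply: le_trans h; rewrite lee_pmul2l ?lte_fin ?divr_gt0.
  rewrite -EFinM lee_fin (_ : rho / 2 * _ = H + rho / 2 * e); last by field; rewrite gt_eqF.
  by rewrite leNgt ltrDl mulr_gt0// divr_gt0.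
have [_ [pi piE <-] lt] := ereal_inf_lt Slt.
have [i2 i1 _] := coupling_dist piE (lt_trans lt (ltry _)).
by exists pi; split=> //; rewrite -lee_fin EFin_Rintegral// ltW.
Qed.

Let Pairs a b : a = nu \/ a = m -> b = nu \/ b = m -> P2 a /\ P2 b.
Proof. by move=> [->|->] [->|->]. Qed.

Section kernel.
Variables (K B Q : X -> X -> R) (c l : R).
Hypothesis sK : split_kernel K B Q c l.
Hypotheses (c0 : 0 <= c) (l0 : 0 <= l).

Let D2_bounded_indicator x y z w :
  D2 B x y z w <= c * ((space_dist x y != 0)%:R * (space_dist z w != 0)%:R).
Proof.
have [_ _ [Bc _] _] := sK.
have [xy|_] := eqVneq (space_dist x y) 0.
  by rewrite (space_dist_eq0 xy) mul0r mulr0 /D2; lra.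
have [zw|_] := eqVneq (space_dist z w) 0; last by rewrite !mulr1.
by rewrite (space_dist_eq0 zw) !mulr0 /D2; lra.
Qed.

(** [form_le] for the indicator of distinct points gives [c * t^2], with [t] the total variation
    distance, and [2 t^2 <= H] by Pinsker. *)
Lemma form_bounded_le : form B nu m <= c / 2 * H.
Proof.
pose g (z : X * X) : R := (space_dist z.1 z.2 != 0)%:R.
have mg : measurable_fun setT g.
  rewrite (_ : g = \1_((fun z => space_dist z.1 z.2) @^-1` (~` [set 0 : R]))).
    apply: measurable_indic; rewrite -[X in measurable X]setTI.
    by apply: measurable_space_dist => //; exact: measurableC.
  apply/funext => z; rewrite indicE /g; case: eqP => h; last by rewrite mem_set.
  by rewrite memNset//= => /(_ h).
have g01 z : 0 <= g z <= 1 by rewrite /g; case: eqP => _ /=; rewrite lexx ler01.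
have gd x : g (x, x) = 0 by rewrite /g /= space_dist0 eqxx.
have [pi [piE le]] := total_variation_le nuf mg g01 gd.
have gi : L1 pi g.
  apply: (L1_bounded (probability_setT pi) mg (M := 1)) => z.
  by rewrite ger0_norm; case/andP: (g01 z).
have Bi a b : a = nu \/ a = m -> b = nu \/ b = m -> L1 (a \x b)%E (fun z => B z.1 z.2).
  by move=> ha hb; have [aP bP] := Pairs ha hb; have [] := split_integrable sK aP bP.
have [_ [mB _] _ _] := sK.
apply: le_trans (form_le piE mB Bi gi D2_bounded_indicator) _.
rewrite -mulrA ler_wpM2l//; have := pinsker f0 (has_density_L1 nuf) (has_density_integral1 nuf) phif.
rewrite -/H => h.
have g0 : 0 <= \int[pi]_z g z by apply: Rint_ge0 => z; case/andP: (g01 z).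
have : (\int[pi]_z g z) ^+ 2 <= (2^-1 * \int[m]_x `|f x - 1|) ^+ 2.
  by rewrite ler_sqr ?nnegrE// (le_trans g0 le).
lra.
Qed.

Lemma form_lipschitz_le : form Q nu m <= 2 * l / rho * H.
Proof.
(* The denominator [l + 1] ensures [l * e' <= e] also for [l = 0]. *)
apply/ler_addgt0Pr => e e0; pose e' := e / (l + 1).
have e'0 : 0 < e' by rewrite divr_gt0// ltr_wpDl.
have [pi [piE i2 i1 le]] := talagrand_coupling e'0.
have Qi a b : a = nu \/ a = m -> b = nu \/ b = m -> L1 (a \x b)%E (fun z => Q z.1 z.2).
  by move=> ha hb; have [aP bP] := Pairs ha hb; have [] := split_integrable sK aP bP.
have [_ [_ mQ] _ [Ql _]] := sK.
have [|_ sq] := @sqr_Rintegral_le _ _ _ pi (fun z => space_dist z.1 z.2) _ i2.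
  exact: measurable_space_dist.
have := form_le piE mQ Qi i1 (a := l).
move=> /(_ _)/le_trans; apply; first by move=> x y z w; rewrite mulrA.
apply: le_trans (ler_wpM2l l0 (le_trans sq le)) _.
rewrite mulrDr (_ : l * (2 / rho * H) = 2 * l / rho * H); last by ring.
rewrite lerD2l /e' mulrA ler_pdivrMr ?ltr_wpDl//; nra.
Qed.

Lemma form_split_le : form K nu m <= (c / 2 + 2 * l / rho) * H.
Proof.
by rewrite (split_form sK nuP mP) mulrDl lerD ?form_bounded_le ?form_lipschitz_le.
Qed.

End kernel.
End density.

(** Test Talagrand's inequality on the density [1 + t h], where [h] is [g] minus its mean: the mean
    of [g] moves by [t v], with [v] the variance, while the entropy is at most [t^2 v] because
    [phi x <= (x - 1)^2]. Hence [(t v)^2 <= 2 / rho * t^2 v]. This holds at a fixed [t], without a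
    linearising limit, at the cost of a factor 2 in the constant. *)
Lemma variance_lipschitz (g : X -> R) (M : R) : measurable_fun setT g ->
  (forall x, `|g x| <= M) -> (forall x y, `|g x - g y| <= space_dist x y) ->
  \int[m]_x (g x ^+ 2) - (\int[m]_x g x) ^+ 2 <= 2 / rho.
Proof.
move=> mg gM gL; have m1 := probability_setT m.
have M0 : 0 <= M by exact: le_trans (normr_ge0 _) (gM origin).
have gi : L1 m g by exact: (L1_bounded m1 mg gM).
set a := \int[m]_x g x.
have aM : `|a| <= M.
  rewrite ler_norml; apply/andP; split.
    rewrite -(Rint_cst m1 (- M)); apply: le_Rint => //; first exact: L1_cst.
    by move=> x; have := gM x; rewrite ler_norml => /andP[].
  rewrite -(Rint_cst m1 M); apply: le_Rint => //; first exact: L1_cst.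
  by move=> x; have := gM x; rewrite ler_norml => /andP[].
pose h x := g x - a; pose t : R := (2 * M + 1)^-1.
have t0 : 0 < t by rewrite invr_gt0; lra.
have mh : measurable_fun setT h by exact: measurable_funB.
have hM x : `|h x| <= 2 * M.
  by apply: le_trans (ler_normB _ _) _; have := gM x; lra.
have th x : `|t * h x| <= 1.
  rewrite normrM gtr0_norm// mulrC ler_pdivrMr ?mul1r; last lra.
  by have := hM x; lra.
have hi : L1 m h by exact: (L1_bounded m1 mh hM).
have mh2 : measurable_fun setT (fun x => h x ^+ 2) by exact: measurable_funX.
have h2i : L1 m (fun x => h x ^+ 2).
  apply: (L1_bounded m1 mh2 (M := (2 * M) ^+ 2)) => x.
  by rewrite normrX ler_sqr ?nnegrE ?mulr_ge0.
have h0 : \int[m]_x h x = 0 by rewrite RintB// ?Rint_cst// ?subrr//; exact: L1_cst.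
set v := \int[m]_x (h x ^+ 2).
have vE : \int[m]_x (g x ^+ 2) - a ^+ 2 = v.
  have -> : v = \int[m]_x (g x ^+ 2 - 2 * a * h x - a ^+ 2).
    by apply: eq_Rintegral => x _; rewrite /h; ring.
  have g2i : L1 m (fun x => g x ^+ 2).
    apply: (L1_bounded m1 (M := M ^+ 2)); first exact: measurable_funX.
    by move=> x; rewrite normrX ler_sqr ?nnegrE.
  have i1 : L1 m (fun x => 2 * a * h x) by exact: L1Z.
  rewrite RintB//; [|exact: L1B|exact: L1_cst].
  by rewrite RintB// RintZ// h0 mulr0 subr0 Rint_cst.
rewrite vE; have v0 : 0 <= v by apply: Rint_ge0 => x; exact: sqr_ge0.
pose f x := 1 + t * h x.
have f0 x : 0 <= f x by have := th x; rewrite ler_norml /f => /andP[? _]; lra.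
have mf : measurable_fun setT f by apply: measurable_funD => //; exact: measurable_funM.
have f1 : (\int[m]_x (f x)%:E = 1)%E.
  have thi : L1 m (fun x => t * h x) by exact: L1Z.
  rewrite -EFin_Rintegral; last by apply: L1D => //; exact: L1_cst.
  by rewrite RintD//; [rewrite Rint_cst// RintZ// h0 mulr0 addr0|exact: L1_cst].
have [nu nuf] := exists_density mf f0 f1.
have nuP : P2 nu.
  apply: (P2_bounded_density mP nuf (M := 2)) => x.
  by have := th x; rewrite ler_norml /f => /andP[_ ?]; lra.
have phm : measurable_fun setT (fun x => phi (f x)) by exact: measurable_fun_phi.
have ph x : phi (f x) <= t ^+ 2 * h x ^+ 2.
  by apply: le_trans (phi_le_sqr (f0 x)) _; rewrite /f -exprMn le_eqVlt; apply/orP; left; apply/eqP; ring.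
have phi_i : L1 m (fun x => phi (f x)).
  apply: (L1_le phm _ (L1Z (t ^+ 2) h2i)) => x.
  by rewrite ger0_norm ?ph// phi_ge0.
have Hv : \int[m]_x phi (f x) <= t ^+ 2 * v.
  by rewrite -RintZ//; apply: le_Rint => //; exact: L1Z.
(* [t v] is the difference of the means of [g] under [nu] and [m], hence at most the mean
   displacement of any coupling. *)
have tv : (t * v) ^+ 2 <= 2 / rho * (t ^+ 2 * v).
  apply/ler_addgt0Pr => e e0.
  have [pi [piE i2 i1 le]] := talagrand_coupling nuP nuf phi_i e0.
  have [|_ sq] := @sqr_Rintegral_le _ _ _ pi (fun z => space_dist z.1 z.2) _ i2.
    exact: measurable_space_dist.
  have [_ e1] := transfer_Rintegral measurable_fst (coupling_fst piE) mg.
  have [_ e2] := transfer_Rintegral measurable_snd (coupling_snd piE) mg.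
  have gpi : L1 pi (fun z => g z.1) /\ L1 pi (fun z => g z.2).
    split; apply: (L1_bounded (probability_setT pi) (M := M)) => //.
      exact: (measurableT_comp mg measurable_fst).
    exact: (measurableT_comp mg measurable_snd).
  case: gpi => gp1 gp2.
  have E : t * v = \int[pi]_z (g z.1 - g z.2).
    rewrite RintB// -e1 -e2 (Rintegral_density nuf)// -/a.
    have -> : \int[m]_x (g x * f x) = \int[m]_x (g x + (t * h x ^+ 2 + t * a * h x)).
      by apply: eq_Rintegral => x _; rewrite /f /h; ring.
    have j1 : L1 m (fun x => t * h x ^+ 2) by exact: L1Z.
    have j2 : L1 m (fun x => t * a * h x) by exact: L1Z.
    rewrite RintD//; last exact: L1D.
    rewrite RintD// RintZ// RintZ// h0 -/v -/a; ring.
  have le1 : t * v <= \int[pi]_z space_dist z.1 z.2.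
    rewrite E; apply: le_Rint => //; first exact: L1B.
    by move=> z; exact: le_trans (ler_norm _) (gL _ _).
  apply: (@le_trans _ _ ((\int[pi]_z space_dist z.1 z.2) ^+ 2)).
    rewrite ler_sqr ?nnegrE//; first by rewrite mulr_ge0// ltW.
    by apply: Rint_ge0 => z; exact: space_dist_ge0.
  apply: le_trans sq (le_trans le _); rewrite lerD2r ler_wpM2l//.
  by rewrite divr_ge0// ltW.
have [->|vn] := eqVneq v 0; first by rewrite divr_ge0// ltW.
have vp : 0 < v by rewrite lt_neqAle eq_sym vn.
move: tv; rewrite exprMn (_ : _ * (t ^+ 2 * v) = t ^+ 2 * v * (2 / rho)); last by ring.
by rewrite expr2 -mulrA expr2 mulrA -expr2 mulrA ler_pM2l// mulr_gt0// exprn_gt0.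
Qed.

End transport_entropy.

(** * Variances of coordinates and second moments on Euclidean space *)

Section coordinate_variance.
Context (R : realType) (d : nat).
Local Notation X := (state_space R Euclid d).
Variables (m : probability X R) (rho : R).
Hypothesis rho0 : 0 < rho.
Hypothesis T2 : talagrand space_dist origin rho m.
Hypothesis mP : P2 m.

Let crd_norm j (x : X) : `|crd j x| <= space_norm x.
Proof.
rewrite /space_norm space_distE -sqrtr_sqr ler_sqrt; last by apply: sumr_ge0 => i _; exact: sqr_ge0.
have c0 i : crd i (@origin R Euclid d) = 0 by rewrite /crd tnth_mktuple.
under eq_bigr do rewrite c0 subr0.
by rewrite (bigD1 j)//= lerDl sumr_ge0// => l _; exact: sqr_ge0.
Qed.

Lemma crd_dist j (x y : X) : `|crd j x - crd j y| <= space_dist x y.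
Proof.
rewrite space_distE -sqrtr_sqr ler_sqrt; last by apply: sumr_ge0 => i _; exact: sqr_ge0.
by rewrite (bigD1 j)//= lerDl sumr_ge0// => l _; exact: sqr_ge0.
Qed.

Lemma P2_crd (nu : probability X R) j : P2 nu ->
  L1 nu (crd j) /\ L1 nu (fun x => crd j x ^+ 2).
Proof.
move=> nuP; split.
  by apply: L1_le (P2_norm nuP) => //; exact: measurable_crd.
apply: L1_le (P2_sqr_norm nuP) => [|x]; first by apply: measurable_funX; exact: measurable_crd.
by rewrite normrX ler_sqr ?nnegrE// ?space_dist_ge0.
Qed.

Let clip (n : nat) (r : R) : R := Num.max (- n%:R) (Num.min n%:R r).

Let clip_bounded n r : `|clip n r| <= n%:R.
Proof.
have n0 : 0 <= n%:R :> R by [].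
rewrite /clip /Num.max /Num.min ler_norml.
by case: (ltP n%:R r) => h1; case: ltP => h2; apply/andP; split; lra.
Qed.

Let clip_le n r : `|clip n r| <= `|r|.
Proof.
have n0 : 0 <= n%:R :> R by [].
rewrite /clip /Num.max /Num.min ler_norml; have := ler_norm r; have := ler_norm (- r); rewrite normrN.
by case: (ltP n%:R r) => h1; case: ltP => h2; move=> ? ?; apply/andP; split; lra.
Qed.

Let clip_lip n r s : `|clip n r - clip n s| <= `|r - s|.
Proof.
have maxl (a b c : R) : `|Num.max a b - Num.max a c| <= `|b - c|.
  rewrite ler_norml; have := ler_norm (b - c); have := ler_norm (- (b - c)); rewrite normrN.
  by rewrite /Num.max; case: (ltP a b) => ?; case: (ltP a c) => ? ? ?; apply/andP; split; lra.
have minl (a b c : R) : `|Num.min a b - Num.min a c| <= `|b - c|.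
  rewrite ler_norml; have := ler_norm (b - c); have := ler_norm (- (b - c)); rewrite normrN.
  by rewrite /Num.min; case: (ltP a b) => ?; case: (ltP a c) => ? ? ?; apply/andP; split; lra.
exact: le_trans (maxl _ _ _) (minl _ _ _).
Qed.

Let clip_cvg r : clip n r @[n --> \oo] --> r.
Proof.
apply: (@cvg_near_cst _ _ _ _ _ (@eventually_filter)).
have := archi_boundP (normr_ge0 r); set n := Num.bound _ => hn.
exists n => // p /= np; have {}hn : `|r| <= p%:R.
  by rewrite (le_trans (ltW hn))// ler_nat.
move: hn; rewrite ler_norml => /andP[h1 h2].
by rewrite /clip (min_idPr _)// (max_idPr _).
Qed.

(** Coordinates are 1-Lipschitz and possibly unbounded; truncation keeps the Lipschitz constant, and
    dominated convergence removes it. *)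
Lemma variance_coordinate j :
  \int[m]_x (crd j x ^+ 2) - (\int[m]_x crd j x) ^+ 2 <= 2 / rho.
Proof.
have [i1 i2] := P2_crd j mP.
have mclip n : measurable_fun setT (fun x : X => clip n (crd j x)).
  by apply: measurable_maxr => //; apply: measurable_minr => //; exact: measurable_crd.
have c1 : \int[m]_x clip n (crd j x) @[n --> \oo] --> \int[m]_x crd j x.
  apply: (dominated_Rintegral (g := fun x => `|crd j x|)) => //; first exact: measurable_crd.
  exact: L1_norm.
have c2 : \int[m]_x (clip n (crd j x) ^+ 2) @[n --> \oo] --> \int[m]_x (crd j x ^+ 2).
  apply: (dominated_Rintegral (g := fun x => crd j x ^+ 2)) => //.
  - by move=> n; exact: measurable_funX.
  - by apply: measurable_funX; exact: measurable_crd.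
  - by move=> x; rewrite expr2; apply: cvgM.
  - by move=> n x; rewrite normrX -[leRHS]real_normK ?num_real// ler_sqr ?nnegrE.
have c : \int[m]_x (clip n (crd j x) ^+ 2) - (\int[m]_x clip n (crd j x)) ^+ 2 @[n --> \oo]
    --> \int[m]_x (crd j x ^+ 2) - (\int[m]_x crd j x) ^+ 2.
  by apply: cvgB => //; rewrite expr2; exact: cvgM.
rewrite -(cvg_lim (@Rhausdorff R) c); apply: limr_le; first by apply/cvg_ex; eexists; exact: c.
apply: nearW => n; apply: (variance_lipschitz rho0 T2 mP (M := n%:R)) => //.
by move=> x y; exact: le_trans (clip_lip _ _ _) (crd_dist _ _ _).
Qed.

Variables (nu : probability X R) (f : X -> R).
Hypothesis nuP : P2 nu.
Hypothesis nuf : has_density nu m f.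
Hypothesis phif : L1 m (fun x => phi (f x)).
Let H : R := \int[m]_x phi (f x).

Let e j : R := \int[m]_x crd j x.
Let Phi (x : X) : R := \sum_j (crd j x - e j) ^+ 2.

Let Phi_term_i (mu : probability X R) j : P2 mu ->
  L1 mu (fun x => crd j x - e j) /\ L1 mu (fun x => (crd j x - e j) ^+ 2).
Proof.
move=> muP; have [i1 i2] := P2_crd j muP; have mu1 := probability_setT mu.
split; first by apply: L1B => //; exact: L1_cst.
rewrite (_ : (fun x => _) = fun x => crd j x ^+ 2 - 2 * e j * crd j x + e j ^+ 2).
  by apply: L1D; [apply: L1B => //; exact: L1Z|exact: L1_cst].
by apply/funext => x; ring.
Qed.

Let Phi_i (mu : probability X R) : P2 mu -> L1 mu Phi.
Proof. by move=> muP; apply: L1_sum => j; have [] := Phi_term_i j muP. Qed.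

(** With [e] the mean of [m], the integral is at most twice the mean of [|x - e|^2] under [nu].
    Transporting [nu] to [m] bounds that mean by twice the transport cost plus twice the total
    variance of [m], itself at most [2 d / rho]. *)
Lemma second_moment_difference : L1 (nu \x nu)%E (fun z => space_dist z.1 z.2 ^+ 2) /\
  \int[(nu \x nu)%E]_z (space_dist z.1 z.2 ^+ 2) <= 8 / rho * H + 8 * d%:R / rho.
Proof.
have [p1 e1] := Rintegral_prod_fst nu (Phi_i nuP).
have [p2 e2] := Rintegral_prod_snd nu (Phi_i nuP).
pose cross (z : X * X) : R := \sum_j (crd j z.1 - e j) * (crd j z.2 - e j).
have crossj j := L1_prodM (Phi_term_i j nuP).1 (Phi_term_i j nuP).1.
have crossi : L1 (nu \x nu)%E cross by apply: L1_sum => j; have [] := crossj j.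
have distE z : space_dist z.1 z.2 ^+ 2 = Phi z.1 + Phi z.2 - 2 * cross z.
  rewrite space_distE sqr_sqrtr; last by apply: sumr_ge0 => i _; exact: sqr_ge0.
  rewrite /Phi /cross mulr_sumr -big_split -sumrB; apply: eq_bigr => j _ /=; ring.
have p12 := L1D p1 p2; have c2 := L1Z 2 crossi.
have di : L1 (nu \x nu)%E (fun z => space_dist z.1 z.2 ^+ 2).
  by rewrite (_ : (fun z => _) = fun z => Phi z.1 + Phi z.2 - 2 * cross z); [exact: L1B|exact/funext].
split=> //.
have c0 : 0 <= \int[(nu \x nu)%E]_z cross z.
  rewrite Rint_sum; last by move=> j; have [] := crossj j.
  by apply: sumr_ge0 => j _; have [_ ->] := crossj j; rewrite -expr2 sqr_ge0.
have leD : \int[(nu \x nu)%E]_z (space_dist z.1 z.2 ^+ 2) <= 2 * \int[nu]_x Phi x.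
  rewrite [leLHS](_ : _ = \int[(nu \x nu)%E]_z (Phi z.1 + Phi z.2 - 2 * cross z)); last first.
    by apply: eq_Rintegral => z _; exact: distE.
  by rewrite RintB// RintD// e1 e2 RintZ//; lra.
apply: le_trans leD _; apply/ler_addgt0Pr => r r0.
have r4 : 0 < r / 4 by rewrite divr_gt0.
have [pi [piE i2 i1 le]] := talagrand_coupling rho0 T2 nuP nuf phif r4.
have mPhi : measurable_fun setT Phi := L1_measurable (Phi_i nuP).
have [f1 f2] := transfer_Rintegral measurable_fst (coupling_fst piE) mPhi.
have [g1 g2] := transfer_Rintegral measurable_snd (coupling_snd piE) mPhi.
have h1 := f1.1 (Phi_i nuP); have h2 := g1.1 (Phi_i mP).
have Phim : \int[m]_x Phi x <= d%:R * (2 / rho).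
  rewrite Rint_sum; last by move=> j; have [] := Phi_term_i j mP.
  rewrite -[d in d%:R]card_ord mulr_natl -sumr_const; apply: ler_sum => j _.
  apply: le_trans (variance_coordinate j); have [j1 j2] := P2_crd j mP.
  have m1 := probability_setT m.
  have -> : \int[m]_x (crd j x - e j) ^+ 2 = \int[m]_x (crd j x ^+ 2 - 2 * e j * crd j x + e j ^+ 2).
    by apply: eq_Rintegral => x _; ring.
  have k1 : L1 m (fun x => 2 * e j * crd j x) by exact: L1Z.
  rewrite RintD//; [|exact: L1B|exact: L1_cst].
  by rewrite RintB// RintZ// Rint_cst// -/(e j); lra.
have le1 : \int[nu]_x Phi x <= 2 * \int[pi]_z (space_dist z.1 z.2 ^+ 2) + 2 * \int[m]_x Phi x.
  rewrite f2 g2 -RintZ// -RintZ// -RintD; [|exact: L1Z|exact: L1Z].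
  apply: le_Rint => //; first by apply: L1D; exact: L1Z.
  move=> z; rewrite space_distE sqr_sqrtr; last by apply: sumr_ge0 => i _; exact: sqr_ge0.
  rewrite /Phi !mulr_sumr -big_split; apply: ler_sum => j _ /=.
  rewrite -subr_ge0 (_ : _ - _ = (crd j z.1 - crd j z.2 - (crd j z.2 - e j)) ^+ 2) ?sqr_ge0//; ring.
have -> : 8 / rho * H + 8 * d%:R / rho + r = 2 * (2 * (2 / rho * H + r / 4) + 2 * (d%:R * (2 / rho))).
  by field; rewrite gt_eqF.
by rewrite ler_pM2l//; apply: le_trans le1 _; rewrite lerD// ler_pM2l.
Qed.

End coordinate_variance.

Lemma second_moment_euclid (R : realType) k d (m nu : probability (state_space R k d) R)
    (rho : R) (f : state_space R k d -> R) : 0 < rho -> talagrand space_dist origin rho m ->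
  P2 m -> P2 nu -> has_density nu m f -> L1 m (fun x => phi (f x)) -> k = Euclid ->
  L1 (nu \x nu)%E (fun z => space_dist z.1 z.2 ^+ 2) /\
  \int[(nu \x nu)%E]_z (space_dist z.1 z.2 ^+ 2) <=
    8 / rho * (\int[m]_x phi (f x)) + 8 * d%:R / rho.
Proof. by case: k m nu f => // m nu f *; exact: (second_moment_difference (m := m)). Qed.

(** * The gap between the diagonal of a kernel and its double mean *)

Section diagonal_gap.
Context (R : realType) (k : ambient) (d : nat).
Local Notation X := (state_space R k d).
Variables (m : probability X R) (rho : R).
Hypothesis rho0 : 0 < rho.
Hypothesis T2 : talagrand space_dist origin rho m.
Hypothesis mP : P2 m.
Variables (nu : probability X R) (f : X -> R).
Hypothesis nuP : P2 nu.
Hypothesis nuf : has_density nu m f.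
Hypothesis phif : L1 m (fun x => phi (f x)).
Let H : R := \int[m]_x phi (f x).
Variables (K B Q : X -> X -> R) (c l : R).
Hypothesis sK : split_kernel K B Q c l.
Hypotheses (l0 : 0 <= l) (torus0 : k = Torus -> l = 0).

(** By symmetry the second difference is [K x x + K y y - 2 K x y]; its mean over two independent
    points is twice the gap. *)
Lemma diagonal_gapE : L1 (nu \x nu)%E (fun z => D2 K z.1 z.2 z.1 z.2) /\
  \int[nu]_x K x x - pairing K nu nu = 2^-1 * \int[(nu \x nu)%E]_z D2 K z.1 z.2 z.1 z.2.
Proof.
have [[KC _] _ _ _] := sK.
have Ki := split_diagonal sK nuP; have [KK _ _] := split_integrable sK nuP nuP.
have [p1 e1] := Rintegral_prod_fst nu Ki; have [p2 e2] := Rintegral_prod_snd nu Ki.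
have E z : D2 K z.1 z.2 z.1 z.2 = K z.1 z.1 + K z.2 z.2 - 2 * K z.1 z.2.
  by rewrite /D2 (KC z.2 z.1); ring.
have p12 := L1D p1 p2; have K2 := L1Z 2 KK.
split; first by rewrite (_ : (fun z => _) = fun z => K z.1 z.1 + K z.2 z.2 - 2 * K z.1 z.2);
  [exact: L1B|exact/funext].
rewrite [X in _ * X](_ : _ = \int[(nu \x nu)%E]_z (K z.1 z.1 + K z.2 z.2 - 2 * K z.1 z.2)); last first.
  by apply: eq_Rintegral => z _; exact: E.
by rewrite RintB// RintD// e1 e2 RintZ// /pairing; lra.
Qed.

Lemma diagonal_gap_le :
  \int[nu]_x K x x - pairing K nu nu <= c / 2 + l * (4 / rho * H + 4 * d%:R / rho).
Proof.
have lin (u v : R) : u <= c + v -> v <= l * (8 / rho * H + 8 * d%:R / rho) ->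
  2^-1 * u <= c / 2 + l * (4 / rho * H + 4 * d%:R / rho) by move=> ? ?; lra.
have [[KC KE] _ [Bc _] [Ql _]] := sK; have [Di ->] := diagonal_gapE.
have nn1 : (nu \x nu)%E setT = 1%E.
  rewrite -setXTT product_measure1E// -[RHS]mule1.
  by congr (_ * _)%E; exact: probability_setT.
suff [si le] : L1 (nu \x nu)%E (fun z => l * space_dist z.1 z.2 ^+ 2) /\
    \int[(nu \x nu)%E]_z (l * space_dist z.1 z.2 ^+ 2) <= l * (8 / rho * H + 8 * d%:R / rho).
  have : \int[(nu \x nu)%E]_z D2 K z.1 z.2 z.1 z.2 <=
      \int[(nu \x nu)%E]_z (c + l * space_dist z.1 z.2 ^+ 2).
    apply: le_Rint => //; first by apply: L1D => //; exact: L1_cst.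
    by move=> z; rewrite (split_D2 sK) lerD// (le_trans (Ql _ _ _ _))// expr2 mulrA.
  rewrite RintD//; last exact: L1_cst.
  by rewrite Rint_cst//; move/lin; apply.
(* Second moments are estimated in the Euclidean case only; on the torus the Lipschitz part has
   constant 0. *)
have [kT|kE] : k = Torus \/ k = Euclid by case: k; [left|right].
  rewrite torus0//; under eq_fun do rewrite mul0r; rewrite !mul0r.
  by split; [exact: L1_cst|rewrite Rint_cst].
have [i le] := second_moment_euclid rho0 T2 mP nuP nuf phif kE.
by split; [exact: L1Z|rewrite RintZ// ler_wpM2l].
Qed.

End diagonal_gap.

(** * The reduced kernel *)

Section reduced_kernels.
Context (R : realType) (k : ambient) (d : nat).
Local Notation X := (state_space R k d).
Implicit Types (U W K B Q : X -> X -> R).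
Variable m : probability X R.
Hypothesis mP : P2 m.

Lemma positive_kernel_section U : positive_kernel U -> L1 m (U origin).
Proof.
move=> [Ui _]; have i0 := Ui _ _ (@dirac_P2 R k d) mP.
have mU : measurable_fun setT (fun z : X * X => U z.1 z.2) := L1_measurable i0.
have mU0 : measurable_fun setT (U origin).
  by apply: (measurableT_comp mU (g := fun y => (origin, y))); exact: measurable_pair1.
have mnU : measurable_fun setT (fun z : X * X => `|U z.1 z.2|%:E).
  by apply/measurable_EFinP; exact: (measurableT_comp _ mU).
apply: L1P => //; apply: le_lt_trans (L1_lty i0); rewrite fubini_tonelli2//=.
rewrite le_eqVlt; apply/orP; left; apply/eqP; apply: eq_integral => y _.
rewrite /fubini_G/= integral_dirac// ?diracT ?mul1e//.
apply/measurable_EFinP/measurableT_comp => //.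
by apply: (measurableT_comp mU (g := fun x => (x, y))); exact: measurable_pair2.
Qed.

Lemma decomposable_section (MW LW : R) W : decomposable MW LW W -> L1 m (W origin).
Proof.
move=> [Wp [Wm [WE [_ _ Wpp] [_ _ Wmp] _]]].
rewrite (_ : W origin = fun y => Wp origin y - Wm origin y); last exact/funext.
by apply: L1B; exact: positive_kernel_section.
Qed.

(** Reduction annihilates constants and functions of one variable, and centering subtracts nothing
    else. *)
Lemma reduced_kernel_centered W : symmetric_kernel W -> L1 m (W origin) ->
  (forall x, L1 m (centered origin W x)) ->
  L1 (m \x m)%E (fun z => centered origin W z.1 z.2) ->
  forall x y, reduced_kernel W m x y = reduced_kernel (centered origin W) m x y.
Proof.
move=> WC Wo Kx KK x y; have m1 := probability_setT m.
have nn1 : (m \x m)%E setT = 1%E.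
  rewrite -setXTT product_measure1E// -[RHS]mule1.
  by congr (_ * _)%E; exact: probability_setT.
set K := centered origin W in Kx KK *; set a := \int[m]_z W origin z; set b := W origin origin.
have WE u v : W u v = K u v + W u origin + W origin v - b by rewrite /K /b /centered /D2; ring.
have S u : \int[m]_z W u z = \int[m]_z K u z + W u origin + a - b.
  transitivity (\int[m]_z (K u z + W u origin + W origin z - b)).
    by apply: eq_Rintegral => z _; exact: WE.
  have i1 : L1 m (fun z => K u z + W u origin) by apply: L1D => //; exact: L1_cst.
  have i2 := L1D i1 Wo.
  rewrite RintB//; last exact: L1_cst.
  by rewrite RintD// RintD//; [rewrite !Rint_cst|exact: L1_cst].
have KC u v : K u v = K v u by exact: centered_symmetric.
have Sl v : \int[m]_z W z v = \int[m]_z K z v + W v origin + a - b.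
  transitivity (\int[m]_z W v z); first by apply: eq_Rintegral => z _; exact: WC.
  by rewrite S; congr (_ + _ + _ - _); apply: eq_Rintegral => z _; exact: KC.
have Po : pairing W m m = pairing K m m + 2 * a - b.
  rewrite /pairing.
  transitivity (\int[(m \x m)%E]_z (K z.1 z.2 + W origin z.1 + W origin z.2 - b)).
    by apply: eq_Rintegral => z _; rewrite WE (WC z.1).
  have [p1 e1] := Rintegral_prod_fst m Wo; have [p2 e2] := Rintegral_prod_snd m Wo.
  have i1 := L1D KK p1; have i2 := L1D i1 p2.
  rewrite RintB//; last exact: L1_cst.
  by rewrite RintD// RintD// e1 e2 Rint_cst// -/a; ring.
rewrite /reduced_kernel S Sl Po WE (WC origin y); ring.
Qed.

Section split.
Variables (K B Q : X -> X -> R) (c l : R).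
Hypothesis sK : split_kernel K B Q c l.

Lemma reduced_split x y :
  reduced_kernel K m x y = K x y - \int[m]_z K x z - \int[m]_z K y z + pairing K m m.
Proof.
have [[KC _] _ _ _] := sK; rewrite /reduced_kernel; congr (_ - _ - _ + _).
by apply: eq_Rintegral => z _; exact: KC.
Qed.

Lemma potential_pairing (nu : probability X R) : P2 nu ->
  L1 nu (fun x => \int[m]_z K x z) /\ \int[nu]_x \int[m]_z K x z = pairing K nu m.
Proof.
move=> nuP; have [KK _ _] := split_integrable sK nuP mP.
by have [|? E] := Rfubini KK; [move=> x; exact: (split_section sK x mP)|rewrite /pairing E].
Qed.

Lemma pairing_reduced (nu nu' : probability X R) : P2 nu -> P2 nu' ->
  L1 (nu \x nu')%E (fun z => reduced_kernel K m z.1 z.2) /\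
  pairing (reduced_kernel K m) nu nu' =
    pairing K nu nu' - pairing K nu m - pairing K nu' m + pairing K m m.
Proof.
move=> nuP nuP'; have [KK _ _] := split_integrable sK nuP nuP'.
have [i1 e1] := potential_pairing nuP; have [i2 e2] := potential_pairing nuP'.
have [p1 f1] := Rintegral_prod_fst nu' i1; have [p2 f2] := Rintegral_prod_snd nu i2.
have nn1 : (nu \x nu')%E setT = 1%E.
  rewrite -setXTT product_measure1E// -[RHS]mule1.
  by congr (_ * _)%E; exact: probability_setT.
have E z : reduced_kernel K m z.1 z.2 =
    K z.1 z.2 - (\int[m]_w K z.1 w) - (\int[m]_w K z.2 w) + pairing K m m by exact: reduced_split.
have j1 := L1B KK p1; have j2 := L1B j1 p2.
split.
  rewrite (_ : (fun z => _) = fun z => K z.1 z.2 - (\int[m]_w K z.1 w) - (\int[m]_w K z.2 w) + pairing K m m).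
    by apply: L1D => //; exact: L1_cst.
  exact/funext.
rewrite {1}/pairing.
transitivity (\int[(nu \x nu')%E]_z (K z.1 z.2 - (\int[m]_w K z.1 w) - (\int[m]_w K z.2 w) + pairing K m m)).
  by apply: eq_Rintegral => z _; exact: E.
rewrite RintD//; last exact: L1_cst.
by rewrite RintB// RintB// f1 f2 e1 e2 Rint_cst.
Qed.

Lemma pairingC (nu nu' : probability X R) : P2 nu -> P2 nu' -> pairing K nu nu' = pairing K nu' nu.
Proof.
move=> nuP nuP'; have [[KC _] _ _ _] := sK.
have [KK _ _] := split_integrable sK nuP nuP'; have [KK' _ _] := split_integrable sK nuP' nuP.
rewrite /pairing /Rintegral; congr fine.
rewrite -(integral21_prod_meas1 KK) -(integral12_prod_meas1 KK').
apply: eq_integral => y _; rewrite /fubini_F /fubini_G/=.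
by apply: eq_integral => x _; rewrite KC.
Qed.

(** Reducing the kernel with respect to [m] amounts to pairing the original kernel with [nu - m]. *)
Lemma pairing_reduced_form (nu : probability X R) : P2 nu ->
  pairing (reduced_kernel K m) nu nu = form K nu m.
Proof.
move=> nuP; have [_ ->] := pairing_reduced nuP nuP.
by rewrite /form (pairingC mP nuP).
Qed.

End split.
End reduced_kernels.

(** The left side is the tangent at [b] of the convex function [phi]. *)
Lemma phi_tangent (R : realType) (x b : R) : 0 <= x -> 0 < b ->
  x * ln b - b + 1 <= phi x.
Proof.
rewrite le_eqVlt => /predU1P[<-|x0] b0; first by rewrite /phi !mul0r; lra.
have := ler_wpM2l (ltW x0) (ln_ge_sub_inv (divr_gt0 x0 b0)).
rewrite ln_div ?posrE// invf_div mulrBr mulr1 mulrCA divff ?gt_eqF// mulr1 /phi; lra.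
Qed.

Section product_density.
Context d d' (T : measurableType d) (T' : measurableType d') (R : realType).
Variables (P nu : probability T R) (P' nu' : probability T' R) (f : T -> R) (f' : T' -> R).
Hypotheses (nuf : has_density nu P f) (nuf' : has_density nu' P' f').

Lemma ge0_integral_product_density (F : T * T' -> \bar R) :
  measurable_fun setT F -> (forall z, 0 <= F z)%E ->
  (\int[nu \x nu']_z F z = \int[P \x P']_z (F z * (f z.1 * f' z.2)%:E))%E.
Proof.
move=> mF F0; have [mf f0 _] := nuf; have [mf' f0' _] := nuf'.
have mff : measurable_fun setT (fun z : T * T' => f z.1 * f' z.2).
  apply: measurable_funM; first exact: (measurableT_comp mf measurable_fst).
  exact: (measurableT_comp mf' measurable_snd).
have mFx x : measurable_fun setT (fun y => F (x, y)).
  by apply: (measurableT_comp mF (g := fun y => (x, y))); exact: measurable_pair1.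
rewrite fubini_tonelli1// fubini_tonelli1//; last 2 first.
- by apply: emeasurable_funM => //; exact/measurable_EFinP.
- by move=> z; rewrite mule_ge0// lee_fin mulr_ge0.
rewrite (ge0_integral_density nuf)//; last 2 first.
- exact: measurable_fun_fubini_tonelli_F.
- by move=> x; apply: integral_ge0.
apply: eq_integral => x _; rewrite /fubini_F/= (ge0_integral_density nuf')//.
rewrite -ge0_integralZr//.
- by apply: eq_integral => y _; rewrite -muleA -EFinM [f' y * _]mulrC.
- by apply: emeasurable_funM => //; exact/measurable_EFinP.
- by move=> y _; rewrite mule_ge0// lee_fin.
- by rewrite lee_fin.
Qed.

Lemma Rintegral_product_density (F : T * T' -> R) : measurable_fun setT F ->
  \int[(nu \x nu')%E]_z F z = \int[(P \x P')%E]_z (F z * (f z.1 * f' z.2)).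
Proof.
move=> mF; have [mf f0 _] := nuf; have [mf' f0' _] := nuf'.
have mEF : measurable_fun setT (EFin \o F) by exact/measurable_EFinP.
have ff0 z : 0 <= f z.1 * f' z.2 by rewrite mulr_ge0.
rewrite /Rintegral integralE [in RHS]integralE; congr fine; congr (_ - _)%E.
  rewrite ge0_integral_product_density//; last exact: measurable_funepos.
  apply: eq_integral => z _; rewrite !funeposE/= -!EFin_max -EFinM.
  by rewrite maxr_pMl// mul0r.
rewrite ge0_integral_product_density//; last exact: measurable_funeneg.
apply: eq_integral => z _; rewrite !funenegE/= -!EFin_max -EFinM.
by rewrite maxr_pMl// mul0r mulNr.
Qed.

End product_density.

(** * Laws on cells and step densities *)

Section cell_laws.
Context d (T : measurableType d) (R : realType) (J : finType) (C : T -> J).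
Hypothesis mC : forall j, measurable [set x | C x = j].
Implicit Types P : probability T R.

Definition cell_mass (P : probability T R) (j : J) : R := fine (P [set x | C x = j]).

Lemma cell_massE P j : (cell_mass P j)%:E = P [set x | C x = j].
Proof. by rewrite fineK// fin_num_measure. Qed.

Lemma measurable_fun_cells (G : J -> R) : measurable_fun setT (fun x => G (C x)).
Proof.
rewrite (_ : (fun x => _) = fun x => \sum_j G j * \1_[set x | C x = j] x).
  by apply: measurable_sum => j; apply: measurable_funM => //; exact: measurable_indic.
apply/funext => x; rewrite (bigD1 (C x))//= big1 => [|j jn].
  by rewrite indicE mem_set// mulr1 addr0.
by rewrite indicE memNset ?mulr0// => /= E; rewrite E eqxx in jn.
Qed.

Lemma Rint_cells P (F : T -> R) : L1 P F ->
  \int[P]_x F x = \sum_j \int[P]_x (\1_[set x | C x = j] x * F x).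
Proof.
move=> Fi; rewrite -Rint_sum; last by move=> j; exact: L1_indicM.
apply: eq_Rintegral => x _; rewrite (bigD1 (C x))//= big1 => [|j jn].
  by rewrite indicE mem_set// mul1r addr0.
by rewrite indicE memNset ?mul0r// => /= E; rewrite E eqxx in jn.
Qed.

Lemma Rint_indic_cell P j : \int[P]_x \1_[set x | C x = j] x = cell_mass P j.
Proof. by rewrite /Rintegral integral_indicT. Qed.

Lemma L1_indic_cell P j : L1 P (\1_[set x | C x = j]).
Proof.
rewrite (_ : \1_ _ = fun x => \1_[set x | C x = j] x * 1); last by apply/funext => x; rewrite mulr1.
by apply: L1_indicM => //; exact: L1_cst (probability_setT P) _.
Qed.

Lemma cell_mass_pmf P : pmf (cell_mass P).
Proof.
split=> [j|]; first exact: fine_ge0.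
have := Rint_cells (L1_cst (probability_setT P) 1).
rewrite (Rint_cst (probability_setT P)) => ->; apply: eq_bigr => j _.
by rewrite -Rint_indic_cell; apply: eq_Rintegral => x _; rewrite mulr1.
Qed.

Lemma Rint_step P (G : J -> R) :
  L1 P (fun x => G (C x)) /\ \int[P]_x G (C x) = \sum_j cell_mass P j * G j.
Proof.
have i : L1 P (fun x => G (C x)).
  apply: (L1_bounded (probability_setT P) (measurable_fun_cells G) (M := \sum_j `|G j|)) => x.
  by rewrite (bigD1 (C x))//= lerDl sumr_ge0.
split=> //; rewrite Rint_cells//; apply: eq_bigr => j _.
rewrite -Rint_indic_cell mulrC -RintZ; last exact: L1_indic_cell.
apply: eq_Rintegral => x _; rewrite indicE; have [<-|/eqP jn] := eqVneq (C x) j.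
  by rewrite mem_set// mulr1 mul1r.
by rewrite memNset// mulr0 mul0r.
Qed.

Section data_processing.
Variables (P nu : probability T R) (f : T -> R).
Hypothesis nuf : has_density nu P f.

Lemma cell_mass_density j : cell_mass nu j = \int[P]_x (\1_[set x | C x = j] x * f x).
Proof.
rewrite -Rint_indic_cell (Rintegral_density nuf)//; exact: measurable_indic.
Qed.

Lemma cell_mass_dominated : dominated (cell_mass nu) (cell_mass P).
Proof.
move=> j qj; have [mf _ nuE] := nuf; rewrite /cell_mass nuE// null_set_integral//.
  exact/measurable_EFinP/measurable_funTS.
by apply: etrans (esym (cell_massE P j)) _; rewrite qj.
Qed.

(** On each cell integrate the tangent to [phi] at the mean density [p / q]. If [p = 0] the tangent
    at that point is vertical, and tangents at small positive [b] replace it. *)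
Lemma kl_data_processing : L1 P (fun x => phi (f x)) ->
  kl (cell_mass nu) (cell_mass P) <= \int[P]_x phi (f x).
Proof.
move=> phif; have [mf f0 _] := nuf; have fi := has_density_L1 nuf.
rewrite kl_phi; [|exact: cell_mass_pmf|exact: cell_mass_pmf|exact: cell_mass_dominated].
rewrite (Rint_cells phif); apply: ler_sum => j _.
set q := cell_mass P j; set p := cell_mass nu j.
have q0 : 0 <= q by exact: fine_ge0. have p0 : 0 <= p by exact: fine_ge0.
have ind01 x : 0 <= \1_[set x | C x = j] x :> R by rewrite indicE.
have [qE|qn] := eqVneq q 0.
  by rewrite qE mul0r; apply: Rint_ge0 => x; rewrite mulr_ge0// phi_ge0.
have qp : 0 < q by rewrite lt_neqAle eq_sym qn.
have tangent (b : R) : 0 < b -> p * ln b + (1 - b) * q <=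
    \int[P]_x (\1_[set x | C x = j] x * phi (f x)).
  move=> b0; have i1 : L1 P (fun x => ln b * (\1_[set x | C x = j] x * f x)).
    by apply: L1Z; exact: L1_indicM.
  have i2 : L1 P (fun x => (1 - b) * \1_[set x | C x = j] x).
    by apply: L1Z; exact: L1_indic_cell.
  have -> : p * ln b + (1 - b) * q = \int[P]_x (ln b * (\1_[set x | C x = j] x * f x)
      + (1 - b) * \1_[set x | C x = j] x).
    rewrite RintD// RintZ; last exact: L1_indicM.
    by rewrite -cell_mass_density RintZ ?Rint_indic_cell 1?mulrC//; exact: L1_indic_cell.
  apply: le_Rint; [exact: L1D|exact: L1_indicM|].
  move=> x; have := phi_tangent (f0 x) b0; have := ind01 x.
  move: (\1_ _ _) => i i0 /(ler_wpM2l i0) => h; lra.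
have [pE|pn] := eqVneq p 0.
  rewrite pE mul0r /phi mul0r sub0r oppr0 add0r mulr1; apply/ler_addgt0Pr => e e0.
  have b0 : 0 < e / q by rewrite divr_gt0.
  have := tangent _ b0; rewrite pE mul0r add0r mulrBl mul1r divfK//; lra.
have pp : 0 < p by rewrite lt_neqAle eq_sym pn.
have := tangent _ (divr_gt0 pp qp); apply: le_trans.
by rewrite /phi le_eqVlt; apply/orP; left; apply/eqP; field.
Qed.

End data_processing.
End cell_laws.

Section step_densities.
Context d (T : measurableType d) (R : realType) (J : finType) (C : T -> J).
Hypothesis mC : forall j, measurable [set x | C x = j].
Variable P : probability T R.
Local Notation q := (cell_mass C P).
Implicit Types a b : J -> R.

(** The density of the law that gives the cells the masses [a] and, inside each cell, is
    proportional to [P]. On null cells the quotient is 0. *)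
Definition step a (x : T) : R := a (C x) / q (C x).

Lemma step_sum a (F : R -> R) : \sum_j q j * F (a j / q j) = \int[P]_x F (step a x).
Proof. by have [_ ->] := Rint_step mC P (fun j => F (a j / q j)). Qed.

Lemma step_density a : pmf a -> dominated a q -> exists nu : probability T R,
  [/\ has_density nu P (step a), L1 P (fun x => phi (step a x)) &
      \int[P]_x phi (step a x) = kl a q].
Proof.
move=> pa aq; have pq := cell_mass_pmf mC P.
have s0 x : 0 <= step a x by rewrite divr_ge0 ?pa.1 ?pq.1.
have s1 : (\int[P]_x (step a x)%:E = 1)%E.
  have [i e] := Rint_step mC P (fun j => a j / q j).
  rewrite -EFin_Rintegral// e -pa.2; congr EFin; apply: eq_bigr => j _.
  have [qj|qn] := eqVneq (q j) 0; first by rewrite (aq _ qj) mul0r mulr0.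
  by rewrite mulrCA divff// mulr1.
have ms : measurable_fun setT (step a) := measurable_fun_cells mC (fun j => a j / q j).
have [nu nuf] := exists_density ms s0 s1.
exists nu; split=> //.
  exact: (Rint_step mC P (fun j => phi (a j / q j))).1.
by rewrite -step_sum kl_phi.
Qed.

Lemma step_le a : pmf a -> exists M : R, forall x, step a x <= M.
Proof.
move=> pa; exists (\sum_j a j / q j) => x; rewrite (bigD1 (C x))//= lerDl sumr_ge0// => j _.
by rewrite divr_ge0 ?pa.1//; exact: (cell_mass_pmf mC P).1.
Qed.

(** This density is 1 except on null cells, where [0 / 0] is 0. *)
Lemma step_self : has_density P P (step q).
Proof.
have pq := cell_mass_pmf mC P.
have s0 x : 0 <= step q x by rewrite divr_ge0 ?pq.1.
have ms : measurable_fun setT (step q) := measurable_fun_cells mC (fun j => q j / q j).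
split=> // A mA; rewrite -[LHS]integral1//.
have ae : ae_eq P setT (EFin \o (fun x => 1 - step q x)) (cst 0%E).
  have [i e] := Rint_step mC P (fun j => `|1 - q j / q j|).
  apply/ae_eq_integral_abs => //; first by apply/measurable_EFinP; exact: measurable_funB.
  rewrite -[LHS](EFin_Rintegral i) e big1// => j _.
  by have [->|qn] := eqVneq (q j) 0; rewrite ?mul0r// divff// subrr normr0 mulr0.
apply: ge0_ae_eq_integral => //.
- exact/measurable_EFinP/measurable_funTS.
- by move=> x _; rewrite lee_fin.
- apply: filterS ae => x /= h _; congr EFin.
  by have := h I; case=> /eqP; rewrite subr_eq0 => /eqP.
Qed.

Section kernel_matrix.
Variable K : T -> T -> R.
Hypothesis Ki : L1 (P \x P)%E (fun z => K z.1 z.2).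

(** The mean of [K] over pairs of points in two cells, with value 0 when one of the cells is
    null. *)
Definition kernel_matrix i j : R := (q i)^-1 * (q j)^-1 *
  \int[(P \x P)%E]_z (\1_[set z | (C z.1, C z.2) = (i, j)] z * K z.1 z.2).

Let mC2 p : measurable [set z : T * T | (C z.1, C z.2) = p].
Proof.
case: p => i j; rewrite (_ : [set _ | _] = [set x | C x = i] `*` [set x | C x = j]).
  exact: measurableX.
by apply/seteqP; split=> -[x y] /= [-> ->].
Qed.

Lemma bil_kernel_matrix a b (nu nu' : probability T R) :
  pmf a -> pmf b -> has_density nu P (step a) -> has_density nu' P (step b) ->
  bil kernel_matrix a b = pairing K nu nu'.
Proof.
move=> pa pb nua nub; have mK := L1_measurable Ki.
rewrite /pairing (Rintegral_product_density nua nub mK).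
have [M aM] := step_le pa; have [M' bM] := step_le pb.
have [ma a0 _] := nua; have [mb b0 _] := nub.
have i : L1 (P \x P)%E (fun z => K z.1 z.2 * (step a z.1 * step b z.2)).
  apply: (L1_le (g := fun z => M * M' * `|K z.1 z.2|)).
  - apply: measurable_funM => //; apply: measurable_funM.
      exact: (measurableT_comp ma measurable_fst).
    exact: (measurableT_comp mb measurable_snd).
  - move=> z; rewrite normrM mulrC ler_wpM2r// ger0_norm; last first.
      by apply: mulr_ge0; [exact: a0|exact: b0].
    by apply: ler_pM; [exact: a0|exact: b0|exact: aM|exact: bM].
  - by apply: L1Z; exact: L1_norm.
rewrite (Rint_cells mC2 i) /bil pair_big/=; apply: eq_bigr => -[j j'] _ /=.
rewrite /kernel_matrix mulrA -RintZ; last exact: (L1_indicM (mC2 _) Ki).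
apply: eq_Rintegral => -[x y] _; rewrite indicE.
have [/= h|/= h] := pselect ((C x, C y) = (j, j')).
  by rewrite mem_set// !mul1r /step; case: h => <- <-; ring.
by rewrite memNset// !mul0r mulr0.
Qed.

(** What the mean of [K x x] over a cell has in excess of the mean over two independent points of
    that cell. With this correction the discrete gap is exactly the gap of the step law. *)
Definition diagonal_matrix i : R :=
  (q i)^-1 * \int[P]_x (\1_[set x | C x = i] x * K x x) - kernel_matrix i i.

Lemma sum_diagonal_matrix a (nu : probability T R) : L1 P (fun x => K x x) ->
  pmf a -> has_density nu P (step a) ->
  \sum_i a i * (diagonal_matrix i + kernel_matrix i i) = \int[nu]_x K x x.
Proof.
move=> Kd pa nua; have mK := L1_measurable Kd; have [ma a0 _] := nua.
rewrite (Rintegral_density nua mK); have [M aM] := step_le pa.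
have i : L1 P (fun x => K x x * step a x).
  apply: (L1_le (g := fun x => M * `|K x x|)).
  - exact: measurable_funM.
  - by move=> x; rewrite normrM mulrC ler_wpM2r// ger0_norm.
  - by apply: L1Z; exact: L1_norm.
rewrite (Rint_cells mC i); apply: eq_bigr => j _.
rewrite subrK mulrA -RintZ; last exact: L1_indicM.
apply: eq_Rintegral => x _; rewrite indicE.
have [/= h|/= h] := pselect (C x = j).
  by rewrite mem_set// !mul1r /step h; ring.
by rewrite memNset// !mul0r mulr0.
Qed.

End kernel_matrix.
End step_densities.

Section product_density_mean.
Context d (T : measurableType d) (R : realType).
Variables (P nu nu' : probability T R) (f f' : T -> R).
Hypotheses (nuf : has_density nu P f) (nuf' : has_density nu' P f').

Lemma product_density_close (F : T * T -> R) (v e : R) : L1 (nu \x nu')%E F ->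
  (forall x y, f x != 0 -> f' y != 0 -> `|F (x, y) - v| <= e) ->
  `|\int[(nu \x nu')%E]_z F z - v| <= e.
Proof.
move=> Fi Fe; have mF := L1_measurable Fi; have [mf f0 _] := nuf; have [mf' f0' _] := nuf'.
have nn1 : (nu \x nu')%E setT = 1%E.
  rewrite -setXTT product_measure1E// -[RHS]mule1.
  by congr (_ * _)%E; exact: probability_setT.
have fi := has_density_L1 nuf; have fi' := has_density_L1 nuf'.
have [ffi ffE] := L1_prodM fi fi'.
rewrite (has_density_integral1 nuf) (has_density_integral1 nuf') mulr1 in ffE.
rewrite -(Rint_cst nn1 v) -RintB//; last exact: L1_cst.
have mFv : measurable_fun setT (fun z => F z - v) by exact: measurable_funB.
rewrite (Rintegral_product_density nuf nuf' mFv).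
have bd z : `|(F z - v) * (f z.1 * f' z.2)| <= e * (f z.1 * f' z.2).
  have p0 : 0 <= f z.1 * f' z.2 by rewrite mulr_ge0.
  rewrite normrM (ger0_norm p0).
  have [->|f1] := eqVneq (f z.1) 0; first by rewrite !mul0r !mulr0.
  have [->|f2] := eqVneq (f' z.2) 0; first by rewrite !mulr0.
  by rewrite ler_wpM2r//; case: z f1 f2 p0 => x y *; exact: Fe.
have ei := L1Z e ffi.
have gi : L1 (P \x P)%E (fun z => (F z - v) * (f z.1 * f' z.2)).
  apply: L1_le bd ei; apply: measurable_funM => //; exact: L1_measurable ffi.
have -> : e = \int[(P \x P)%E]_z (e * (f z.1 * f' z.2)) by rewrite RintZ// ffE mulr1.
rewrite ler_norml; apply/andP; split.
  rewrite lerNl -RintN//; apply: le_Rint => //; first exact: L1N.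
  by move=> z; have := bd z; rewrite ler_norml => /andP[]; rewrite lerNl.
by apply: le_Rint => // z; have := bd z; rewrite ler_norml => /andP[].
Qed.

End product_density_mean.

Section dirac_pairings.
Context (R : realType) (k : ambient) (d : nat).
Local Notation X := (state_space R k d).

Lemma dirac_P2_at (x : X) : P2 (\d_x : probability X R).
Proof.
have md : measurable_fun setT (fun y : X => (space_dist y origin ^+ 2)%:E).
  by apply/measurable_EFinP/measurable_funX; exact: measurable_space_norm.
by rewrite /P2 /finite_moment/= integral_dirac//= diracT mul1e ltry.
Qed.

Lemma Rintegral_dirac (x : X) (f : X -> R) : measurable_fun setT f -> \int[\d_x]_y f y = f x.
Proof.
move=> mf; rewrite /Rintegral integral_dirac//; last exact/measurable_EFinP.
by rewrite diracT mul1e.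
Qed.

Variables (K B Q : X -> X -> R) (c l : R).
Hypothesis sK : split_kernel K B Q c l.

Lemma pairing_dirac (x y : X) : pairing K \d_x \d_y = K x y.
Proof.
have mK := split_measurable sK.
have [Ki _ _] := split_integrable sK (dirac_P2_at x) (dirac_P2_at y).
rewrite /pairing; have [|i ->] := Rfubini Ki.
  by move=> z; exact: (split_section sK z (dirac_P2_at y)).
rewrite Rintegral_dirac; last exact: L1_measurable i.
by rewrite Rintegral_dirac//; apply: (measurableT_comp mK (g := fun y => (x, y))); exact: measurable_pair1.
Qed.

(** Positivity tested on two Dirac masses. *)
Lemma square_nonneg_D2 (x y : X) : square_nonneg K -> 0 <= D2 K x y x y.
Proof.
move=> /(_ _ _ (dirac_P2_at x) (dirac_P2_at y)).
by rewrite !pairing_dirac.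
Qed.

End dirac_pairings.

Lemma form_rate_le (R : realType) (a b M u v w : R) : a + b <= 4 * M -> u + v <= w ->
  a / 2 + 2 * u + (b / 2 + 2 * v) <= 2 * (M + w).
Proof. by move=> h1 h2; lra. Qed.

(** * Transfer of the hypotheses to cells *)

Section discretized.
Context (R : realType) (k : ambient) (d : nat).
Local Notation X := (state_space R k d).
Variables (m : probability X R) (rho MW LW delta eps : R) (N : nat).
Hypotheses (rho0 : 0 < rho) (MW0 : 0 <= MW) (LW0 : 0 <= LW).
Hypotheses (delta0 : 0 < delta) (delta1 : delta <= 1) (eps0 : 0 < eps) (N0 : (0 < N)%N).
Hypotheses (T2 : talagrand space_dist origin rho m) (mP : P2 m).
Variables (Kp Bp Qp Km Bm Qm : X -> X -> R) (cp lp cm lm : R).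
Hypotheses (sKp : split_kernel Kp Bp Qp cp lp) (sKm : split_kernel Km Bm Qm cm lm).
Hypotheses (Kp0 : square_nonneg Kp) (Km0 : square_nonneg Km).
Hypotheses (cp0 : 0 <= cp) (cm0 : 0 <= cm) (lp0 : 0 <= lp) (lm0 : 0 <= lm).
Hypotheses (cpm : cp + cm <= 4 * MW) (lpm : lp + lm <= LW) (torus : k = Torus -> LW = 0).
Hypothesis coercive : forall nu f, P2 nu -> has_density nu m f -> L1 m (fun x => phi (f x)) ->
  delta * (\int[m]_x phi (f x)) <=
  \int[m]_x phi (f x) + 2^-1 * (form Kp nu m - form Km nu m).

Let S : R := MW + LW / rho.
Let c0 : R := 2 * MW + 4 * (LW / rho) * d%:R.
Let l4 : R := 4 * (LW / rho).

Let lr0 : 0 <= LW / rho. Proof. by rewrite divr_ge0// ltW. Qed.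

Let torusp : k = Torus -> lp = 0.
Proof. by move=> kT; apply/eqP; move: lpm; rewrite torus//; apply: contraTT => ?; rewrite -ltNge ltr_wpDr// lt_neqAle eq_sym; apply/andP. Qed.

Let torusm : k = Torus -> lm = 0.
Proof. by move=> kT; apply/eqP; move: lpm; rewrite torus//; apply: contraTT => ?; rewrite -ltNge ltr_wpDl// lt_neqAle eq_sym; apply/andP. Qed.

(** The oscillations contribute [(cp + cm) / 2 <= 2 * MW] and the Hessians
    [2 * (lp + lm) / rho <= 2 * LW / rho]: this is the origin of [S]. *)
Lemma form_sum_le nu f : P2 nu -> has_density nu m f -> L1 m (fun x => phi (f x)) ->
  form Kp nu m + form Km nu m <= 2 * S * (\int[m]_x phi (f x)).
Proof.
move=> nuP nuf phif.
have H0 : 0 <= \int[m]_x phi (f x).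
  by apply: Rint_ge0 => x; apply: phi_ge0; case: nuf.
have h1 := form_split_le rho0 T2 mP nuP nuf phif sKp cp0 lp0.
have h2 := form_split_le rho0 T2 mP nuP nuf phif sKm cm0 lm0.
apply: le_trans (lerD h1 h2) _; rewrite -mulrDl ler_wpM2r//.
have h3 : lp / rho + lm / rho <= LW / rho by rewrite -mulrDl ler_wpM2r// invr_ge0 ltW.
by rewrite -(mulrA 2 lp) -(mulrA 2 lm); exact: form_rate_le.
Qed.

Lemma gap_sum_le nu f : P2 nu -> has_density nu m f -> L1 m (fun x => phi (f x)) ->
  (\int[nu]_x Kp x x - pairing Kp nu nu) + (\int[nu]_x Km x x - pairing Km nu nu) <=
  c0 + l4 * (\int[m]_x phi (f x)).
Proof.
move=> nuP nuf phif.
have H0 : 0 <= \int[m]_x phi (f x).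
  by apply: Rint_ge0 => x; apply: phi_ge0; case: nuf.
have h1 := diagonal_gap_le rho0 T2 mP nuP nuf phif sKp lp0 torusp.
have h2 := diagonal_gap_le rho0 T2 mP nuP nuf phif sKm lm0 torusm.
apply: le_trans (lerD h1 h2) _; set H := \int[m]_x _ in H0 *.
set r := 4 / rho * H + 4 * d%:R / rho.
have r0 : 0 <= r by rewrite addr_ge0// ?mulr_ge0// ?invr_ge0// ltW.
have h3 : lp * r + lm * r <= LW * r by rewrite -mulrDl ler_wpM2r.
have -> : c0 + l4 * H = 2 * MW + LW * r by rewrite /c0 /l4 /r; ring.
by rewrite addrACA lerD// -mulrDl ler_pdivrMr// mulrAC -natrM.
Qed.

Context (J : finType) (C : X -> J).
Hypothesis mC : forall j, measurable [set x | C x = j].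
Local Notation q := (cell_mass C m).
Local Notation M K := (kernel_matrix C m K).
Local Notation G K := (diagonal_matrix C m K).

Let pq : pmf q. Proof. exact: cell_mass_pmf. Qed.

Let Ki K B Q c l : split_kernel K B Q c l -> L1 (m \x m)%E (fun z => K z.1 z.2).
Proof. by move=> sK; have [] := split_integrable sK mP mP. Qed.

Lemma step_P2 a (nu : probability X R) : pmf a -> has_density nu m (step C m a) -> P2 nu.
Proof.
move=> pa nua; have [A aA] := step_le mC m pa.
exact: P2_bounded_density mP nua aA.
Qed.

Let delta_pmf (i : J) : pmf (fun j => (i == j)%:R : R).
Proof. by split=> [j|]; rewrite ?ler0n// (bigD1 i)//= eqxx big1 ?addr0// => j; rewrite eq_sym => /negPf->. Qed.

Let delta_dom (i : J) : q i != 0 -> dominated (fun j => (i == j)%:R : R) q.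
Proof. by move=> qi j qj; case: eqP => // ij; rewrite ij qj eqxx in qi. Qed.

Section one_kernel.
Variables (K B Q : X -> X -> R) (c l : R).
Hypotheses (sK : split_kernel K B Q c l) (K0 : square_nonneg K).

(** An entry is the pairing of [m] conditioned on each of the two cells, so its symmetry is that of
    pairings; null cells are treated apart. *)
Lemma kernel_matrixC i j : M K i j = M K j i.
Proof.
have [qi|qi] := eqVneq (q i) 0; first by rewrite /kernel_matrix qi invr0 mulr0 !mul0r.
have [qj|qj] := eqVneq (q j) 0; first by rewrite /kernel_matrix qj invr0 mulr0 !mul0r.
have [nu [nua _ _]] := step_density mC (delta_pmf i) (delta_dom qi).
have [nu' [nub _ _]] := step_density mC (delta_pmf j) (delta_dom qj).
rewrite -(bil_delta (M K) i j) -(bil_delta (M K) j i).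
rewrite (bil_kernel_matrix mC (Ki sK) (delta_pmf i) (delta_pmf j) nua nub).
rewrite (bil_kernel_matrix mC (Ki sK) (delta_pmf j) (delta_pmf i) nub nua).
exact: (pairingC sK (step_P2 (delta_pmf i) nua) (step_P2 (delta_pmf j) nub)).
Qed.

Lemma bil_form a b (nu nu' : probability X R) : pmf a -> pmf b ->
  has_density nu m (step C m a) -> has_density nu' m (step C m b) ->
  bil (M K) (fun i => a i - b i) (fun i => a i - b i) = form K nu nu'.
Proof.
move=> pa pb nua nub; rewrite bilBl !bilBr /form.
rewrite (bil_kernel_matrix mC (Ki sK) pa pa nua nua) (bil_kernel_matrix mC (Ki sK) pa pb nua nub).
rewrite (bil_kernel_matrix mC (Ki sK) pb pa nub nua) (bil_kernel_matrix mC (Ki sK) pb pb nub nub).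
by rewrite opprB addrA addrAC.
Qed.

Lemma kernel_matrix_positive : positive_on q (M K).
Proof.
move=> a b pa pb aq bq.
have [nu [nua _ _]] := step_density mC pa aq.
have [nu' [nub _ _]] := step_density mC pb bq.
by rewrite (bil_form pa pb nua nub); apply: K0; [exact: step_P2 nua|exact: step_P2 nub].
Qed.

(** For [m] conditioned on cell [i] the entry is the gap of [diagonal_gapE], a mean of second
    differences that positivity makes nonnegative. *)
Lemma diagonal_matrix_ge0 i : q i != 0 -> 0 <= G K i.
Proof.
move=> qi; have [nu [nua _ _]] := step_density mC (delta_pmf i) (delta_dom qi).
have nuP := step_P2 (delta_pmf i) nua.
have := sum_diagonal_matrix mC (split_diagonal sK mP) (delta_pmf i) nua.
rewrite (bigD1 i)//= eqxx mul1r big1 ?addr0 => [|j ji]; last by rewrite eq_sym (negPf ji) mul0r.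
have := bil_kernel_matrix mC (Ki sK) (delta_pmf i) (delta_pmf i) nua nua.
rewrite bil_delta => -> /(canRL (addrK _)) ->.
have [Di ->] := diagonal_gapE nuP sK; rewrite mulr_ge0 ?invr_ge0//.
by apply: Rint_ge0 => z; exact: (square_nonneg_D2 sK).
Qed.

End one_kernel.

(** The constants are those of [discrete_core]: [c0 / 2 = MW + 2 * (LW / rho) * d] and
    [l4 / (2 * N) = 2 * (LW / rho) / N]. *)
Lemma discretized_energy (p : N.-tuple J -> R) : pmf p ->
  (forall c, p c != 0 -> forall i, q (tnth c i) != 0) ->
  0 <= (1 - ((1 - eps) * delta - (1 + S / (eps * delta)) * (2 * (LW / rho) / N%:R)))
         * kl p (fun c => \prod_i q (tnth c i))
       + \sum_c p c * mean_energy q (M Kp) (M Km) (G Kp) (G Km) c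
       + (1 + S / (eps * delta)) * (MW + 2 * (LW / rho) * d%:R).
Proof.
move=> pp pdom.
have main := @discrete_core R J N q (M Kp) (M Km) (G Kp) (G Km) S c0 l4 delta eps N0 pq
  (kernel_matrixC sKp) (kernel_matrixC sKm).
have Nn : N%:R != 0 :> R by rewrite pnatr_eq0 -lt0n.
have -> : 2 * (LW / rho) / N%:R = l4 / (2 * N%:R) by rewrite /l4; field; rewrite Nn gt_eqF.
have -> : MW + 2 * (LW / rho) * d%:R = c0 / 2 by rewrite /c0; field; rewrite gt_eqF.
apply: main => //.
- by rewrite addr_ge0.
- move=> S0; have := MW0; rewrite le_eqVlt => /predU1P[M00|Mp]; last first.
    by move: (ltr_wpDr lr0 Mp); rewrite -/S S0 ltxx.
  have lr : LW / rho = 0 by move: S0; rewrite /S -M00 add0r.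
  by rewrite /c0 /l4 lr -M00 !mulr0 mul0r addr0.
- exact: (kernel_matrix_positive sKp).
- exact: (kernel_matrix_positive sKm).
- exact: (diagonal_matrix_ge0 sKp).
- exact: (diagonal_matrix_ge0 sKm).
- move=> a pa aq; have [nu [nua phia klE]] := step_density mC pa aq.
  rewrite (bil_form sKp pa pq nua (step_self mC m)) (bil_form sKm pa pq nua (step_self mC m)).
  by rewrite -klE; apply: form_sum_le => //; exact: step_P2 nua.
- move=> a pa aq; have [nu [nua phia klE]] := step_density mC pa aq.
  rewrite (sum_diagonal_matrix mC (split_diagonal sKp mP) pa nua).
  rewrite (sum_diagonal_matrix mC (split_diagonal sKm mP) pa nua).
  rewrite (bil_kernel_matrix mC (Ki sKp) pa pa nua nua) (bil_kernel_matrix mC (Ki sKm) pa pa nua nua).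
  by rewrite -klE; apply: gap_sum_le => //; exact: step_P2 nua.
- move=> a pa aq; have [nu [nua phia klE]] := step_density mC pa aq.
  rewrite (bil_form sKp pa pq nua (step_self mC m)) (bil_form sKm pa pq nua (step_self mC m)).
  by rewrite -klE; apply: coercive => //; exact: step_P2 nua.
Qed.

End discretized.

(** * Comparison of the cell energy with the energy of a configuration *)

Lemma bil_suml (R : realType) (I : finType) (k : I -> I -> R) K (s : seq K) (u : K -> I -> R)
    (v : I -> R) :
  bil k (fun i => \sum_(j <- s) u j i) v = \sum_(j <- s) bil k (u j) v.
Proof.
rewrite /bil [RHS]exchange_big; apply: eq_bigr => i _; rewrite [RHS]exchange_big.
by apply: eq_bigr => j _; rewrite !mulr_suml; apply: eq_bigr.
Qed.

Lemma bil_empirical (R : realType) (I : finType) (N : nat) (k : I -> I -> R) (q : I -> R)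
    (c : N.-tuple I) : (0 < N)%N ->
  N%:R ^+ 2 * bil k (fun j => empirical_pmf R c j - q j) (fun j => empirical_pmf R c j - q j) =
  \sum_i \sum_j bil k (fun l => (tnth c i == l)%:R - q l) (fun l => (tnth c j == l)%:R - q l).
Proof.
move=> N0; have Nn : N%:R != 0 :> R by rewrite pnatr_eq0 -lt0n.
have muE : (fun j => empirical_pmf R c j - q j) =
    fun j => N%:R^-1 * \sum_i ((tnth c i == j)%:R - q j).
  apply/funext => j; rewrite sumrB mulrBr /empirical_pmf; congr (_ - _).
  by rewrite sumr_const card_ord -(mulr_natl (q j)) mulKf.
have bilZr (u v : I -> R) r : bil k u (fun i => r * v i) = r * bil k u v.
  rewrite mulr_sumr; apply: eq_bigr => i _; rewrite mulr_sumr.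
  by apply: eq_bigr => j _; ring.
rewrite {1}muE bilZl muE bilZr.
have Z (z : R) : N%:R ^+ 2 * (N%:R^-1 * (N%:R^-1 * z)) = z by field.
rewrite Z bil_suml; apply: eq_bigr => i _; exact: bil_sumr.
Qed.

Section energy.
Context (R : realType) (k : ambient) (d : nat).
Local Notation X := (state_space R k d).

(** [N/2 <W_*, mu_x^2>] with the empirical measure written out. *)
Definition reduced_energy (Wst : X -> X -> R) (N : nat) (x : N.-tuple X) : R :=
  (2 * N%:R)^-1 * \sum_i \sum_j Wst (tnth x i) (tnth x j).

Variables (m : probability X R) (W Kp Bp Qp Km Bm Qm : X -> X -> R) (cp lp cm lm : R).
Hypothesis mP : P2 m.
Hypotheses (sKp : split_kernel Kp Bp Qp cp lp) (sKm : split_kernel Km Bm Qm cm lm).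
Hypotheses (Wsym : symmetric_kernel W)
  (WK : forall x y, centered origin W x y = Kp x y - Km x y)
  (WstE : forall x y, reduced_kernel W m x y = reduced_kernel Kp m x y - reduced_kernel Km m x y).
Local Notation Wst := (reduced_kernel W m).
Local Notation w := (fun x => \int[m]_z W x z).

Context (J : finType) (C : X -> J).
Hypothesis mC : forall j, measurable [set x | C x = j].
Variables (good : pred J) (eta : R).
Hypothesis w_close : forall x x', good (C x) -> C x' = C x -> `|w x - w x'| <= eta.
Hypothesis W_close : forall x y x' y', good (C x) -> good (C y) -> C x' = C x -> C y' = C y ->
  `|W x y - W x' y'| <= eta.
Local Notation q := (cell_mass C m).
Local Notation M K := (kernel_matrix C m K).
Local Notation G K := (diagonal_matrix C m K).

Let WstW x y : Wst x y = W x y - w x - w y + pairing W m m.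
Proof. by congr (_ - _ - _ + _); apply: eq_Rintegral => z _; exact: Wsym. Qed.

Lemma Wst_close x y x' y' : good (C x) -> good (C y) -> C x' = C x -> C y' = C y ->
  `|Wst x' y' - Wst x y| <= 3 * eta.
Proof.
move=> gx gy Cx Cy; have h1 := W_close gx gy Cx Cy; have h2 := w_close gx Cx; have h3 := w_close gy Cy.
move: h1 h2 h3; rewrite !WstW !ler_norml; move: (w x) (w x') (w y) (w y') => a b u v.
by move=> /andP[? ?] /andP[? ?] /andP[? ?]; apply/andP; split; lra.
Qed.

Let delta_pmf (i : J) : pmf (fun j => (i == j)%:R : R).
Proof. by split=> [j|]; rewrite ?ler0n// (bigD1 i)//= eqxx big1 ?addr0// => j; rewrite eq_sym => /negPf->. Qed.

Let delta_dom (i : J) : q i != 0 -> dominated (fun j => (i == j)%:R : R) q.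
Proof. by move=> qi j qj; case: eqP => // ij; rewrite ij qj eqxx in qi. Qed.

Let delta_step i x : step C m (fun j => (i == j)%:R) x != 0 -> C x = i.
Proof. by rewrite /step; have [|_] := eqVneq i (C x); rewrite ?mul0r ?eqxx. Qed.

Let Ki K B Q c l : split_kernel K B Q c l -> L1 (m \x m)%E (fun z => K z.1 z.2).
Proof. by move=> sK; have [] := split_integrable sK mP mP. Qed.

Let stepP2 a (nu : probability X R) : pmf a -> has_density nu m (step C m a) -> P2 nu.
Proof.
move=> pa nua; have [A aA] := step_le mC m pa.
exact: P2_bounded_density mP nua aA.
Qed.

Lemma reduced_matrix_close i j x y : C x = i -> C y = j -> good i -> good j ->
  q i != 0 -> q j != 0 ->
  `|bil (M Kp) (fun l => (i == l)%:R - q l) (fun l => (j == l)%:R - q l) -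
    bil (M Km) (fun l => (i == l)%:R - q l) (fun l => (j == l)%:R - q l) - Wst x y| <= 3 * eta.
Proof.
move=> xi yj gi gj qi qj.
have [nu [nua _ _]] := step_density mC (delta_pmf i) (delta_dom qi).
have [nu' [nub _ _]] := step_density mC (delta_pmf j) (delta_dom qj).
have nuP := stepP2 (delta_pmf i) nua; have nuP' := stepP2 (delta_pmf j) nub.
have pq := cell_mass_pmf mC m; have qq := step_self mC m.
have one K B Q c l : split_kernel K B Q c l ->
    bil (M K) (fun l => (i == l)%:R - q l) (fun l => (j == l)%:R - q l) =
    pairing (reduced_kernel K m) nu nu' /\ L1 (nu \x nu')%E (fun z => reduced_kernel K m z.1 z.2).
  move=> sK; have [ii ->] := pairing_reduced mP sK nuP nuP'; split=> //; rewrite bilBl !bilBr.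
  rewrite (bil_kernel_matrix mC (Ki sK) (delta_pmf i) (delta_pmf j) nua nub).
  rewrite (bil_kernel_matrix mC (Ki sK) (delta_pmf i) pq nua qq).
  rewrite (bil_kernel_matrix mC (Ki sK) pq (delta_pmf j) qq nub).
  rewrite (bil_kernel_matrix mC (Ki sK) pq pq qq qq) (pairingC sK mP nuP').
  by move: (pairing _ _ _) (pairing _ _ _) (pairing _ _ _) (pairing _ _ _) => *; ring.
have [-> ip] := one _ _ _ _ _ sKp; have [-> im] := one _ _ _ _ _ sKm.
rewrite /pairing -RintB//.
apply: (product_density_close nua nub (L1B ip im)) => x' y' /delta_step x'i /delta_step y'j /=.
by rewrite -WstE; apply: Wst_close; rewrite ?xi ?yj.
Qed.

(** Only the difference of the two corrections is small: it involves second differences of [W],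
    which varies little over a good cell, whereas nothing of the kind is known of [Kp] and [Km]
    separately. *)
Lemma diagonal_matrix_close i : good i -> q i != 0 -> `|G Kp i - G Km i| <= eta.
Proof.
move=> gi qi; have [nu [nua _ _]] := step_density mC (delta_pmf i) (delta_dom qi).
have nuP := stepP2 (delta_pmf i) nua.
have one K B Q c l : split_kernel K B Q c l ->
    L1 (nu \x nu)%E (fun z => D2 K z.1 z.2 z.1 z.2) /\
    G K i = 2^-1 * \int[(nu \x nu)%E]_z D2 K z.1 z.2 z.1 z.2.
  move=> sK; have := sum_diagonal_matrix mC (split_diagonal sK mP) (delta_pmf i) nua.
  rewrite (bigD1 i)//= eqxx mul1r big1 ?addr0 => [|j ji]; last by rewrite eq_sym (negPf ji) mul0r.
  have := bil_kernel_matrix mC (Ki sK) (delta_pmf i) (delta_pmf i) nua nua.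
  rewrite bil_delta => -> /(canRL (addrK _)) ->.
  exact: (diagonal_gapE nuP sK).
have [ip ->] := one _ _ _ _ _ sKp; have [im ->] := one _ _ _ _ _ sKm.
rewrite -mulrBr -RintB// normrM ger0_norm ?invr_ge0//.
suff h : `|\int[(nu \x nu)%E]_z (D2 Kp z.1 z.2 z.1 z.2 - D2 Km z.1 z.2 z.1 z.2) - 0| <= 2 * eta.
  by rewrite subr0 in h; rewrite mulrC ler_pdivrMr// mulrC.
apply: (product_density_close nua nua (L1B ip im)) => x y /delta_step xi /delta_step yi /=.
have -> : D2 Kp x y x y - D2 Km x y x y - 0 = (W x x - W x y) + (W y y - W y x).
  rewrite subr0 -[RHS](_ : D2 (centered origin W) x y x y = _).
    by rewrite /D2 !WK; ring.
  by rewrite D2_centered /D2; ring.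
apply: le_trans (ler_normD _ _) _; rewrite mulr_natl mulr2n.
by apply: lerD; apply: W_close; rewrite ?xi ?yi.
Qed.

(** Each of the [N^2] pairs costs [3 * eta] and each diagonal correction [eta], all divided by
    [2 * N]. *)
Lemma mean_energy_close (N : nat) (c : N.-tuple J) (x : N.-tuple X) : (0 < N)%N -> 0 <= eta ->
  (forall i, C (tnth x i) = tnth c i) -> (forall i, good (tnth c i)) ->
  (forall i, q (tnth c i) != 0) ->
  `|mean_energy q (M Kp) (M Km) (G Kp) (G Km) c - reduced_energy Wst x| <= 2 * N%:R * eta.
Proof.
move=> N0 eta0 xc gc qc; have Np : 0 < N%:R :> R by rewrite ltr0n.
rewrite /mean_energy mulrBr !bil_empirical// /reduced_energy -mulrBr normrM.
rewrite ger0_norm; last by rewrite invr_ge0 mulr_ge0// ltW.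
rewrite mulrC ler_pdivrMr ?mulr_gt0//.
rewrite addrAC -sumrB -sumrB; apply: le_trans (ler_normD _ _) _.
have h1 : `|\sum_i (G Kp (tnth c i) - G Km (tnth c i))| <= N%:R * eta.
  rewrite -[N in leRHS]card_ord mulr_natl -sumr_const; apply: le_trans (ler_norm_sum _ _ _) _.
  by apply: ler_sum => i _; exact: diagonal_matrix_close.
set A := \sum_i _ in h1 *; set D := (X in `|X| + _).
have h2 : `|D| <= N%:R * (N%:R * (3 * eta)).
  rewrite /D -[N in leRHS]card_ord (mulr_natl (3 * eta)) mulr_natl -sumr_const; apply: le_trans (ler_norm_sum _ _ _) _.
  apply: ler_sum => i _; rewrite -sumrB -sumrB -sumr_const; apply: le_trans (ler_norm_sum _ _ _) _.
  by apply: ler_sum => j _; apply: reduced_matrix_close.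
apply: le_trans (lerD h2 h1) _.
have N1 : 1 <= N%:R :> R by rewrite ler1n.
have : N%:R * eta <= N%:R * (N%:R * eta) by rewrite ler_wpM2l ?ler_peMl ?(ltW Np).
move: N%:R => n; nra.
Qed.

End energy.

Lemma Rint_null d (T : measurableType d) (R : realType) (P : probability T R) (A : set T)
    (g : T -> R) : measurable A -> measurable_fun setT g -> P A = 0%E ->
  \int[P]_x (\1_A x * g x) = 0.
Proof.
move=> mA mg A0; rewrite /Rintegral (_ : (\int[P]_x _ = 0)%E)//.
transitivity (\int[P]_(x in A) (g x)%:E)%E.
  rewrite [RHS]integral_mkcond; apply: eq_integral => x _; rewrite patchE indicE.
  by case: ifPn; rewrite ?mul1r// mul0r.
by rewrite null_set_integral//; exact/measurable_EFinP/measurable_funTS.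
Qed.

(** * The energy inequality for laws of bounded support *)

Section supported.
Context (R : realType) (k : ambient) (d : nat).
Local Notation X := (state_space R k d).
Variables (m : probability X R) (rho MW LW delta eps : R) (N : nat).
Hypotheses (rho0 : 0 < rho) (MW0 : 0 <= MW) (LW0 : 0 <= LW).
Hypotheses (delta0 : 0 < delta) (delta1 : delta <= 1) (eps0 : 0 < eps) (N0 : (0 < N)%N).
Hypotheses (T2 : talagrand space_dist origin rho m) (mP : P2 m).
Variables (W Kp Bp Qp Km Bm Qm : X -> X -> R) (cp lp cm lm : R).
Hypotheses (sKp : split_kernel Kp Bp Qp cp lp) (sKm : split_kernel Km Bm Qm cm lm).
Hypotheses (Kp0 : square_nonneg Kp) (Km0 : square_nonneg Km).
Hypotheses (cp0 : 0 <= cp) (cm0 : 0 <= cm) (lp0 : 0 <= lp) (lm0 : 0 <= lm).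
Hypotheses (cpm : cp + cm <= 4 * MW) (lpm : lp + lm <= LW) (torus : k = Torus -> LW = 0).
Hypothesis coercive : forall nu f, P2 nu -> has_density nu m f -> L1 m (fun x => phi (f x)) ->
  delta * (\int[m]_x phi (f x)) <=
  \int[m]_x phi (f x) + 2^-1 * (form Kp nu m - form Km nu m).
Hypotheses (WC2 : kernel_C2 W) (Wsym : symmetric_kernel W)
  (WK : forall x y, centered origin W x y = Kp x y - Km x y)
  (WstE : forall x y, reduced_kernel W m x y = reduced_kernel Kp m x y - reduced_kernel Km m x y).
Local Notation w := (fun x => \int[m]_z W x z).
Hypothesis mw : measurable_fun setT w.
Local Notation E := (@reduced_energy R k d (reduced_kernel W m) N).

Let S : R := MW + LW / rho.
Let dN : R := (1 - eps) * delta - (1 + S / (eps * delta)) * (2 * (LW / rho) / N%:R).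
Let C0 : R := (1 + S / (eps * delta)) * (MW + 2 * (LW / rho) * d%:R).

(** The potential [w] is bounded along with the coordinates because its value serves as one more
    coordinate of the cells. *)
Definition inner_point (n : nat) (x : X) : Prop :=
  (forall j, - n%:R <= crd j x < n%:R) /\ - n%:R <= w x < n%:R.

(** The sign of [1 - dN] allows the entropy of the cell law to be replaced by the larger entropy of
    the law itself. *)
Lemma dN_le1 : dN <= 1.
Proof.
have l0 : 0 <= LW / rho by rewrite divr_ge0// ltW.
have h1 : (1 - eps) * delta <= 1.
  by apply: le_trans delta1; rewrite mulrBl mul1r gerBl mulr_ge0// ltW.
have h2 : 0 <= (1 + S / (eps * delta)) * (2 * (LW / rho) / N%:R).
  apply: mulr_ge0; last by rewrite divr_ge0// mulr_ge0.
  by rewrite addr_ge0// divr_ge0 ?addr_ge0// mulr_ge0// ltW.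
by apply: (le_trans _ h1); rewrite /dN gerBl.
Qed.

Lemma supported_energy (nu : probability (N.-tuple X) R) (f : N.-tuple X -> R) (n : nat) :
  has_density nu (tensor_prob m N) f -> L1 (tensor_prob m N) (fun x => phi (f x)) ->
  L1 nu E -> (forall x, f x != 0 -> forall i, inner_point n (tnth x i)) ->
  0 <= (1 - dN) * (\int[tensor_prob m N]_x phi (f x)) + \int[nu]_x E x + C0.
Proof.
move=> nuf phif Ei fn; apply/ler_addgt0Pl => e e0.
have Np : 0 < N%:R :> R by rewrite ltr0n.
(* The error [2 * N * eta] of [mean_energy_close] is then [e]. *)
pose eta : R := e / (2 * N%:R); have eta0 : 0 < eta by rewrite divr_gt0// mulr_gt0.
have [t t0 ucW] := kernel_unif_continuous n%:R WC2 eta0.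
pose tm := Num.min t eta; have tm0 : 0 < tm by rewrite lt_min t0.
pose s := (Num.bound tm^-1).+1.
have s0 : (0 < s)%N by [].
have st : s%:R^-1 <= tm.
  rewrite -[leRHS]invrK lef_pV2 ?posrE ?invr_gt0 ?ltr0n//.
  apply: ltW; apply: lt_le_trans (archi_boundP _) _; first by rewrite invr_ge0 ltW.
  by rewrite ler_nat.
(* The reduced kernel contains the potential [w], for which only measurability is available. Cutting
   the cells along its values too makes it nearly constant on each of them. *)
pose feat (i : 'I_d.+1) (x : X) : R := if unlift ord0 i is Some j then crd j x else w x.
have mfeat i : measurable_fun setT (feat i).
  by rewrite /feat; case: (unlift ord0 i) => [j|]; [exact: measurable_crd|exact: mw].
pose C (x : X) := cell_of feat n s x.
have mC j : measurable [set x | C x = j] by exact: measurable_cell_of.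
pose good := @inner_cell d.+1 n s.
have goodE x : reflect (inner_point n x) (good (C x)).
  rewrite /good /C inner_cellE//; apply: (iffP forallP) => [h|[h1 h2] i].
    split=> [j|]; first by have := h (lift ord0 j); rewrite /feat liftK.
    by have := h ord0; rewrite /feat unlift_none.
  by rewrite /feat; case: unliftP => [j|] _; [exact: h1|exact: h2].
have w_close x x' : good (C x) -> C x' = C x -> `|w x - w x'| <= eta.
  move=> gx Cx; have := cell_mesh s0 ord0 (esym Cx) gx; rewrite /feat unlift_none => h.
  by rewrite (le_trans h)// (le_trans st)// ge_min lexx orbT.
have crd_close x x' j : good (C x) -> C x' = C x -> `|crd j x - crd j x'| <= t.
  move=> gx Cx; have := cell_mesh s0 (lift ord0 j) (esym Cx) gx; rewrite /feat liftK => h.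
  by rewrite (le_trans h)// (le_trans st)// ge_min lexx.
have crd_bound x j : good (C x) -> `|crd j x| <= n%:R.
  by move=> /goodE[/(_ j)/andP[h1 h2] _]; rewrite ler_norml h1 ltW.
have W_close x y x' y' : good (C x) -> good (C y) -> C x' = C x -> C y' = C y ->
    `|W x y - W x' y'| <= eta.
  by move=> gx gy Cx Cy; apply: ucW => j; [exact: crd_bound|exact: crd_bound|
    exact: crd_close|exact: crd_close].
pose CN (x : N.-tuple X) : N.-tuple _ := [tuple C (tnth x i) | i < N].
have CNbox c : [set x | CN x = c] = box (fun i => [set x | C x = tnth c i]).
  apply/seteqP; split=> x /= h; first by move=> i /=; rewrite -h tnth_mktuple.
  by apply: eq_from_tnth => i; rewrite tnth_mktuple; exact: h.
have mCN c : measurable [set x | CN x = c].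
  by rewrite CNbox; apply: measurable_box => i; exact: mC.
pose q := cell_mass C m.
have qNE c : cell_mass CN (tensor_prob m N) c = \prod_i q (tnth c i).
  apply: EFin_inj; rewrite cell_massE// CNbox.
  apply: etrans (tensor_prob_box m (fun i => mC (tnth c i))) _.
  by rewrite -prodEFin; apply: eq_bigr => i _; rewrite -(cell_massE mC).
pose p := cell_mass CN nu.
have pp : pmf p by exact: cell_mass_pmf.
have pdom c : p c != 0 -> forall i, q (tnth c i) != 0.
  move=> pn i; apply: contra pn => /eqP qi; apply/eqP/(cell_mass_dominated mCN nuf).
  by rewrite qNE (bigD1 i)//= qi mul0r.
have main := @discretized_energy R k d m rho MW LW delta eps N rho0 MW0 LW0 delta0 delta1 eps0 N0 T2 mP
  _ _ _ _ _ _ cp lp cm lm sKp sKm Kp0 Km0 cp0 cm0 lp0 lm0 cpm lpm torus coercive _ C mC p pp pdom.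
have klle : kl p (fun c => \prod_i q (tnth c i)) <= \int[tensor_prob m N]_x phi (f x).
  rewrite (_ : (fun c => _) = cell_mass CN (tensor_prob m N)); last by apply/funext => c; rewrite qNE.
  exact: kl_data_processing.
apply: le_trans main _; rewrite addrA lerD2r addrCA lerD//.
  by rewrite ler_wpM2l// subr_ge0 dN_le1.
have nu1 := probability_setT nu; have mE := L1_measurable Ei; have [mf f0 _] := nuf.
have Eei : L1 nu (fun x => e + E x) by apply: L1D => //; exact: L1_cst.
have -> : e + \int[nu]_x E x = \int[nu]_x (e + E x).
  by rewrite RintD// ?Rint_cst//; exact: L1_cst.
rewrite (Rint_cells mCN Eei); apply: ler_sum => c _.
set me := mean_energy _ _ _ _ _ c.
have [p0|pn] := eqVneq (p c) 0.
  rewrite p0 mul0r Rint_null//; first exact: measurable_funD.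
  by apply: etrans (esym (cell_massE mCN nu c)) _; rewrite -/p p0.
have pcE : p c = \int[nu]_x \1_[set x | CN x = c] x by rewrite Rint_indic_cell.
rewrite pcE.
rewrite mulrC -RintZ; last exact: L1_indic_cell.
have mI : measurable_fun setT (\1_[set x | CN x = c] : N.-tuple X -> R) by exact: measurable_indic.
have m1 : measurable_fun setT (fun x => me * \1_[set x | CN x = c] x) by exact: measurable_funM.
have m2 : measurable_fun setT (fun x => \1_[set x | CN x = c] x * (e + E x)).
  by apply: measurable_funM => //; exact: measurable_funD.
have i1 : L1 nu (fun x => me * \1_[set x | CN x = c] x) by apply: L1Z; exact: L1_indic_cell.
have i2 : L1 nu (fun x => \1_[set x | CN x = c] x * (e + E x)) by exact: L1_indicM.
rewrite (Rintegral_density nuf m1) (Rintegral_density nuf m2).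
apply: le_Rint; [exact/(L1_density nuf m1)|exact/(L1_density nuf m2)|move=> x].
(* Configurations that are not made of inner points may fail the comparison, but they have density
   zero. *)
have [->|fx] := eqVneq (f x) 0; first by rewrite !mulr0.
rewrite ler_wpM2r// indicE.
have [/= Cx|/= Cx] := pselect (CN x = c); last by rewrite memNset// mulr0 mul0r.
rewrite mem_set// mulr1 mul1r.
have xc i : C (tnth x i) = tnth c i by rewrite -Cx tnth_mktuple.
have gc i : good (tnth c i) by rewrite -xc; apply/goodE; exact: fn.
have := @mean_energy_close R k d m W _ _ _ _ _ _ _ _ _ _ mP sKp sKm Wsym WK WstE _ C mC good eta
  w_close W_close N c x N0 (ltW eta0) xc gc (pdom _ pn).
rewrite ler_norml => /andP[_]; rewrite -/me.
rewrite (_ : 2 * N%:R * eta = e); last by rewrite /eta; field; rewrite gt_eqF.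
by rewrite lerBlDr.
Qed.

End supported.

(** * Conditioning a law on a set *)

Section conditioning.
Context d (T : measurableType d) (R : realType).
Variables (P nu : probability T R) (f : T -> R).
Hypothesis nuf : has_density nu P f.

Let P1 : P setT = 1%E := probability_setT P.
Let mf : measurable_fun setT f. Proof. by case: nuf. Qed.
Let f0 x : 0 <= f x. Proof. by case: nuf. Qed.
Let fi : L1 P f. Proof. exact: has_density_L1 nuf. Qed.

Variable A : set T.
Hypothesis mA : measurable A.
Let r : R := \int[P]_x (\1_A x * f x).
Hypothesis r0 : 0 < r.

Let ind01 x : \1_A x = 0 :> R \/ \1_A x = 1 :> R.
Proof. by rewrite indicE; case: (_ \in _); [right|left]. Qed.

Lemma exists_conditioned : exists nuA : probability T R,
  has_density nuA P (fun x => r^-1 * (\1_A x * f x)) /\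
  has_density nuA nu (fun x => r^-1 * \1_A x).
Proof.
have g0 x : 0 <= r^-1 * (\1_A x * f x).
  by rewrite !mulr_ge0 ?invr_ge0 ?(ltW r0)// indicE.
have h0 x : 0 <= r^-1 * \1_A x :> R by rewrite mulr_ge0 ?invr_ge0 ?(ltW r0)// indicE.
have mI : measurable_fun setT (\1_A : T -> R) by exact: measurable_indic.
have mg : measurable_fun setT (fun x => r^-1 * (\1_A x * f x)).
  by apply: measurable_funM => //; exact: measurable_funM.
have mh : measurable_fun setT (fun x => r^-1 * \1_A x : R) by exact: measurable_funM.
have g1 : (\int[P]_x (r^-1 * (\1_A x * f x))%:E = 1)%E.
  have i := L1_indicM mA fi.
  rewrite -EFin_Rintegral; last exact: L1Z.
  by rewrite RintZ// -/r mulVf// gt_eqF.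
have [nuA nuAg] := exists_density mg g0 g1; exists nuA; split=> //; split=> // B mB.
have [_ _ ->//] := nuAg.
rewrite [RHS](_ : _ = \int[nu]_x (\1_B x * (r^-1 * \1_A x))%:E)%E; last first.
  rewrite [LHS]integral_mkcond; apply: eq_integral => x _; rewrite patchE [\1_B x]indicE.
  by case: ifPn; rewrite ?mul1r// mul0r.
rewrite (ge0_integral_density nuf); last 2 first.
- by apply/measurable_EFinP; apply: measurable_funM => //; exact: measurable_indic.
- by move=> x; rewrite lee_fin mulr_ge0// indicE.
rewrite [LHS]integral_mkcond; apply: eq_integral => x _; rewrite patchE [\1_B x]indicE.
by case: ifPn => _; rewrite ?mul1r ?mul0r -?EFinM ?mul0r// mulrA.
Qed.

(** On [A] the logarithm of the new density is [ln f - ln r], outside [phi 0 = 1]. The formula is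
    exact, and its right side tends to the entropy of [nu] when [A] exhausts the space. *)
Lemma phi_conditioned : L1 P (fun x => phi (f x)) ->
  L1 P (fun x => phi (r^-1 * (\1_A x * f x))) /\
  \int[P]_x phi (r^-1 * (\1_A x * f x)) =
    r^-1 * (\int[P]_x (\1_A x * phi (f x)) + r - \int[P]_x \1_A x) - ln r.
Proof.
move=> phif; have i1 := L1_indicM mA phif; have i2 := L1_indicM mA fi.
have iA : L1 P (\1_A : T -> R).
  rewrite (_ : \1_ _ = fun x => \1_A x * 1); last by apply/funext => x; rewrite mulr1.
  by apply: L1_indicM => //; exact: L1_cst.
have i3 := L1D i1 i2; have i4 := L1B i3 iA; have i5 := L1Z r^-1 i4.
have i6 := L1Z (- r^-1 * (ln r + 1)) i2; have i7 := L1D i5 i6; have i8 := L1D i7 (L1_cst P1 1).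
have E x : phi (r^-1 * (\1_A x * f x)) = r^-1 * (\1_A x * phi (f x) + \1_A x * f x - \1_A x)
    + - r^-1 * (ln r + 1) * (\1_A x * f x) + 1.
  case: (ind01 x) => ->; rewrite ?mul0r ?mulr0 ?mul1r; first by rewrite /phi mul0r; ring.
  have [->|fn] := eqVneq (f x) 0; first by rewrite /phi mulr0 mul0r; ring.
  have fp : 0 < f x by rewrite lt_neqAle eq_sym fn f0.
  by rewrite /phi lnM ?posrE ?invr_gt0// lnV ?posrE//; ring.
split; first by rewrite (funext E).
rewrite (eq_Rintegral _ (fun x _ => E x)).
rewrite RintD//; last exact: L1_cst.
rewrite RintD// RintZ// RintZ// RintB// RintD// Rint_cst// -/r.
by move: (\int[P]_x _) (\int[P]_x _) => u v; field; rewrite gt_eqF.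
Qed.

End conditioning.

Lemma cvg_Rint_indic d (T : measurableType d) (R : realType) (mu : {measure set T -> \bar R})
    (A : nat -> set T) (g : T -> R) :
  (forall n, measurable (A n)) -> (forall x, \forall n \near \oo, A n x) -> L1 mu g ->
  \int[mu]_x (\1_(A n) x * g x) @[n --> \oo] --> \int[mu]_x g x.
Proof.
move=> mA Ax gi; have mg := L1_measurable gi.
apply: (dominated_Rintegral (g := fun x => `|g x|)) => //.
- by move=> n; apply: measurable_funM => //; exact: measurable_indic.
- move=> x; apply: (@cvg_near_cst _ _ _ _ _ (@eventually_filter)).
  by apply: filterS (Ax x) => n An; rewrite indicE mem_set// mul1r.
- exact: L1_norm.
- move=> n x; rewrite normrM indicE; case: (_ \in _); rewrite ?normr1 ?mul1r// normr0 mul0r.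
  exact: normr_ge0.
Qed.

(** * Growth of the reduced kernel and integrability of the energy *)

Section growth.
Context (R : realType) (k : ambient) (d N : nat).
Local Notation X := (state_space R k d).
Variables (m : probability X R).
Hypothesis mP : P2 m.

Lemma reduced_kernel_growth (K B Q : X -> X -> R) (c l : R) : split_kernel K B Q c l -> 0 <= l ->
  exists2 A : R, 0 <= A &
    forall x y, `|reduced_kernel K m x y| <= A * (1 + space_norm x ^+ 2 + space_norm y ^+ 2).
Proof.
move=> sK l0; have [[_ KE] _ [_ Bc] [_ Ql]] := sK; have m1 := probability_setT m.
have c0 : 0 <= c by exact: le_trans (normr_ge0 _) (Bc origin origin).
pose I : R := \int[m]_x space_norm x; have I0 : 0 <= I by apply: Rint_ge0 => x; exact: space_dist_ge0.
have Kb x y : `|K x y| <= c + l * (space_norm x * space_norm y).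
  by rewrite KE mulrA (le_trans (ler_normD _ _))// lerD.
have k1 x : `|\int[m]_z K x z| <= c + l * (space_norm x * I).
  have i := split_section sK x mP; have ni := P2_norm mP.
  have ii : L1 m (fun z => c + l * space_norm x * space_norm z).
    by apply: L1D; [exact: L1_cst|exact: L1Z].
  have -> : c + l * (space_norm x * I) = \int[m]_z (c + l * space_norm x * space_norm z).
    rewrite RintD//; [|exact: L1_cst|exact: L1Z].
    by rewrite Rint_cst// RintZ// mulrA.
  rewrite ler_norml; apply/andP; split.
    rewrite lerNl -RintN//; apply: le_Rint => //; first exact: L1N.
    by move=> z; have := Kb x z; rewrite mulrA ler_norml lerNl => /andP[].
  apply: le_Rint => // z.
  by have := Kb x z; rewrite mulrA ler_norml => /andP[].
exists (3 * c + `|pairing K m m| + l + 2 * l * I).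
  by rewrite !addr_ge0 ?mulr_ge0.
move=> x y; rewrite (reduced_split m sK).
have nx : 0 <= space_norm x by exact: space_dist_ge0.
have ny : 0 <= space_norm y by exact: space_dist_ge0.
have T (a b e f : R) : `|a - b - e + f| <= `|a| + `|b| + `|e| + `|f|.
  apply: le_trans (ler_normD _ _) _; rewrite lerD2r.
  apply: le_trans (ler_normB _ _) _; rewrite lerD2r; exact: ler_normB.
apply: le_trans (T _ _ _ _) _; have := k1 x; have := k1 y; have := Kb x y.
have := normr_ge0 (pairing K m m).
move: `|K x y| `|pairing K m m| `|\int[m]_z K x z| `|\int[m]_z K y z| => a p b e p0 ha he hb.
move: (space_norm x) (space_norm y) nx ny ha hb he => u v u0 v0 ha hb he.
apply: (@le_trans _ _ (3 * c + p + l * (u * v) + l * I * (u + v))); first lra.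
have uv : u * v <= 1 + u ^+ 2 + v ^+ 2.
  by have := sqr_ge0 (u - v); have := sqr_ge0 u; have := sqr_ge0 v; rewrite sqrrB; lra.
have us : u + v <= 2 * (1 + u ^+ 2 + v ^+ 2).
  by have := sqr_ge0 (u - 1); have := sqr_ge0 (v - 1); have := sqr_ge0 u; have := sqr_ge0 v; rewrite !sqrrB; lra.
have h1 := ler_wpM2l l0 uv; have h2 := ler_wpM2l (mulr_ge0 l0 I0) us.
have h3 : 3 * c + p <= (3 * c + p) * (1 + u ^+ 2 + v ^+ 2).
  by rewrite ler_peMr ?addr_ge0 ?mulr_ge0// -addrA lerDl addr_ge0 ?sqr_ge0.
rewrite [leRHS](_ : _ = (3 * c + p) * (1 + u ^+ 2 + v ^+ 2) + l * (1 + u ^+ 2 + v ^+ 2) +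
  l * I * (2 * (1 + u ^+ 2 + v ^+ 2))); last by ring.
by rewrite !lerD.
Qed.

Lemma config_norm_sqr (x : N.-tuple X) :
  config_dist x config_origin ^+ 2 = \sum_i space_norm (tnth x i) ^+ 2.
Proof.
rewrite (tuple_dist_sqr); apply: eq_bigr => i _; by rewrite tnth_mktuple.
Qed.

Lemma moment_tnth (nu : probability (N.-tuple X) R) i :
  finite_moment config_dist config_origin 2 nu -> L1 nu (fun x => space_norm (tnth x i) ^+ 2).
Proof.
move=> h; have mi : measurable_fun setT (fun x : N.-tuple X => space_norm (tnth x i)).
  exact: (measurableT_comp (@measurable_space_norm R k d) (measurable_tnth i)).
apply: L1_ge0 => //; [exact: measurable_funX|by move=> x; exact: sqr_ge0|].
apply: le_lt_trans h; apply: ge0_le_integral => //.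
- by move=> x _; rewrite lee_fin sqr_ge0.
- by apply/measurable_EFinP; exact: measurable_funX.
- apply/measurable_EFinP/measurable_funX.
  apply: (measurableT_comp (@measurable_config_dist R k d N) (g := fun x => (x, config_origin))).
  exact: measurable_pair2.
- move=> x _; rewrite lee_fin config_norm_sqr (bigD1 i)//= lerDl sumr_ge0// => j _.
  exact: sqr_ge0.
Qed.

Lemma L1_reduced_energy (nu : probability (N.-tuple X) R) (Wst : X -> X -> R) (A : R) :
  measurable_kernel Wst ->
  (forall x y, `|Wst x y| <= A * (1 + space_norm x ^+ 2 + space_norm y ^+ 2)) ->
  finite_moment config_dist config_origin 2 nu ->
  (forall i j, L1 nu (fun x => Wst (tnth x i) (tnth x j))) /\ L1 nu (@reduced_energy R k d Wst N).
Proof.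
move=> mWst WA h.
have ij i j : L1 nu (fun x => Wst (tnth x i) (tnth x j)).
  have ii := moment_tnth i h; have jj := moment_tnth j h.
  apply: (L1_le (g := fun x => A * (1 + space_norm (tnth x i) ^+ 2 + space_norm (tnth x j) ^+ 2))).
  - apply: (measurableT_comp mWst (g := fun x : N.-tuple X => (tnth x i, tnth x j))).
    by apply/measurable_fun_pairP; split; exact: measurable_tnth.
  - by move=> x; exact: WA.
  - by apply: L1Z; apply: L1D => //; apply: L1D => //; exact: L1_cst (probability_setT nu) _.
split=> //; apply: L1Z; apply: L1_sum => i; exact: L1_sum.
Qed.

End growth.

(** * The energy inequality for general laws *)

Section energy_inequality.
Context (R : realType) (k : ambient) (d : nat).
Local Notation X := (state_space R k d).
Variables (m : probability X R) (rho MW LW delta eps : R) (N : nat).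
Hypotheses (rho0 : 0 < rho) (MW0 : 0 <= MW) (LW0 : 0 <= LW).
Hypotheses (delta0 : 0 < delta) (delta1 : delta <= 1) (eps0 : 0 < eps) (N0 : (0 < N)%N).
Hypotheses (T2 : talagrand space_dist origin rho m) (mP : P2 m).
Variables (W Kp Bp Qp Km Bm Qm : X -> X -> R) (cp lp cm lm : R).
Hypotheses (sKp : split_kernel Kp Bp Qp cp lp) (sKm : split_kernel Km Bm Qm cm lm).
Hypotheses (Kp0 : square_nonneg Kp) (Km0 : square_nonneg Km).
Hypotheses (cp0 : 0 <= cp) (cm0 : 0 <= cm) (lp0 : 0 <= lp) (lm0 : 0 <= lm).
Hypotheses (cpm : cp + cm <= 4 * MW) (lpm : lp + lm <= LW) (torus : k = Torus -> LW = 0).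
Hypothesis coercive : forall nu f, P2 nu -> has_density nu m f -> L1 m (fun x => phi (f x)) ->
  delta * (\int[m]_x phi (f x)) <=
  \int[m]_x phi (f x) + 2^-1 * (form Kp nu m - form Km nu m).
Hypotheses (WC2 : kernel_C2 W) (Wsym : symmetric_kernel W)
  (WK : forall x y, centered origin W x y = Kp x y - Km x y)
  (WstE : forall x y, reduced_kernel W m x y = reduced_kernel Kp m x y - reduced_kernel Km m x y).
Local Notation w := (fun x => \int[m]_z W x z).
Hypothesis mw : measurable_fun setT w.
Local Notation E := (@reduced_energy R k d (reduced_kernel W m) N).

Let S : R := MW + LW / rho.
Let dN : R := (1 - eps) * delta - (1 + S / (eps * delta)) * (2 * (LW / rho) / N%:R).
Let C0 : R := (1 + S / (eps * delta)) * (MW + 2 * (LW / rho) * d%:R).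

Let inner_config (n : nat) : set (N.-tuple X) := box (fun=> [set x | inner_point m W n x]).

Let measurable_inner n : measurable (inner_config n).
Proof.
apply: measurable_box => _.
rewrite (_ : [set x | _] = (\bigcap_j (@crd R k d j @^-1` `[- n%:R, n%:R[%classic)) `&`
    (w @^-1` `[- n%:R, n%:R[%classic)).
  apply: measurableI; last by rewrite -[X in measurable X]setTI; apply: mw => //; exact: measurable_itv.
  apply: fin_bigcap_measurable => // j _; rewrite -[X in measurable X]setTI.
  by apply: measurable_crd => //; exact: measurable_itv.
apply/seteqP; split=> x /=.
  by move=> [h1 h2]; split=> [j _|]; rewrite /= in_itv; [exact: h1|exact: h2].
move=> [h1 h2]; split=> [j|]; last by move: h2; rewrite in_itv.
by have := h1 j I; rewrite /= in_itv.
Qed.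

Let inner_near x : \forall n \near \oo, inner_config n x.
Proof.
pose B : R := \sum_i (\sum_j `|crd j (tnth x i)| + `|w (tnth x i)|).
have Bi i : \sum_j `|crd j (tnth x i)| + `|w (tnth x i)| <= B.
  by rewrite /B [leRHS](bigD1 i)//= lerDl sumr_ge0// => l _; rewrite addr_ge0// sumr_ge0.
have B0 : 0 <= B by rewrite sumr_ge0// => i _; rewrite addr_ge0// sumr_ge0.
have hb (n : nat) (r : R) : B < n%:R -> `|r| <= B -> - n%:R <= r < n%:R.
  move=> h1 h2; have := le_lt_trans h2 h1; rewrite ltr_norml => /andP[h3 ->].
  by rewrite ltW.
exists (Num.bound B) => // n /= Bn i.
have {}Bn : B < n%:R by rewrite (lt_le_trans (archi_boundP B0))// ler_nat.
split=> [j|]; apply: hb => //; apply: le_trans (Bi i).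
  by rewrite (bigD1 j)//= -addrA lerDl addr_ge0// sumr_ge0.
by rewrite lerDr sumr_ge0.
Qed.

(** Condition on configurations of inner points, where [supported_energy] applies, and let the bound
    [n] grow: every term converges, by dominated convergence and the exact entropy formula of
    [phi_conditioned]. *)
Lemma energy_inequality (nu : probability (N.-tuple X) R) (f : N.-tuple X -> R) :
  has_density nu (tensor_prob m N) f -> L1 (tensor_prob m N) (fun x => phi (f x)) ->
  L1 nu E -> 0 <= (1 - dN) * (\int[tensor_prob m N]_x phi (f x)) + \int[nu]_x E x + C0.
Proof.
move=> nuf phif Ei; pose mN : probability (N.-tuple X) R := tensor_prob m N.
have mN1 := probability_setT mN; have fi : L1 mN f := has_density_L1 nuf.
pose A := inner_config.
pose r n : R := \int[mN]_x (\1_(A n) x * f x).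
pose a n : R := \int[mN]_x (\1_(A n) x * phi (f x)).
pose p n : R := \int[mN]_x \1_(A n) x.
pose b n : R := \int[nu]_x (\1_(A n) x * E x).
have rc : r n @[n --> \oo] --> (1 : R).
  have <- : \int[mN]_x f x = 1 := has_density_integral1 nuf.
  exact: cvg_Rint_indic.
have ac : a n @[n --> \oo] --> \int[mN]_x phi (f x) by exact: cvg_Rint_indic.
have pc : p n @[n --> \oo] --> (1 : R).
  rewrite -(Rint_cst mN1 1).
  have h : \int[mN]_x (\1_(A n) x * 1) @[n --> \oo] --> \int[mN]_x (1 : R).
    by apply: cvg_Rint_indic => //; exact: L1_cst.
  by apply: cvg_trans h; apply: near_eq_cvg; apply: nearW => n;
    apply: eq_Rintegral => x _; rewrite mulr1.
have bc : b n @[n --> \oo] --> \int[nu]_x E x by exact: cvg_Rint_indic.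
pose u n := (1 - dN) * ((r n)^-1 * (a n + r n - p n) - ln (r n)) + (r n)^-1 * b n + C0.
have uc : u n @[n --> \oo] --> (1 - dN) * (1^-1 * (\int[mN]_x phi (f x) + 1 - 1) - ln 1)
    + 1^-1 * (\int[nu]_x E x) + C0.
  have rV : (r n)^-1 @[n --> \oo] --> (1^-1 : R) by apply: cvgV => //; rewrite oner_eq0.
  have lnc : ln (r n) @[n --> \oo] --> ln (1 : R).
    by apply: continuous_cvg => //; exact: continuous_ln.
  apply: cvgD; last exact: cvg_cst.
  apply: cvgD; last exact: cvgM.
  apply: cvgM; first exact: cvg_cst.
  apply: cvgB => //; apply: cvgM => //.
  by apply: cvgB => //; apply: cvgD.
suff : 0 <= (1 - dN) * (1^-1 * (\int[mN]_x phi (f x) + 1 - 1) - ln 1)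
    + 1^-1 * (\int[nu]_x E x) + C0.
  by rewrite ln1 invr1 addrK subr0 !mul1r.
rewrite -(cvg_lim (@Rhausdorff R) uc); apply: limr_ge; first by apply/cvg_ex; eexists; exact: uc.
have : \forall n \near \oo, 0 < r n.
  exact: (cvgr_gt _ rc).
apply: filterS => n rn.
have [nuA [nuAf nuAnu]] := exists_conditioned nuf (measurable_inner n) rn.
have [phiA entA] := phi_conditioned nuf (measurable_inner n) rn phif.
have mE := L1_measurable Ei.
have iAE := L1_indicM (measurable_inner n) Ei.
have EA : L1 nuA E.
  apply/(L1_density nuAnu mE); rewrite (_ : (fun x => _) = fun x => (r n)^-1 * (\1_(A n) x * E x)).
    exact: L1Z.
  by apply/funext => x; ring.
have EAE : \int[nuA]_x E x = (r n)^-1 * b n.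
  rewrite (Rintegral_density nuAnu mE) -RintZ//; apply: eq_Rintegral => x _.
  by rewrite /r /=; ring.
have := @supported_energy R k d m rho MW LW delta eps N rho0 MW0 LW0 delta0 delta1 eps0 N0 T2 mP
  W _ _ _ _ _ _ cp lp cm lm sKp sKm Kp0 Km0 cp0 cm0 lp0 lm0 cpm lpm torus coercive WC2 Wsym WK WstE mw
  nuA _ n nuAf phiA EA.
rewrite entA EAE; apply => x fx.
have [Ax i|nA] := pselect (A n x); first exact: Ax.
by rewrite indicE memNset// mul0r mulr0 eqxx in fx.
Qed.

End energy_inequality.

(** * Integrals against empirical measures *)

Lemma Rintegral_atomic d (T : measurableType d) (R : realType) (mu : {measure set T -> \bar R})
    (J : finType) (t : J -> T) (a : R) : 0 <= a ->
  (forall F : T -> \bar R, measurable_fun setT F -> (forall x, 0 <= F x)%E ->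
    (\int[mu]_x F x = \sum_j a%:E * F (t j))%E) ->
  forall f : T -> R, measurable_fun setT f -> \int[mu]_x f x = a * \sum_j f (t j).
Proof.
move=> a0 muE f mf; have mEf : measurable_fun setT (EFin \o f) by exact/measurable_EFinP.
have pos (g : T -> R) : measurable_fun setT g -> (forall x, 0 <= g x) ->
    (\int[mu]_x (g x)%:E = (\sum_j a * g (t j))%:E)%E.
  move=> mg g0; rewrite muE//; last exact/measurable_EFinP.
  by rewrite -sumEFin; apply: eq_bigr => j _; rewrite EFinM.
rewrite /Rintegral integralE.
rewrite (_ : (fun x => _) = fun x => (Num.max (f x) 0)%:E); last first.
  by apply/funext => x; rewrite funeposE EFin_max.
rewrite [X in (_ - X)%E](_ : _ = (\int[mu]_x (Num.max (- f x) 0)%:E)%E); last first.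
  by apply: eq_integral => x _; rewrite funenegE EFin_max.
rewrite !pos/=; last 4 first.
- by apply: measurable_maxr => //; exact: measurableT_comp.
- by move=> x; rewrite le_max lexx orbT.
- exact: measurable_maxr.
- by move=> x; rewrite le_max lexx orbT.
rewrite -sumrB mulr_sumr; apply: eq_bigr => j _; rewrite -mulrBr; congr (_ * _).
by rewrite /Num.max; case: ltP => h1; case: ltP => h2; lra.
Qed.

Section empirical_integrals.
Context d (T : measurableType d) (R : realType) (N : nat) (x : N.-tuple T).
Hypothesis N0 : (0 < N)%N.

Lemma ge0_integral_empirical (F : T -> \bar R) : measurable_fun setT F ->
  (forall y, 0 <= F y)%E ->
  (\int[empirical (R := R) x]_y F y = \sum_(i < N) (N%:R^-1)%:E * F (tnth x i))%E.
Proof.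
move=> mF F0; rewrite ge0_integral_mscale// ge0_integral_measure_sum// -ge0_sume_distrr//.
by congr (_ * _)%E; apply: eq_bigr => i _; rewrite integral_dirac// diracT mul1e (tnth_nth point).
Qed.

Lemma Rintegral_empirical (f : T -> R) : measurable_fun setT f ->
  \int[empirical (R := R) x]_y f y = N%:R^-1 * \sum_i f (tnth x i).
Proof.
by apply: Rintegral_atomic; [rewrite invr_ge0|exact: ge0_integral_empirical].
Qed.

Lemma pairing_empirical (U : T -> T -> R) : measurable_kernel U ->
  pairing U (empirical (R := R) x) (empirical x) =
  N%:R^-1 ^+ 2 * \sum_i \sum_j U (tnth x i) (tnth x j).
Proof.
move=> mU; rewrite pair_big/=.
apply: (Rintegral_atomic (t := fun p : 'I_N * 'I_N => (tnth x p.1, tnth x p.2))) => //.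
move=> F mF F0; rewrite fubini_tonelli1// ge0_integral_empirical; last 2 first.
- exact: measurable_fun_fubini_tonelli_F.
- by move=> y; apply: integral_ge0.
rewrite -(pair_big predT predT (fun i j => (N%:R^-1 ^+ 2)%:E * F (tnth x i, tnth x j))%E)/=.
apply: eq_bigr => i _; rewrite /fubini_F/= ge0_integral_empirical//; last first.
  by apply: (measurableT_comp mF (g := fun y => (tnth x i, y))); exact: measurable_pair1.
rewrite ge0_sume_distrr; last by move=> j _; rewrite mule_ge0// lee_fin invr_ge0.
by apply: eq_bigr => j _; rewrite muleA -EFinM expr2.
Qed.

End empirical_integrals.

(** * The Gibbs measure relative to the product measure *)

Lemma gibbs_has_density d (T : measurableType d) (R : realType)
    (vol : {measure set T -> \bar R}) (U : T -> R) (P : probability T R) :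
  measurable_fun setT U -> is_gibbs vol U P -> exists2 z : R, 0 < z &
  has_density P vol (fun x => z * expR (- U x)).
Proof.
move=> mU [/andP[Z0 Zoo] PE].
have mexp : measurable_fun setT (fun x => expR (- U x)).
  by apply: measurableT_comp => //; exact: measurableT_comp.
have z0 : 0 < (fine (partition_function vol U))^-1 by rewrite invr_gt0 fine_gt0// Z0.
exists (fine (partition_function vol U))^-1 => //; split.
- exact: measurable_funM.
- by move=> x; rewrite mulr_ge0 ?expR_ge0// ltW.
- move=> A mA; rewrite PE// -ge0_integralZl//; last by rewrite lee_fin ltW.
  by apply/measurable_EFinP/measurable_funTS.
Qed.

Section particle_density.
Context (R : realType) (k : ambient) (d N : nat).
Local Notation X := (state_space R k d).
Variables (V : X -> R) (W : X -> X -> R) (m : probability X R) (M : probability (N.-tuple X) R).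
Hypotheses (N0 : (0 < N)%N) (mV : measurable_fun setT V) (mW : measurable_kernel W)
  (Wsym : symmetric_kernel W) (mw : measurable_fun setT (fun x => \int[m]_z W x z))
  (mE : measurable_fun setT (@reduced_energy R k d (reduced_kernel W m) N)).
Hypotheses (m_gibbs : is_gibbs (@space_volume R k d) (mean_field_potential V W m) m)
  (M_gibbs : is_gibbs (@config_volume R k d N) (@particle_energy _ _ R V W N) M).
Local Notation E := (@reduced_energy R k d (reduced_kernel W m) N).

(** Insert [W x y = W_* x y + w x + w y - <W, m^2>]: the linear terms join [V] and form the
    mean-field potential. *)
Lemma particle_energyE (x : N.-tuple X) : particle_energy V W x =
  E x + \sum_i mean_field_potential V W m (tnth x i) - N%:R / 2 * pairing W m m.
Proof.
have Nn : N%:R != 0 :> R by rewrite pnatr_eq0 -lt0n.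
rewrite /particle_energy Rintegral_empirical// pairing_empirical// mulVKf//.
pose w y := \int[m]_z W y z; set c := pairing W m m.
have WstE y z : reduced_kernel W m y z = W y z - w y - w z + c.
  by congr (_ - _ - _ + _); apply: eq_Rintegral => u _; exact: Wsym.
have sumE : \sum_i \sum_j reduced_kernel W m (tnth x i) (tnth x j) =
    \sum_i \sum_j W (tnth x i) (tnth x j) - 2 * N%:R * \sum_i w (tnth x i) + N%:R ^+ 2 * c.
  transitivity (\sum_(i < N) (\sum_(j < N) W (tnth x i) (tnth x j) - N%:R * w (tnth x i)
      - \sum_(j < N) w (tnth x j) + N%:R * c)).
    apply: eq_bigr => i _; rewrite (eq_bigr (fun j => W (tnth x i) (tnth x j) - w (tnth x i) - w (tnth x j) + c)).
      rewrite big_split/= sumrB sumrB; congr (_ - _ - _ + _).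
        by rewrite sumr_const card_ord mulr_natl.
      by rewrite sumr_const card_ord mulr_natl.
    by move=> j _; exact: WstE.
  rewrite big_split/= sumrB sumrB -mulr_sumr !sumr_const card_ord.
  rewrite -(mulr_natl (\sum_j _)) -(mulr_natl (N%:R * c)).
  move: (\sum_i _) (\sum_i _) => a b; ring.
rewrite /reduced_energy sumE.
have -> : \sum_i mean_field_potential V W m (tnth x i) = \sum_i V (tnth x i) + \sum_i w (tnth x i).
  by rewrite -big_split.
rewrite -/c; move: (\sum_i \sum_j W (tnth x i) (tnth x j)) (\sum_i V (tnth x i)) (\sum_i w (tnth x i)) => a b e.
by field.
Qed.

(** Since [m] is a fixed point, the mean-field factors of the particle weight make up the density of
    the product measure; the reduced energy and constants remain. *)
Lemma particle_density : exists2 kappa : R, 0 < kappa &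
  has_density M (tensor_prob m N) (fun x => kappa * expR (- E x)).
Proof.
have mmf : measurable_fun setT (mean_field_potential V W m) by exact: measurable_funD.
have mP : measurable_fun setT (@particle_energy _ _ R V W N).
  rewrite (_ : @particle_energy _ _ R V W N = fun x => E x +
    \sum_i mean_field_potential V W m (tnth x i) - N%:R / 2 * pairing W m m); last first.
    by apply/funext => x; exact: particle_energyE.
  apply: measurable_funB => //; apply: measurable_funD => //.
  by apply: measurable_sum => i; exact: (measurableT_comp mmf (measurable_tnth i)).
have [z z0 md] := gibbs_has_density mmf m_gibbs.
have [z' z'0 Md] := gibbs_has_density mP M_gibbs.
have mNd : has_density (tensor_prob m N) (@config_volume R k d N)
    (fun x => \prod_i (z * expR (- mean_field_potential V W m (tnth x i)))).
  exact: has_density_tensor md.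
(* Both normalising constants and the constant term of [particle_energyE]. *)
pose kappa := z' * expR (N%:R / 2 * pairing W m m) * z ^- N.
have kappa0 : 0 < kappa by rewrite !mulr_gt0 ?expR_gt0// invr_gt0 exprn_gt0.
exists kappa => //.
have mexp : measurable_fun setT (fun x : N.-tuple X => kappa * expR (- E x)).
  by apply: measurable_funM => //; apply: measurableT_comp => //; exact: measurableT_comp.
split=> // [x|A mA]; first by rewrite mulr_ge0 ?expR_ge0// ltW.
have [_ _ ->//] := Md.
rewrite [RHS](_ : _ = \int[tensor_prob m N]_x (\1_A x * (kappa * expR (- E x)))%:E)%E; last first.
  rewrite [LHS]integral_mkcond; apply: eq_integral => x _; rewrite patchE [\1_A x]indicE.
  by case: ifPn; rewrite ?mul1r// mul0r.
rewrite (ge0_integral_density mNd); last 2 first.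
- by apply/measurable_EFinP; apply: measurable_funM => //; exact: measurable_indic.
- move=> x; rewrite lee_fin; apply: mulr_ge0; first by rewrite indicE.
  by apply: mulr_ge0; [exact: ltW|exact: expR_ge0].
rewrite [LHS]integral_mkcond; apply: eq_integral => x _; rewrite patchE [\1_A x]indicE.
case: ifPn => _; last by rewrite !mul0r -EFinM mul0r.
rewrite mul1r -EFinM; congr EFin; rewrite big_split/= prodr_const card_ord.
rewrite -expR_sum particle_energyE /kappa sumrN !opprD opprK !expRD.
move: (expR _) (expR _) (expR _) => a b c.
by field; rewrite expf_neq0// gt_eqF.
Qed.

End particle_density.

(** * Change of reference measure in the entropy *)

Section change_of_base.
Context d (T : measurableType d) (R : realType).
Variables (P M : probability T R) (kappa : R) (E : T -> R).
Hypotheses (kappa0 : 0 < kappa) (mE : measurable_fun setT E)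
  (MP : has_density M P (fun x => kappa * expR (- E x))).
Local Notation g := (fun x => kappa * expR (- E x)).

Let P1 : P setT = 1%E := probability_setT P.
Let gi : L1 P g. Proof. exact: has_density_L1 MP. Qed.
Let g1 : \int[P]_x g x = 1. Proof. exact: has_density_integral1 MP. Qed.
Let gp x : 0 < g x. Proof. by rewrite mulr_gt0// expR_gt0. Qed.
Let lng x : ln (g x) = ln kappa - E x.
Proof. by rewrite lnM ?posrE ?expR_gt0// expRK. Qed.

(** Jensen's inequality, in the form [ln g <= g - 1] integrated against [P]. *)
Lemma ln_partition_le : L1 P E -> ln kappa <= \int[P]_x E x.
Proof.
move=> Ei; rewrite -subr_le0 -{1}(Rint_cst P1 (ln kappa)) -RintB//; last exact: L1_cst.
have -> : 0 = \int[P]_x (g x - 1) :> R by rewrite RintB// ?g1 ?Rint_cst ?subrr//; exact: L1_cst.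
apply: le_Rint; [apply: L1B => //; exact: L1_cst|apply: L1B => //; exact: L1_cst|].
move=> x; rewrite -lng; have h : -1 < g x - 1 by have := gp x; lra.
by have := le_ln1Dx h; rewrite addrC subrK.
Qed.

Variables (nu : probability T R) (h : T -> R).
Hypotheses (nuh : has_density nu M h) (phih : L1 M (fun x => phi (h x))) (Ei : L1 nu E).

Let mg : measurable_fun setT g. Proof. by case: MP. Qed.

Lemma density_base : has_density nu P (fun x => h x * g x).
Proof.
have [mh h0 nuE] := nuh; split=> [|x|A mA]; first exact: measurable_funM.
  by rewrite mulr_ge0// ltW.
rewrite nuE//.
rewrite [LHS](_ : _ = \int[M]_x (\1_A x * h x)%:E)%E; last first.
  rewrite [LHS]integral_mkcond; apply: eq_integral => x _; rewrite patchE indicE.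
  by case: ifPn; rewrite ?mul1r// mul0r.
rewrite (ge0_integral_density MP); last 2 first.
- by apply/measurable_EFinP; apply: measurable_funM => //; exact: measurable_indic.
- by move=> x; rewrite lee_fin mulr_ge0// indicE.
rewrite [RHS]integral_mkcond; apply: eq_integral => x _; rewrite patchE indicE.
by case: ifPn => _; rewrite ?mul1r ?mul0r -?EFinM// mul0r.
Qed.

(** Pointwise, [phi (h g)] is [phi h] weighted by [g], plus [ln g] weighted by [h g], plus terms of
    total mass zero. Each piece is integrable, so no infinite quantities are subtracted. *)
Lemma entropy_base : L1 P (fun x => phi (h x * g x)) /\
  \int[P]_x phi (h x * g x) = \int[M]_x phi (h x) + ln kappa - \int[nu]_x E x.
Proof.
have [mh h0 _] := nuh; have nuP := density_base; have nu1 := probability_setT nu.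
have mphi : measurable_fun setT (fun x => phi (h x)) by exact: measurable_fun_phi.
have mlE : measurable_fun setT (fun x => ln kappa - E x) by exact: measurable_funB.
have i1 := (L1_density MP mphi).1 phih.
have lEi : L1 nu (fun x => ln kappa - E x) by apply: L1B => //; exact: L1_cst.
have i2 := (L1_density nuP mlE).1 lEi.
have pw x : phi (h x * g x) = phi (h x) * g x + (ln kappa - E x) * (h x * g x) - g x + 1.
  have [->|hn] := eqVneq (h x) 0; first by rewrite /phi !mul0r; ring.
  have hp : 0 < h x by rewrite lt_neqAle eq_sym hn h0.
  by rewrite /phi lnM ?posrE// lng; ring.
have i12 := L1D i1 i2; have i3 := L1B i12 gi; have i4 := L1D i3 (L1_cst P1 1).
split; first by rewrite (funext pw).
rewrite (eq_Rintegral _ (fun x _ => pw x)) RintD//; last exact: L1_cst.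
rewrite RintB// RintD// Rint_cst// g1 subrK -(Rintegral_density MP mphi).
rewrite -(Rintegral_density nuP mlE) RintB//; last exact: L1_cst.
by rewrite Rint_cst// addrA.
Qed.

End change_of_base.

(** * Moments of the product measure and the entropy inequality *)

Section tensor_moment.
Context (R : realType) (k : ambient) (d N : nat).
Local Notation X := (state_space R k d).
Variable m : probability X R.
Hypothesis mP : P2 m.

Lemma tensor_moment : finite_moment config_dist config_origin 2 (tensor_prob m N).
Proof.
have mn : measurable_fun setT (fun y : X => (space_norm y ^+ 2)%:E).
  by apply/measurable_EFinP/measurable_funX; exact: measurable_space_norm.
rewrite /finite_moment/=.
rewrite (eq_integral (fun x : N.-tuple X => \sum_i (space_norm (tnth x i) ^+ 2)%:E)%E); last first.
  by move=> x _; rewrite config_norm_sqr sumEFin.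
rewrite ge0_integral_sum//.
- apply/lte_sum_pinfty => i _.
  rewrite (ge0_integral_tensor1 m i mn) => [|x]; last by rewrite lee_fin sqr_ge0.
  exact: mP.
- by move=> i; exact: (measurableT_comp mn (measurable_tnth i)).
- by move=> i x _; rewrite lee_fin sqr_ge0.
Qed.

End tensor_moment.

Section entropy_estimate.
Context (R : realType) (k : ambient) (d N : nat).
Local Notation X := (state_space R k d).
Variables (V : X -> R) (W : X -> X -> R) (m : probability X R)
  (M : probability (N.-tuple X) R) (MW LW rho delta eps : R).
Hypotheses (V_C2 : potential_C2 V) (W_C2 : kernel_C2 W) (W_sym : symmetric_kernel W)
  (mW : measurable_kernel W) (mP : P2 m)
  (m_gibbs : is_gibbs (@space_volume R k d) (mean_field_potential V W m) m)
  (M_gibbs : is_gibbs (@config_volume R k d N) (@particle_energy _ _ R V W N) M)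
  (MW0 : 0 <= MW) (LW0 : 0 <= LW) (rho0 : 0 < rho) (delta0 : 0 < delta) (delta1 : delta <= 1)
  (N0 : (0 < N)%N) (W_dec : decomposable MW LW W) (T2 : talagrand space_dist origin rho m)
  (coercive : forall nu, P2 nu ->
       (delta%:E * relative_entropy nu m <= free_energy W m nu)%E)
  (eps0 : 0 < eps).
Local Notation w := (fun x => \int[m]_z W x z).
Local Notation Wst := (reduced_kernel W m).
Local Notation E := (@reduced_energy R k d Wst N).

Let lW : R := LW / rho.
Let dN : R := (1 - eps) * delta - (1 + (MW + lW) / (eps * delta)) * (2 * lW / N%:R).
Let C0 : R := (1 + (MW + lW) / (eps * delta)) * (MW + 2 * lW * d%:R).
Let m1 : m setT = 1%E := probability_setT m.

(** By [entropy_base] the entropy relative to the product is that relative to [M], plus [ln kappa],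
    minus the mean energy. The energy inequality cancels the mean energy, and [ln kappa] is bounded
    separately. *)
Lemma entropy_estimate (nu : probability (N.-tuple X) R) (h : N.-tuple X -> R) :
  finite_moment config_dist config_origin 2 nu -> has_density nu M h ->
  L1 M (fun x => phi (h x)) ->
  exists f, [/\ has_density nu (tensor_prob m N) f, L1 (tensor_prob m N) (fun x => phi (f x)) &
    dN * (\int[tensor_prob m N]_x phi (f x)) <=
    \int[M]_x phi (h x) + C0 + (MW + 2 * lW * d%:R)].
Proof.
move=> nuP nuh phih.
have [Kp [Bp [Qp [Km [Bm [Qm [cp [lp [cm [lm [[sKp Kp0] [sKm Km0] WK [cp0 cm0 lp0 lm0]
  [cpm lpm torus]]]]]]]]]]]] := decomposable_split W_dec LW0.
have Wo := decomposable_section mP W_dec.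
have ip x := split_section sKp x mP; have im x := split_section sKm x mP.
have [KKp _ _] := split_integrable sKp mP mP; have [KKm _ _] := split_integrable sKm mP mP.
have KE : centered origin W = fun x y => Kp x y - Km x y.
  by apply/funext => x; apply/funext => y; exact: WK.
have WstE x y : Wst x y = reduced_kernel Kp m x y - reduced_kernel Km m x y.
  rewrite (reduced_kernel_centered W_sym Wo); last 2 first.
  - by move=> u; rewrite KE; exact: L1B.
  - by rewrite KE; exact: L1B.
  have sw K B Q c l : split_kernel K B Q c l -> L1 m (fun z => K z y).
    move=> sK; have [[KC _] _ _ _] := sK.
    by rewrite (_ : (fun z => _) = K y); [exact: (split_section sK y mP)|apply/funext => z; exact: KC].
  have jp := sw _ _ _ _ _ sKp; have jm := sw _ _ _ _ _ sKm.
  rewrite KE /reduced_kernel /pairing (RintB (ip x) (im x)) (RintB jp jm) (RintB KKp KKm).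
  by move: (\int[_]_z _) (\int[_]_z _) (\int[_]_z _) (\int[_]_z _) (\int[_]_z _) (\int[_]_z _) => *; ring.
have [rp rpE] := pairing_reduced mP sKp mP mP; have [rm rmE] := pairing_reduced mP sKm mP mP.
have WstF : (fun z : X * X => Wst z.1 z.2) =
    fun z => reduced_kernel Kp m z.1 z.2 - reduced_kernel Km m z.1 z.2.
  by apply/funext => z; exact: WstE.
have mWst : measurable_kernel Wst.
  by rewrite /measurable_kernel WstF; exact: L1_measurable (L1B rp rm).
have pWst (mu : probability X R) : P2 mu ->
    pairing Wst mu mu = form Kp mu m - form Km mu m.
  move=> muP; have [pp _] := pairing_reduced mP sKp muP muP; have [pm _] := pairing_reduced mP sKm muP muP.
  rewrite -(pairing_reduced_form mP sKp muP) -(pairing_reduced_form mP sKm muP) /pairing WstF.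
  exact: RintB.
have coer mu f : P2 mu -> has_density mu m f -> L1 m (fun x => phi (f x)) ->
    delta * (\int[m]_x phi (f x)) <=
    \int[m]_x phi (f x) + 2^-1 * (form Kp mu m - form Km mu m).
  move=> muP muf phif; have := coercive muP; rewrite /free_energy pWst//.
  by rewrite (relative_entropyE muf m1) -EFin_Rintegral// -EFinM -EFinD lee_fin.
(* [w] is recovered from the potentials of the two centered kernels, measurable by Fubini, and from
   a section of [W]. *)
have mw : measurable_fun setT w.
  have [wp _] := potential_pairing mP sKp mP; have [wm _] := potential_pairing mP sKm mP.
  rewrite (_ : w = fun x => \int[m]_z Kp x z - \int[m]_z Km x z + (W origin x + (\int[m]_z W origin z - W origin origin))).
    apply: measurable_funD; first by apply: measurable_funB; [exact: L1_measurable wp|exact: L1_measurable wm].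
    by apply: measurable_funD => //; exact: L1_measurable Wo.
  apply/funext => x; have pm := L1B (ip x) (im x).
  have WE z : W x z = Kp x z - Km x z + W origin z + (W origin x - W origin origin).
    by rewrite -WK /centered /D2 (W_sym origin x); ring.
  rewrite (eq_Rintegral _ (fun z _ => WE z)) RintD; [|exact: L1D|exact: L1_cst].
  by rewrite RintD// RintB// Rint_cst//; ring.
have [Ap Ap0 hAp] := reduced_kernel_growth mP sKp lp0.
have [Am Am0 hAm] := reduced_kernel_growth mP sKm lm0.
have WstA x y : `|Wst x y| <= (Ap + Am) * (1 + space_norm x ^+ 2 + space_norm y ^+ 2).
  by rewrite WstE mulrDl (le_trans (ler_normB _ _))// lerD.
have [_ Ei] := L1_reduced_energy mWst WstA nuP.
have [mNij mNE] := L1_reduced_energy mWst WstA (tensor_moment N mP).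
have mE : measurable_fun setT E := L1_measurable Ei.
have [kappa kappa0 MD] := particle_density N0 (measurable_potential V_C2) mW W_sym mw mE m_gibbs M_gibbs.
have [fi fE] := entropy_base kappa0 mE MD nuh phih Ei.
have nuf := density_base kappa0 MD nuh.
exists (fun x => h x * (kappa * expR (- E x))); split=> //.
have := @energy_inequality R k d m rho MW LW delta eps N rho0 MW0 LW0 delta0 delta1 eps0 N0 T2 mP W
  _ _ _ _ _ _ cp lp cm lm sKp sKm Kp0 Km0 cp0 cm0 lp0 lm0 cpm lpm torus coer W_C2 W_sym WK WstE mw
  nu _ nuf fi Ei.
(* [ln kappa] is at most the mean energy under the product. Distinct particles contribute nothing,
   as the reduced kernel has zero pairing with [m] twice; the diagonal is a gap at [nu = m], where
   the entropy vanishes. *)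
have : ln kappa <= MW + 2 * lW * d%:R.
  apply: le_trans (ln_partition_le kappa0 MD mNE) _.
  have Nn : N%:R != 0 :> R by rewrite pnatr_eq0 -lt0n.
  pose D := \int[m]_x Wst x x.
  have mWd : measurable_fun setT (fun x => Wst x x).
    by apply: (measurableT_comp mWst (g := fun x => (x, x))); exact: measurable_fun_pair.
  have diag i : \int[tensor_prob m N]_x Wst (tnth x i) (tnth x i) = D.
    have [_ e] := transfer_Rintegral (measurable_tnth i)
      (fun F mF F0 => esym (ge0_integral_tensor1 m i mF F0)) mWd.
    exact: esym e.
  have offdiag i j : i != j -> \int[tensor_prob m N]_x Wst (tnth x i) (tnth x j) = 0.
    move=> ij.
    have mg : measurable_fun setT (fun x : N.-tuple X => (tnth x i, tnth x j)).
      by apply/measurable_fun_pairP; split; exact: measurable_tnth.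
    have [_ e] := transfer_Rintegral mg (fun F mF F0 => esym (ge0_integral_tensor2 m ij mF F0)) mWst.
    apply: etrans (esym e) _; rewrite -/(pairing Wst m m) pWst// /form; ring.
  have -> : \int[tensor_prob m N]_x E x = 2^-1 * D.
    rewrite /reduced_energy RintZ; last by apply: L1_sum => i; exact: L1_sum.
    rewrite Rint_sum; last by move=> i; exact: L1_sum.
    rewrite (eq_bigr (fun=> D)); last first.
      move=> i _; rewrite Rint_sum// (bigD1 i)//= diag big1 ?addr0// => j ji.
      by rewrite offdiag// eq_sym.
    by rewrite sumr_const card_ord -mulr_natl; field.
  have one1 : has_density m m (cst 1 : X -> R).
    by split=> // A mA; rewrite [RHS]integral1.
  have phi1E : (fun x : X => phi ((cst 1 : X -> R) x)) = fun=> 0 by apply/funext => x /=; exact: phi1.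
  have phi1i : L1 m (fun x : X => phi ((cst 1 : X -> R) x)) by rewrite phi1E; exact: L1_cst.
  have H1 : \int[m]_x phi ((cst 1 : X -> R) x) = 0 by rewrite phi1E Rint_cst.
  have := gap_sum_le rho0 T2 mP sKp sKm lp0 lm0 cpm lpm torus mP one1 phi1i.
  rewrite H1 mulr0 addr0.
  have [_ gp] := diagonal_gapE mP sKp; have [_ gm] := diagonal_gapE mP sKm.
  have gm0 : 0 <= \int[m]_x Km x x - pairing Km m m.
    by rewrite gm mulr_ge0 ?invr_ge0//; apply: Rint_ge0 => z; exact: (square_nonneg_D2 sKm).
  have dK K B Q c l : split_kernel K B Q c l -> L1 m (fun x => reduced_kernel K m x x) /\
      \int[m]_x reduced_kernel K m x x = \int[m]_x K x x - pairing K m m.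
    move=> sK; have Kd := split_diagonal sK mP; have [wi we] := potential_pairing mP sK mP.
    have RE x : reduced_kernel K m x x = K x x - \int[m]_z K x z - \int[m]_z K x z + pairing K m m.
      exact: (reduced_split m sK).
    have i2 := L1B (L1B Kd wi) wi.
    split; first by rewrite (funext RE); apply: L1D => //; exact: L1_cst.
    rewrite (eq_Rintegral _ (fun x _ => RE x)) RintD//; last exact: L1_cst.
    by rewrite RintB ?RintB//; [rewrite we Rint_cst//; ring|exact: L1B].
  have [dpi dp] := dK _ _ _ _ _ sKp; have [dmi dm] := dK _ _ _ _ _ sKm.
  have DE : D = (\int[m]_x Kp x x - pairing Kp m m) - (\int[m]_x Km x x - pairing Km m m).
    by rewrite -dp -dm -RintB//; apply: eq_Rintegral => x _; exact: WstE.
  rewrite DE; move: gm0; move: (_ - pairing Kp m m) (_ - pairing Km m m) => u v v0.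
  by rewrite -/lW => uv; lra.
rewrite fE -/lW -/dN -/C0 => hk hE; move: hE; rewrite mulrBl mul1r.
by move: (dN * _) => z; lra.
Qed.

End entropy_estimate.

(** * Finite mixtures and restrictions *)

Section finite_mixture.
Context d (T : measurableType d) (R : realType) (J : finType).
Variables (a : J -> R) (P : J -> probability T R) (j0 : J).
Hypothesis pa : pmf a.

Let a0 j : 0 <= a j. Proof. exact: pa.1. Qed.
Let nj (n : nat) : J := nth j0 (enum J) n.

Let mixture : set T -> \bar R := msum (fun n => mscale (NngNum (a0 (nj n))) (P (nj n))) #|J|.

HB.instance Definition _ := Measure.on mixture.

Let sum_nj (F : J -> \bar R) : (\sum_(n < #|J|) F (nj n) = \sum_j F j)%E.
Proof. by rewrite -[RHS]big_enum/= (big_nth j0) -cardE big_mkord. Qed.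

Let mixtureE A : mixture A = (\sum_j (a j)%:E * P j A)%E.
Proof. by rewrite /mixture /msum -(sum_nj (fun j => (a j)%:E * P j A)%E). Qed.

Let mixture1 : mixture setT = 1%E.
Proof.
rewrite mixtureE; under eq_bigr do rewrite probability_setT mule1.
by rewrite sumEFin pa.2.
Qed.

HB.instance Definition _ := Measure_isProbability.Build _ _ _ mixture mixture1.

Lemma exists_finite_mixture : exists M : probability T R,
  forall F : T -> \bar R, measurable_fun setT F -> (forall x, 0 <= F x)%E ->
    (\int[M]_x F x = \sum_j (a j)%:E * \int[P j]_x F x)%E.
Proof.
exists mixture => F mF F0; rewrite ge0_integral_measure_sum//.
rewrite -(sum_nj (fun j => (a j)%:E * \int[P j]_x F x)%E).
by apply: eq_bigr => n _; rewrite ge0_integral_mscale.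
Qed.

End finite_mixture.

(** [Q] is [P] conditioned on [A]. With the factor [P A] on the left the formula also covers null
    sets, for which any law will do. *)
Lemma exists_restriction d (T : measurableType d) (R : realType) (P : probability T R)
    (A : set T) : measurable A -> exists Q : probability T R,
  forall F : T -> \bar R, measurable_fun setT F -> (forall x, 0 <= F x)%E ->
    ((fine (P A))%:E * \int[Q]_x F x = \int[P]_x ((\1_A x)%:E * F x))%E.
Proof.
move=> mA; set r := fine (P A); have r0 : 0 <= r by exact: fine_ge0.
have rE : P A = r%:E by rewrite fineK// fin_num_measure.
have mI : measurable_fun setT (\1_A : T -> R) by exact: measurable_indic.
have [r00|rn] := eqVneq r 0.
  exists P => F mF F0; rewrite r00 mul0e; apply/esym.
  transitivity (\int[P]_(x in A) F x)%E; last first.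
    have PA0 : P A = 0%E by rewrite rE r00.
    have mFA : measurable_fun A F by exact: measurable_funTS.
    by rewrite null_set_integral.
  rewrite [RHS]integral_mkcond; apply: eq_integral => x _; rewrite patchE indicE.
  by case: ifPn; rewrite ?mul1e// mul0e.
have rp : 0 < r by rewrite lt_neqAle eq_sym rn.
have mg : measurable_fun setT (fun x => r^-1 * \1_A x : R) by exact: measurable_funM.
have g0 x : 0 <= r^-1 * \1_A x :> R by rewrite mulr_ge0 ?invr_ge0// indicE.
have g1 : (\int[P]_x (r^-1 * \1_A x)%:E = 1)%E.
  under eq_integral do rewrite EFinM.
  rewrite ge0_integralZl//.
  - transitivity ((r^-1)%:E * r%:E)%E; last by rewrite -EFinM mulVf.
    by congr (_ * _)%E; apply: etrans (integral_indicT _ mA) rE.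
  - exact/measurable_EFinP.
  - by rewrite lee_fin invr_ge0.
have [Q Qg] := exists_density mg g0 g1; exists Q => F mF F0.
rewrite (ge0_integral_density Qg)// -ge0_integralZl//.
- by apply: eq_integral => x _; rewrite muleCA -EFinM mulrA divff// mul1r muleC.
- by apply: emeasurable_funM => //; exact/measurable_EFinP.
- by move=> x _; rewrite mule_ge0// lee_fin.
Qed.

(** * Tensorisation of transport inequalities on cells *)

Section cons_sums.
Context (R : realType) (J : finType) (n : nat).

Lemma sum_tupleS (F : n.+1.-tuple J -> R) :
  \sum_c F c = \sum_i \sum_(c : n.-tuple J) F [tuple of i :: c].
Proof.
rewrite pair_big/= (reindex (fun p : J * n.-tuple J => [tuple of p.1 :: p.2]))//=.
exists (fun t => (thead t, [tuple of behead t])) => [[i c] _|t _] /=.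
  by rewrite theadE; congr pair; exact/val_inj.
by rewrite [RHS](tuple_eta t).
Qed.

Variables (p : n.+1.-tuple J -> R) (q : J -> R).
Hypothesis pp : pmf p.

Definition head_pmf i : R := \sum_(c : n.-tuple J) p [tuple of i :: c].
Definition tail_pmf i (c : n.-tuple J) : R := p [tuple of i :: c] / head_pmf i.

Lemma head_pmfP : pmf head_pmf.
Proof.
split=> [i|]; first by rewrite sumr_ge0// => c _; exact: pp.1.
by rewrite -sum_tupleS pp.2.
Qed.

Lemma tail_pmfP i : head_pmf i != 0 -> pmf (tail_pmf i).
Proof.
move=> hn; split=> [c|]; first by rewrite divr_ge0 ?pp.1// head_pmfP.1.
by rewrite -mulr_suml divff.
Qed.

Lemma head_pmf_eq0 i (c : n.-tuple J) : head_pmf i = 0 -> p [tuple of i :: c] = 0.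
Proof.
move=> /eqP; rewrite psumr_eq0 => [|c' _]; last exact: pp.1.
by move=> /allP/(_ c); rewrite mem_index_enum => /(_ isT)/eqP.
Qed.

Hypothesis q0 : forall i, 0 <= q i.
Hypothesis pq : forall c, p c != 0 -> forall i, q (tnth c i) != 0.

Lemma head_pmf_dominated : dominated head_pmf q.
Proof.
move=> i qi; rewrite /head_pmf big1// => c _; apply/eqP; apply/negPn/negP => /pq/(_ ord0).
by rewrite tnth0 qi eqxx.
Qed.

(** The chain rule in the form suited to induction: the first particle, then all the others given
    its cell. *)
Lemma kl_cons : kl p (fun c => \prod_i q (tnth c i)) =
  kl head_pmf q + \sum_i head_pmf i * kl (tail_pmf i) (fun c => \prod_j q (tnth c j)).
Proof.
rewrite {1}/kl sum_tupleS /kl -big_split; apply: eq_bigr => i _ /=.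
have [h0|hn] := eqVneq (head_pmf i) 0.
  rewrite h0 !mul0r addr0 big1// => c _; by rewrite (head_pmf_eq0 c h0) mul0r.
rewrite {1}/head_pmf mulr_suml mulr_sumr -big_split; apply: eq_bigr => c _ /=.
have [pc|pn] := eqVneq (p [tuple of i :: c]) 0; first by rewrite /tail_pmf pc !mul0r mulr0 addr0.
have hp : 0 < head_pmf i by rewrite lt_neqAle eq_sym hn head_pmfP.1.
have pp0 : 0 < p [tuple of i :: c] by rewrite lt_neqAle eq_sym pn pp.1.
have qi : 0 < q i by rewrite lt_neqAle eq_sym q0 andbT; have := pq pn ord0; rewrite tnth0.
have qc : 0 < \prod_j q (tnth c j).
  apply: prodr_gt0 => j _; rewrite lt_neqAle eq_sym q0 andbT.
  by have := pq pn (lift ord0 j); rewrite tnthS.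
have -> : \prod_j q (tnth [tuple of i :: c] j) = q i * \prod_j q (tnth c j).
  by rewrite big_ord_recl tnth0; congr (_ * _); apply: eq_bigr => j _; rewrite tnthS.
have tE : head_pmf i * tail_pmf i c = p [tuple of i :: c] by rewrite mulrC divfK.
rewrite mulrA tE -mulrDr; congr (_ * _).
rewrite -lnM ?posrE ?divr_gt0//; congr ln; rewrite /tail_pmf.
by field; rewrite hn !gt_eqF.
Qed.

End cons_sums.

Lemma eq_indic (T T' : Type) (R : realType) (A : set T) (B : set T') x y :
  (A x <-> B y) -> \1_A x = \1_B y :> R.
Proof.
move=> AB; rewrite !indicE; have [h|h] := pselect (A x).
  by rewrite !mem_set//; exact/AB.
by rewrite !memNset// => /AB.
Qed.

Section cell_coupling.
Context d (T : measurableType d) (R : realType) (J : finType) (C : T -> J).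
Hypothesis mC : forall j, measurable [set x | C x = j].
Variables (m : probability T R) (dist : T -> T -> R) (kappa e : R).
Hypothesis md : measurable_fun setT (fun z : T * T => dist z.1 z.2).
Local Notation q := (cell_mass C m).

Definition tuple_cell n (x : n.-tuple T) : n.-tuple J := map_tuple C x.

Lemma measurable_tuple_cell n (c : n.-tuple J) : measurable [set x | tuple_cell x = c].
Proof.
rewrite (_ : [set x | _] = box (fun i => [set x | C x = tnth c i])).
  by apply: measurable_box => i; exact: mC.
apply/seteqP; split=> x /= h; first by move=> i /=; rewrite -h tnth_map.
by apply: eq_from_tnth => i; rewrite tnth_map; exact: h.
Qed.

(** The first marginal is prescribed on cells only: the later particles are conditioned on the cell
    of the first one and not on its position, which keeps the construction finite. The second
    marginal is the exact product. Each particle brings a slack [e]. *)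
Definition cell_coupling n (p : n.-tuple J -> R)
    (Th : probability (n.-tuple T * n.-tuple T)%type R) : Prop :=
  [/\ forall c, Th ([set x | tuple_cell x = c] `*` setT) = (p c)%:E,
      forall A, measurable A -> Th (setT `*` A) = tensor_prob m n A &
      (\int[Th]_z (tuple_dist dist z.1 z.2 ^+ 2)%:E <=
        (kappa * kl p (fun c => \prod_i q (tnth c i)) + n%:R * e)%:E)%E].

Hypothesis one_step : forall a, pmf a -> dominated a q ->
  exists pi : probability (T * T)%type R,
  [/\ forall j, pi ([set x | C x = j] `*` setT) = (a j)%:E,
      forall A, measurable A -> pi (setT `*` A) = m A &
      (\int[pi]_z (dist z.1 z.2 ^+ 2)%:E <= (kappa * kl a q + e)%:E)%E].

Let tuple_dist_cons n (x y : T) (s t : n.-tuple T) :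
  tuple_dist dist [tuple of x :: s] [tuple of y :: t] ^+ 2 =
  dist x y ^+ 2 + tuple_dist dist s t ^+ 2.
Proof.
rewrite !tuple_dist_sqr big_ord_recl !tnth0; congr (_ + _).
by apply: eq_bigr => i _; rewrite !tnthS.
Qed.

(** Couple the first particles by [one_step] and, given the cell of the first one, the others by
    induction. The tail couplings depend on that cell, but their second marginal does not, so the
    second marginal of the whole is again a product. *)
Lemma exists_cell_coupling n (p : n.-tuple J -> R) : pmf p ->
  (forall c, p c != 0 -> forall i, q (tnth c i) != 0) ->
  exists Th, cell_coupling p Th.
Proof.
elim: n p => [|n IH] p pp pq.
  exists (\d_([tuple], [tuple])).
  have p1 c : p c = 1.
    have := pp.2; rewrite (bigD1 c)//= big1 ?addr0// => c' /eqP; rewrite (tuple0 c) (tuple0 c')//.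
  split=> [c|A mA|].
  - rewrite /= diracE mem_set ?p1//; split=> //=.
    by rewrite (tuple0 c); exact: val_inj.
  - rewrite [RHS](_ : _ = \d_([tuple] : 0.-tuple T) A)// /= !diracE.
    have [At|At] := pselect (A [tuple]); first by rewrite !mem_set.
    by rewrite !memNset// => -[].
  - rewrite integral_dirac//; last first.
      by apply/measurable_EFinP/measurable_funX; exact: measurable_tuple_dist.
    rewrite diracT mul1e lee_fin tuple_dist_sqr big_ord0 mul0r addr0.
    by rewrite /kl big1 ?mulr0// => c _; rewrite p1 big_ord0 divr1 ln1 mulr0.
have hp := head_pmfP pp; have q0 i : 0 <= q i by exact: fine_ge0.
have [pi1 [pi1a pi1m pi1d]] := one_step hp (head_pmf_dominated pq).
pose A i : set (T * T) := [set x | C x = i] `*` setT.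
have mA i : measurable (A i) by exact: measurableX.
have pi1A i : (\int[pi1]_z (\1_(A i) z : R)%:E = (head_pmf p i)%:E)%E.
  exact: etrans (integral_indicT _ (mA i)) (pi1a i).
have [Q QE] := choice (fun i => exists_restriction pi1 (mA i)).
have fineA i : fine (pi1 (A i)) = head_pmf p i by rewrite /A pi1a.
(* For a null cell any coupling with the right second marginal will do. *)
have ThEx i : exists Th : probability (n.-tuple T * n.-tuple T)%type R,
    (head_pmf p i != 0 -> cell_coupling (tail_pmf p i) Th) /\
    forall B, measurable B -> Th (setT `*` B) = tensor_prob m n B.
  have [h0|hn] := eqVneq (head_pmf p i) 0.
    have [PQ PQE] := exists_product (tensor_prob m n) (tensor_prob m n).
    exists PQ; split=> // B mB; rewrite PQE; last exact: measurableX.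
    rewrite product_measure1E// -[RHS]mul1e; congr (_ * _)%E; exact: probability_setT.
  have [|Thi hTh] := IH _ (tail_pmfP pp hn).
    move=> c; rewrite /tail_pmf mulf_eq0 negb_or => /andP[pc _] j.
    by have := pq _ pc (lift ord0 j); rewrite tnthS.
  by exists Thi; split=> //; case: hTh.
have [Th ThP] := choice ThEx.
have [PQ PQE] := choice (fun i => exists_product (Q i) (Th i)).
have [j0 _] : exists j : J, True.
  have [//|nJ] := pselect (exists j : J, True); have := hp.2.
  by rewrite big1 => [/eqP|i _]; [rewrite eq_sym oner_eq0|case: nJ; exists i].
have [M ME] := exists_finite_mixture PQ j0 hp.
pose g (z : (T * T) * (n.-tuple T * n.-tuple T)) : n.+1.-tuple T * n.+1.-tuple T :=
  ([tuple of z.1.1 :: z.2.1], [tuple of z.1.2 :: z.2.2]).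
have mg : measurable_fun setT g.
  apply/measurable_fun_pairP; split.
    apply: (measurableT_comp (f := @cons_pair _ T n) (g := fun z => (z.1.1, z.2.1))).
      exact: measurable_cons_pair.
    apply/measurable_fun_pairP; split; first exact: measurableT_comp measurable_fst measurable_fst.
    exact: measurableT_comp measurable_fst measurable_snd.
  apply: (measurableT_comp (f := @cons_pair _ T n) (g := fun z => (z.1.2, z.2.2))).
    exact: measurable_cons_pair.
  apply/measurable_fun_pairP; split; first exact: measurableT_comp measurable_snd measurable_fst.
  exact: measurableT_comp measurable_snd measurable_snd.
have [Xi [XiA XiE]] := exists_pushforward M mg.
(* Integrals against the constructed coupling reduce to integrals against [pi1], the tail being
   integrated out cell by cell. *)
have key (F : n.+1.-tuple T * n.+1.-tuple T -> \bar R) (G : J -> T * T -> \bar R) :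
    measurable_fun setT F -> (forall z, 0 <= F z)%E ->
    (forall i z, \int[Th i]_u F (g (z, u)) = G i z)%E ->
    (\int[Xi]_z F z = \sum_i \int[pi1]_z ((\1_(A i) z)%:E * G i z))%E.
  move=> mF F0 FG; rewrite XiE// ME//; last exact: (measurableT_comp mF mg).
  apply: eq_bigr => i _; rewrite -fineA.
  have mFg : measurable_fun setT (fun z => F (g z)) by exact: (measurableT_comp mF mg).
  rewrite (eq_measure_integral (Q i \x Th i)%E); last by move=> B mB _; exact: PQE.
  rewrite fubini_tonelli1// QE; last 2 first.
  - exact: measurable_fun_fubini_tonelli_F.
  - by move=> z; apply: integral_ge0.
  by apply: eq_integral => z _; rewrite /fubini_F/= FG.
have sumA (H : T * T -> \bar R) : measurable_fun setT H -> (forall z, 0 <= H z)%E ->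
    (\sum_i \int[pi1]_z ((\1_(A i) z)%:E * H z) = \int[pi1]_z H z)%E.
  move=> mH H0; rewrite -ge0_integral_sum//; last 2 first.
  - move=> i; apply: emeasurable_funM => //; apply/measurable_EFinP; exact: measurable_indic.
  - by move=> i z _; rewrite mule_ge0// lee_fin indicE.
  apply: eq_integral => z _; rewrite (bigD1 (C z.1))//= big1 => [|i iC].
    by rewrite indicE mem_set// mul1e adde0.
  by rewrite indicE memNset ?mul0e// => -[/= E _]; rewrite E eqxx in iC.
exists Xi; split.
- move=> c; have [i0 [c' ->]] : exists i0 (c' : n.-tuple J), c = [tuple of i0 :: c'].
    by exists (thead c), [tuple of behead c]; exact: tuple_eta.
  pose B := [set x : n.+1.-tuple T | tuple_cell x = [tuple of i0 :: c']] `*` [set: n.+1.-tuple T].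
  have mB : measurable B by apply: measurableX => //; exact: measurable_tuple_cell.
  pose D := [set x : n.-tuple T | tuple_cell x = c'] `*` [set: n.-tuple T].
  have mD : measurable D by apply: measurableX => //; exact: measurable_tuple_cell.
  rewrite -/B -(integral_indicT Xi mB).
  rewrite (key _ (fun i z => ((C z.1 == i0)%:R)%:E * Th i D)%E); last 3 first.
  + by apply/measurable_EFinP; exact: measurable_indic.
  + by move=> z; rewrite lee_fin indicE.
  + move=> i z; rewrite -(integral_indicT (Th i) mD) -ge0_integralZl//; last first.
      by apply/measurable_EFinP; exact: measurable_indic.
    apply: eq_integral => u _; rewrite -EFinM; congr EFin.
    case: eqP => Cz; rewrite ?mul1r ?mul0r.
      apply: eq_indic; split=> -[/= h _]; split=> //.
        by move/(congr1 val): h => [_ h]; exact: val_inj.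
      by apply: val_inj; rewrite /= Cz -h.
    by rewrite indicE memNset// => -[/= /(congr1 val)[]].
  rewrite (bigD1 i0)//= big1 ?adde0 => [|i ii0].
    rewrite (eq_integral (fun z => (Th i0 D) * (\1_(A i0) z)%:E)%E); last first.
      move=> z _; rewrite indicE; have [Az|nA] := pselect (A i0 z); last first.
        by rewrite memNset// mul0e mule0.
      by rewrite mem_set//; case: Az => /= -> _; rewrite eqxx !mul1e mule1.
    rewrite ge0_integralZl//; last first.
      by apply/measurable_EFinP; exact: measurable_indic.
    rewrite pi1A.
    have [h0|hn] := eqVneq (head_pmf p i0) 0; first by rewrite h0 mule0 (head_pmf_eq0 pp c' h0).
    have [/(_ hn)[ThD _ _] _] := ThP i0.
    by rewrite /D ThD -EFinM /tail_pmf divfK.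
  apply: integral0_eq => z _; rewrite indicE; have [Az|nA] := pselect (A i z); last first.
    by rewrite memNset// mul0e.
  by case: Az => /= -> _; rewrite (negPf ii0) mul0e mule0.
- move=> B mB; rewrite -(integral_indicT Xi (measurableX measurableT mB)).
  pose H (y : T) : \bar R := (\int[tensor_prob m n]_t (\1_B [tuple of y :: t])%:E)%E.
  have mcons (y : T) : measurable_fun setT (fun t : n.-tuple T => [tuple of y :: t]).
    apply: (measurableT_comp (f := @cons_pair _ T n) (g := fun t => (y, t))).
      exact: measurable_cons_pair.
    exact: measurable_pair1.
  have mIB : measurable_fun setT (fun t : n.+1.-tuple T => (\1_B t : R)%:E).
    by apply/measurable_EFinP; exact: measurable_indic.
  rewrite (key _ (fun i z => H z.2)); last 3 first.
  + by apply/measurable_EFinP; apply: measurable_indic; exact: measurableX.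
  + by move=> z; rewrite lee_fin indicE.
  + move=> i z; rewrite /H -(@ge0_integral_snd _ _ _ _ _ (Th i) (tensor_prob m n)
      (fun t => (\1_B [tuple of z.2 :: t])%:E)).
    * by apply: eq_integral => u _; congr EFin; apply: eq_indic; split=> [[]|].
    * by move=> D mD; exact: (ThP i).2.
    * exact: (measurableT_comp mIB (mcons z.2)).
    * by move=> t; rewrite lee_fin indicE.
  have mH : measurable_fun setT H.
    apply: (measurable_fun_fubini_tonelli_F (m2 := tensor_prob m n)
      (fun z : T * n.-tuple T => (\1_B (cons_pair z))%:E)).
      exact: (measurableT_comp mIB (@measurable_cons_pair _ T n)).
    by move=> z; rewrite lee_fin indicE.
  have H0 y : (0 <= H y)%E by apply: integral_ge0 => t _; rewrite lee_fin indicE.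
  rewrite sumA//; last exact: (measurableT_comp mH measurable_snd).
  rewrite (@ge0_integral_snd _ _ _ _ _ pi1 m)//.
  rewrite -[RHS](integral_indicT _ mB) [RHS]ge0_integral_tensorS//.
- have mtd k : measurable_fun setT (fun z : k.-tuple T * k.-tuple T => (tuple_dist dist z.1 z.2 ^+ 2)%:E).
    by apply/measurable_EFinP/measurable_funX; exact: measurable_tuple_dist.
  pose K i := (\int[Th i]_u (tuple_dist dist u.1 u.2 ^+ 2)%:E)%E.
  have K0 i : (0 <= K i)%E by apply: integral_ge0 => u _; rewrite lee_fin sqr_ge0.
  have mdE : measurable_fun setT (fun z : T * T => (dist z.1 z.2 ^+ 2)%:E).
    by apply/measurable_EFinP; exact: measurable_funX.
  rewrite (key _ (fun i z => (dist z.1 z.2 ^+ 2)%:E + K i)%E); last 3 first.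
  + exact: mtd.
  + by move=> z; rewrite lee_fin sqr_ge0.
  + move=> i z; rewrite (eq_integral (fun u => (dist z.1 z.2 ^+ 2)%:E + (tuple_dist dist u.1 u.2 ^+ 2)%:E)%E); last first.
      by move=> u _; rewrite -EFinD tuple_dist_cons.
    rewrite ge0_integralD//; [|by move=> u _; rewrite lee_fin sqr_ge0|
      by move=> u _; rewrite lee_fin sqr_ge0|exact: mtd].
    rewrite [X in (X + _)%E = _]integral_cstr//; congr (_ + _)%E.
    by rewrite -[RHS]mule1; congr (_ * _)%E; exact: probability_setT.
  have mIA i : measurable_fun setT (fun z => (\1_(A i) z : R)%:E).
    by apply/measurable_EFinP; exact: measurable_indic.
  have -> : (\sum_i \int[pi1]_z ((\1_(A i) z)%:E * ((dist z.1 z.2 ^+ 2)%:E + K i)) =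
      \int[pi1]_z (dist z.1 z.2 ^+ 2)%:E + \sum_i K i * (head_pmf p i)%:E)%E.
    rewrite -sumA//; last by move=> z; rewrite lee_fin sqr_ge0.
    rewrite -big_split; apply: eq_bigr => i _ /=.
    rewrite -pi1A -ge0_integralZl//.
    rewrite -ge0_integralD//.
    + by apply: eq_integral => z _; rewrite ge0_muleDr ?lee_fin ?sqr_ge0// [(K i * _)%E]muleC.
    + by move=> z _; rewrite mule_ge0// lee_fin ?indicE// sqr_ge0.
    + exact: emeasurable_funM.
    + by move=> z _; rewrite mule_ge0// lee_fin indicE.
    + exact: emeasurable_funM.
  have Kle i : (K i * (head_pmf p i)%:E <= (head_pmf p i * (kappa * kl (tail_pmf p i) (fun c => \prod_j q (tnth c j)) + n%:R * e))%:E)%E.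
    have [h0|hn] := eqVneq (head_pmf p i) 0; first by rewrite h0 mule0 mul0r.
    have [/(_ hn)[_ _ h] _] := ThP i.
    by rewrite muleC EFinM lee_pmul2l// lte_fin lt_neqAle eq_sym hn hp.1.
  apply: le_trans (leeD pi1d (lee_sum _ (fun i _ => Kle i))) _.
  rewrite sumEFin -EFinD lee_fin (kl_cons pp q0 pq).
  under eq_bigr do rewrite mulrDr mulrCA.
  rewrite big_split/= -mulr_sumr -mulr_suml hp.2 mul1r -natr1.
  by rewrite le_eqVlt; apply/orP; left; apply/eqP; ring.
Qed.

End cell_coupling.

(** * Talagrand's inequality for configurations *)

Section config_talagrand.
Context (R : realType) (k : ambient) (d N : nat).
Local Notation X := (state_space R k d).
Variables (m : probability X R) (rho : R).
Hypotheses (rho0 : 0 < rho) (T2 : talagrand space_dist origin rho m) (mP : P2 m).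
Local Notation mN := (tensor_prob m N).

Lemma one_cell_coupling (J : finType) (C : X -> J) (e : R) :
  (forall j, measurable [set x | C x = j]) -> 0 < e ->
  forall a, pmf a -> dominated a (cell_mass C m) -> exists pi : probability (X * X)%type R,
  [/\ forall j, pi ([set x | C x = j] `*` setT) = (a j)%:E,
      forall A, measurable A -> pi (setT `*` A) = m A &
      (\int[pi]_z (space_dist z.1 z.2 ^+ 2)%:E <= (2 / rho * kl a (cell_mass C m) + e)%:E)%E].
Proof.
move=> mC e0 a pa aq; have [nu [nua phia klE]] := step_density mC pa aq.
have [A aA] := step_le mC m pa; have nuP := P2_bounded_density mP nua aA.
have [pi [piE i2 _ le]] := talagrand_coupling rho0 T2 nuP nua phia e0.
exists pi; split=> [j|B mB|].
- have [-> _] := piE _ (mC j); rewrite -(cell_massE mC) (cell_mass_density mC nua); congr EFin.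
  have [_ e1] := Rint_step mC m (fun i => (i == j)%:R * (a i / cell_mass C m i)).
  transitivity (\int[m]_x ((C x == j)%:R * (a (C x) / cell_mass C m (C x)))).
    apply: eq_Rintegral => x _; rewrite indicE; case: eqP => Cx.
      by rewrite mem_set// mul1r.
    by rewrite memNset// mul0r.
  rewrite e1 (bigD1 j)//= big1 ?addr0 => [|i ij]; last by rewrite (negPf ij) mul0r mulr0.
  rewrite eqxx mul1r; have [qj|qn] := eqVneq (cell_mass C m j) 0; first by rewrite (aq _ qj) mul0r mulr0.
  by rewrite mulrCA divff// mulr1.
- by have [_] := piE _ mB.
- by rewrite -EFin_Rintegral// lee_fin -klE.
Qed.

Section bounded_support.
Variables (nu : probability (N.-tuple X) R) (f : N.-tuple X -> R) (n : nat).
Hypotheses (nuf : has_density nu mN f) (phif : L1 mN (fun x => phi (f x))).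
Hypothesis fn : forall x, f x != 0 -> forall i j, - n%:R <= crd j (tnth x i) < n%:R.
Local Notation H := (\int[mN]_x phi (f x)).

(** Glue the diagonal coupling of [nu] with itself to a coupling of its cell law. Gluing displaces
    configurations within a cell only, and the cells that carry mass are inner ones, of small
    diameter. *)
Lemma bounded_config_talagrand (e : R) : 0 < e ->
  exists pi : probability (N.-tuple X * N.-tuple X)%type R, couplings nu mN pi /\
  (\int[pi]_z (config_dist z.1 z.2 ^+ 2)%:E <= (2 / rho * H + e)%:E)%E.
Proof.
move=> e0; have [mf f0 nuE] := nuf.
have kap0 : 0 < 2 / rho by rewrite divr_gt0.
have H0 : 0 <= H by apply: Rint_ge0 => x; exact: phi_ge0.
have kH0 : 0 <= 2 / rho * H by rewrite mulr_ge0// ltW.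
set K := 2 / rho * H in kH0 *.
(* The slack [e] is split in three: [tau] covers the factor [1 + tau] of Young's inequality on the
   main term, [e1] the slacks of the particles, [eta] the mesh. *)
pose tau := e / (3 * (K + e)).
have D0 : 0 < 3 * (K + e) by rewrite mulr_gt0// ltr_wpDl.
have tau0 : 0 < tau by rewrite divr_gt0.
have tauE : tau * (K) <= e / 3.
  rewrite /tau mulrAC ler_pdivrMr// (_ : e / 3 * _ = e * (K + e)); last by field.
  by rewrite ler_pM2l// lerDl ltW.
have tau1 : tau <= 1.
  by rewrite /tau ler_pdivrMr// mul1r; lra.
pose e1 := e / (6 * N.+1%:R); have e10 : 0 < e1 by rewrite divr_gt0// mulr_gt0// ltr0n.
have e1E : (1 + tau) * (N%:R * e1) <= e / 3.
  have h1 : N%:R * e1 <= e / 6.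
    rewrite /e1 mulrA ler_pdivrMr ?mulr_gt0 ?ltr0n//.
    rewrite (_ : e / 6 * _ = N.+1%:R * e); last by field.
    by rewrite ler_pM2r// ler_nat.
  have h0 : 0 <= N%:R * e1 by rewrite mulr_ge0// ltW.
  by nra.
pose B := (1 + tau^-1) * (2 * (N%:R * d%:R)); have B0 : 0 <= B.
  by rewrite !mulr_ge0// ?addr_ge0// ?invr_ge0 ltW.
pose s := (Num.bound (3 * (B + 1) / e)).+1; have s0 : (0 < s)%N by [].
pose eta : R := s%:R^-1; have eta0 : 0 < eta by rewrite invr_gt0 ltr0n.
have etaE : B * eta ^+ 2 <= e / 3.
  have eta1 : eta <= 1 by rewrite /eta invf_le1 ?ltr0n// ler1n.
  have h : 3 * (B + 1) / e <= s%:R.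
    apply: ltW; apply: lt_le_trans (archi_boundP _) _; last by rewrite ler_nat.
    by rewrite divr_ge0// ?(ltW e0)// mulr_ge0// addr_ge0.
  have h2 : 3 * (B + 1) * eta <= e.
    rewrite /eta ler_pdivrMr ?ltr0n//; move: h; rewrite ler_pdivrMr// mulrC; lra.
  have h3 : B * eta ^+ 2 <= B * eta by rewrite ler_wpM2l// expr2 ler_piMr// ltW.
  have : B * eta <= (B + 1) * eta by rewrite ler_wpM2r ?lerDl// ltW.
  by move: h2; rewrite -mulrA; lra.
pose C (x : X) := cell_of (@crd R k d) n s x.
have mC j : measurable [set x | C x = j] by apply: measurable_cell_of => // i; exact: measurable_crd.
have mCN c := measurable_tuple_cell mC (n := N) c.
pose p := cell_mass (@tuple_cell _ _ _ C N) nu; have pp : pmf p by exact: cell_mass_pmf.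
have qNE c : cell_mass (@tuple_cell _ _ _ C N) mN c = \prod_i cell_mass C m (tnth c i).
  apply: EFin_inj; rewrite (cell_massE mCN).
  have -> : [set x | @tuple_cell _ _ _ C N x = c] = box (fun i => [set x | C x = tnth c i]).
    apply/seteqP; split=> x /= h; first by move=> i /=; rewrite -h tnth_map.
    by apply: eq_from_tnth => i; rewrite tnth_map; exact: h.
  apply: etrans (tensor_prob_box m (fun i => mC (tnth c i))) _.
  by rewrite -prodEFin; apply: eq_bigr => i _; rewrite -(cell_massE mC).
have pdom c : p c != 0 -> forall i, cell_mass C m (tnth c i) != 0.
  move=> pn i; apply: contra pn => /eqP qi; apply/eqP/(cell_mass_dominated mCN nuf).
  by rewrite qNE (bigD1 i)//= qi mul0r.
have [Th [Thp Thm Thc]] := exists_cell_coupling mC (@measurable_space_dist R k d)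
  (one_cell_coupling mC e10) pp pdom.
have klle : kl p (fun c => \prod_i cell_mass C m (tnth c i)) <= H.
  rewrite (_ : (fun c => _) = cell_mass (@tuple_cell _ _ _ C N) mN); last by apply/funext => c; rewrite qNE.
  exact: (kl_data_processing mCN nuf phif).
have mdiag : measurable_fun setT (fun x : N.-tuple X => (x, x)) by exact: measurable_fun_pair.
have [pi1 [pi1A pi1E]] := exists_pushforward nu mdiag.
pose c (x : N.-tuple X) : nat := pickle (tuple_cell C x).
have cell_c x : c @^-1` [set c x] = [set y | tuple_cell C y = tuple_cell C x].
  by apply/seteqP; split=> y /= => [/(pcan_inj pickleK)|h]; [|rewrite /c h].
have mcell j : measurable (c @^-1` [set j]).
  have [[x <-]|nj] := pselect (exists x, c x = j); first by rewrite cell_c; exact: mCN.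
  by rewrite (_ : _ @^-1` _ = set0)//; apply/seteqP; split=> // x /= h; case: nj; exists x.
have mc : measurable_fun setT c by apply: measurable_fun_countable => j; exact: mcell.
have pi1c j : pi1 (setT `*` c @^-1` [set j]) = nu (c @^-1` [set j]).
  rewrite pi1A; last exact: measurableX.
  by congr (nu _); apply/seteqP; split=> x //= [].
have same j : pi1 (setT `*` c @^-1` [set j]) = Th (c @^-1` [set j] `*` setT).
  rewrite pi1c; have [[x <-]|nj] := pselect (exists x, c x = j).
    by rewrite cell_c Thp (cell_massE mCN).
  by rewrite (_ : c @^-1` _ = set0) ?set0X ?measure0//; apply/seteqP; split=> // x /= h; case: nj; exists x.
have [pi [piA1 piA2 pile]] := gluing mc same.
exists pi; split=> [A mA|].
  split; last by rewrite piA2// Thm.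
  rewrite piA1// pi1A; last exact: measurableX.
  by congr (nu _); apply/seteqP; split=> x //= [].
have mcd := @measurable_config_dist R k d N.
have [cd0 cdd cdC cdT] := @config_dist_is_dist R k d N.
pose G1 (z : N.-tuple X * N.-tuple X) : R :=
  (1 + tau^-1) * (2 * config_dist z.1 z.2 ^+ 2 + 2 * (N%:R * d%:R * eta ^+ 2)).
pose G2 (z : N.-tuple X * N.-tuple X) : R := (1 + tau) * config_dist z.1 z.2 ^+ 2.
have ti0 : 0 <= 1 + tau^-1 by rewrite addr_ge0// invr_ge0 ltW.
have mG1 : measurable_fun setT G1.
  by apply: measurable_funM => //; apply: measurable_funD => //;
    apply: measurable_funM => //; exact: measurable_funX.
have mG2 : measurable_fun setT G2 by apply: measurable_funM => //; exact: measurable_funX.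
apply: (le_trans (pile (fun z => config_dist z.1 z.2 ^+ 2) G1 G2 _ mG1 mG2 _ _ _ _)).
- exact: measurable_funX.
- by move=> z; exact: sqr_ge0.
- move=> z; apply: mulr_ge0 => //; apply: addr_ge0; first by rewrite mulr_ge0// sqr_ge0.
  by rewrite !mulr_ge0// ltW.
- by move=> z; rewrite mulr_ge0 ?sqr_ge0// addr_ge0// ltW.
- move=> x z z' y czz mass.
  have tz : tuple_cell C z = tuple_cell C z' := pcan_inj pickleK czz.
  (* A cell of positive mass contains a configuration where [f] is nonzero, so all its particle
     cells are inner. *)
  have [x0 [x0z fx0]] : exists x0, tuple_cell C x0 = tuple_cell C z /\ f x0 != 0.
    apply: contrapT => nx; move/negP: mass; apply; apply/eqP.
    rewrite pi1c cell_c nuE// (eq_integral (fun=> 0%E)) ?integral0// => u; rewrite inE /= => uz.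
    by congr EFin; apply: contrapT => /eqP fu; apply: nx; exists u.
  have zz : config_dist z z' <= Num.sqrt N%:R * (Num.sqrt d%:R * eta).
    apply: config_dist_le => [|i]; first by rewrite mulr_ge0 ?sqrtr_ge0// ltW.
    apply: space_dist_le => [|j]; first exact: ltW.
    have Ci : C (tnth z i) = C (tnth z' i).
      by have := congr1 (fun t => tnth t i) tz; rewrite !tnth_map.
    have C0 : C (tnth x0 i) = C (tnth z i).
      by have := congr1 (fun t => tnth t i) x0z; rewrite !tnth_map.
    have good : inner_cell (C (tnth z i)).
      by rewrite -C0 /C inner_cellE//; apply/forallP => l; exact: fn.
    exact: (cell_mesh s0 j Ci good).
  have h1 := sqr_dist_triangle x z' y (@config_dist_is_dist R k d N) (t := tau^-1).
  rewrite invrK invr_gt0 in h1; have {}h1 := h1 tau0.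
  have h2 := sqr_dist_triangle x z z' (@config_dist_is_dist R k d N) ltr01.
  rewrite invr1 in h2.
  have h3 : config_dist z z' ^+ 2 <= N%:R * d%:R * eta ^+ 2.
    have -> : N%:R * d%:R * eta ^+ 2 = (Num.sqrt N%:R * (Num.sqrt d%:R * eta)) ^+ 2.
      by rewrite !exprMn !sqr_sqrtr// mulrA.
    by rewrite ler_sqr ?nnegrE// ?mulr_ge0 ?sqrtr_ge0// ltW.
  apply: le_trans h1 _; rewrite /G1 /G2 /= lerD2r ler_wpM2l//.
  by apply: le_trans h2 _; rewrite (_ : 1 + 1 = 2)// lerD2l ler_wpM2l.
rewrite pi1E; [|exact/measurable_EFinP|move=> z; rewrite lee_fin; apply: mulr_ge0 => //;
  apply: addr_ge0; [by rewrite mulr_ge0// sqr_ge0|by rewrite !mulr_ge0// ltW]].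
rewrite /G1 /G2 /=; under eq_integral do rewrite cdd expr0n mulr0 add0r.
rewrite [X in (X + _)%E](_ : _ = ((1 + tau^-1) * (2 * (N%:R * d%:R * eta ^+ 2)))%:E); last first.
  by rewrite integral_cstr// -[RHS]mule1; congr (_ * _)%E; exact: probability_setT.
under [X in (_ + X)%E]eq_integral do rewrite EFinM.
rewrite ge0_integralZl//; last 3 first.
- by apply/measurable_EFinP; exact: measurable_funX.
- by move=> z _; rewrite lee_fin sqr_ge0.
- by rewrite lee_fin addr_ge0// ltW.
apply: (@le_trans _ _ (((1 + tau^-1) * (2 * (N%:R * d%:R * eta ^+ 2)))%:E +
  (1 + tau)%:E * (K + N%:R * e1)%:E)%E).
  rewrite leeD2l// lee_wpmul2l ?lee_fin ?addr_ge0 ?(ltW tau0)//.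
  by apply: le_trans Thc _; rewrite lee_fin lerD2r ler_wpM2l// ltW.
rewrite -EFinM -EFinD lee_fin.
have -> : (1 + tau^-1) * (2 * (N%:R * d%:R * eta ^+ 2)) = B * eta ^+ 2 by rewrite /B; ring.
move: etaE tauE e1E; move: (B * eta ^+ 2) (N%:R * e1) => u v hu hz hv.
rewrite mulrDr (mulrDl 1 tau K) mul1r; lra.
Qed.

End bounded_support.

Let crd_box (n : nat) : set (N.-tuple X) :=
  box (fun=> [set x : X | forall j, - n%:R <= crd j x < n%:R]).

Lemma measurable_crd_box n : measurable (crd_box n).
Proof.
apply: measurable_box => _.
rewrite (_ : [set x | _] = \bigcap_j (@crd R k d j @^-1` `[- n%:R, n%:R[%classic)).
  apply: fin_bigcap_measurable => // j _; rewrite -[X in measurable X]setTI.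
  by apply: measurable_crd => //; exact: measurable_itv.
apply/seteqP; split=> x /= h j; first by move=> _; rewrite /= in_itv; exact: h.
by have := h j I; rewrite /= in_itv.
Qed.

Lemma crd_box_near x : \forall n \near \oo, crd_box n x.
Proof.
pose B : R := \sum_i \sum_j `|crd j (tnth x i)|.
have B0 : 0 <= B by rewrite sumr_ge0// => i _; rewrite sumr_ge0.
have Bij i j : `|crd j (tnth x i)| <= B.
  rewrite /B (bigD1 i)//= (bigD1 j)//= -addrA lerDl addr_ge0// sumr_ge0// => l _.
  by rewrite sumr_ge0.
exists (Num.bound B) => // n /= Bn i j.
have {}Bn : B < n%:R by rewrite (lt_le_trans (archi_boundP B0))// ler_nat.
have := le_lt_trans (Bij i j) Bn; rewrite ltr_norml => /andP[h ->].
by rewrite ltW.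
Qed.

(** Use the previous coupling for [nu] conditioned on a large box, and couple the remaining mass
    independently with the product: finite second moments make the cost of the latter vanish in the
    limit. *)
Lemma config_talagrand (nu : probability (N.-tuple X) R) (f : N.-tuple X -> R) (e : R) :
  has_density nu mN f -> L1 mN (fun x => phi (f x)) ->
  finite_moment config_dist config_origin 2 nu -> 0 < e ->
  exists pi : probability (N.-tuple X * N.-tuple X)%type R, couplings nu mN pi /\
  (\int[pi]_z (config_dist z.1 z.2 ^+ 2)%:E <= (2 / rho * (\int[mN]_x phi (f x)) + e)%:E)%E.
Proof.
move=> nuf phif nuP e0; have [mf f0 _] := nuf.
pose P : probability (N.-tuple X) R := mN; have P1 := probability_setT P.
have fi : L1 P f := has_density_L1 nuf; have nu1 := probability_setT nu.
pose nrm2 (x : N.-tuple X) : R := config_dist x config_origin ^+ 2.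
have mcd := @measurable_config_dist R k d N.
have mn : measurable_fun setT nrm2.
  apply: measurable_funX.
  by apply: (measurableT_comp mcd (g := fun x => (x, config_origin))); exact: measurable_pair2.
have nrm0 x : 0 <= nrm2 x by exact: sqr_ge0.
have ni : L1 nu nrm2 by exact: L1_ge0.
have Pi : L1 P nrm2 by apply: L1_ge0 => //; exact: tensor_moment.
pose A := crd_box; have mA n : measurable (A n) := measurable_crd_box n.
pose M2 := \int[P]_x nrm2 x.
pose r n : R := \int[P]_x (\1_(A n) x * f x).
pose a n : R := \int[P]_x (\1_(A n) x * phi (f x)).
pose p n : R := \int[P]_x \1_(A n) x.
pose b n : R := \int[nu]_x (\1_(A n) x * nrm2 x).
have rc : r n @[n --> \oo] --> (1 : R).
  have <- : \int[P]_x f x = 1 := has_density_integral1 nuf.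
  by apply: cvg_Rint_indic => //; exact: crd_box_near.
have ac : a n @[n --> \oo] --> \int[P]_x phi (f x).
  by apply: cvg_Rint_indic => //; exact: crd_box_near.
have pc : p n @[n --> \oo] --> (1 : R).
  rewrite -(Rint_cst P1 1).
  have h : \int[P]_x (\1_(A n) x * 1) @[n --> \oo] --> \int[P]_x (1 : R).
    by apply: cvg_Rint_indic => //; [exact: crd_box_near|exact: L1_cst].
  by apply: cvg_trans h; apply: near_eq_cvg; apply: nearW => n;
    apply: eq_Rintegral => x _; rewrite mulr1.
have bc : b n @[n --> \oo] --> \int[nu]_x nrm2 x.
  by apply: cvg_Rint_indic => //; exact: crd_box_near.
(* The cost of the mixture: [r n] times the bound for the conditioned law, then twice the second
   moments carried by the remaining mass, of [nu] and of the product. *)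
pose u n := 2 / rho * (a n + r n - p n - r n * ln (r n)) + r n * (e / 4)
  + 2 * (\int[nu]_x nrm2 x - b n) + 2 * ((1 - r n) * M2).
have uc : u n @[n --> \oo] --> 2 / rho * (\int[P]_x phi (f x) + 1 - 1 - 1 * ln 1) + 1 * (e / 4)
    + 2 * (\int[nu]_x nrm2 x - \int[nu]_x nrm2 x) + 2 * ((1 - 1) * M2).
  have lnc : ln (r n) @[n --> \oo] --> ln (1 : R).
    by apply: continuous_cvg => //; exact: continuous_ln.
  apply: cvgD; last first.
    by apply: cvgM; [exact: cvg_cst|apply: cvgM; [apply: cvgB => //; exact: cvg_cst|exact: cvg_cst]].
  apply: cvgD; last by apply: cvgM; [exact: cvg_cst|apply: cvgB => //; exact: cvg_cst].
  apply: cvgD; last by apply: cvgM => //; exact: cvg_cst.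
  apply: cvgM; first exact: cvg_cst.
  apply: cvgB; last exact: cvgM.
  by apply: cvgB => //; exact: cvgD.
move: uc; rewrite ln1 (_ : _ + 2 * ((1 - 1) * M2) = 2 / rho * (\int[P]_x phi (f x)) + e / 4); last by ring.
move=> uc.
have ulim : 2 / rho * (\int[P]_x phi (f x)) + e / 4 < 2 / rho * (\int[P]_x phi (f x)) + e.
  by rewrite ltrD2l; lra.
have [n [rn un]] : exists n, 0 < r n /\ u n < 2 / rho * (\int[P]_x phi (f x)) + e.
  have h1 : \forall n \near \oo, 0 < r n by exact: (cvgr_gt _ rc).
  have h2 : \forall n \near \oo, u n < 2 / rho * (\int[P]_x phi (f x)) + e.
    by apply: (cvgr_lt _ uc).
  case: h1 => n1 _ h1; case: h2 => n2 _ h2; exists (maxn n1 n2).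
  by split; [exact: (h1 _ (leq_maxl _ _))|exact: (h2 _ (leq_maxr _ _))].
have [nuA [nuAf nuAnu]] := exists_conditioned nuf (mA n) rn.
have [phiA entA] := phi_conditioned nuf (mA n) rn phif.
have e4 : 0 < e / 4 by rewrite divr_gt0.
have [|pi [piE pile]] := bounded_config_talagrand (n := n) nuAf phiA _ e4.
  move=> x fx i j; have [Ax|nA] := pselect (A n x); first exact: Ax.
  by rewrite indicE memNset// mul0r mulr0 eqxx in fx.
rewrite entA in pile.
have mAc : measurable (~` A n) by exact: measurableC.
have [Q QE] := exists_restriction nu mAc.
have indC x : \1_(~` A n) x = 1 - \1_(A n) x :> R.
  by rewrite !indicE in_setC; case: (_ \in _); rewrite /= ?subrr ?subr0.
have rE : fine (nu (~` A n)) = 1 - r n.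
  have -> : r n = fine (nu (A n)).
    rewrite -(_ : \int[nu]_x \1_(A n) x = fine (nu (A n))); last by rewrite /Rintegral integral_indicT.
    by rewrite (Rintegral_density nuf)//; exact: measurable_indic.
  have AF : nu (A n) \is a fin_num by exact: fin_num_measure.
  have h : nu (~` A n) = (1 - nu (A n))%E by exact: probability_setC.
  by rewrite h fineB.
have rn01 : 0 <= 1 - r n <= 1.
  by rewrite -rE fine_ge0// -lee_fin fineK ?fin_num_measure// probability_le1.
have [PQ PQE] := exists_product Q mN.
have [Mx [MxA MxE]] := exists_mixture pi PQ rn01.
exists Mx; rewrite opprB addrCA subrr addr0 in MxA MxE.
have PQint (F : N.-tuple X * N.-tuple X -> \bar R) : measurable_fun setT F -> (forall z, 0 <= F z)%E ->
    (\int[PQ]_z F z = \int[Q \x P]_z F z)%E.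
  by move=> mF F0; apply: eq_measure_integral => B mB _; exact: PQE.
split=> [B mB|].
  have mBT : measurable (B `*` [set: N.-tuple X]) by exact: measurableX.
  have mTB : measurable ([set: N.-tuple X] `*` B) by exact: measurableX.
  have [E1 E2] := piE _ mB.
  have mI : measurable_fun setT (fun x : N.-tuple X => (\1_B x : R)%:E).
    by apply/measurable_EFinP; exact: measurable_indic.
  have I0 (x : N.-tuple X) : (0 <= (\1_B x : R)%:E)%E by rewrite lee_fin indicE.
  have PQ1 : PQ (B `*` setT) = Q B.
    rewrite PQE// product_measure1E// -[RHS]mule1; congr (_ * _)%E; exact: probability_setT.
  have PQ2 : PQ (setT `*` B) = mN B.
    rewrite PQE// product_measure1E// -[RHS]mul1e; congr (_ * _)%E; exact: probability_setT.
  split.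
    rewrite MxA// E1 PQ1 -(integral_indicT nuA mB) -(integral_indicT Q mB).
    rewrite -rE QE//.
    have mIA : measurable_fun setT (fun x : N.-tuple X => ((r n)^-1 * \1_(A n) x)%:E).
      by apply/measurable_EFinP; apply: measurable_funM => //; exact: measurable_indic.
    have mIAc : measurable_fun setT (fun x : N.-tuple X => (\1_(~` A n) x : R)%:E).
      by apply/measurable_EFinP; exact: measurable_indic.
    have E3 : ((r n)%:E * \int[nuA]_x (\1_B x)%:E =
        \int[nu]_x ((r n)%:E * ((\1_B x)%:E * ((r n)^-1 * \1_(A n) x)%:E)))%E.
      rewrite (ge0_integral_density nuAnu)// ge0_integralZl//; try exact: emeasurable_funM.
        by move=> x _; rewrite -EFinM lee_fin !mulr_ge0 ?invr_ge0 ?(ltW rn)// indicE.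
      by rewrite lee_fin ltW.
    rewrite E3.
    rewrite -ge0_integralD//; try by move=> x _; rewrite -!EFinM lee_fin !mulr_ge0 ?invr_ge0 ?(ltW rn)// indicE.
    2,3: by repeat apply: emeasurable_funM => //.
    rewrite -[RHS](integral_indicT nu mB); apply: eq_integral => x _.
    rewrite -!EFinM -EFinD; congr EFin; rewrite indC (mulrCA (r n)) mulVKf ?gt_eqF//; ring.
  by rewrite MxA// E2 PQ2 -ge0_muleDl ?lee_fin ?(ltW rn)//; [rewrite -EFinD addrC subrK mul1e|case/andP: rn01].
have mcd2 : measurable_fun setT (fun z : N.-tuple X * N.-tuple X => (config_dist z.1 z.2 ^+ 2)%:E).
  by apply/measurable_EFinP; exact: measurable_funX.
rewrite MxE//; last by move=> z; rewrite lee_fin sqr_ge0.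
have PQle : ((1 - r n)%:E * \int[PQ]_z (config_dist z.1 z.2 ^+ 2)%:E <=
    (2 * (\int[nu]_x nrm2 x - b n) + 2 * ((1 - r n) * M2))%:E)%E.
  pose G (z : N.-tuple X * N.-tuple X) : \bar R := ((2 * nrm2 z.1)%:E + (2 * nrm2 z.2)%:E)%E.
  have mfs : measurable_fun setT (fun z : N.-tuple X * N.-tuple X => (2 * nrm2 z.1)%:E).
    by apply/measurable_EFinP/measurable_funM => //; exact: (measurableT_comp mn measurable_fst).
  have msn : measurable_fun setT (fun z : N.-tuple X * N.-tuple X => (2 * nrm2 z.2)%:E).
    by apply/measurable_EFinP/measurable_funM => //; exact: (measurableT_comp mn measurable_snd).
  apply: (@le_trans _ _ ((1 - r n)%:E * \int[PQ]_z G z)%E).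
    apply: lee_wpmul2l; first by rewrite lee_fin; case/andP: rn01.
    apply: ge0_le_integral => //.
    - by move=> z _; rewrite lee_fin sqr_ge0.
    - exact: emeasurable_funD.
    - move=> z _; rewrite /G -EFinD lee_fin.
      have [_ _ cdC _] := @config_dist_is_dist R k d N.
      have := sqr_dist_triangle z.1 config_origin z.2 (@config_dist_is_dist R k d N) ltr01.
      by rewrite invr1 (cdC config_origin) /nrm2 (_ : 1 + 1 = 2).
  rewrite /G ge0_integralD//; last 2 first.
  - by move=> z _; rewrite lee_fin mulr_ge0.
  - by move=> z _; rewrite lee_fin mulr_ge0.
  rewrite (PQint _ mfs) ?(PQint _ msn); last 2 first.
  - by move=> z; rewrite lee_fin mulr_ge0.
  - by move=> z; rewrite lee_fin mulr_ge0.
  have m2 : measurable_fun setT (fun x : N.-tuple X => (2 * nrm2 x)%:E).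
    by apply/measurable_EFinP; exact: measurable_funM.
  rewrite -(@ge0_integral_prod_fst _ _ _ _ _ Q P _ m2); last by move=> z; rewrite lee_fin mulr_ge0.
  rewrite -(@ge0_integral_prod_snd _ _ _ _ _ Q P _ m2); last by move=> z; rewrite lee_fin mulr_ge0.
  rewrite ge0_muleDr; last 2 first.
  - by apply: integral_ge0 => z _; rewrite lee_fin mulr_ge0.
  - by apply: integral_ge0 => z _; rewrite lee_fin mulr_ge0.
  rewrite -{1}rE QE//; last by move=> z; rewrite lee_fin mulr_ge0.
  have iA := L1_indicM mAc ni; have i2 := L1Z 2 iA.
  rewrite (eq_integral (fun x => (2 * (\1_(~` A n) x * nrm2 x))%:E)); last first.
    by move=> x _; rewrite -EFinM mulrCA.
  rewrite -(EFin_Rintegral i2) -(EFin_Rintegral (L1Z 2 Pi)) -EFinM -EFinD lee_fin.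
  rewrite RintZ// RintZ// -/M2 (mulrCA (1 - r n)) lerD2r ler_pM2l//.
  rewrite /b -RintB//; last exact: L1_indicM.
  rewrite le_eqVlt; apply/orP; left; apply/eqP; apply: eq_Rintegral => x _.
  by rewrite indC; ring.
apply: (@le_trans _ _ ((r n)%:E * (2 / rho * ((r n)^-1 * (a n + r n - p n) - ln (r n)) + e / 4)%:E +
   (2 * (\int[nu]_x nrm2 x - b n) + 2 * ((1 - r n) * M2))%:E)%E).
  by apply: leeD => //; apply: lee_wpmul2l => //; rewrite lee_fin ltW.
rewrite -EFinM -EFinD lee_fin; apply: le_trans (ltW un).
rewrite le_eqVlt; apply/orP; left; apply/eqP; rewrite /u.
move: rn; move: (r n) (a n) (p n) (b n) => r' a' p' b' rn.
by field; rewrite !gt_eqF.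
Qed.

End config_talagrand.

(** * From the defective entropy inequality to the transport inequality *)

Section transport_bound.
Context d (T : measurableType d) (R : realType).
Variables (dist : T -> T -> R) (o : T) (P M : probability T R) (a kappa C : R).
Hypotheses (distP : is_dist dist) (md : measurable_fun setT (fun z : T * T => dist z.1 z.2)).
Hypotheses (a0 : 0 < a) (kappa0 : 0 < kappa) (C0 : 0 <= C).
Hypothesis PP : finite_moment dist o 2 P.
Hypothesis cells : forall eta : R, 0 < eta -> exists2 c : T -> nat, measurable_fun setT c &
  forall x y, c x = c y -> dist x y <= eta.
Hypothesis entropy_le : forall (nu : probability T R) h, finite_moment dist o 2 nu -> has_density nu M h ->
  L1 M (fun x => phi (h x)) -> exists f, [/\ has_density nu P f, L1 P (fun x => phi (f x)) &
    a * (\int[P]_x phi (f x)) <= \int[M]_x phi (h x) + C].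
Hypothesis talagrandP : forall (nu : probability T R) f (e : R), has_density nu P f -> L1 P (fun x => phi (f x)) ->
  finite_moment dist o 2 nu -> 0 < e -> exists pi : probability (T * T)%type R,
  couplings nu P pi /\
  (\int[pi]_z (dist z.1 z.2 ^+ 2)%:E <= (kappa * (\int[P]_x phi (f x)) + e)%:E)%E.

Let d0 x y : 0 <= dist x y. Proof. by case: distP. Qed.
Let dxx x : dist x x = 0. Proof. by case: distP. Qed.
Let dC x y : dist x y = dist y x. Proof. by case: distP. Qed.
Let M1 : M setT = 1%E := probability_setT M.
Let mn : measurable_fun setT (fun x => dist x o).
Proof. by apply: (measurableT_comp md (g := fun x => (x, o))); exact: measurable_pair2. Qed.
Let md2 : measurable_fun setT (fun z : T * T => (dist z.1 z.2 ^+ 2)%:E).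
Proof. by apply/measurable_EFinP; exact: measurable_funX. Qed.
Let mn2 : measurable_fun setT (fun x => (dist x o ^+ 2)%:E).
Proof. by apply/measurable_EFinP; exact: measurable_funX. Qed.

(** Entropy relative to [M] controls that relative to [P] up to the defect [C], and the latter
    controls transport to [P]. As [C] remains even for [nu = M], this is not the final bound for
    [nu]. *)
Lemma coupling_reference (nu : probability T R) h e : finite_moment dist o 2 nu ->
  has_density nu M h -> L1 M (fun x => phi (h x)) -> 0 < e ->
  exists pi : probability (T * T)%type R, couplings nu P pi /\
  (\int[pi]_z (dist z.1 z.2 ^+ 2)%:E <= (kappa / a * (\int[M]_x phi (h x) + C) + e)%:E)%E.
Proof.
move=> nuP nuh phih e0; have [f [nuf phif le]] := entropy_le nuP nuh phih.
have [pi [piE pile]] := talagrandP nuf phif nuP e0; exists pi; split=> //.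
apply: le_trans pile _; rewrite lee_fin lerD2r -mulrA ler_pM2l//.
by rewrite mulrC ler_pdivlMr// mulrC.
Qed.

(** The normalised parts of [h - 1] are only known to have finite entropy. Conditioned on balls they
    have finite moments, which [coupling_reference] bounds uniformly; monotone convergence
    concludes. *)
Lemma finite_entropy_moment (nu : probability T R) h : has_density nu M h ->
  L1 M (fun x => phi (h x)) -> finite_moment dist o 2 nu.
Proof.
move=> nuh phih; have [mh h0 _] := nuh; have hi := has_density_L1 nuh.
pose A (n : nat) := [set x | dist x o <= n%:R].
have mA n : measurable (A n).
  rewrite (_ : A n = (fun x => dist x o) @^-1` `]-oo, n%:R]%classic).
    by rewrite -[X in measurable X]setTI; apply: mn => //; exact: measurable_itv.
  by apply/seteqP; split=> x /=; rewrite in_itv.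
have An x : \forall n \near \oo, A n x.
  exists (Num.bound (dist x o)) => // n /= xn; rewrite /A /=.
  by rewrite (le_trans (ltW (archi_boundP (d0 x o))))// ler_nat.
pose r n : R := \int[M]_x (\1_(A n) x * h x).
pose b n : R := \int[M]_x (\1_(A n) x * phi (h x)).
pose p n : R := \int[M]_x \1_(A n) x.
have rc : r n @[n --> \oo] --> (1 : R).
  by have <- : \int[M]_x h x = 1 := has_density_integral1 nuh; exact: cvg_Rint_indic.
have bc : b n @[n --> \oo] --> \int[M]_x phi (h x) by exact: cvg_Rint_indic.
have pc : p n @[n --> \oo] --> (1 : R).
  rewrite -(Rint_cst M1 1).
  have e : \int[M]_x (\1_(A n) x * 1) @[n --> \oo] --> \int[M]_x (1 : R).
    by apply: cvg_Rint_indic => //; exact: L1_cst.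
  by apply: cvg_trans e; apply: near_eq_cvg; apply: nearW => n;
    apply: eq_Rintegral => x _; rewrite mulr1.
pose u n := (r n)^-1 * (b n + r n - p n) - ln (r n).
have uc : u n @[n --> \oo] --> 1^-1 * (\int[M]_x phi (h x) + 1 - 1) - ln (1 : R).
  have rV : (r n)^-1 @[n --> \oo] --> (1^-1 : R) by apply: cvgV => //; rewrite oner_eq0.
  have lnc : ln (r n) @[n --> \oo] --> ln (1 : R).
    by apply: continuous_cvg => //; exact: continuous_ln.
  apply: cvgB => //; apply: cvgM => //.
  by apply: cvgB => //; apply: cvgD.
move: uc; rewrite ln1 invr1 mul1r addrK subr0 => uc.
set H := \int[M]_x phi (h x) in uc bc.
have HH1 : H < H + 1 by rewrite ltrDl.
have e1 : \forall n \near \oo, 0 < r n by exact: (cvgr_gt _ rc).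
have e2 : \forall n \near \oo, u n < H + 1 by apply: (cvgr_lt _ uc).
have [n0 hn0] : exists n0, forall n, (n0 <= n)%N -> 0 < r n /\ u n < H + 1.
  case: e1 => n1 _ h1; case: e2 => n2 _ h2; exists (maxn n1 n2) => n /= nn.
  by split; [apply: h1; rewrite /= (leq_trans (leq_maxl _ _) nn)|
    apply: h2; rewrite /= (leq_trans (leq_maxr _ _) nn)].
pose Mo := \int[P]_x (dist x o ^+ 2).
have Moi : L1 P (fun x => dist x o ^+ 2).
  by apply: L1_ge0 => //; [exact: measurable_funX|move=> x; exact: sqr_ge0].
(* Twice the cost of a coupling with [P] plus twice the moment of [P]; the two unit terms are the
   slacks in the entropy and in the coupling. *)
pose B : R := 2 * (kappa / a * (H + 1 + C) + 1) + 2 * Mo.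
have mI n : measurable_fun setT (fun x => (\1_(A n) x : R)%:E).
  by apply/measurable_EFinP; exact: measurable_indic.
have bound n : (n0 <= n)%N -> (\int[nu]_x ((\1_(A n) x)%:E * (dist x o ^+ 2)%:E) <= B%:E)%E.
  move=> nn; have [rn un] := hn0 _ nn.
  have [nuA [nuAh nuAnu]] := exists_conditioned nuh (mA n) rn.
  have [phiA entA] := phi_conditioned nuh (mA n) rn phih.
  have r1 : r n <= 1.
    rewrite -(has_density_integral1 nuh); apply: le_Rint => //; first exact: L1_indicM.
    by move=> x; rewrite indicE; case: (_ \in _); rewrite ?mul1r ?mul0r.
  have EA : (\int[nu]_x ((\1_(A n) x)%:E * (dist x o ^+ 2)%:E) =
      (r n)%:E * \int[nuA]_x (dist x o ^+ 2)%:E)%E.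
    have mIr : measurable_fun setT (fun x => ((r n)^-1 * \1_(A n) x)%:E).
      by apply/measurable_EFinP; apply: measurable_funM => //; exact: measurable_indic.
    rewrite (ge0_integral_density nuAnu)//; try by move=> x; rewrite lee_fin sqr_ge0.
    rewrite -ge0_integralZl//; try exact: emeasurable_funM;
      try (by rewrite lee_fin ltW);
      try (by move=> x _; rewrite -EFinM lee_fin !mulr_ge0 ?sqr_ge0 ?invr_ge0 ?(ltW rn)// indicE).
    apply: eq_integral => x _; rewrite -!EFinM; congr EFin.
    by rewrite (mulrCA (r n)) mulVKf ?gt_eqF// mulrC.
  have nuAP : finite_moment dist o 2 nuA.
    rewrite /finite_moment/= (ge0_integral_density nuAnu)//; try by move=> x; rewrite lee_fin sqr_ge0.
    have ci : L1 nu (fun x => n%:R ^+ 2 * (r n)^-1 : R) := L1_cst (probability_setT nu) _.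
    have := L1_lty ci; apply: le_lt_trans; apply: ge0_le_integral => //.
    - by move=> x _; rewrite -EFinM lee_fin !mulr_ge0 ?sqr_ge0 ?invr_ge0 ?(ltW rn)// indicE.
    - by apply: emeasurable_funM => //; apply/measurable_EFinP; apply: measurable_funM.
    - move=> x _; rewrite -EFinM lee_fin ger0_norm ?mulr_ge0 ?sqr_ge0 ?invr_ge0 ?(ltW rn)//.
      have [Ax|nAx] := pselect (A n x); rewrite indicE.
        rewrite mem_set// mulr1 ler_wpM2r ?invr_ge0 ?(ltW rn)// ler_sqr ?nnegrE//; exact: d0.
      by rewrite memNset// !mulr0 mulr_ge0 ?sqr_ge0 ?invr_ge0 ?(ltW rn).
  have [pi [piE pile]] := coupling_reference nuAP nuAh phiA ltr01.
  have Ale : (\int[nuA]_x (dist x o ^+ 2)%:E <= B%:E)%E.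
    rewrite (coupling_fst piE mn2); last by move=> x; rewrite lee_fin sqr_ge0.
    apply: (@le_trans _ _ (\int[pi]_z (2%:E * (dist z.1 z.2 ^+ 2)%:E + 2%:E * (dist z.2 o ^+ 2)%:E))%E).
      apply: ge0_le_integral => //.
      - by move=> z _; rewrite lee_fin sqr_ge0.
      - exact: (measurableT_comp mn2 measurable_fst).
      - apply: emeasurable_funD; first exact: emeasurable_funM.
        by apply: emeasurable_funM => //; exact: (measurableT_comp mn2 measurable_snd).
      - move=> z _; rewrite -!EFinM -EFinD lee_fin.
        by have := sqr_dist_triangle z.1 z.2 o distP ltr01; rewrite invr1 (_ : 1 + 1 = 2).
    have mn2s : measurable_fun setT (fun z : T * T => (dist z.2 o ^+ 2)%:E).
      exact: (measurableT_comp mn2 measurable_snd).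
    rewrite ge0_integralD//; try (by move=> z _; rewrite -EFinM lee_fin mulr_ge0// sqr_ge0);
      try exact: emeasurable_funM.
    rewrite !ge0_integralZl//; try (by move=> z _; rewrite lee_fin sqr_ge0).
    rewrite -(coupling_snd piE mn2); last by move=> x; rewrite lee_fin sqr_ge0.
    have i2 : L1 pi (fun z => dist z.1 z.2 ^+ 2).
      apply: L1_ge0 => [|z|]; [exact: measurable_funX|exact: sqr_ge0|].
      exact: le_lt_trans pile (ltry _).
    move: pile; rewrite -(EFin_Rintegral Moi) -(EFin_Rintegral i2) -/Mo -!EFinM -EFinD !lee_fin.
    move=> pile; rewrite /B lerD2r ler_pM2l//; apply: le_trans pile _.
    rewrite lerD2r ler_wpM2l ?divr_ge0 ?(ltW a0) ?(ltW kappa0)// lerD2r.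
    by rewrite entA; exact: ltW un.
  rewrite EA; apply: le_trans Ale; rewrite -[X in (_ <= X)%E]mul1e.
  apply: lee_wpmul2r; last by rewrite lee_fin.
  by apply: integral_ge0 => x _; rewrite lee_fin sqr_ge0.
rewrite /finite_moment/=; apply: (@le_lt_trans _ _ B%:E); last exact: ltry.
pose g n x := ((\1_(A n) x)%:E * (dist x o ^+ 2)%:E)%E : \bar R.
have mg n : measurable_fun setT (g n) by exact: emeasurable_funM.
have g0 n x : setT x -> (0 <= g n x)%E by move=> _; rewrite /g -EFinM lee_fin mulr_ge0 ?sqr_ge0// indicE.
have gnd x : setT x -> nondecreasing_seq (g^~ x).
  move=> _ n l nl; rewrite /g -!EFinM lee_fin ler_wpM2r ?sqr_ge0// !indicE.
  have [An'|nAn] := pselect (A n x); last by rewrite memNset.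
  rewrite mem_set// mem_set//; apply: le_trans An' _; by rewrite ler_nat.
have := cvg_monotone_convergence measurableT mg g0 gnd.
have -> : (fun x => limn (g^~ x)) = fun x => (dist x o ^+ 2)%:E.
  apply/funext => x; apply/cvg_lim => //.
  apply: (@cvg_near_cst _ _ _ _ _ (@eventually_filter)).
  by apply: filterS (An x) => n Ax; rewrite /g indicE mem_set// mul1e.
move=> /(_ nu) gc; rewrite -(cvg_lim (@ereal_hausdorff R) gc).
apply: lime_le; first by apply/cvg_ex; eexists; exact: gc.
by exists n0 => // n /= nn; exact: bound.
Qed.

(** [w] is [t] times the mean displacement from one normalised part to [P] and on to the other part.
    In [w^2] the factor [t^2] turns the entropies of the parts into [8 H], namely 7 from the scaled
    bounds and 1 from [2 t^2 <= H], and the two defects [C] into [C H]. *)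
Lemma transport_entropy_coupling (nu : probability T R) h (e : R) : has_density nu M h ->
  L1 M (fun x => phi (h x)) -> 0 < e ->
  exists (pi : probability (T * T)%type R) (w : R), [/\ couplings nu M pi,
    (\int[pi]_z (dist z.1 z.2)%:E = w%:E)%E, 0 <= w &
    w ^+ 2 <= 3 * (kappa / a) * (8 + C) * (\int[M]_x phi (h x)) + e].
Proof.
move=> nuh phih e0; have [mh h0 _] := nuh; set H := \int[M]_x phi (h x).
have H0 : 0 <= H by apply: Rint_ge0 => x; exact: phi_ge0.
have ka0 : 0 < kappa / a by rewrite divr_gt0.
have mdE : measurable_fun setT (fun z : T * T => (dist z.1 z.2)%:E) by exact/measurable_EFinP.
have dE0 (z : T * T) : (0 <= (dist z.1 z.2)%:E)%E by rewrite lee_fin.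
pose t : R := 2^-1 * \int[M]_x `|h x - 1|.
have t0 : 0 <= t by rewrite mulr_ge0 ?invr_ge0//; exact: Rint_ge0.
have [t00|tn0] := eqVneq t 0.
  have [pi [piE h1]] := diagonal_coupling nuh t00; exists pi, 0; split=> //.
    by rewrite (h1 _ mdE)// => x /=; rewrite dxx.
  rewrite expr0n/=; apply: addr_ge0; last exact: ltW.
  by apply: mulr_ge0 => //; apply: mulr_ge0; [apply: mulr_ge0 => //; exact: ltW|exact: addr_ge0].
have tp : 0 < t by rewrite lt_neqAle eq_sym tn0.
have [nup [num [hp hm]]] := variation_parts nuh tp.
have [PQ PQE] := exists_product nup num.
have cPQ : couplings nup num PQ.
  move=> A mA; rewrite !PQE; try exact: measurableX.
  split; rewrite product_measure1E//; first by rewrite -[RHS]mule1; congr (_ * _)%E; exact: probability_setT.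
  by rewrite -[RHS]mul1e; congr (_ * _)%E; exact: probability_setT.
have [t1 _] := total_variation_coupling nuh tp hp hm cPQ.
have t01 : 0 < t <= 1 by rewrite tp.
pose fp x := Num.max (h x - 1) 0 / t; pose fm x := Num.max (1 - h x) 0 / t.
have fp0 x : 0 <= fp x by rewrite /fp divr_ge0// le_max lexx orbT.
have fm0 x : 0 <= fm x by rewrite /fm divr_ge0// le_max lexx orbT.
(* At each point one of the two parts vanishes and contributes [t^2 * phi 0 = t^2]. *)
have pw x : t ^+ 2 * phi (fp x) + t ^+ 2 * phi (fm x) <= 7 * phi (h x) + 2 * t ^+ 2.
  have hx0 := h0 x; rewrite /fp /fm.
  have [h1|h1] := leP 1 (h x).
    rewrite (max_idPl _) ?subr_ge0// (max_idPr _) ?subr_le0//.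
    have h2 : 0 <= h x - 1 by rewrite subr_ge0.
    have := scaled_phi_pos t01 h2; have := scaled_phi_neg t01 (u := 0).
    rewrite lexx ler01 subr0 phi1 mulr0 add0r => /(_ isT).
    by rewrite (_ : 1 + (h x - 1) = h x); [lra|ring].
  rewrite (max_idPr _) ?subr_le0 ?(ltW h1)// (max_idPl _) ?subr_ge0 ?(ltW h1)//.
  have h2 : 0 <= 1 - h x <= 1 by apply/andP; split; lra.
  have := scaled_phi_neg t01 h2; have := scaled_phi_pos t01 (lexx 0).
  rewrite addr0 phi1 mulr0 add0r.
  by rewrite (_ : 1 - (1 - h x) = h x); [lra|ring].
have part (f : T -> R) : (forall x, 0 <= f x) -> measurable_fun setT f ->
    (forall x, t ^+ 2 * phi (f x) <= 7 * phi (h x) + 2 * t ^+ 2) -> L1 M (fun x => phi (f x)).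
  move=> f0 mf fle; have i : L1 M (fun x => 7 * phi (h x) + 2 * t ^+ 2).
    by apply: L1D; [exact: L1Z|exact: L1_cst].
  apply: L1_le (L1Z (t ^+ 2)^-1 i) => [|x]; first exact: measurable_fun_phi.
  rewrite ger0_norm ?phi_ge0// mulrC ler_pdivlMr ?exprn_gt0// mulrC; exact: fle.
have [mfp _ _] := hp; have [mfm _ _] := hm.
have t20 : 0 <= t ^+ 2 by exact: sqr_ge0.
have phip : L1 M (fun x => phi (fp x)).
  apply: part => // x; apply: le_trans (pw x); rewrite lerDl mulr_ge0//; exact: phi_ge0.
have phim : L1 M (fun x => phi (fm x)).
  apply: part => // x; apply: le_trans (pw x); rewrite lerDr mulr_ge0//; exact: phi_ge0.
pose Hp := \int[M]_x phi (fp x); pose Hm := \int[M]_x phi (fm x).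
have pins : 2 * t ^+ 2 <= H := pinsker h0 (has_density_L1 nuh) (has_density_integral1 nuh) phih.
have Hpm : t ^+ 2 * (Hp + Hm) <= 8 * H.
  have i1 := L1D (L1Z (t ^+ 2) phip) (L1Z (t ^+ 2) phim).
  have i2 := L1D (L1Z 7 phih) (L1_cst M1 (2 * t ^+ 2)).
  have := le_Rint i1 i2 pw.
  rewrite (RintD (L1Z (t ^+ 2) phip) (L1Z (t ^+ 2) phim)) (RintD (L1Z 7 phih) (L1_cst M1 (2 * t ^+ 2))).
  rewrite (RintZ (t ^+ 2) phip) (RintZ (t ^+ 2) phim) (RintZ 7 phih) (Rint_cst M1) -/Hp -/Hm -/H.
  by move: pins; move: (t ^+ 2) => v; lra.
(* Three error terms follow, each multiplied by 3. *)
pose e' := e / 9; have e'0 : 0 < e' by rewrite divr_gt0.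
have [pip [pipE piple]] := coupling_reference (finite_entropy_moment hp phip) hp phip e'0.
have [pim [pimE pimle]] := coupling_reference (finite_entropy_moment hm phim) hm phim e'0.
pose eta := Num.min 1 e'; have eta0 : 0 < eta by rewrite lt_min ltr01.
have eta2 : eta ^+ 2 <= e'.
  have h1 : eta <= 1 by rewrite ge_min lexx.
  have h2 : eta <= e' by rewrite ge_min lexx orbT.
  by apply: le_trans h2; rewrite expr2 ler_piMr// ltW.
have [c mc ceta] := cells eta0.
have msw : measurable_fun setT (fun z : T * T => (z.2, z.1)).
  by apply/measurable_fun_pairP; split; [exact: measurable_snd|exact: measurable_fst].
have [pis [pisA pisE]] := exists_pushforward pim msw.
have mcell j : measurable (c @^-1` [set j]) by rewrite -[X in measurable X]setTI; exact: mc.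
have same j : pip (setT `*` c @^-1` [set j]) = pis (c @^-1` [set j] `*` setT).
  have [_ ->] := pipE _ (mcell j); rewrite pisA; last exact: measurableX.
  have [_ <-] := pimE _ (mcell j); congr (pim _).
  by apply/seteqP; split=> -[x y] /= [].
have [pi0 [pi0A pi0B pi0le]] := gluing mc same.
have pi0E : couplings nup num pi0.
  move=> A mA; rewrite pi0A// pi0B//; have [-> _] := pipE _ mA; split=> //.
  rewrite pisA; last exact: measurableX.
  have [<- _] := pimE _ mA; congr (pim _).
  by apply/seteqP; split=> -[x y] /= [].
(* The path has three legs, two transports and a displacement inside a cell:
   [(u + eta + v)^2 <= 3 (u^2 + eta^2 + v^2)]. *)
pose G1 (z : T * T) := 3 * dist z.1 z.2 ^+ 2 + 3 * eta ^+ 2; pose G2 (z : T * T) := 3 * dist z.1 z.2 ^+ 2.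
have mG2 : measurable_fun setT G2 by apply: measurable_funM => //; exact: measurable_funX.
have mG1 : measurable_fun setT G1 by exact: measurable_funD.
have G20 z : 0 <= G2 z by rewrite mulr_ge0// sqr_ge0.
have G10 z : 0 <= G1 z by rewrite addr_ge0// mulr_ge0// sqr_ge0.
have F0 (z : T * T) : 0 <= dist z.1 z.2 ^+ 2 by exact: sqr_ge0.
have mF : measurable_fun setT (fun z : T * T => dist z.1 z.2 ^+ 2) by exact: measurable_funX.
have FG x z z' y : c z = c z' -> pip (setT `*` c @^-1` [set c z]) != 0%E ->
    dist x y ^+ 2 <= G1 (x, z) + G2 (z', y).
  move=> /ceta zz _; have [_ _ _ dT] := distP; rewrite /G1 /G2 /=.
  have h1 : dist x y <= dist x z + eta + dist z' y.
    apply: le_trans (dT x z' y) _; rewrite lerD2r; apply: le_trans (dT x z z') _.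
    by rewrite lerD2l.
  apply: (@le_trans _ _ ((dist x z + eta + dist z' y) ^+ 2)).
    by rewrite ler_sqr ?nnegrE// !addr_ge0// ltW.
  move: (dist x z) (dist z' y) => u v; rewrite -subr_ge0.
  rewrite (_ : _ - _ = (u - eta) ^+ 2 + (u - v) ^+ 2 + (eta - v) ^+ 2); last by ring.
  by rewrite !addr_ge0 ?sqr_ge0.
have := pi0le _ _ _ mF mG1 mG2 F0 G10 G20 FG.
rewrite (pisE (fun z => (G2 z)%:E)); [|exact/measurable_EFinP|by move=> z; rewrite lee_fin].
have -> : (\int[pip]_z (G1 z)%:E = 3%:E * \int[pip]_z (dist z.1 z.2 ^+ 2)%:E + (3 * eta ^+ 2)%:E)%E.
  under eq_integral do rewrite EFinD EFinM.
  rewrite ge0_integralD//; try exact: emeasurable_funM;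
    try (by move=> z _; rewrite -?EFinM lee_fin mulr_ge0// sqr_ge0).
  rewrite ge0_integralZl//; try (by move=> z _; rewrite lee_fin sqr_ge0).
  congr (_ + _)%E; rewrite integral_cstr// -[RHS]mule1; congr (_ * _)%E; exact: probability_setT.
have -> : (\int[pim]_z (G2 (z.2, z.1))%:E = 3%:E * \int[pim]_z (dist z.1 z.2 ^+ 2)%:E)%E.
  rewrite -ge0_integralZl//; try (by move=> z _; rewrite lee_fin sqr_ge0).
  by apply: eq_integral => z _; rewrite /G2 /= dC EFinM.
move=> le0.
have {}le0 : (\int[pi0]_z (dist z.1 z.2 ^+ 2)%:E <=
    (3 * (kappa / a) * (Hp + Hm + 2 * C) + e)%:E)%E.
  apply: le_trans le0 _.
  have ip : L1 pip (fun z => dist z.1 z.2 ^+ 2).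
    by apply: L1_ge0 => //; exact: le_lt_trans piple (ltry _).
  have im : L1 pim (fun z => dist z.1 z.2 ^+ 2).
    by apply: L1_ge0 => //; exact: le_lt_trans pimle (ltry _).
  move: piple pimle; rewrite -(EFin_Rintegral ip) -(EFin_Rintegral im) -!EFinM -!EFinD !lee_fin.
  rewrite -/Hp -/Hm => lep lem.
  apply: (@le_trans _ _ (3 * (kappa / a * (Hp + C) + e') + 3 * e' + 3 * (kappa / a * (Hm + C) + e'))).
    by apply: lerD; [apply: lerD|]; rewrite ler_pM2l.
  by rewrite /e' le_eqVlt; apply/orP; left; apply/eqP; field; rewrite gt_eqF.
have i2 : L1 pi0 (fun z => dist z.1 z.2 ^+ 2).
  by apply: L1_ge0 => //; exact: le_lt_trans le0 (ltry _).
have [i1 sq] := sqr_Rintegral_le md i2.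
have [_ [pi [piE piF]]] := total_variation_coupling nuh tp hp hm pi0E.
exists pi, (t * \int[pi0]_z dist z.1 z.2); split=> //.
- have dE1 x : (dist (x, x).1 (x, x).2)%:E = 0%E :> \bar R by rewrite /= dxx.
  by rewrite (piF _ mdE dE0 dE1) [RHS]EFinM; congr (_ * _)%E; apply: esym; exact: (EFin_Rintegral i1).
- by rewrite mulr_ge0//; exact: Rint_ge0.
rewrite exprMn; rewrite -(EFin_Rintegral i2) lee_fin in le0.
apply: le_trans (ler_wpM2l t20 (le_trans sq le0)) _.
have t21 : t ^+ 2 <= 1 by rewrite expr_le1.
have h1 : t ^+ 2 * e <= e by rewrite ler_piMl// ltW.
have h2 : t ^+ 2 * (Hp + Hm + 2 * C) <= (8 + C) * H.
  have h3 := ler_wpM2l C0 pins; rewrite mulrDr (mulrDl 8); apply: lerD => //.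
  by rewrite mulrA (mulrC _ C) (mulrC _ 2).
rewrite mulrDr lerD// mulrCA -(mulrA (3 * (kappa / a))) ler_wpM2l//.
by apply: mulr_ge0 => //; exact: ltW.
Qed.

Lemma transport_entropy_inequality (nu : probability T R) :
  ((a / (3 * kappa * (8 + C)))%:E * wasserstein dist 1 nu M ^+ 2 <= relative_entropy nu M)%E.
Proof.
have [ro|rn] := eqVneq (relative_entropy nu M) +oo%E; first by rewrite ro leey.
have rlt : (relative_entropy nu M < +oo)%E by rewrite ltey.
have [h nuh] := density_of_dominated (relative_entropy_lty rlt).
have [mh h0 _] := nuh; have rE := relative_entropyE nuh M1.
have phih : L1 M (fun x => phi (h x)).
  apply: L1_ge0 => [|x|]; [exact: measurable_fun_phi|exact: phi_ge0|].
  by rewrite rE in rlt.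
rewrite rE -(EFin_Rintegral phih); set H := \int[M]_x phi (h x).
have c0 : 0 < 3 * kappa * (8 + C) by rewrite !mulr_gt0// ltr_wpDr.
pose S := [set (\int[pi : probability (T * T)%type R]_z (dist z.1 z.2 ^+ 1)%:E)%E | pi in couplings nu M].
have S0 : (0 <= ereal_inf S)%E.
  apply: le_ereal_inf_tmp => _ [pi _ <-].
  by apply: integral_ge0 => z _; rewrite lee_fin exprn_ge0.
have -> : wasserstein dist 1 nu M = ereal_inf S by rewrite /wasserstein invr1 poweRe1.
have near (e : R) : 0 < e -> exists2 w : R, (ereal_inf S <= w%:E)%E &
    0 <= w /\ w ^+ 2 <= 3 * (kappa / a) * (8 + C) * H + e.
  move=> e0; have [pi [w [piE wE w0 we]]] := transport_entropy_coupling nuh phih e0.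
  by exists w => //; apply: ereal_inf_lbound; exists pi => //; rewrite -wE.
have Sfin : ereal_inf S \is a fin_num.
  by rewrite ge0_fin_numE//; have [w wS _] := near _ ltr01; exact: le_lt_trans wS (ltry _).
move: S0 near; rewrite -(fineK Sfin); move: (fine _) => i; rewrite lee_fin => i0 near.
have le : i ^+ 2 <= 3 * (kappa / a) * (8 + C) * H.
  apply/ler_addgt0Pr => e /near[w]; rewrite lee_fin => iw [w0 we].
  by apply: le_trans we; rewrite ler_sqr.
rewrite -EFin_expe -EFinM lee_fin.
rewrite mulrAC ler_pdivrMr//.
apply: le_trans (ler_wpM2l (ltW a0) le) _; rewrite le_eqVlt; apply/orP; left; apply/eqP.
by field; rewrite gt_eqF.
Qed.

End transport_bound.

(** * Small cells of configurations, and conclusion *)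

Lemma config_cells (R : realType) k d N (eta : R) : 0 < eta ->
  exists2 c : N.-tuple (state_space R k d) -> nat, measurable_fun setT c &
  forall x y, c x = c y -> config_dist x y <= eta.
Proof.
move=> eta0; pose m := #|{: 'I_N * 'I_d}|.
pose feat (l : 'I_m) (x : N.-tuple (state_space R k d)) : R :=
  crd (enum_val l).2 (tnth x (enum_val l).1).
have mfeat l : measurable_fun setT (feat l).
  exact: (measurableT_comp (measurable_crd _) (measurable_tnth _)).
pose b : R := Num.sqrt N%:R * Num.sqrt d%:R.
have b0 : 0 <= b by rewrite mulr_ge0 ?sqrtr_ge0.
pose s := (Num.bound (b / eta)).+1.
have s0 : 0 < s%:R :> R by rewrite ltr0n.
have bs : b / s%:R <= eta.
  rewrite ler_pdivrMr// mulrC -ler_pdivrMr//; apply: ltW.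
  apply: (lt_le_trans (archi_boundP (divr_ge0 b0 (ltW eta0)))).
  by rewrite ler_nat.
exists (floor_cell feat s); first exact: measurable_floor_cell.
move=> x y E; apply: le_trans bs; rewrite /b -mulrA.
apply: config_dist_le => [|i]; first by rewrite mulr_ge0 ?sqrtr_ge0 ?invr_ge0// ltW.
apply: space_dist_le => [|j]; first by rewrite invr_ge0 ltW.
by have := floor_cell_mesh (ltn0Sn _) (enum_rank (i, j)) E; rewrite /feat enum_rankK.
Qed.

Lemma entropy_density d (T : measurableType d) (R : realType) (nu M : probability T R) :
  (relative_entropy nu M < +oo)%E ->
  exists h, [/\ has_density nu M h, L1 M (fun x => phi (h x)) &
    relative_entropy nu M = (\int[M]_x phi (h x))%:E].
Proof.
move=> rlt; have [h nuh] := density_of_dominated (relative_entropy_lty rlt).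
have [mh h0 _] := nuh; have rE := relative_entropyE nuh (probability_setT M).
have phih : L1 M (fun x => phi (h x)).
  apply: L1_ge0 => [|x|]; [exact: measurable_fun_phi|exact: phi_ge0|].
  by rewrite rE in rlt.
by exists h; split=> //; rewrite rE (EFin_Rintegral phih).
Qed.

Theorem corollary2 (R : realType) (k : ambient) (d N : nat)
    (V : state_space R k d -> R) (W : state_space R k d -> state_space R k d -> R)
    (mstar : probability (state_space R k d) R)
    (mNstar : probability (N.-tuple (state_space R k d)) R)
    (MW LW rho delta eps : R)
    (d_gt0 : (0 < d)%N)
    (V_C2 : potential_C2 V) (W_C2 : kernel_C2 W)
    (W_sym : symmetric_kernel W) (W_growth : quadratic_growth W)
    (Pi_normalizable : forall nu, P2 nu ->
       normalizable (@space_volume R k d) (mean_field_potential V W nu))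
    (mstar_P2 : P2 mstar)
    (mstar_fixed : is_gibbs (@space_volume R k d)
       (mean_field_potential V W mstar) mstar)
    (mNstar_gibbs : is_gibbs (@config_volume R k d N)
       (@particle_energy _ _ R V W N) mNstar)
    (MW_ge0 : 0 <= MW) (LW_ge0 : 0 <= LW) (rho_gt0 : 0 < rho)
    (delta_gt0 : 0 < delta) (delta_le1 : delta <= 1) (N_gt0 : (0 < N)%N)
    (W_decomposable : decomposable MW LW W)
    (mstar_talagrand : talagrand space_dist origin rho mstar)
    (free_energy_coercive : forall nu, P2 nu ->
       (delta%:E * relative_entropy nu mstar <= free_energy W mstar nu)%E)
    (eps_gt0 : 0 < eps) (eps_le1 : eps <= 1) :
  let lW := LW / rho in
  let deltaN := (1 - eps) * delta
    - (1 + (MW + lW) / (eps * delta)) * (2 * lW / N%:R) in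
  let DeltaF := 2 * (1 + (MW + lW) / (eps * delta)) * (MW + lW * d%:R) in
  (forall nuN : probability (N.-tuple (state_space R k d)) R,
     finite_moment config_dist config_origin 2 nuN ->
     (deltaN%:E * relative_entropy nuN (tensor_power mstar N)
        - (DeltaF + 2 * MW + 2 * lW * d%:R)%:E
      <= relative_entropy nuN mNstar)%E) /\
  (forall nuN : probability (N.-tuple (state_space R k d)) R,
     finite_moment config_dist config_origin 1 nuN ->
     ((deltaN * rho / (64 * (1 + DeltaF + 2 * MW + 2 * lW * d%:R) ^+ 2))%:E
        * wasserstein config_dist 1 nuN mNstar ^+ 2
      <= relative_entropy nuN mNstar)%E).
Proof.
move=> lW deltaN DeltaF; set C := DeltaF + 2 * MW + 2 * lW * d%:R.
have lW0 : 0 <= lW by rewrite divr_ge0// ltW.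
pose D := 1 + (MW + lW) / (eps * delta).
have ed : 0 < eps * delta by exact: mulr_gt0.
have D0 : 0 <= D by rewrite /D addr_ge0// divr_ge0 ?addr_ge0 ?(ltW ed).
have lWd : 0 <= lW * d%:R by rewrite mulr_ge0.
have DF : DeltaF = 2 * D * (MW + lW * d%:R) by [].
have DF0 : 0 <= DeltaF by rewrite DF mulr_ge0 ?addr_ge0// mulr_ge0.
have C0 : 0 <= C by rewrite /C -(mulrA 2 lW) !addr_ge0// mulr_ge0.
(* The estimate comes with the additive constant [(D + 1) * (MW + 2 lW d)], while [C] is
   [(D + 1) * (2 MW + 2 lW d)]. *)
have key (nu : probability (N.-tuple (state_space R k d)) R) h :
    finite_moment config_dist config_origin 2 nu -> has_density nu mNstar h ->
    L1 mNstar (fun x => phi (h x)) ->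
    exists f, [/\ has_density nu (tensor_prob mstar N) f,
      L1 (tensor_prob mstar N) (fun x => phi (f x)) &
      deltaN * (\int[tensor_prob mstar N]_x phi (f x)) <= \int[mNstar]_x phi (h x) + C].
  move=> nuP nuh phih; have [f [nuf phif le]] := entropy_estimate V_C2 W_C2 W_sym W_growth.1
    mstar_P2 mstar_fixed mNstar_gibbs MW_ge0 LW_ge0 rho_gt0 delta_gt0 delta_le1 N_gt0
    W_decomposable mstar_talagrand free_energy_coercive eps_gt0 nuP nuh phih.
  exists f; split=> //; apply: le_trans le _; rewrite -addrA lerD2l /C DF -/lW -/D.
  have := mulr_ge0 D0 MW_ge0; move: MW_ge0 lWd; rewrite -!(mulrA 2 lW) mulrDr.
  by rewrite (mulrDr (2 * D)) -(mulrA 2 D) -(mulrA 2 D) (mulrCA D 2); lra.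
have ent0 nu : (0 <= relative_entropy nu mNstar)%E.
  have [->|rn] := eqVneq (relative_entropy nu mNstar) +oo%E; first exact: leey.
  have rlt : (relative_entropy nu mNstar < +oo)%E by rewrite ltey.
  have [h [[_ h0 _] _ ->]] := entropy_density rlt.
  by rewrite lee_fin; apply: Rint_ge0 => x; exact: phi_ge0.
split=> nu nuP.
  have [->|rn] := eqVneq (relative_entropy nu mNstar) +oo%E; first exact: leey.
  have rlt : (relative_entropy nu mNstar < +oo)%E by rewrite ltey.
  have [h [nuh phih ->]] := entropy_density rlt.
  have [f [nuf phif le]] := key _ _ nuP nuh phih.
  have nuf' : has_density nu (tensor_power mstar N) f :=
    eq_has_density (fun _ _ => erefl) (fun _ _ => erefl) nuf.
  rewrite (relative_entropyE nuf' (probability_setT (tensor_prob mstar N))).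
  have -> : (\int[tensor_power mstar N]_x (phi (f x))%:E = (\int[tensor_prob mstar N]_x phi (f x))%:E)%E.
    by rewrite EFin_Rintegral.
  by rewrite -EFinM -EFinB lee_fin lerBlDr.
have w0 : (0 <= wasserstein config_dist 1 nu mNstar ^+ 2)%E by rewrite expe2 mule_ge0// poweR_ge0.
set K := 64 * _; have K0 : 0 < K.
  by rewrite mulr_gt0// exprn_gt0// -!addrA ltr_pwDl// addrA.
(* A nonpositive [deltaN] makes the left side nonpositive; a positive one is the parameter [a] of
   [transport_entropy_inequality]. *)
have [dn0|dp] := leP deltaN 0.
  apply: le_trans (ent0 nu); apply: mule_le0_ge0 => //.
  by rewrite lee_fin mulr_le0_ge0 ?invr_ge0 ?(ltW K0)// mulr_le0_ge0// ltW.
have kappa0 : 0 < 2 / rho by rewrite divr_gt0.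
have := transport_entropy_inequality (config_dist_is_dist R k d N)
  (@measurable_config_dist R k d N) dp kappa0 C0 (tensor_moment N mstar_P2)
  (@config_cells R k d N) key
  (@config_talagrand R k d N mstar rho rho_gt0 mstar_talagrand mstar_P2) nu.
apply: le_trans; apply: lee_wpmul2r => //; rewrite lee_fin -mulrA ler_pM2l//.
(* The constant obtained is [deltaN * rho / (6 * (8 + C))], and [6 * (8 + C) <= 64 * (1 + C)^2]. *)
rewrite (_ : 3 * (2 / rho) * (8 + C) = 6 * (8 + C) / rho); last by field; rewrite gt_eqF.
rewrite invf_div ler_pM2l// lef_pV2 ?posrE// ?mulr_gt0 ?ltr_wpDr//.
rewrite (_ : K = 64 * (1 + C) ^+ 2); last by rewrite /K /C !addrA.
rewrite expr2.
have := mulr_ge0 C0 C0; move: C0; lra.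
Qed.
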